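(* Let $(R,\mathfrak m)$ be an Artinian Gorenstein local ring satisfying one of the following: (1) $\mathfrak m^4=0$ and $\mu(\mathfrak m^2)\le 4$; (2) $R$ has multiplicity at most $11$. Then $R$ satisfies Tor-persistence. Moreover, if the embedding dimension of $R$ is at least $5$, then $R$ also satisfies Tor-vanishing.
   Context: All rings are commutative Noetherian local rings with $1\neq 0$, and all modules are finitely generated. $\mu(I)$ denotes the minimal number of generators of an ideal $I$. The multiplicity of an Artinian local ring is its length. Tor-persistence: $R$ satisfies Tor-persistence if for every finitely generated $R$-module $M$, $\operatorname{Tor}^R_i(M,M)=0$ for all $i\gg 0$ implies that $M$ has finite projective dimension. Tor-vanishing: $R$ satisfies Tor-vanishing if for all finitely generated $R$-modules $M,N$, $\operatorname{Tor}^R_i(M,N)=0$ for all $i\gg0$ implies that $M$ or $N$ has finite projective dimension. *)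

(* Defs.v *)
From HB Require Import structures.
From mathcomp Require Import all_boot all_order all_algebra.
From mathcomp Require Import boolp classical_sets.
From mathcomp Require Import freeg.

Set Implicit Arguments.
Unset Strict Implicit.
Unset Printing Implicit Defensive.

Import GRing.Theory.

Local Open Scope ring_scope.
Local Open Scope quotient_scope.

Section Ideals.
Variable R : comNzRingType.

Definition is_ideal (I : {pred R}) : Prop := submod_closed (I : {pred R^o}).

Definition spanned_by (M : lmodType R) (S : {pred M}) (n : nat)
    (e : 'I_n -> M) : Prop :=
  forall x, x \in S <-> exists c : 'I_n -> R, x = \sum_(i < n) c i *: e i.

Definition generated_in (M : lmodType R) (S : {pred M}) (n : nat) : Prop :=
  exists e : 'I_n -> M, spanned_by S e.

Definition finitely_generated (M : lmodType R) : Prop :=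
  exists n, generated_in (predT : {pred M}) n.

(* The value is 0 when [I] is not finitely generated; this does not occur over
   a Noetherian ring. *)
Definition mu (I : {pred R}) : nat :=
  xget 0%N [set n | generated_in (I : {pred R^o}) n /\
    forall k, generated_in (I : {pred R^o}) k -> (n <= k)%N]%classic.

Definition noetherian : Prop :=
  forall I : {pred R}, is_ideal I -> exists n, generated_in (I : {pred R^o}) n.

Definition artinian : Prop :=
  forall I : nat -> {pred R}, (forall n, is_ideal (I n)) ->
    (forall n, {subset I n.+1 <= I n}) ->
    exists n, forall k, (n <= k)%N -> I k =i I n.

Definition maximal_ideal (m : {pred R}) : Prop :=
  [/\ is_ideal m, 1 \notin m &
      forall J : {pred R}, is_ideal J -> 1 \notin J ->
        {subset m <= J} -> J =i m].

Definition local_ring (m : {pred R}) : Prop :=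
  maximal_ideal m /\ forall J : {pred R}, maximal_ideal J -> J =i m.

Definition ideal_mul (I J : {pred R}) : {pred R} :=
  [pred x | `[< exists n (a b : 'I_n -> R),
     [/\ forall i, a i \in I, forall i, b i \in J &
         x = \sum_(i < n) a i * b i] >]].

Definition ideal_exp (I : {pred R}) (n : nat) : {pred R} :=
  iter n (ideal_mul I) predT.

Definition composition_series (M : lmodType R) (n : nat)
    (S : nat -> {pred M}) : Prop :=
  [/\ S 0%N =i pred1 0, S n =i predT,
      forall i, (i <= n)%N -> submod_closed (S i),
      forall i, (i < n)%N ->
        {subset S i <= S i.+1} /\ ~ {subset S i.+1 <= S i} &
      forall i, (i < n)%N -> forall T : {pred M}, submod_closed T ->
        {subset S i <= T} -> {subset T <= S i.+1} ->
        T =i S i \/ T =i S i.+1].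

(* The value is 0 when [M] has no composition series; this does not occur for
   finitely generated modules over an Artinian ring. *)
Definition module_length (M : lmodType R) : nat :=
  xget 0%N [set n | exists S : nat -> {pred M}, composition_series n S]%classic.

(* For Artinian local rings, where the multiplicity is the length. *)
Definition multiplicity : nat := module_length (R^o : lmodType R).

Definition embdim (m : {pred R}) : nat := mu m.

End Ideals.

Section Kernel.
Variables (R : comNzRingType) (A B : lmodType R) (f : {linear A -> B}).

Definition ker_pred : {pred A} := [pred x | f x == 0].

Fact ker_pred_closed : subsemimod_closed ker_pred.
Proof.
split; [split|] => [|u v|a u]; rewrite !inE ?linear0 //.
- by move=> /eqP fu /eqP fv; rewrite linearD fu fv addr0.
- by move=> /eqP fu; rewrite linearZ /= fu scaler0.
Qed.

HB.instance Definition _ :=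
  GRing.isSubmodClosed.Build R A ker_pred ker_pred_closed.

Record kernel := Kernel { ker_val : A; _ : ker_val \in ker_pred }.

HB.instance Definition _ := [isSub for ker_val].
HB.instance Definition _ := [Choice of kernel by <:].
HB.instance Definition _ := [SubChoice_isSubLmodule of kernel by <:].

End Kernel.

Section Quotient.
Variables (R : comNzRingType) (V : lmodType R) (S : {pred V}).
Hypothesis S_closed : submod_closed S.

Local Lemma S0 : 0 \in S. Proof. by case: S_closed. Qed.
Local Lemma SD u v : u \in S -> v \in S -> u + v \in S.
Proof. by case: S_closed => _ /(_ 1 u v); rewrite scale1r. Qed.
Local Lemma SZ a u : u \in S -> a *: u \in S.
Proof. by move=> Su; case: S_closed => S0 /(_ a u 0 Su S0); rewrite addr0. Qed.
Local Lemma SN u : u \in S -> - u \in S.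
Proof. by rewrite -scaleN1r; apply: SZ. Qed.

Definition quo_rel (x y : V) : bool := x - y \in S.

Fact quo_rel_equiv : equiv_class_of quo_rel.
Proof.
split=> [x|x y|y x z]; rewrite /quo_rel ?subrr ?S0 //.
  by apply/idP/idP => /SN; rewrite opprB.
by move=> Sxy Syz; rewrite -[x](addrNK y) -addrA SD.
Qed.

Canonical quo_rel_equivRel := EquivRelPack quo_rel_equiv.
Canonical quo_rel_encModRel := defaultEncModRel quo_rel.

Definition quo := {eq_quot quo_rel}.

HB.instance Definition _ : EqQuotient V quo_rel quo := EqQuotient.on quo.
HB.instance Definition _ := Choice.on quo.

Definition quo_pi (x : V) : quo := \pi_quo x.

Lemma quo_piE x y : (quo_pi x = quo_pi y) <-> (x - y \in S).
Proof. by split=> [/eqP|H]; [|apply/eqP]; rewrite /quo_pi piE. Qed.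

Lemma quo_reprK (q : quo) : quo_pi (repr q) = q.
Proof. exact: reprK. Qed.

Lemma quo_repr_pi x : repr (quo_pi x) - x \in S.
Proof. by apply/quo_piE; rewrite quo_reprK. Qed.

Definition quo_add (p q : quo) := quo_pi (repr p + repr q).
Definition quo_opp (p : quo) := quo_pi (- repr p).
Definition quo_scale (a : R) (p : quo) := quo_pi (a *: repr p).

Lemma quo_addE x y : quo_add (quo_pi x) (quo_pi y) = quo_pi (x + y).
Proof. by apply/quo_piE; rewrite opprD addrACA SD ?quo_repr_pi. Qed.
Lemma quo_oppE x : quo_opp (quo_pi x) = quo_pi (- x).
Proof. by apply/quo_piE; rewrite -opprD SN ?quo_repr_pi. Qed.
Lemma quo_scaleE a x : quo_scale a (quo_pi x) = quo_pi (a *: x).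
Proof. by apply/quo_piE; rewrite -scalerBr SZ ?quo_repr_pi. Qed.

Fact quo_addA : associative quo_add.
Proof.
move=> p q r; rewrite -[p]quo_reprK -[q]quo_reprK -[r]quo_reprK.
by rewrite !quo_addE addrA.
Qed.
Fact quo_addC : commutative quo_add.
Proof. by move=> p q; rewrite /quo_add addrC. Qed.
Fact quo_add0 : left_id (quo_pi 0) quo_add.
Proof. by move=> p; rewrite -[p]quo_reprK quo_addE add0r. Qed.
Fact quo_addN : left_inverse (quo_pi 0) quo_opp quo_add.
Proof. by move=> p; rewrite -[p]quo_reprK quo_oppE quo_addE addNr. Qed.

HB.instance Definition _ :=
  GRing.isZmodule.Build quo quo_addA quo_addC quo_add0 quo_addN.

Fact quo_scaleA a b p : quo_scale a (quo_scale b p) = quo_scale (a * b) p.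
Proof. by rewrite -[p]quo_reprK !quo_scaleE scalerA. Qed.
Fact quo_scale1 : left_id 1 quo_scale.
Proof. by move=> p; rewrite -[p]quo_reprK quo_scaleE scale1r. Qed.
Fact quo_scaleDr : right_distributive quo_scale +%R.
Proof.
move=> a p q; rewrite -[p]quo_reprK -[q]quo_reprK.
by rewrite [_ + _]quo_addE !quo_scaleE [RHS]quo_addE scalerDr.
Qed.
Fact quo_scaleDl p : {morph quo_scale^~ p : a b / a + b}.
Proof.
by move=> a b; rewrite -[p]quo_reprK !quo_scaleE [RHS]quo_addE scalerDl.
Qed.

HB.instance Definition _ := GRing.Zmodule_isLmodule.Build R quo
  quo_scaleA quo_scale1 quo_scaleDr quo_scaleDl.

Fact quo_pi_linear : linear quo_pi.
Proof. by move=> a x y; rewrite [a *: quo_pi x]quo_scaleE [RHS]quo_addE. Qed.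

HB.instance Definition _ :=
  GRing.isLinear.Build R V quo *:%R quo_pi quo_pi_linear.

Section Lift.
Variables (W : lmodType R) (g : {linear V -> W}).

(* The compatibility hypothesis is a parameter so that linearity of the induced
   map can be inferred. *)
Definition quo_lift of (forall x, x \in S -> g x = 0) :=
  fun p : quo => g (repr p).

Hypothesis gS : forall x, x \in S -> g x = 0.

Lemma quo_lift_pi x : quo_lift gS (quo_pi x) = g x.
Proof. by apply/eqP; rewrite -subr_eq0 -linearB gS ?quo_repr_pi. Qed.

Fact quo_lift_linear : linear (quo_lift gS).
Proof.
move=> a p q; rewrite -[p]quo_reprK -[q]quo_reprK -linearP !quo_lift_pi.
exact: linearP.
Qed.

HB.instance Definition _ :=
  GRing.isLinear.Build R quo W *:%R (quo_lift gS) quo_lift_linear.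
End Lift.

End Quotient.

Section Homology.
Variables (R : comNzRingType) (A B C : lmodType R).
Variables (f : {linear A -> B}) (g : {linear B -> C}).

Definition boundary : {pred kernel g} :=
  [pred z | `[< exists x : A, f x = \val z >]].

Fact boundary_closed : submod_closed boundary.
Proof.
split=> [|a u v]; rewrite !inE.
  by exists 0; rewrite linear0 (linear0 (\val : kernel g -> B)).
move=> [x fx] [y fy].
by exists (a *: x + y); rewrite linearP fx fy (linearP (\val : kernel g -> B)).
Qed.

Definition homology : lmodType R := quo boundary_closed.

End Homology.

Section Free.
Variables (R : comNzRingType) (K : choiceType).

Definition free_module : lmodType R := {freeg K / R}.

Definition free_gen (k : K) : free_module := Freeg [:: (1, k)].

Section Lift.
Variables (M : lmodType R) (f : K -> M).

Definition free_lift (D : free_module) : M := fglift f D.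

Fact free_lift_linear : linear free_lift.
Proof.
have fB x y : free_lift (x - y) = free_lift x - free_lift y.
  exact: lift_is_additive.
have f0 : free_lift 0 = 0 by rewrite -(subrr 0) fB subrr.
have fN y : free_lift (- y) = - free_lift y by rewrite -sub0r fB f0 sub0r.
have fD x y : free_lift (x + y) = free_lift x + free_lift y.
  by rewrite -{1}[y]opprK fB fN opprK.
have fsum (I : Type) (r : seq I) (F : I -> free_module) :
    free_lift (\sum_(i <- r) F i) = \sum_(i <- r) free_lift (F i).
  exact: (big_morph free_lift fD f0).
have fZ a x : free_lift (a *: x) = a *: free_lift x.
  have -> : a *: x = fgscale a x by [].
  rewrite -[in RHS](freeg_sumE x) /fgscale !fsum scaler_sumr.
  by apply: eq_bigr => z _; rewrite /free_lift !liftU scalerA.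
by move=> a x y; rewrite fD fZ.
Qed.

HB.instance Definition _ :=
  GRing.isLinear.Build R free_module M *:%R free_lift free_lift_linear.

Lemma free_lift_gen k : free_lift (free_gen k) = f k.
Proof. by rewrite /free_lift liftU scale1r. Qed.
End Lift.

End Free.

Section Tensor.
Variables (R : comNzRingType) (M N : lmodType R).

Local Notation F := (free_module R (M * N)%type).
Local Notation gen m n := (free_gen R (m, n)).

Inductive tensor_rel : F -> Prop :=
| TensorDl m m' n : tensor_rel (gen (m + m') n - gen m n - gen m' n)
| TensorDr m n n' : tensor_rel (gen m (n + n') - gen m n - gen m n')
| TensorZl a m n : tensor_rel (gen (a *: m) n - a *: gen m n)
| TensorZr a m n : tensor_rel (gen m (a *: n) - a *: gen m n).

Definition tensor_ker : {pred F} :=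
  [pred x | `[< forall S : {pred F}, submod_closed S ->
                  (forall y, tensor_rel y -> y \in S) -> x \in S >]].

Fact tensor_ker_closed : submod_closed tensor_ker.
Proof.
split=> [|a u v]; rewrite !inE; first by move=> S [].
move=> uS vS S cS relS.
by case: (cS) => _; apply; [apply: uS | apply: vS].
Qed.

Definition tensor : lmodType R := quo tensor_ker_closed.

Definition tens (m : M) (n : N) : tensor :=
  quo_pi tensor_ker_closed (gen m n).

Lemma tensor_rel_eq0 y : tensor_rel y -> quo_pi tensor_ker_closed y = 0.
Proof.
move=> rel; apply/(quo_piE tensor_ker_closed y 0).
by rewrite subr0 inE => S _; apply.
Qed.

Lemma tensDl m m' n : tens (m + m') n = tens m n + tens m' n.
Proof.
have /eqP := tensor_rel_eq0 (TensorDl m m' n).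
by rewrite !linearB -addrA -opprD subr_eq0 => /eqP.
Qed.
Lemma tensDr m n n' : tens m (n + n') = tens m n + tens m n'.
Proof.
have /eqP := tensor_rel_eq0 (TensorDr m n n').
by rewrite !linearB -addrA -opprD subr_eq0 => /eqP.
Qed.
Lemma tensZl a m n : tens (a *: m) n = a *: tens m n.
Proof.
have /eqP := tensor_rel_eq0 (TensorZl a m n).
by rewrite linearB linearZ subr_eq0 => /eqP.
Qed.
Lemma tensZr a m n : tens m (a *: n) = a *: tens m n.
Proof.
have /eqP := tensor_rel_eq0 (TensorZr a m n).
by rewrite linearB linearZ subr_eq0 => /eqP.
Qed.

Section Lift.
Variables (W : lmodType R) (b : M -> N -> W).
Hypotheses (bDl : forall m m' n, b (m + m') n = b m n + b m' n)
  (bDr : forall m n n', b m (n + n') = b m n + b m n')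
  (bZl : forall a m n, b (a *: m) n = a *: b m n)
  (bZr : forall a m n, b m (a *: n) = a *: b m n).

Local Notation bl := (free_lift (fun p : M * N => b p.1 p.2)).

Fact tensor_lift_subproof x : x \in tensor_ker -> bl x = 0.
Proof.
rewrite inE => /(_ (ker_pred bl)) H; apply/eqP; apply: H.
  exact/GRing.subsemimod_closed_submod/ker_pred_closed.
move=> y [] *; rewrite inE ?linearB ?linearZ /= !free_lift_gen /=.
- by rewrite bDl -addrA -opprD subrr.
- by rewrite bDr -addrA -opprD subrr.
- by rewrite bZl -scalerDr subrr scaler0.
- by rewrite bZr -scalerDr subrr scaler0.
Qed.

Definition tensor_lift : {linear tensor -> W} :=
  @quo_lift _ _ _ tensor_ker_closed _ bl tensor_lift_subproof.

Lemma tensor_lift_tens m n : tensor_lift (tens m n) = b m n.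
Proof.
rewrite [LHS](quo_lift_pi tensor_ker_closed tensor_lift_subproof).
exact: free_lift_gen.
Qed.
End Lift.

End Tensor.

Section TensorMap.
Variables (R : comNzRingType) (A B N : lmodType R) (f : {linear A -> B}).

Definition tensor_map : {linear tensor A N -> tensor B N}.
Proof.
apply: (@tensor_lift R A N (tensor B N) (fun a n => tens (f a) n)).
- by move=> *; rewrite linearD tensDl.
- by move=> *; rewrite tensDr.
- by move=> *; rewrite linearZ tensZl.
- by move=> *; rewrite tensZr.
Defined.

Lemma tensor_map_tens a n : tensor_map (tens a n) = tens (f a) n.
Proof. exact: tensor_lift_tens. Qed.

End TensorMap.

Section Resolutions.
Variable R : comNzRingType.

Definition is_zero_module (M : lmodType R) : Prop := forall x : M, x = 0.

Definition is_exact (A B C : lmodType R) (f : {linear A -> B})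
    (g : {linear B -> C}) : Prop :=
  forall y, g y = 0 <-> exists x, f x = y.

Definition projective (P : lmodType R) : Prop :=
  forall (A B : lmodType R) (p : {linear A -> B}) (f : {linear P -> B}),
    (forall y, exists x, p x = y) ->
    exists g : {linear P -> A}, forall x, p (g x) = f x.

Definition injective_module (E : lmodType R) : Prop :=
  forall (A B : lmodType R) (i : {linear A -> B}) (f : {linear A -> E}),
    injective i -> exists g : {linear B -> E}, forall x, g (i x) = f x.

Record proj_resolution (M : lmodType R) := ProjResolution {
  pr_obj : nat -> lmodType R;
  pr_diff : forall i, {linear pr_obj i.+1 -> pr_obj i};
  pr_aug : {linear pr_obj 0%N -> M};
  pr_projective : forall i, projective (pr_obj i);
  pr_aug_surj : forall y, exists x, pr_aug x = y;
  pr_exact0 : is_exact (pr_diff 0%N) pr_aug;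
  pr_exact : forall i, is_exact (pr_diff i.+1) (pr_diff i)
}.

Record inj_resolution (M : lmodType R) := InjResolution {
  ir_obj : nat -> lmodType R;
  ir_diff : forall i, {linear ir_obj i -> ir_obj i.+1};
  ir_aug : {linear M -> ir_obj 0%N};
  ir_injective : forall i, injective_module (ir_obj i);
  ir_aug_inj : injective ir_aug;
  ir_exact0 : is_exact ir_aug (ir_diff 0%N);
  ir_exact : forall i, is_exact (ir_diff i) (ir_diff i.+1)
}.

Definition finite_projdim (M : lmodType R) : Prop :=
  exists (P : proj_resolution M) (n : nat),
    forall i, (n < i)%N -> is_zero_module (pr_obj P i).

Definition finite_injdim (M : lmodType R) : Prop :=
  exists (E : inj_resolution M) (n : nat),
    forall i, (n < i)%N -> is_zero_module (ir_obj E i).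

(** The canonical free resolution: each step covers the previous syzygy by the
    free module on all of its elements. *)

Definition free_cover (M : lmodType R) : {linear free_module R M -> M} :=
  free_lift (fun x : M => x).

Definition syzygy (M : lmodType R) (n : nat) : lmodType R :=
  iter n (fun X : lmodType R => kernel (free_cover X) : lmodType R) M.

Definition free_res_obj (M : lmodType R) (n : nat) : lmodType R :=
  free_module R (syzygy M n).

Definition free_res_diff (M : lmodType R) (n : nat) :
    {linear free_res_obj M n.+1 -> free_res_obj M n} :=
  (\val : kernel (free_cover (syzygy M n)) -> free_res_obj M n)
    \o free_cover (syzygy M n.+1).

Lemma free_cover_surj (M : lmodType R) y : exists x, free_cover M x = y.
Proof. by exists (free_gen R y); rewrite /free_cover /= free_lift_gen. Qed.

Lemma free_module_ext (K : choiceType) (M : lmodType R)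
    (f g : {linear free_module R K -> M}) :
  (forall k, f (free_gen R k) = g (free_gen R k)) -> f =1 g.
Proof.
move=> fg x; rewrite -[x]freeg_sumE.
have E z : (Freeg [:: (coeff z x, z)] : free_module R K)
         = coeff z x *: free_gen R z.
  apply/eqP/freeg_eqP => k; rewrite [RHS]coeffZ !coeffU mul1r.
  by [].
rewrite (linear_sum f) (linear_sum g); apply: eq_bigr => z _.
by rewrite E !linearZ /= fg.
Qed.

Lemma free_module_projective (K : choiceType) : projective (free_module R K).
Proof.
move=> A B p f psurj.
have [s sP] := choice psurj.
exists (free_lift (fun k => s (f (free_gen R k)))) => x.
have H := @free_module_ext K B
  (p \o (free_lift (fun k => s (f (free_gen R k))))) f.
by apply: H => k /=; rewrite free_lift_gen sP.
Qed.

Lemma free_res_exact0 (M : lmodType R) :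
  is_exact (free_res_diff M 0) (free_cover M).
Proof.
move=> y; split=> [My0 | [x <-]] /=; last first.
  by apply/eqP; case: (free_lift _ x).
have yK : y \in ker_pred (free_cover M) by rewrite inE My0.
have [x xP] := free_cover_surj (Kernel yK).
by exists x; rewrite /= -/(free_cover _ _) xP.
Qed.

Lemma free_res_exact (M : lmodType R) n :
  is_exact (free_res_diff M n.+1) (free_res_diff M n).
Proof.
move=> y; have [H1 H2] := @free_res_exact0 (syzygy M n.+1) y.
split=> [y0 | Hy].
  by apply: H1; apply: val_inj.
by rewrite /= -/(free_cover _ _) H2.
Qed.

Definition free_resolution (M : lmodType R) : proj_resolution M :=
  @ProjResolution M (free_res_obj M) (free_res_diff M) (free_cover M)
    (fun i => @free_module_projective _) (@free_cover_surj M)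
    (@free_res_exact0 M) (@free_res_exact M).

(** [Tor_of P N i] is the homology in degree [i] of the complex [P (x) N];
    in degree 0 the outgoing differential is the zero map. *)
Definition Tor_of (M : lmodType R) (P : proj_resolution M) (N : lmodType R)
    (i : nat) : lmodType R :=
  match i with
  | 0%N => homology (tensor_map N (pr_diff P 0))
             (\0 : {linear tensor (pr_obj P 0) N -> tensor (pr_obj P 0) N})
  | j.+1 => homology (tensor_map N (pr_diff P j.+1))
              (tensor_map N (pr_diff P j))
  end.

Definition Tor (i : nat) (M N : lmodType R) : lmodType R :=
  Tor_of (free_resolution M) N i.

Definition Tor_eventually_zero (M N : lmodType R) : Prop :=
  exists n, forall i, (n <= i)%N -> is_zero_module (Tor i M N).

Definition Tor_persistence : Prop :=
  forall M : lmodType R, finitely_generated M ->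
    Tor_eventually_zero M M -> finite_projdim M.

Definition Tor_vanishing : Prop :=
  forall M N : lmodType R, finitely_generated M -> finitely_generated N ->
    Tor_eventually_zero M N -> finite_projdim M \/ finite_projdim N.

Definition gorenstein : Prop := finite_injdim (R^o : lmodType R).

End Resolutions.

(* Main.v *)
From HB Require Import structures.
From mathcomp Require Import all_boot all_order all_algebra.
From mathcomp Require Import boolp classical_sets functions.
From mathcomp Require Import zify ring.
Require Import Defs.

(** Eventual vanishing of [Tor(M, N)] is used as an exactness property of products
    of the matrices of the minimal resolutions of [M] and [N]. Let [e] be the
    embedding dimension.

    If [e >= 5], then [m^2] has length at most 5, so some [y] outside [m^2] is
    killed by [m^2]; multiplication by [y] forces the Betti numbers of one of the
    modules to be eventually constant, and counting lengths excludes this.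

    If [e <= 4], then [R] has length at most 11, and [M = N]. Lengths of the images
    of the maps between the terms of [F (x) F] bound the ratios of consecutive Betti
    numbers by [7/3], and bound each ratio below in terms of the previous one. The
    Koszul complex of [R] gives a lower bound for the growth of the Betti numbers
    that contradicts these estimates, unless [e <= 3] and the Koszul homology is an
    exterior algebra on [e] one-cycles. In that case these cycles induce operators
    of degree [-2] over which both [F] and [F (x) F] are finite, and linear algebra
    over the residue field shows that [F] is finite. *)

Set Implicit Arguments.
Unset Strict Implicit.
Unset Printing Implicit Defensive.

Import GRing.Theory.
Local Open Scope classical_set_scope.
Local Open Scope ring_scope.

(** * Submodules and length *)

Section Submodules.
Variable R : comNzRingType.
Implicit Types V W : lmodType R.

(** Once the socle is known to be generated by one element, the Gorenstein hypothesis acts through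
    lengths: orthogonals for a nondegenerate pairing have complementary length, which relates ideals
    to annihilators and Koszul cycles to Koszul boundaries. The constant 7/3 is a rational bound
    above [sqrt 11 - 1] and comes from [(b + b')^2 <= 11 b^2] for consecutive Betti numbers. Growth
    estimates alone cannot treat exterior Koszul homology, since complete intersections admit
    infinite resolutions with bounded Betti numbers. There, adjoining divided power variables to the
    Koszul complex K gives a resolution of the residue field k. Its product with F has homology F
    (x) k, because F is minimal, and this homology is Artinian over the derivations in the
    variables, because F (x) K has bounded homology. If F were infinite, the operators would give
    commuting matrices acting irreducibly, and a form intertwining them with their transposes would
    give elements of the tensor square, in arbitrarily high degrees, killed by all operators. That
    form pairs F with itself, which is why this part yields persistence and not vanishing. *)

Definition subm V (U : set V) : Prop :=
  U 0 /\ forall a u v, U u -> U v -> U (a *: u + v).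

Lemma sub0 V (U : set V) : subm U -> U 0. Proof. by case. Qed.
Lemma subD V (U : set V) u v : subm U -> U u -> U v -> U (u + v).
Proof. by case=> _ /(_ 1 u v); rewrite scale1r. Qed.
Lemma subZ V (U : set V) a u : subm U -> U u -> U (a *: u).
Proof. by move=> [U0 /(_ a u 0)]; rewrite addr0 => UZ Uu; apply: UZ. Qed.
Lemma subN V (U : set V) u : subm U -> U u -> U (- u).
Proof. by move=> sU Uu; rewrite -scaleN1r; apply: subZ. Qed.
Lemma subB V (U : set V) u v : subm U -> U u -> U v -> U (u - v).
Proof. by move=> sU Uu Uv; apply: subD => //; apply: subN. Qed.
Lemma sub_sum V (U : set V) (I : Type) (r : seq I) (P : pred I) (F : I -> V) :
  subm U -> (forall i, P i -> U (F i)) -> U (\sum_(i <- r | P i) F i).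
Proof.
move=> sU UF; elim/big_rec: _ => [|i x Pi Ux]; first exact: sub0.
by apply: subD => //; apply: UF.
Qed.
Lemma subDl V (U : set V) u v : subm U -> U u -> U (u + v) -> U v.
Proof. by move=> sU Uu Uuv; rewrite -(addKr u v) addrC; apply: subB. Qed.
Lemma subDr V (U : set V) u v : subm U -> U v -> U (u + v) -> U u.
Proof. by rewrite addrC; apply: subDl. Qed.

Lemma subm_pred V (U : {pred V}) : submod_closed U -> subm [set x | x \in U].
Proof. by move=> [U0 UD]; split=> [|a u v]; [exact: U0|exact: UD]. Qed.
Lemma pred_subm V (U : set V) : subm U -> submod_closed [pred x | `[<U x>]].
Proof.
case=> U0 UD; split=> [|a u v]; first exact/asboolP.
by move=> /asboolP Uu /asboolP Uv; apply/asboolP; apply: UD.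
Qed.

Lemma subm0 V : subm [set 0 : V].
Proof. by split=> //= a u v -> ->; rewrite scaler0 addr0. Qed.
Lemma submT V : subm [set: V]. Proof. by []. Qed.
Lemma submI V (U U' : set V) : subm U -> subm U' -> subm (U `&` U').
Proof.
move=> [U0 UD] [U'0 U'D]; split=> // a u v [? ?] [? ?].
by split; [apply: UD | apply: U'D].
Qed.
Lemma subm_img V W (f : {linear V -> W}) (U : set V) :
  subm U -> subm (f @` U).
Proof.
move=> [U0 UD]; split; first by exists 0 => //; rewrite linear0.
by move=> a _ _ [u Uu <-] [v Uv <-]; exists (a *: u + v);
   [apply: UD | rewrite linearP].
Qed.
Lemma subm_pre V W (f : {linear V -> W}) (U : set W) :
  subm U -> subm (f @^-1` U).
Proof.
move=> [U0 UD]; split; rewrite /preimage /= ?linear0 // => a u v Uu Uv.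
by rewrite linearP; apply: UD.
Qed.
Definition ker V W (f : {linear V -> W}) : set V := [set x | f x = 0].
Lemma subm_ker V W (f : {linear V -> W}) : subm (ker f).
Proof. exact: (subm_pre f (subm0 W)). Qed.

Definition addm V (U U' : set V) : set V :=
  [set x | exists2 u, U u & exists2 v, U' v & x = u + v].
Lemma subm_add V (U U' : set V) : subm U -> subm U' -> subm (addm U U').
Proof.
move=> sU sU'; split.
  by exists 0; [apply: sub0|exists 0; [apply: sub0|rewrite addr0]].
move=> a _ _ [u Uu [v Uv ->]] [u' Uu' [v' Uv' ->]].
exists (a *: u + u'); first by case: sU => _; apply.
exists (a *: v + v'); first by case: sU' => _; apply.
by rewrite scalerDr addrACA.
Qed.
Lemma addmL V (U U' : set V) : subm U' -> U `<=` addm U U'.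
Proof. by move=> sU' u Uu; exists u => //; exists 0; [apply: sub0|rewrite addr0]. Qed.
Lemma addmR V (U U' : set V) : subm U -> U' `<=` addm U U'.
Proof. by move=> sU u Uu; exists 0; [apply: sub0|exists u; rewrite ?add0r]. Qed.
Lemma addm_sub V (U U' W : set V) :
  subm W -> U `<=` W -> U' `<=` W -> addm U U' `<=` W.
Proof. by move=> sW UW U'W _ [u Uu [v Uv ->]]; apply: subD; auto. Qed.

Definition span V (A : set V) : set V :=
  [set x | forall S : set V, subm S -> A `<=` S -> S x].
Lemma subm_span V (A : set V) : subm (span A).
Proof.
split=> [S sS _|a u v uA vA S sS AS]; first exact: sub0.
by case: (sS) => _; apply; [apply: uA|apply: vA].
Qed.
Lemma span_incl V (A : set V) : A `<=` span A.
Proof. by move=> x Ax S _; apply. Qed.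
Lemma span_sub V (A S : set V) : subm S -> A `<=` S -> span A `<=` S.
Proof. by move=> sS AS x; apply. Qed.

Definition smul V (I : set R) (U : set V) : set V :=
  span [set x | exists2 a, I a & exists2 u, U u & x = a *: u].
Lemma subm_smul V (I : set R) (U : set V) : subm (smul I U).
Proof. exact: subm_span. Qed.
Lemma smul_incl V (I : set R) (U : set V) a u : I a -> U u -> smul I U (a *: u).
Proof. by move=> Ia Uu; apply: span_incl; exists a => //; exists u. Qed.
Lemma smul_sub V (I : set R) (U S : set V) : subm S ->
  (forall a u, I a -> U u -> S (a *: u)) -> smul I U `<=` S.
Proof. by move=> sS H; apply: span_sub => // _ [a Ia [u Uu ->]]; apply: H. Qed.
Lemma smul_mono V (I I' : set R) (U U' : set V) :
  I `<=` I' -> U `<=` U' -> smul I U `<=` smul I' U'.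
Proof.
move=> II UU; apply: smul_sub; first exact: subm_smul.
by move=> a u Ia Uu; apply: smul_incl; auto.
Qed.
Lemma smul_subr V (I : set R) (U : set V) : subm U -> smul I U `<=` U.
Proof. by move=> sU; apply: smul_sub => // a u _; apply: subZ. Qed.
(** Length is measured by strict chains instead of composition series: it is then monotone by
    definition, and additivity reduces to gluing and splitting chains. The sequence is total, but
    only its terms up to index [n] are constrained to increase. *)
Definition chain V (U : set V) (n : nat) : Prop :=
  exists W : nat -> set V,
    [/\ forall i, subm (W i),
        forall i, (i < n)%N -> W i `<=` W i.+1 /\ exists2 x, W i.+1 x & ~ W i x
      & W n `<=` U].

Definition fl V (U : set V) : Prop := subm U /\ exists n, ~ chain U n.+1.

(** Meaningful under [fl], where it is used through [lenP]. *)
Definition len V (U : set V) : nat :=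
  xget 0%N [set n | chain U n /\ ~ chain U n.+1].

Lemma chain0 V (U : set V) : subm U -> chain U 0.
Proof. by move=> sU; exists (fun=> U); split. Qed.

Lemma chainS V (U : set V) n : chain U n.+1 -> chain U n.
Proof.
move=> [W [sW cW WU]]; exists W; split=> // [i ltin|].
  by apply: cW; apply: ltnW.
by apply: subset_trans WU; case: (cW n (ltnSn n)).
Qed.

Lemma chain_le V (U : set V) n k : (k <= n)%N -> chain U n -> chain U k.
Proof.
elim: n => [|n IHn]; first by rewrite leqn0 => /eqP->.
by rewrite leq_eqVlt => /predU1P[->//|/IHn IH /chainS].
Qed.

Lemma chain_sub V (U U' : set V) n : U `<=` U' -> chain U n -> chain U' n.
Proof.
by move=> UU' [W [sW cW WU]]; exists W; split=> //; apply: subset_trans UU'.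
Qed.

Lemma chain_ext V (U U' : set V) n : subm U' -> U `<=` U' ->
  (exists2 x, U' x & ~ U x) -> chain U n -> chain U' n.+1.
Proof.
move=> sU' UU' [x U'x nUx] [W [sW cW WU]].
exists (fun i => if (i <= n)%N then W i else U'); split.
- by move=> i; case: ifP.
- move=> i; rewrite ltnS => lein; rewrite lein.
  case: ltngtP lein => // [ltin _|-> _]; first exact: cW.
  split; first exact: subset_trans UU'.
  by exists x => // /WU.
- by rewrite ltnn.
Qed.

Lemma lenP V (U : set V) n : fl U -> chain U n <-> (n <= len U)%N.
Proof.
move=> [sU [k nUk]].
have [l [cl ncl]] : exists l, chain U l /\ ~ chain U l.+1.
  apply: contrapT => H; apply: nUk.
  suff : forall i, chain U i by [].
  elim=> [|i IH]; first exact: chain0.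
  by apply: contrapT => ?; apply: H; exists i.
have [c1 c2] : [set n | chain U n /\ ~ chain U n.+1] (len U).
  by apply: (@xgetPex _ 0%N); exists l.
split=> [cn|len_n]; last exact: chain_le c1.
by rewrite leqNgt; apply/negP => lt; apply: c2; apply: chain_le cn.
Qed.

Lemma chain_nle V (U : set V) n : subm U -> ~ chain U n.+1 -> fl U /\ (len U <= n)%N.
Proof.
move=> sU nc; have fU : fl U by split=> //; exists n.
split=> //; rewrite leqNgt; apply/negP => lt; apply: nc; exact/lenP.
Qed.

Lemma fl_subm V (U : set V) : fl U -> subm U. Proof. by case. Qed.

Lemma chain_glue V W (f : {linear V -> W}) (U : set V) a b : subm U ->
  chain (f @` U) a -> chain (U `&` ker f) b -> chain U (a + b)%N.
Proof.
move=> sU [X [sX cX XU]] [Y [sY cY YU]].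
have Y0 x : Y b x -> U x /\ f x = 0 by move=> /YU.
have glue : Y b `<=` U `&` f @^-1` X 0%N.
  by move=> x /Y0[Ux fx]; split=> //; rewrite /preimage /= fx; apply: sub0.
(* The chain of the kernel comes first, followed by the preimages of the chain of the image. The two
   parts join since [Y b] lies in every preimage. *)
exists (fun i => if (i < b)%N then Y i else U `&` f @^-1` X (i - b)%N); split.
- by move=> i; case: ifP => // _; apply: submI => //; apply: subm_pre.
- move=> i ltiab; case: ifP => ltib.
    have [Yi [x Yx nYx]] := cY i ltib; case: ifP => [_|ltSib]; first by split=> //; exists x.
    have bE : b = i.+1 by lia.
    rewrite bE subnn in glue *.
    by split; [exact: subset_trans glue|exists x => //; apply: glue].
  have -> : (i.+1 < b)%N = false by lia.
  have lti : (i - b < a)%N by lia.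
  have -> : (i.+1 - b)%N = (i - b).+1 by lia.
  have [Xi [y Xy nXy]] := cX _ lti; split.
    by move=> x [Ux]; split=> //; apply: Xi.
  have [x Ux fx] : (f @` U) y.
    apply: XU; suff : forall j, ((i - b).+1 + j <= a)%N -> X ((i - b).+1 + j)%N y.
      by move=> /(_ (a - (i - b).+1)%N); rewrite subnKC //; apply.
    elim=> [|j IH] lej; first by rewrite addn0.
    have ltj : ((i - b).+1 + j < a)%N by lia.
    by rewrite addnS; have [h _] := cX _ ltj; apply: h; apply: IH; lia.
  by exists x; [split=> //; rewrite /preimage /= fx | move=> [_]; rewrite /preimage /= fx].
- have -> : (a + b < b)%N = false by lia.
  by move=> x [].
Qed.

(** Every strict step of a chain remains strict in the image or in the kernel, so the two induced
    chains together have at least as many steps. *)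
Lemma chain_split V W (f : {linear V -> W}) (U : set V) n : subm U -> chain U n ->
  exists a b, [/\ (n <= a + b)%N, chain (f @` U) a & chain (U `&` ker f) b].
Proof.
move=> sU [X [sX cX XU]].
suff [a [b [lab ca cb]]] : exists a b, [/\ (n <= a + b)%N, chain (f @` X n) a
    & chain (X n `&` ker f) b].
  exists a, b; split=> //; first by apply: chain_sub ca; apply: image_subset.
  by apply: chain_sub cb => x [/XU].
elim: n cX {XU} => [|n IH] cX.
  exists 0%N, 0%N; split=> //; apply: chain0; first exact: subm_img.
  by apply: submI => //; apply: subm_ker.
have [a [b [lab ca cb]]] := IH (fun i h => cX i (ltnW h)).
have [XX [x Xx nXx]] := cX n (ltnSn n).
case: (pselect (exists2 y, (f @` X n.+1) y & ~ (f @` X n) y)) => [ey|ney].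
  exists a.+1, b; split; first by rewrite addSn ltnS.
    by apply: chain_ext ca => //; [apply: subm_img|apply: image_subset].
  by apply: chain_sub cb => z [/XX].
(* If the images agree, subtracting from the new element one of the smaller term with the same image
   gives a new element of the kernel. *)
exists a, b.+1; split; first by rewrite addnS ltnS.
  by apply: chain_sub ca; apply: image_subset.
have [z Xz fz] : (f @` X n) (f x).
  by apply: contrapT => h; apply: ney; exists (f x) => //; exists x.
apply: chain_ext cb => [|y [/XX]//|]; first by apply: submI => //; exact: subm_ker.
exists (x - z); first by split; [apply: subB (XX _ Xz) | rewrite /ker /= linearB fz subrr].
by move=> [Xxz _]; apply: nXx; rewrite -(subrK z x); apply: subD.
Qed.

Lemma fl_exact V W (f : {linear V -> W}) (U : set V) : subm U ->
  fl (f @` U) -> fl (U `&` ker f) -> fl U.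
Proof.
move=> sU fI fK; split=> //; exists (len (f @` U) + len (U `&` ker f))%N.
move=> /(chain_split f sU)[a [b [lab /(lenP _ fI) ca /(lenP _ fK) cb]]].
by move: (leq_add ca cb); lia.
Qed.

Lemma fl_sub V (U U' : set V) : fl U' -> subm U -> U `<=` U' -> fl U.
Proof. by move=> [_ [n nc]] sU UU'; split=> //; exists n => /(chain_sub UU'). Qed.

Lemma fl_img V W (f : {linear V -> W}) (U : set V) : fl U -> fl (f @` U).
Proof.
move=> [sU [n nc]]; split; first exact: subm_img.
exists n => c; apply: nc; rewrite -[n.+1]addn0; apply: (chain_glue sU c).
by apply: chain0; apply: submI => //; apply: subm_ker.
Qed.

Theorem len_exact V W (f : {linear V -> W}) (U : set V) : fl U ->
  len U = (len (f @` U) + len (U `&` ker f))%N.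
Proof.
move=> fU; have sU := fl_subm fU.
have fI := fl_img f fU.
have fK : fl (U `&` ker f).
  by apply: fl_sub fU _ _ => [|x []//]; apply: submI => //; apply: subm_ker.
apply/anti_leq/andP; split.
  have /(chain_split f sU)[a [b [lab /(lenP _ fI) ca /(lenP _ fK) cb]]] :
    chain U (len U) by apply/lenP.
  by apply: leq_trans lab _; apply: leq_add.
by apply/lenP => //; apply: (@chain_glue _ _ f) => //; apply/lenP.
Qed.

Lemma len_sub V (U U' : set V) : fl U' -> subm U -> U `<=` U' -> (len U <= len U')%N.
Proof.
move=> fU' sU UU'; apply/lenP => //; apply: (chain_sub UU').
by apply/lenP => //; apply: fl_sub UU'.
Qed.

Lemma len_eq V (U U' : set V) : fl U' -> subm U -> U `<=` U' ->
  (len U' <= len U)%N -> U = U'.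
Proof.
move=> fU' sU UU' le; apply/seteqP; split=> // x U'x; apply: contrapT => nUx.
have : chain U' (len U).+1.
  apply: (chain_ext (fl_subm fU') UU'); first by exists x.
  by apply/lenP => //; apply: fl_sub UU'.
by move=> /(lenP _ fU'); rewrite ltnNge le.
Qed.

Lemma fl0 V : fl [set 0 : V].
Proof.
split; first exact: subm0.
exists 0%N => -[W [sW cW W0]]; have [+ [x /W0 /= -> nx]] := cW 0%N (ltnSn _).
by move=> _; apply: nx; apply: sub0.
Qed.

Lemma len0 V : len [set 0 : V] = 0%N.
Proof.
apply/eqP; rewrite -leqn0 leqNgt; apply/negP => /(lenP _ (@fl0 V)).
case=> W [sW cW W0]; have [+ [x /W0 /= -> nx]] := cW 0%N (ltnSn _).
by move=> _; apply: nx; apply: sub0.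
Qed.

Lemma len_eq0 V (U : set V) : fl U -> len U = 0%N -> U = [set 0].
Proof.
move=> fU U0; apply/esym/len_eq => //; rewrite ?U0 //; first exact: subm0.
by move=> _ ->; apply: sub0; apply: fl_subm.
Qed.

Lemma len_inj V W (f : {linear V -> W}) (U : set V) : fl U ->
  (forall x, U x -> f x = 0 -> x = 0) -> len (f @` U) = len U.
Proof.
move=> fU inj; rewrite (len_exact f fU).
suff -> : U `&` ker f = [set 0] by rewrite len0 addn0.
apply/seteqP; split=> [x [Ux /inj]|_ ->]; first exact.
by split; [apply: sub0; apply: fl_subm | rewrite /ker /= linear0].
Qed.

Definition qpi V (U : set V) (sU : subm U) : {linear V -> quo (pred_subm sU)} :=
  quo_pi (pred_subm sU).

Lemma ker_qpi V (U : set V) (sU : subm U) : ker (qpi sU) = U.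
Proof.
have E x : qpi sU x = 0 <-> U x.
  rewrite -(linear0 (qpi sU)); split=> [/(quo_piE (pred_subm sU))|Ux].
    by rewrite subr0 => /asboolP.
  by apply/(quo_piE (pred_subm sU)); rewrite subr0; apply/asboolP.
by apply/seteqP; split=> x /E.
Qed.

Lemma len_add V (U U' : set V) : fl U -> fl U' ->
  fl (addm U U') /\ (len (addm U U') + len (U `&` U') = len U + len U')%N.
Proof.
move=> fU fU'; have [sU sU'] := (fl_subm fU, fl_subm fU').
have imgE : qpi sU' @` (addm U U') = qpi sU' @` U.
  apply/seteqP; split; last by apply: image_subset; apply: addmL.
  move=> _ [_ [u Uu [v U'v ->]] <-]; exists u => //; rewrite linearD.
  by have : ker (qpi sU') v by [rewrite ker_qpi]; rewrite /ker /= => ->; rewrite addr0.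
have kE : addm U U' `&` ker (qpi sU') = U'.
  by rewrite ker_qpi; apply/seteqP; split=> [x []//|x U'x]; split=> //; apply: addmR.
have fA : fl (addm U U').
  apply: (@fl_exact _ _ (qpi sU')); first exact: subm_add.
    by rewrite imgE; apply: fl_img.
  by rewrite kE.
split=> //; rewrite (len_exact (qpi sU') fA) imgE kE.
by rewrite (len_exact (qpi sU') fU) ker_qpi addnAC.
Qed.

End Submodules.

(** * Artinian local rings *)

(** The form in which the ring is used below: nilpotence of [m] replaces finite generation in
    Nakayama's lemma, and the finite length of the ring replaces both chain conditions. *)
Record artin_local (R : comNzRingType) (m : set R^o) : Prop := ArtinLocal {
  al_sub : subm m;
  al_proper : ~ m 1;
  al_unit : forall x : R, ~ m x -> exists y : R, y * x = 1;
  al_nil : exists n, iter n (smul (m : set R)) [set: R^o] = [set 0];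
  al_fl : fl [set: R^o]
}.

Definition gen (R : comNzRingType) (V : lmodType R) (r : nat) (e : 'I_r -> V) : set V :=
  [set y | exists c : 'I_r -> R, y = \sum_i c i *: e i].

Section Gen.
Variables (R : comNzRingType) (V : lmodType R).

Lemma subm_gen r (e : 'I_r -> V) : subm (gen e).
Proof.
split=> [|a _ _ [c ->] [d ->]].
  by exists (fun=> 0); rewrite big1 // => i _; rewrite scale0r.
exists (fun i => a * c i + d i); rewrite scaler_sumr -big_split /=.
by apply: eq_bigr => i _; rewrite scalerDl scalerA.
Qed.

Lemma gen_in r (e : 'I_r -> V) i : gen e (e i).
Proof.
exists (fun j => if j == i then 1 else 0); rewrite (bigD1 i) //= eqxx scale1r.
by rewrite big1 ?addr0 // => j /negPf->; rewrite scale0r.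
Qed.

Lemma gen_sub r (e : 'I_r -> V) (U : set V) : subm U -> (forall i, U (e i)) ->
  gen e `<=` U.
Proof. by move=> sU Ue _ [c ->]; apply: sub_sum => // i _; apply: subZ. Qed.

Lemma smul_gens (I : set R^o) r (e : 'I_r -> V) (y : V) : subm I ->
  smul (I : set R) (gen e) y ->
  exists2 c : 'I_r -> R, forall i, I (c i) & y = \sum_i c i *: e i.
Proof.
move=> sI; suff H : smul (I : set R) (gen e) `<=`
  [set y | exists2 c : 'I_r -> R, forall i, I (c i) & y = \sum_i c i *: e i].
  by move=> /H.
apply: smul_sub; first split.
- by exists (fun=> 0) => [_|]; [exact: (sub0 sI)|rewrite big1 // => i _; rewrite scale0r].
- move=> a _ _ [c mc ->] [d md ->]; exists (fun i => a * c i + d i).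
    by move=> i; case: sI => _; apply.
  rewrite scaler_sumr -big_split /=.
  by apply: eq_bigr => i _; rewrite scalerDl scalerA.
- move=> a _ ma [c ->]; exists (fun i => a * c i).
    by move=> i; rewrite mulrC; apply: (subZ (c i) sI ma).
  by rewrite scaler_sumr; apply: eq_bigr => i _; rewrite scalerA.
Qed.

End Gen.

Section Local.
Variables (R : comNzRingType) (m : set R^o).
Hypotheses (m_sub : subm m) (m_proper : ~ m 1)
  (m_unit : forall x : R, ~ m x -> exists y : R, y * x = 1).

Lemma chain_simple (V : lmodType R) (a : V) :
  (forall x : R, m x -> x *: a = 0) -> ~ chain [set y | exists r : R, y = r *: a] 2.
Proof.
move=> ma [W [sW cW WU]].
have [W01 [x W1x nW0x]] := cW 0%N isT; have [W12 [z W2z nW1z]] := cW 1%N isT.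
have [r xE] := WU _ (W12 _ W1x); have [t zE] := WU _ W2z.
have nr : ~ m r by move=> mr; apply: nW0x; rewrite xE ma //; apply: sub0.
have [u ur] := m_unit nr; apply: nW1z.
by rewrite zE -(scale1r a) -ur -scalerA -xE; do 2 apply: subZ => //.
Qed.

Lemma subm_cyclic (V : lmodType R) (a : V) : subm [set y | exists r : R, y = r *: a].
Proof.
split=> [|c _ _ [r ->] [t ->]]; first by exists 0; rewrite scale0r.
by exists (c * r + t); rewrite scalerDl scalerA.
Qed.

(** The quotient by [U] is cyclic and killed by [m], hence simple or zero. *)
Lemma len_addcyc (V : lmodType R) (U : set V) (a : V) : fl U ->
  (forall x : R, m x -> U (x *: a)) ->
  fl (addm U [set y | exists r : R, y = r *: a]) /\
  (len (addm U [set y | exists r : R, y = r *: a]) <= (len U).+1)%N.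
Proof.
move=> fU ma; have sU := fl_subm fU; set C := [set y | _].
have sC : subm C by exact: subm_cyclic.
have imE : qpi sU @` (addm U C) = [set y | exists r : R, y = r *: qpi sU a].
  apply/seteqP; split=> [_ [_ [u Uu [_ [r ->] ->]] <-]|_ [r ->]].
    exists r; rewrite linearD linearZ; have : ker (qpi sU) u by rewrite ker_qpi.
    by rewrite /ker /= => ->; rewrite add0r.
  by exists (r *: a); [apply: addmR => //; exists r | rewrite linearZ].
have kE : addm U C `&` ker (qpi sU) = U.
  by rewrite ker_qpi; apply/seteqP; split=> [x []//|x Ux]; split=> //; apply: addmL.
have nc : ~ chain (qpi sU @` (addm U C)) 2.
  rewrite imE; apply: chain_simple => x mx; rewrite -linearZ.
  by have : ker (qpi sU) (x *: a) by rewrite ker_qpi; apply: ma.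
have sA : subm (addm U C) by exact: subm_add.
have [fI lI] := chain_nle (subm_img (qpi sU) sA) nc.
have fA : fl (addm U C) by apply: (@fl_exact _ _ _ (qpi sU)) => //; rewrite kE.
by split=> //; rewrite (len_exact (qpi sU) fA) kE addnC -addn1 leq_add2l.
Qed.

Lemma len_addgens (V : lmodType R) (W : set V) (r : nat) (e : 'I_r -> V) : fl W ->
  (forall (x : R) i, m x -> W (x *: e i)) ->
  let U := addm W (gen e) in
  fl U /\ (len U <= len W + r)%N.
Proof.
elim: r e => [|r IH] e fW me U.
  have -> : U = W.
    apply/seteqP; split; last by apply: addmL; split=> [|a _ _ [c ->] [d ->]];
      exists (fun=> 0); rewrite !big_ord0 ?scaler0 ?addr0.
    by move=> _ [w Ww [_ [c ->] ->]]; rewrite big_ord0 addr0.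
  by rewrite addn0.
pose e' i := e (lift ord_max i).
have [fU' lU'] := IH e' fW (fun x i => me x _).
set U' := addm W _ in fU' lU'.
have sU' := fl_subm fU'.
have [fA lA] := len_addcyc fU' (fun x mx => addmL (subm_gen e') (me x ord_max mx)).
suff -> : U = addm U' [set y | exists r0 : R, y = r0 *: e ord_max].
  by split=> //; apply: leq_trans lA _; rewrite addnS ltnS.
apply/seteqP; split.
  move=> _ [w Ww [_ [c ->] ->]]; exists (w + \sum_i c (lift ord_max i) *: e' i).
    by exists w => //; exists (\sum_i c (lift ord_max i) *: e' i) => //; eexists.
  exists (c ord_max *: e ord_max); first by eexists.
  rewrite big_ord_recr /= addrA; congr (_ + _ + _).
  apply: eq_bigr => i _; rewrite /e'; suff -> : widen_ord (leqnSn r) i = lift ord_max i by [].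
  by apply: val_inj; rewrite /= /bump leqNgt ltn_ord.
have sU : subm U := subm_add (fl_subm fW) (subm_gen e).
apply: addm_sub => //.
  apply: addm_sub => //; first exact: addmL (subm_gen e).
  apply: gen_sub => // i; apply: addmR (fl_subm fW) _ _; exact: gen_in.
move=> _ [c ->]; apply: subZ => //; apply: addmR (fl_subm fW) _ _; exact: gen_in.
Qed.

End Local.

Section Setup.
Variables (R : comNzRingType) (mp : {pred R}).
Hypotheses (R_noetherian : noetherian R) (R_local : local_ring mp)
  (R_artinian : artinian R).

Definition mset : set R^o := [set x | x \in mp].
Local Notation m := mset.

Lemma mset_sub : subm m. Proof. by case: R_local => -[/subm_pred]. Qed.
Lemma mset_proper : ~ m 1. Proof. by case: R_local => -[_ /negP]. Qed.

(** A nonunit lies in some maximal ideal by Zorn's lemma, and there is only one. *)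
Lemma ideal_in_mset (x : R) : (forall y : R, y * x <> 1) -> m x.
Proof.
move=> nx.
pose P (J : set R^o) := [/\ subm J, ~ J 1 & J x].
pose le (A B : {J : set R^o | P J}) := `[< sval A `<=` sval B >].
have [| | | |[J [sJ nJ1 Jx]] Jmax] := @Zorn {J : set R^o | P J} le.
- by move=> A; apply/asboolP.
- by move=> A B C /asboolP AB /asboolP BC; apply/asboolP; apply: subset_trans BC.
- move=> [A PA] [B PB] /asboolP AB /asboolP BA; apply: eq_exist; exact/seteqP.
(* The empty chain is bounded by the principal ideal of [x], which is proper. *)
- move=> A totA; case: (pselect (exists J0, A J0)) => [[J0 AJ0]|nA]; last first.
    have PJ : P [set y | exists r : R, y = r *: (x : R^o)].
      split; first exact: (@subm_cyclic R R^o x).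
        by move=> [r /esym]; apply: nx.
      by exists 1; rewrite scale1r.
    by exists (exist _ _ PJ) => J AJ; case: nA; exists J.
  have PU : P [set y | exists2 J, A J & sval J y].
    split; last by exists J0 => //; case: (svalP J0).
      split; first by exists J0 => //; case: (svalP J0) => /sub0.
      move=> a u v [J AJ Ju] [J' AJ' J'v].
      have [/asboolP JJ|/asboolP JJ] := totA _ _ AJ AJ'.
        by exists J' => //; case: (svalP J') => -[_ h] _ _; apply: h => //; apply: JJ.
      by exists J => //; case: (svalP J) => -[_ h] _ _; apply: h => //; apply: JJ.
    by move=> [J AJ]; case: (svalP J).
  by exists (exist _ _ PU) => J AJ; apply/asboolP => y Jy; exists J.
- have mJ : maximal_ideal [pred x | `[<J x>]].
    split; first exact: (@pred_subm R R^o).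
      by apply/negP => /asboolP.
    move=> K sK nK JK y; apply/idP/idP; last by move=> Jy; apply: JK.
    have PK : P [set x | x \in K].
      split; first exact: (@subm_pred R R^o).
        by apply/negP.
      by apply: JK; apply/asboolP.
    have JK' : le (exist _ J (And3 sJ nJ1 Jx)) (exist _ _ PK).
      by apply/asboolP => z Jz /=; apply: JK; apply/asboolP.
    have /(congr1 sval) /= E := Jmax _ JK'.
    by move=> Ky; apply/asboolP; rewrite -E.
  have [_ /(_ _ mJ) E] := R_local.
  by rewrite /m /= -E; apply/asboolP.
Qed.

Lemma mset_unit (x : R) : ~ m x -> exists y : R, y * x = 1.
Proof.
move=> nmx; apply: contrapT => nx; apply: nmx; apply: ideal_in_mset => y yx.
by apply: nx; exists y.
Qed.

Lemma nakayama_fg (r : nat) (e : 'I_r -> R^o) :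
  gen e `<=` smul (m : set R) (gen e) -> forall y, gen e y -> y = 0.
Proof.
elim: r e => [|r IH] e IsI y [c ->]; first by rewrite big_ord0.
have [d md eE] := smul_gens mset_sub (IsI _ (gen_in e ord_max)).
have [u uE] : exists u, u * (1 - d ord_max) = 1.
  apply: mset_unit => m1d; apply: mset_proper.
  by rewrite -(subrK (d ord_max) 1); apply: (subD mset_sub).
pose e' i := e (widen_ord (leqnSn r) i).
have eE' : e ord_max = \sum_i (u * d (widen_ord (leqnSn r) i)) *: e' i.
  rewrite -[LHS](scale1r (e ord_max : R^o)) -uE -scalerA scalerBl scale1r.
  rewrite {1}eE big_ord_recr /= addrK scaler_sumr.
  by apply: eq_bigr => i _; rewrite scalerA.
have I'E : gen e' = gen e.
  apply/seteqP; split.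
    by apply: gen_sub => [|i]; [exact: subm_gen | exact: gen_in].
  apply: gen_sub => [|i]; first exact: subm_gen.
  case: (unliftP ord_max i) => [j ->|->]; last by exists (fun i => u * d (widen_ord (leqnSn r) i)).
  have -> : lift ord_max j = widen_ord (leqnSn r) j.
    by apply: val_inj; rewrite /= /bump leqNgt ltn_ord.
  exact: gen_in e' j.
apply: (IH e'); first by rewrite I'E.
by rewrite I'E; exists c.
Qed.

Lemma noeth_gen (I : set R^o) : subm I -> exists r (e : 'I_r -> R^o), I = gen e.
Proof.
move=> sI; have [r [e eP]] := R_noetherian (@pred_subm R R^o _ sI).
by exists r, e; apply/seteqP; split=> x; rewrite -(asboolE (I x)) => /eP.
Qed.

Local Notation J := (fun k => iter k (smul (m : set R)) [set: R^o]).

Lemma subm_pow k : subm (J k).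
Proof. by case: k => [|k]; [exact: submT | exact: subm_smul]. Qed.
Lemma pow_sub k : J k.+1 `<=` J k.
Proof. by apply: smul_subr; apply: subm_pow. Qed.

(** The powers of [m] stabilize, and the stable one is finitely generated and equal to [m] times
    itself. *)
Lemma mset_nil : exists n, J n = [set 0].
Proof.
pose I n : {pred R} := [pred x | `[<J n x>]].
have [|k x|n nP] := R_artinian (I := I).
- by move=> k; apply: (@pred_subm R R^o); apply: subm_pow.
- by move=> /asboolP Jx; apply/asboolP; apply: pow_sub.
exists n; have [r [e JE]] := noeth_gen (subm_pow n).
apply/seteqP; split=> [x|_ ->]; last exact: sub0 (subm_pow n).
rewrite [J n]JE; apply: nakayama_fg; rewrite -JE => y Jy.
have : y \in I n.+1 by rewrite nP //; apply/asboolP.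
by move=> /asboolP.
Qed.

(** Descending induction along the powers of [m]: a power is obtained from the next one by adding
    finitely many elements that [m] sends into it. *)
Lemma fl_mset : fl [set: R^o].
Proof.
have [n nE] := mset_nil; suff H k : (k <= n)%N -> fl (J (n - k)%N).
  by have := H n (leqnn n); rewrite subnn.
elim: k => [|k IH] lek; first by rewrite subn0 nE; apply: fl0.
have := IH (ltnW lek); set a := (n - k.+1)%N; have -> : (n - k = a.+1)%N by lia.
move=> fS; have [r [e JE]] := noeth_gen (subm_pow a).
have [|fA _] := @len_addgens _ m mset_unit _ _ r e fS.
  by move=> x i mx; apply: smul_incl => //; have := gen_in e i; rewrite -JE.
suff -> : J a = addm (J a.+1) (gen e) by [].
apply/seteqP; split; first by rewrite {1}JE; apply: addmR; apply: subm_pow.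
by apply: addm_sub; [exact: subm_pow|exact: pow_sub|rewrite JE].
Qed.

Lemma artin_localP : artin_local m.
Proof.
by split; [exact: mset_sub|exact: mset_proper|exact: mset_unit|exact: mset_nil|exact: fl_mset].
Qed.

End Setup.

Section ArtinLocal.
Variables (R : comNzRingType) (m : set R^o).
Hypothesis mP : artin_local m.
Local Notation "'m*' U" := (smul (m : set R) U) (at level 35).

(** Iterating the inclusion gives [U] inside [U'] plus [m^k U] for every [k], and some power of [m]
    is zero. *)
Lemma nakayama (V : lmodType R) (U U' : set V) : subm U' ->
  U `<=` addm U' (m* U) -> U `<=` U'.
Proof.
move=> sU' H; have [n nE] := al_nil mP.
pose it k := iter k (smul (m : set R)) U.
have itU k : it k.+1 `<=` addm U' (it k.+2).
  elim: k => [|k IH].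
    apply: smul_sub; first exact/subm_add/subm_smul.
    move=> a u ma /H[u' Uu' [v mv ->]]; rewrite scalerDr.
    by exists (a *: u'); [exact: subZ|exists (a *: v) => //; apply: smul_incl].
  apply: smul_sub; first exact/subm_add/subm_smul.
  move=> a u ma /IH[u' Uu' [v mv ->]]; rewrite scalerDr.
  by exists (a *: u'); [exact: subZ|exists (a *: v) => //; apply: smul_incl].
have UU k : U `<=` addm U' (it k.+1).
  elim: k => [//|k IH] x /IH[u Uu [v /itU[u' Uu' [v' mv' ->]] ->]].
  by exists (u + u'); [exact: subD|exists v'; rewrite ?addrA].
suff itE : it n.+1 `<=` [set 0].
  by move=> x /(UU n)[u Uu [v /itE -> ->]]; rewrite addr0.
have itS k : it k `<=` smul (iter k (smul (m : set R)) [set: R^o] : set R) U.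
  elim: k => [|k IH]; first by move=> x Ux; rewrite -(scale1r x); apply: smul_incl.
  apply: smul_sub; first exact: subm_smul.
  move=> a u ma /IH; move: u; apply: smul_sub.
    split=> [|c u v]; first by rewrite scaler0; apply: sub0; apply: subm_smul.
    rewrite scalerDr scalerA mulrC -scalerA => Hu Hv.
    by apply: subD (subm_smul _ _) (subZ _ (subm_smul _ _) _) _.
  move=> b u Jb Uu /=; rewrite scalerA; apply: smul_incl => //.
  exact: (@smul_incl R R^o m _ a b).
move=> x /itS; apply: smul_sub; first exact: subm0.
move=> a u; rewrite /= nE => Ja _; suff -> : a = 0 by rewrite scale0r.
have H0 : smul (m : set R) [set 0 : R^o] `<=` [set 0].
  by apply: smul_sub; [exact: subm0|move=> b v _ ->; rewrite /= scaler0].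
exact: H0 Ja.
Qed.

(** The dimension of [U / m U] over the residue field. *)
Definition nu (V : lmodType R) (U : set V) : nat := (len U - len (m* U))%N.

(** Generators are picked one at a time outside the span of the previous ones and [m U]. Each raises
    the length by one, so [nu U] of them exhaust [U] modulo [m U], and Nakayama's lemma does the
    rest. The second clause says that they form a basis of [U / m U]. *)
Lemma mingens (V : lmodType R) (U : set V) : fl U -> exists e : 'I_(nu U) -> V,
  U = gen e /\ forall c : 'I_(nu U) -> R, (m* U) (\sum_i c i *: e i) -> forall i, m (c i).
Proof.
move=> fU; have sU := fl_subm fU.
have [msub mpr mun _ _] := mP.
have sm : subm (m* U) by apply: subm_smul.
have mU : m* U `<=` U by apply: smul_subr.
have fm : fl (m* U) := fl_sub fU sm mU.
suff H k : (k <= nu U)%N -> exists e : 'I_k -> V, [/\ forall i, U (e i),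
    forall c : 'I_k -> R, (m* U) (\sum_i c i *: e i) -> forall i, m (c i) &
    (len (m* U) + k <= len (addm (m* U) (gen e)))%N].
  have [e [Ue ind le]] := H _ (leqnn _); exists e; split=> //.
  have AE : addm (m* U) (gen e) = U.
    apply: len_eq => //; first exact: subm_add sm (subm_gen e).
      by apply: addm_sub => //; apply: gen_sub.
    by apply: leq_trans le; rewrite /nu; have := len_sub fU sm mU; lia.
  apply/seteqP; split; last exact: gen_sub.
  apply: nakayama; first exact: subm_gen.
  by move=> x; rewrite -{1}AE => -[u mu [v ev ->]]; exists v => //; exists u; rewrite // addrC.
elim: k => [|k IH] lek.
  exists (fun=> 0); split=> [[]//|c _ []//|]; rewrite addn0.
  apply: len_sub; [|by []|exact: addmL (subm_gen _)].
  by apply: fl_sub fU (subm_add sm (subm_gen _)) _; apply: addm_sub => //; apply: gen_sub => // -[].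
have [e [Ue ind le]] := IH (ltnW lek).
have [fA lA] := len_addgens mun (e := e) fm
  (fun x i mx => @smul_incl _ _ _ _ x _ mx (Ue i)).
have [u Uu nu] : exists2 u, U u & ~ addm (m* U) (gen e) u.
  apply: contrapT => nex; have UA : U `<=` addm (m* U) (gen e).
    by move=> u Uu; apply: contrapT => nu; apply: nex; exists u.
  by have := len_sub fA sU UA; move: lek lA; rewrite /nu; lia.
exists (fun i => if unlift ord_max i is Some j then e j else u); split.
- by move=> i; case: unliftP.
- move=> c; rewrite big_ord_recr /= unlift_none.
  have wE (j : 'I_k) : widen_ord (leqnSn k) j = lift ord_max j.
    by apply: val_inj; rewrite /= /bump leqNgt ltn_ord.
  under eq_bigr => j _ do rewrite wE liftK.
  move=> mS; have mc : m (c ord_max).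
    apply: contrapT => /mun[y yE]; apply: nu.
    rewrite -[u]scale1r -yE -scalerA; apply: subZ; first exact: subm_add sm (subm_gen _).
    exists (\sum_i c (lift ord_max i) *: e i + c ord_max *: u) => //.
    exists (- \sum_i c (lift ord_max i) *: e i); last by rewrite addrC addKr.
    by apply: subN; [exact: subm_gen|exists (fun i => c (lift ord_max i))].
  have mS' := subDr sm (smul_incl mc Uu) mS.
  move=> i; case: (unliftP ord_max i) => [j ->|->//].
  exact: (ind (fun j => c (lift ord_max j))).
- rewrite addnS; set e' := fun i => _; apply/lenP.
    apply: fl_sub fU (subm_add sm (subm_gen _)) _; apply: addm_sub => //.
    by apply: gen_sub => // i; rewrite /e'; case: unliftP.
  apply: (chain_ext (U := addm (m* U) (gen e))).
  + exact: subm_add sm (subm_gen _).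
  + apply: addm_sub; [exact: subm_add sm (subm_gen _)|exact: addmL (subm_gen _)|].
    apply: gen_sub => [|i]; first exact: subm_add sm (subm_gen _).
    by apply: addmR sm _ _; have := gen_in e' (lift ord_max i); rewrite {2}/e' liftK.
  + by exists u => //; apply: addmR sm _ _; have := gen_in e' ord_max; rewrite {2}/e' unlift_none.
  + exact/lenP.
Qed.

Lemma nu_le (V : lmodType R) r (e : 'I_r -> V) : fl (gen e) -> (nu (gen e) <= r)%N.
Proof.
move=> fU; have [msub mpr mun _ _] := mP.
have fm : fl (m* (gen e)) := fl_sub fU (subm_smul _ _) (smul_subr (subm_gen e)).
have [fA] := len_addgens mun (e := e) fm
  (fun x i mx => @smul_incl _ _ _ _ x _ mx (gen_in e i)).
suff -> : addm (m* (gen e)) (gen e) = gen e by rewrite /nu; lia.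
apply/seteqP; split; last exact: addmR (subm_smul _ _).
by apply: addm_sub => //; [exact: subm_gen|apply: smul_subr; exact: subm_gen].
Qed.

Lemma fl_gen (V : lmodType R) r (e : 'I_r -> V) : fl (gen e).
Proof.
elim: r e => [|r IH] e.
  suff -> : gen e = [set 0] by apply: fl0.
  by apply/seteqP; split=> [x [c ->]|_ ->]; [rewrite big_ord0|exists (fun=> 0); rewrite big_ord0].
have sg := subm_gen e.
pose g (c : R^o) : V := c *: e ord_max.
have gl : linear g by move=> a x y; rewrite /g scalerDl scalerA.
pose G : {linear R^o -> V} := HB.pack g (GRing.isLinear.Build _ _ _ _ g gl).
have fG : fl (G @` [set: R^o]) by apply: fl_img; apply: al_fl mP.
have [fA _] := len_add (IH (fun i => e (widen_ord (leqnSn r) i))) fG.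
apply: fl_sub fA sg _ => x [c ->]; rewrite big_ord_recr /=.
exists (\sum_i c (widen_ord (leqnSn r) i) *: e (widen_ord (leqnSn r) i)); first by eexists.
by exists (c ord_max *: e ord_max) => //; exists (c ord_max).
Qed.

End ArtinLocal.

(** * Comparison with composition series *)

Section Length.
Variables (R : comNzRingType) (V : lmodType R).

Lemma comp_series_ge n (S : nat -> {pred V}) : fl [set: V] ->
  composition_series n S -> (len [set: V] <= n)%N.
Proof.
move=> fV [S0 Sn cS iS sS].
pose U i : set V := [set x | x \in S i].
have sU i : (i <= n)%N -> subm (U i) by move=> lei; apply/subm_pred/cS.
suff H i : (i <= n)%N -> (len (U i) <= i)%N.
  have -> : [set: V] = U n by apply/seteqP; split=> // x _; rewrite /U /= Sn.
  exact: H.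
elim: i => [_|i IH lti].
  have -> : U 0%N = [set 0].
    by apply/seteqP; split=> x; rewrite /U /= S0 inE => /eqP.
  by rewrite len0.
have [s s'] := (sU i (ltnW lti), sU i.+1 lti).
have f' : fl (U i.+1) by apply: fl_sub fV s' _.
have sub : U i `<=` U i.+1 by case: (iS i lti).
rewrite (len_exact (qpi s) f') ker_qpi (_ : U i.+1 `&` U i = U i); last first.
  by apply/seteqP; split=> [x []//|x Ux]; split=> //; apply: sub.
have nc : ~ chain (qpi s @` U i.+1) 2.
  move=> [W [sW cW WU]].
  pose T : {pred V} := [pred x | `[< U i.+1 x /\ W 1%N (qpi s x) >]].
  have qU x : U i x <-> qpi s x = 0.
    by have /seteqP[h1 h2] := ker_qpi s; split=> [/h2|?]; [|apply: h1].
  have cT : submod_closed T.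
    apply: (@pred_subm R V (U i.+1 `&` qpi s @^-1` W 1%N)).
    by apply: submI => //; apply: subm_pre.
  have [W01 [x W1x nW0x]] := cW 0%N isT; have [W12 [y W2y nW1y]] := cW 1%N isT.
  have [y' Uy' y'E] := WU _ W2y; have [x' Ux' x'E] := WU _ (W12 _ W1x).
  case: (sS i lti T cT) => [z Uz|z|TE|TE].
  + by apply/asboolP; split; [exact: sub|rewrite (qU z).1 //; apply: sub0].
  + by move=> /asboolP[].
  + apply: nW0x; rewrite -x'E (qU x').1; first exact: sub0.
    by rewrite /U /= -TE; apply/asboolP; rewrite x'E.
  + apply: nW1y; rewrite -y'E; have : y' \in T by rewrite TE.
    by move=> /asboolP[].
have [_ l] := chain_nle (subm_img (qpi s) s') nc.
by apply: leq_trans (leq_add l (IH (ltnW lti))) _; rewrite add1n.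
Qed.

Lemma comp_series_ex : fl [set: V] -> exists S : nat -> {pred V},
  composition_series (len [set: V]) S.
Proof.
move=> fV.
suff H n (U : set V) : fl U -> len U = n -> exists S : nat -> set V,
   [/\ forall i, subm (S i), S n = U, forall i, (i <= n)%N -> len (S i) = i
     & forall i, (i < n)%N -> S i `<=` S i.+1].
  have [S [sS Sn lS iS]] := H _ _ fV erefl.
  have fS i : fl (S i) by apply: fl_sub fV _ _.
  have ltS i : (i < len [set: V])%N -> ~ S i.+1 `<=` S i.
    move=> lti /(len_sub (fS i) (sS _)); rewrite !lS //; last exact: ltnW.
    by rewrite ltnn.
  exists (fun i => [pred x | `[<S i x>]] : {pred V}); split.
  - move=> x; rewrite !inE; have -> : S 0%N = [set 0] by apply: len_eq0; rewrite ?lS.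
    by apply/asboolP/eqP.
  - by move=> x; rewrite !inE Sn; apply/asboolP.
  - by move=> i _; apply: pred_subm.
  - move=> i lti; split=> [x|xS]; first by move=> /asboolP Sx; apply/asboolP; apply: iS Sx.
    by apply: (ltS i lti) => x Sx; apply/asboolP; apply: xS; apply/asboolP.
  - move=> i lti T cT ST TS.
    have sT := subm_pred cT; set T' := [set x | x \in T] in sT.
    have ST' : S i `<=` T' by move=> x Sx; apply: ST; apply/asboolP.
    have TS' : T' `<=` S i.+1 by move=> x Tx; apply/asboolP/TS.
    have fT : fl T' by apply: fl_sub fV _ _.
    have [l1 l2] := (len_sub fT (sS i) ST', len_sub (fS i.+1) sT TS').
    rewrite !lS // ?(ltnW lti) // in l1 l2.
    case: (leqP (len T') i) => lT; [left|right] => x; apply/idP/asboolP.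
    + by move=> Tx; rewrite (len_eq fT (sS i) ST') // lS // ltnW.
    + by move=> Sx; apply: ST'.
    + by move=> Tx; apply: TS'.
    + by rewrite -(len_eq (fS i.+1) sT TS') // lS.
elim: n U => [|n IH] U fU lU.
  by exists (fun=> U); split=> // [i|i]; [exact: fl_subm|rewrite leqn0 => /eqP->].
have : chain U n.+1 by apply/lenP; rewrite ?lU.
case=> W [sW cW WU]; have [Wn [x Wx nWx]] := cW n (ltnSn n).
have WnU : W n `<=` U by apply: subset_trans WU.
have fW : fl (W n) := fl_sub fU (sW n) WnU.
have cn : chain (W n) n by exists W; split=> // i /ltnW; apply: cW.
have lW : len (W n) = n.
  apply/anti_leq/andP; split; last exact/lenP.
  rewrite leqNgt; apply/negP => lt; apply: nWx.
  by rewrite (len_eq fU (sW n) WnU) ?lU //; apply: WU.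
have [S [sS Sn lS iS]] := IH _ fW lW.
exists (fun i => if (i <= n)%N then S i else U); split.
- by move=> i; case: ifP => // _; apply: fl_subm.
- by rewrite ltnn.
- by move=> i; case: ifP => [lei _|/negbT]; [exact: lS|rewrite -ltnNge => lt lei; rewrite lU; lia].
- move=> i; rewrite ltnS => lei; rewrite lei; case: ltngtP lei => // [lti|->] _; first exact: iS.
  by rewrite Sn.
Qed.

(** Each factor of a composition series adds at most one to [len], so the bound holds for whichever
    series the choice in [module_length] selects. *)
Lemma module_lengthE : fl [set: V] -> (len [set: V] <= module_length V)%N.
Proof.
move=> fV; have [S cS] := comp_series_ex fV; rewrite /module_length.
by case: xgetP => [n -> [S' /(comp_series_ge fV)]//|/(_ _ (ex_intro _ S cS))].
Qed.

End Length.

(** * Self-injectivity and the socle *)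

(** A linear map from an ideal to [E], encoded by its graph, so that the ideal does not have to be
    made a module. *)
Definition functional (R : comNzRingType) (E : lmodType R) (G : set (R^o * E)) :=
  subm G /\ forall y, G (0, y) -> y = 0.

Lemma injective_ext (R : comNzRingType) (E : lmodType R) (G : set (R^o * E)) :
  injective_module E -> functional G -> exists e, forall x y, G (x, y) -> y = x *: e.
Proof.
move=> injE [sG G0].
(* The graph becomes a module as the kernel of the quotient map by it; the first projection is then
   an injection into the ring. *)
pose A : lmodType R := kernel (qpi sG).
pose v : {linear A -> (R^o * E)%type} := \val.
pose i : {linear A -> R^o} := fst \o v.
have Gv (z : A) : G (v z) by have := ker_qpi sG => <-; case: z => z /= /eqP.
have iinj : injective i.
  move=> z z' /eqP; rewrite -subr_eq0 -linearB => /eqP E0.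
  apply/eqP; rewrite -subr_eq0; apply/eqP/val_inj; change (v (z - z') = v 0).
  rewrite linear0; have := Gv (z - z').
  move: E0; change ((v (z - z')).1 = 0 -> G (v (z - z')) -> v (z - z') = 0).
  by case: (v _) => a b /= -> /G0 ->.
have [g gP] := injE _ _ i (snd \o v : {linear A -> E}) iinj.
exists (g 1) => x y Gxy.
have xyK : (x, y) \in ker_pred (qpi sG).
  by apply/eqP; have /seteqP[_ h] := ker_qpi sG; apply: h.
have := gP (Kernel xyK); rewrite /= => <-.
by rewrite -[in LHS](mulr1 x) -[x * 1]/(x *: (1 : R^o)) linearZ.
Qed.

Section Socle.
Variables (R : comNzRingType) (m : set R^o).
Hypothesis mP : artin_local m.
Local Notation J := (fun k => iter k (smul (m : set R)) [set: R^o]).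

Lemma unit_or_m (r : R) : m r \/ exists u, u * r = 1.
Proof. by case: (pselect (m r)) => [|/(al_unit mP)]; [left|right]. Qed.

Lemma mod_socle (I : set R^o) : subm I -> ~ I 1 ->
  exists2 a, ~ I a & forall x, m x -> I (x * a).
Proof.
move=> sI nI1; have [n nE] := al_nil mP.
have H : J n `<=` I by rewrite nE => _ ->; apply: sub0.
elim: n {nE} H => [H|n IH H]; first by case: nI1; apply: H.
case: (pselect (J n `<=` I)) => [/IH//|nJ].
have [a Ja nIa] : exists2 a, J n a & ~ I a.
  by apply: contrapT => h; apply: nJ => a Ja; apply: contrapT => nIa; apply: h; exists a.
by exists a => // x mx; apply: H; apply: smul_incl.
Qed.

Lemma exists_socle : exists2 a : R, a <> 0 & forall x, m x -> x * a = 0.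
Proof.
have [] := @mod_socle [set 0] (subm0 _); first by move/eqP; rewrite oner_eq0.
by move=> a a0 h; exists a => // x /h.
Qed.

(** Induction along a composition series of [R / I], from the top: every proper ideal is enlarged by
    an element that lies in the socle of the quotient. *)
Lemma ideal_ind (P : set R^o -> Prop) : P [set: R^o] ->
  (forall (I : set R^o) a, subm I -> ~ I a -> (forall x, m x -> I (x * a)) ->
     P (addm I [set y | exists r : R, y = r *: (a : R^o)]) -> P I) ->
  forall I, subm I -> P I.
Proof.
move=> PT PS I sI; have [k lek] := ex_intro (fun k => len [set: R^o] <= len I + k)%N
  (len [set: R^o]) (leq_addl _ _).
elim: k I sI lek => [|k IH] I sI lek.
  by rewrite (len_eq (al_fl mP) sI) // -[len I]addn0.
case: (pselect (I 1)) => [I1|/(mod_socle sI)[a nIa ma]].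
  suff -> : I = [set: R^o] by [].
  by apply/seteqP; split=> // x _; rewrite -[x]mulr1; apply: (subZ x sI I1).
have sC := subm_cyclic (a : R^o).
have sA := subm_add sI sC.
have fA : fl (addm I [set y | exists r : R, y = r *: (a : R^o)]).
  exact: fl_sub (al_fl mP) sA _.
apply: (PS I a) => //; apply: IH => //.
have : chain (addm I [set y | exists r : R, y = r *: (a : R^o)]) (len I).+1.
  apply: (chain_ext sA (addmL sC)).
    by exists a => //; apply: addmR => //; exists 1; rewrite scale1r.
  by apply/lenP => //; apply: fl_sub (al_fl mP) sI _.
by move=> /(lenP _ fA); lia.
Qed.

Section Descend.
Variables (A B C : lmodType R) (d : {linear A -> B}) (d' : {linear B -> C}).
Hypotheses (injA : injective_module A) (exB : is_exact d d').
Hypothesis PB : forall G : set (R^o * B), functional G ->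
  (forall x y, G (x, y) -> d' y = 0) ->
  exists2 e, d' e = 0 & forall x y, G (x, y) -> y = x *: e.

(** This is the vanishing of Ext^1(R/I, ker d), stated as the lifting of elements of [ker d'] killed
    by [I]. It is reduced to the residue field by adding one socle element at a time to [I]. *)
Lemma lift_annihilated (I : set R^o) : subm I -> forall e', d' e' = 0 ->
  (forall x, I x -> x *: e' = 0) ->
  exists2 e, d e = e' & forall x, I x -> x *: e = 0.
Proof.
move: I; apply: ideal_ind.
  move=> e' _ /(_ 1 I); rewrite scale1r => ->; exists 0 => [|x _]; first by rewrite linear0.
  by rewrite scaler0.
move=> I a sI nIa ma IH e' de' Ie'; set C0 := [set y | _] in IH.
have sC : subm C0 := subm_cyclic (a : R^o).
have mu x : m x -> x *: (a *: e') = 0 by move=> mx; rewrite scalerA Ie' //; apply: ma.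
(* Since [ker d'] extends maps from ideals, sending the socle element [s] to [a *: e'] shows that
   [a *: e'] is [s] times an element [e0]. Lifting [e0] to [A] and multiplying by [s] yields a lift
   killed by [m]; this is where depth zero matters. *)
have [w dw mw] : exists2 w, d w = a *: e' & forall x, m x -> x *: w = 0.
  have [s s0 ms] := exists_socle.
  pose G : set (R^o * B) := [set z | exists r : R, z = (r *: (s : R^o), r *: (a *: e'))].
  have [||e0 de0 eP] := @PB G.
  - split=> [|y [r [rs ->]]].
      split=> [|b _ _ [r ->] [t ->]]; first by exists 0; rewrite !scale0r.
      by exists (b * r + t); rewrite !scalerDl -!(scalerA b).
    have [/mu //|[u ur]] := unit_or_m r.
    by case: s0; rewrite -(mul1r s) -ur -mulrA -[r * s]/(r *: (s : R^o)) -rs mulr0.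
  - by move=> x y [r [_ ->]]; rewrite !linearZ /= de' !scaler0.
  have [e1 e1E] := (exB e0).1 de0.
  exists (s *: e1); first rewrite linearZ /= e1E -(eP s (a *: e')) //.
    by exists 1; rewrite !scale1r.
  by move=> x mx; rewrite scalerA ms // scale0r.
(* By injectivity of [A] there is [e2] killed by [I] with [a *: e2 = w]; then [e' - d e2] is killed
   by the larger ideal. *)
pose G : set (R^o * A) := [set z | exists2 x, I x & exists r : R, z = (x + r *: (a : R^o), r *: w)].
have [|e2 e2P] := injective_ext injA (G := G).
  split=> [|y [x Ix [r [xr ->]]]].
    split=> [|b _ _ [x Ix [r ->]] [y Iy [t ->]]].
      by exists 0; [exact: sub0|exists 0; rewrite !scale0r addr0].
    exists (b *: x + y); first by case: sI => _; apply.
    by exists (b * r + t); congr pair; rewrite /= !scalerDl -!(scalerA b) ?scalerDr // addrACA.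
  have [/mw //|[u ur]] := unit_or_m r.
  case: nIa; rewrite -(mul1r a) -ur -mulrA; apply: (subZ u sI).
  by apply: (subDl sI Ix); rewrite -[r * a]/(r *: (a : R^o)) -xr; apply: sub0.
have Ie2 x : I x -> x *: e2 = 0.
  by move=> Ix; rewrite -(e2P x 0) //; exists x => //; exists 0; rewrite !scale0r addr0.
have ae2 : a *: e2 = w.
  by rewrite -(e2P a w) //; exists 0; [exact: sub0|exists 1; rewrite !scale1r add0r].
have [|x [y Iy [_ [r ->] ->]]|e de Ie] := IH (e' - d e2).
- by rewrite linearB de' (exB _).2 ?subr0 //; exists e2.
- rewrite scalerDl !scalerBr Ie' // -!linearZ /= Ie2 // linear0 subr0 add0r.
  by change ((r * a) *: e' - d ((r * a) *: e2) = 0); rewrite -!scalerA ae2 [d _]linearZ_LR dw subrr.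
- exists (e + e2); first by rewrite linearD de subrK.
  by move=> x Ix; rewrite scalerDr Ie2 // Ie ?addr0 //; apply: addmL.
Qed.

(** Injectivity of [A] extends the map to multiplication by some [e], but [d e] may be nonzero. It
    is killed by the domain of the map, so it has a lift with the same property, which is subtracted
    from [e]. *)
Lemma ideal_inj_descend (G : set (R^o * A)) : functional G ->
  (forall x y, G (x, y) -> d y = 0) ->
  exists2 e, d e = 0 & forall x y, G (x, y) -> y = x *: e.
Proof.
move=> fG dG; have [e eP] := injective_ext injA fG.
pose I : set R^o := [set x | exists y, G (x, y)].
have sI : subm I.
  case: fG => -[G0 GD] _; split=> [|a x x' [y Gy] [y' Gy']]; first by exists 0.
  by exists (a *: y + y'); apply: (GD a (x, y) (x', y')).
have [|x [y Gxy]|e1 de1 Ie1] := @lift_annihilated I sI (d e).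
- by apply/exB; exists e.
- by rewrite -linearZ /= -(eP _ _ Gxy) (dG _ _ Gxy).
- exists (e - e1); first by rewrite linearB de1 subrr.
  move=> x y Gxy; rewrite scalerBr -(eP _ _ Gxy) Ie1 ?subr0 //.
  by exists y.
Qed.

End Descend.

(** Beyond the length of the injective resolution the cosyzygies are zero, and injectivity descends
    from each cosyzygy to the previous one, down to the ring. A Gorenstein Artinian local ring is
    thus self-injective. *)
Theorem gorenstein_ext : gorenstein R -> forall G : set (R^o * R^o), functional G ->
  exists r : R, forall x y, G (x, y) -> y = x * r.
Proof.
move=> [E [n En]] G [[G0 GD] Gf].
pose P i := forall G : set (R^o * ir_obj E i), functional G ->
  (forall x y, G (x, y) -> ir_diff E i y = 0) ->
  exists2 e, ir_diff E i e = 0 & forall x y, G (x, y) -> y = x *: e.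
have PS i : P i.+1 -> P i.
  by move=> Pi; apply: ideal_inj_descend Pi; [exact: ir_injective|exact: ir_exact].
have P0 : P 0%N.
  have : P n.+1.
    move=> G' _ _; exists 0; first by rewrite linear0.
    by move=> x y _; rewrite scaler0; apply: En.
  by elim: n.+1 => // k IH /PS.
have [] := P0 [set z | exists2 y, ir_aug E y = z.2 & G (z.1, y)].
- split=> [|y [z zE /Gf z0]]; last by move: zE; rewrite z0 linear0 /= => <-.
  split=> [|a [x y] [x' y'] [z /= <- Gz] [z' /= <- Gz']].
    by exists 0; rewrite ?linear0.
  exists (a *: z + z'); first by rewrite linearP.
  exact: (GD a (x, z) (x', z')).
- by move=> x y [z /= <- _]; apply: (ir_exact0 _).2; exists z.
- move=> e /(ir_exact0 _).1[r <-] eP; exists r => x y Gxy.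
  by apply: (@ir_aug_inj _ _ E); rewrite (eP x (ir_aug E y)) -?linearZ //; exists y.
Qed.

(** Sending one socle element [s] to another is well defined, and self-injectivity makes it a
    multiplication. *)
Theorem gorenstein_socle : gorenstein R -> exists s : R, [/\ s <> 0,
  forall x, m x -> x * s = 0 & forall t : R, (forall x, m x -> x * t = 0) -> exists r, t = r * s].
Proof.
move=> gor; have [s s0 ms] := exists_socle; exists s; split=> // t mt.
have [|r rP] := gorenstein_ext gor (G := [set z | exists r : R, z = (r *: (s : R^o), r *: (t : R^o))]).
  split=> [|y [r [rs ->]]].
    split=> [|b _ _ [r ->] [u ->]]; first by exists 0; rewrite !scale0r.
    by exists (b * r + u); rewrite !scalerDl -!(scalerA b).
  have [/mt //|[u ur]] := unit_or_m r.
  by case: s0; rewrite -(mul1r s) -ur -mulrA -[r * s]/(r *: (s : R^o)) -rs mulr0.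
by exists r; rewrite mulrC; apply: (rP s t); exists 1; rewrite !scale1r.
Qed.

End Socle.

(** * Duality *)

(** All that is kept of the Gorenstein property: the socle is generated by one nonzero element. *)
Record gor_local (R : comNzRingType) (m : set R^o) (s : R) : Prop := GorLocal {
  gl_al : artin_local m;
  gl_s0 : s <> 0;
  gl_ms : forall x : R, m x -> x * s = 0;
  gl_soc : forall t : R, (forall x : R, m x -> x * t = 0) -> exists r, t = r * s
}.

Section Free.
Variables (R : comNzRingType) (V : lmodType R).

Lemma len_coord (T : finType) (c : T -> {linear V -> R^o}) (I : set R^o) : fl I ->
  (forall v, (forall t, c t v = 0) -> v = 0) ->
  (forall g : T -> R, exists v, forall t, c t v = g t) ->
  let F := [set v | forall t, I (c t v)] in
  fl F /\ len F = (#|T| * len I)%N.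
Proof.
move=> fI inj surj F; have sI := fl_subm fI.
pose U (l : seq T) : set V := [set v | forall t, if t \in l then I (c t v) else c t v = 0].
have sU l : subm (U l).
  split=> [t|a u v Uu Uv t]; first by rewrite linear0; case: ifP => // _; apply: sub0.
  have := Uu t; have := Uv t; rewrite linearP; case: ifP => [_ hv hu|_ -> ->].
    by case: sI => _; apply.
  by rewrite scaler0 addr0.
suff H l : uniq l -> fl (U l) /\ len (U l) = (size l * len I)%N.
  have [fU lU] := H _ (enum_uniq T).
  have E : U (enum T) = F.
    by apply/seteqP; split=> v h t; have := h t; rewrite mem_enum.
  by rewrite -E cardE.
elim: l => [_|t l IH /= /andP[/negPf tl /IH[fl_l len_l]]].
  have -> : U [::] = [set 0].
    by apply/seteqP; split=> [v h|_ -> t /=]; [apply: inj => t; apply: h|rewrite linear0].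
  by rewrite len0 mul0n; split=> //; apply: fl0.
have kE : U (t :: l) `&` ker (c t) = U l.
  apply/seteqP; split=> [v [h h'] u|v h].
    have := h u; rewrite inE; have [->|//] := eqVneq u t.
    by rewrite tl.
  split=> [u|]; last by have := h t; rewrite tl.
  have := h u; rewrite inE; have [->|//] := eqVneq u t.
  by rewrite tl /= => ->; apply: sub0.
have imE : c t @` U (t :: l) = I.
  apply/seteqP; split=> [_ [v Uv <-]|x Ix]; first by have := Uv t; rewrite inE eqxx.
  have [v vP] := surj (fun u => if u == t then x else 0).
  exists v; last by rewrite vP eqxx.
  move=> u; rewrite inE vP; have [_|_] := eqVneq u t => //=.
  by case: ifP => // _; apply: sub0.
have fl' : fl (U (t :: l)).
  by apply: (@fl_exact _ _ _ (c t)); rewrite ?imE ?kE.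
by split=> //; rewrite (len_exact (c t) fl') imE kE len_l mulSn.
Qed.

End Free.

Definition mxin (R : comNzRingType) a b (I : set R^o) : set 'M[R]_(a, b) :=
  [set M | forall i j, I (M i j)].
Arguments mxin {R a b} I.

Section Mxin.
Variables (R : comNzRingType) (a b : nat).
Implicit Types I : set R^o.

Lemma len_mxin I : fl I ->
  fl (mxin I : set 'M[R]_(a, b)) /\ len (mxin I : set 'M[R]_(a, b)) = (a * b * len I)%N.
Proof.
move=> fI.
have cl (t : 'I_a * 'I_b) : linear (fun M : 'M[R]_(a, b) => M t.1 t.2 : R^o).
  by move=> x M N; rewrite !mxE.
pose c t : {linear 'M[R]_(a, b) -> R^o} := HB.pack (fun M : 'M[R]_(a, b) => M t.1 t.2 : R^o)
  (GRing.isLinear.Build _ _ _ _ _ (cl t)).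
have [|g|] := @len_coord R 'M[R]_(a, b) ('I_a * 'I_b)%type c I fI.
- by move=> M M0; apply/matrixP => i j; rewrite mxE; apply: (M0 (i, j)).
- by exists (\matrix_(i, j) g (i, j)) => -[i j] /=; rewrite mxE.
- rewrite card_prod !card_ord; have -> // : [set v | forall t, I (c t v)] = mxin I.
  by apply/seteqP; split=> M h => [i j|[i j]]; [exact: (h (i, j))|exact: h].
Qed.

Lemma len_mx : fl [set: R^o] ->
  fl [set: 'M[R]_(a, b)] /\ len [set: 'M[R]_(a, b)] = (a * b * len [set: R^o])%N.
Proof.
move=> /len_mxin; have -> // : mxin [set: R^o] = [set: 'M[R]_(a, b)].
by apply/seteqP; split.
Qed.

Lemma subm_mxin I : subm I -> subm (mxin I : set 'M[R]_(a, b)).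
Proof.
move=> sI; split=> [i j|x M N IM IN i j]; rewrite !mxE; first exact: (@sub0 R R^o I).
by case: sI => _; apply; [exact: IM|exact: IN].
Qed.

Lemma mxin_sum I (M : 'M[R]_(a, b)) (S : set 'M[R]_(a, b)) : subm S -> mxin I M ->
  (forall x N, I x -> S (x *: N)) -> S M.
Proof.
move=> sS IM H; rewrite (matrix_sum_delta M); apply: sub_sum => // i _.
by apply: sub_sum => // j _; apply: H; apply: IM.
Qed.

Lemma mxin_smul I : subm I -> mxin I = smul (I : set R) [set: 'M[R]_(a, b)].
Proof.
move=> sI; apply/seteqP; split=> [M IM|].
  by apply: (mxin_sum (subm_smul _ _) IM) => x N Ix; apply: smul_incl.
apply: smul_sub; first exact: subm_mxin.
by move=> x N Ix _ i j; rewrite mxE mulrC; apply: (subZ (V := R^o) _ sI).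
Qed.

End Mxin.
Arguments subm_mxin {R a b I}.

Lemma mxin_mul (R : comNzRingType) (I J : set R^o) a b c (A : 'M[R]_(a, b)) (B : 'M_(b, c)) :
  mxin I A -> mxin J B -> mxin (smul (I : set R) J) (A *m B).
Proof.
move=> IA JB i j; rewrite mxE; apply: (@sub_sum R R^o) => [|k _]; first exact: subm_smul.
by apply: (@smul_incl R R^o).
Qed.

Lemma mxin_mull (R : comNzRingType) (I : set R^o) a b c (A : 'M[R]_(a, b)) (B : 'M_(b, c)) :
  subm I -> mxin I A -> mxin I (A *m B).
Proof.
move=> sI IB i j; rewrite mxE; apply: (@sub_sum R R^o I) => // k _.
by rewrite mulrC; apply: (subZ (V := R^o)).
Qed.

Section Perp.
Variables (R : comNzRingType) (m : set R^o) (s : R).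
Hypothesis mP : gor_local m s.
Local Notation lam := (len [set: R^o]).

Lemma len_soc_le1 (U : set R^o) : subm U -> (forall x u, m x -> U u -> x * u = 0) ->
  (len U <= 1)%N.
Proof.
move=> sU mU; have [al _ ms socs] := mP.
have nc := chain_simple (al_unit al) (a := s : R^o) ms.
have [fS lS] := chain_nle (subm_cyclic (s : R^o)) nc.
apply: leq_trans lS; apply: len_sub => // u Uu.
by apply: socs => x mx; apply: mU.
Qed.

Variables (V W : lmodType R) (B : V -> {linear W -> R^o}).
Hypothesis Bl : forall w, linear (fun v => B v w).
Hypotheses (fV : fl [set: V]) (fW : fl [set: W]).

Definition perp (U : set V) : set W := [set w | forall u, U u -> B u w = 0].

Lemma subm_perp U : subm (perp U).
Proof.
split=> [u _|a w w' Uw Uw' u Uu]; first by rewrite linear0.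
by rewrite linearP Uw // Uw' // scaler0 addr0.
Qed.

(** Enlarging [U] by an element [a] with [m a] inside [U] shrinks the orthogonal by at most one,
    because [B a] maps [perp U] into the socle. *)
Lemma len_perp_step (U U' : set V) : subm U -> subm U' -> U `<=` U' ->
  (len (perp U) <= len (perp U') + (len U' - len U))%N.
Proof.
move=> sU sU' UU.
have fl_V (X : set V) : subm X -> fl X by move=> sX; apply: fl_sub fV sX (@subsetT _ _).
have fl_W (X : set W) : subm X -> fl X by move=> sX; apply: fl_sub fW sX (@subsetT _ _).
have [k] := ubnP (len U' - len U)%N; elim: k => // k IH in U sU UU *; rewrite ltnS => lek.
case: (pselect (U' `<=` U)) => [U'U|nU'U].
  have -> : U = U' by apply/seteqP.
  by rewrite leq_addr.
have al := gl_al mP.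
have [a [U'a nUa ma]] : exists a, [/\ U' a, ~ U a & forall x, m x -> U (x *: a)].
  apply: contrapT => nex; apply: nU'U; have [n nE] := al_nil al.
  suff H j : forall a, U' a -> (forall x, iter j (smul (m : set R)) [set: R^o] x -> U (x *: a)) -> U a.
    move=> a U'a; apply: (H n) => // x; rewrite nE => ->; rewrite scale0r; exact: sub0.
  elim: j => [|j IHj] a U'a Ja; first by rewrite -(scale1r a); apply: Ja.
  apply: IHj => // y Jy; apply: contrapT => nUya; apply: nex; exists (y *: a); split=> //.
    exact: subZ.
  by move=> x mx; rewrite scalerA; apply: Ja; apply: smul_incl.
set C := [set y | exists r : R, y = r *: a].
have sC : subm C := subm_cyclic a.
have sA := subm_add sU sC.
have AU : addm U C `<=` U' by apply: addm_sub => // _ [r ->]; apply: subZ.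
have lA : (len U < len (addm U C))%N.
  apply/lenP; first exact: fl_V.
  apply: (chain_ext sA (addmL sC)); last by apply/lenP => //; apply: fl_V.
  by exists a => //; apply: addmR => //; exists 1; rewrite scale1r.
have lAU := len_sub (fl_V _ sU') sA AU.
have := IH _ sA AU; move=> /(_ ltac:(lia)) le.
suff : (len (perp U) <= len (perp (addm U C)) + 1)%N by lia.
have fP := fl_W _ (subm_perp U).
rewrite (len_exact (B a) fP) addnC leq_add //.
  apply: len_sub; [exact/fl_W/subm_perp|apply: submI; [exact: subm_perp|exact: subm_ker]|].
  move=> w [Uw aw] _ [u Uu [_ [r ->] ->]].
  have -> : B (u + r *: a) w = B u w + r *: B a w.
    by rewrite addrC Bl addrC.
  by rewrite Uw // aw scaler0 addr0.
apply: len_soc_le1; first exact/subm_img/subm_perp.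
move=> x _ mx [w Uw <-]; have := Uw _ (ma x mx).
by move: (Bl w x a 0); rewrite addr0 => ->; rewrite (Uw 0 (sub0 sU)) addr0.
Qed.

Hypotheses (lVW : len [set: V] = len [set: W])
  (Br : forall w, (forall v, B v w = 0) -> w = 0).

(** The step inequality, applied between [U] and [V] and between 0 and [U], bounds the length of the
    orthogonal from both sides. *)
Lemma len_perp (U : set V) : subm U -> (len U + len (perp U))%N = len [set: V].
Proof.
move=> sU; have l1 := len_perp_step sU (@submT _ V) (@subsetT _ U).
have l2 := len_perp_step (@subm0 _ V) sU ltac:(by move=> _ ->; apply: sub0).
have E1 : perp [set: V] = [set 0].
  by apply/seteqP; split=> [w h|_ -> v _]; [apply: Br => v; apply: h|rewrite linear0].
have E0 : perp [set 0] = [set: W].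
  apply/seteqP; split=> // w _ _ ->; have := Bl w (-1) 0 0.
  by rewrite scaler0 addr0 scaleN1r addNr.
rewrite E1 E0 !len0 in l1 l2.
have := len_sub fV sU (@subsetT _ U); lia.
Qed.

End Perp.

Section Annihilator.
Variables (R : comNzRingType) (m : set R^o) (s : R).
Hypothesis mP : gor_local m s.

Definition ann (I : set R^o) : set R^o := [set r | forall x : R, I x -> x * r = 0].

Lemma len_ann (I : set R^o) : subm I -> (len I + len (ann I))%N = len [set: R^o].
Proof.
move=> sI; apply: (@len_perp _ _ _ mP R^o R^o (fun x => *:%R x)) => //.
- by move=> w a x y; rewrite /= scalerDl scalerA.
- exact: al_fl (gl_al mP).
- exact: al_fl (gl_al mP).
- by move=> w /(_ 1) /=; rewrite -[X in X = _]/(1 * w) mul1r.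
Qed.

Lemma subm_ann (I : set R^o) : subm (ann I).
Proof.
split=> [x _|a u v Iu Iv x Ix]; first by rewrite mulr0.
by rewrite mulrDr -[a *: u]/(a * u) mulrCA Iu // Iv // mulr0 addr0.
Qed.

Lemma annm : ann m = [set y | exists r : R, y = r *: (s : R^o)].
Proof.
have [_ _ ms soc] := mP; apply/seteqP; split=> [x /soc[r ->]|_ [r ->] x mx]; first by exists r.
by rewrite -[r *: _]/(r * s) mulrCA ms // mulr0.
Qed.

Lemma len_m : (len m).+1 = len [set: R^o] /\ len (ann m) = 1%N.
Proof.
have al := gl_al mP; have fR := al_fl al.
have E := len_ann (al_sub al).
have l1 : (len (ann m) <= 1)%N.
  by apply: (len_soc_le1 mP (subm_ann m)) => x u mx mu; apply: mu.
have l2 : (0 < len (ann m))%N.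
  rewrite lt0n; apply/eqP => l0; have f := fl_sub fR (subm_ann m) (@subsetT _ _).
  have : ann m s by rewrite annm; exists 1; rewrite scale1r.
  by rewrite (len_eq0 f l0); apply: gl_s0 mP.
lia.
Qed.

End Annihilator.

(** * Minimal resolutions *)

Lemma dependent_seq (T : nat -> Type) (Rel : forall i, T i -> T i.+1 -> Prop)
    (Inv : forall i, T i -> Prop) :
  (exists t, Inv 0%N t) ->
  (forall i t, Inv i t -> exists2 t', Rel i t t' & Inv i.+1 t') ->
  exists t : forall i, T i, (forall i, Inv i (t i)) /\ forall i, Rel i (t i) (t i.+1).
Proof.
move=> /cid[t0 I0] step.
have nxt i (t : {t | Inv i t}) : {t' : {t' | Inv i.+1 t'} | Rel i (sval t) (sval t')}.
  by case: t => t It; have /cid2[t' Rt' It'] := step i t It; exists (exist _ t' It').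
pose s := nat_rect (fun i => {t | Inv i t}) (exist _ t0 I0) (fun i t => sval (nxt i t)).
exists (fun i => sval (s i)); split=> i; first exact: svalP.
exact: (svalP (nxt i (s i))).
Qed.

Section Mact.
Variables (R : comNzRingType) (N : lmodType R).

Definition mact a b (A : 'M[R]_(a, b)) (v : 'I_b -> N) : 'I_a -> N :=
  fun i => \sum_j A i j *: v j.

Lemma mactM a b c (A : 'M_(a, b)) (B : 'M_(b, c)) v : mact (A *m B) v = mact A (mact B v).
Proof.
apply/funext => i; rewrite /mact.
under eq_bigr => k _ do rewrite mxE scaler_suml.
rewrite exchange_big /=; apply: eq_bigr => j _; rewrite scaler_sumr.
by apply: eq_bigr => k _; rewrite scalerA.
Qed.
Lemma mactDl a b (A B : 'M_(a, b)) v : mact (A + B) v = mact A v + mact B v.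
Proof.
apply/funext => i; rewrite /mact -[RHS]big_split /=; apply: eq_bigr => j _.
by rewrite mxE scalerDl.
Qed.
Lemma mactBr a b (A : 'M_(a, b)) v w : mact A (v - w) = mact A v - mact A w.
Proof.
apply/funext => i; rewrite /mact -[RHS]sumrB; apply: eq_bigr => j _.
by rewrite -scalerBr.
Qed.
Lemma mact1 a v : mact (1%:M : 'M_a) v = v.
Proof.
apply/funext => i; rewrite /mact (bigD1 i) //= mxE eqxx scale1r big1 ?addr0 // => j.
by rewrite mxE eq_sym => /negPf->; rewrite scale0r.
Qed.
Lemma mactr0 a b (A : 'M_(a, b)) : mact A 0 = 0.
Proof. by apply/funext => i; rewrite /mact big1 // => j _; rewrite scaler0. Qed.

End Mact.

(** [d p] maps [F_(p+1)] to [F_p] by acting on columns. The resolved module is the cokernel of [d 0]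
    and is kept apart, so truncations are again of this form. *)
Record minres (R : comNzRingType) (m : set R^o) (b : nat -> nat)
    (d : forall p, 'M[R]_(b p, b p.+1)) : Prop := MinRes {
  mr_min : forall p i j, m (d p i j);
  mr_ex : forall p (v : 'cV[R]_(b p.+1)), d p *m v = 0 <-> exists w, v = d p.+1 *m w
}.

Section MinimalResolution.
Variables (R : comNzRingType) (m : set R^o).
Hypothesis mP : artin_local m.

Lemma mulmx_cV a r (D : 'M[R]_(a, r)) (w : 'cV_r) : D *m w = \sum_j w j 0 *: col j D.
Proof.
apply/colP => i; rewrite mxE summxE; apply: eq_bigr => j _; rewrite !mxE.
exact: mulrC.
Qed.

Lemma cover (a : nat) (U : set 'cV[R]_a) : subm U ->
  exists r (D : 'M[R]_(a, r)), (forall v, U v <-> exists w, v = D *m w) /\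
    forall w : 'cV_r, D *m w = 0 -> forall i, m (w i 0).
Proof.
move=> sU; have [fV _] := len_mx a 1%N (al_fl mP).
have [e [UE ind]] := mingens mP (fl_sub fV sU (@subsetT _ U)).
exists _, (\matrix_(i, j) e j i 0).
have E (w : 'cV_(nu m U)) : (\matrix_(i, j) e j i 0) *m w = \sum_j w j 0 *: e j.
  rewrite mulmx_cV; apply: eq_bigr => j _; congr (_ *: _).
  by apply/colP => i; rewrite !mxE.
split=> [v|w]; rewrite ?E.
  rewrite {1}UE; split=> [[c ->]|[w ->]]; last by rewrite E; exists (fun j => w j 0).
  by exists (\col_j c j); rewrite E; apply: eq_bigr => j _; rewrite mxE.
by move=> w0 i; apply: (ind (fun j => w j 0)); rewrite w0; apply: sub0; exact: subm_smul.
Qed.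

Lemma entries_min a b c (D : 'M[R]_(a, b)) (D' : 'M[R]_(b, c)) :
  (forall w : 'cV_b, D *m w = 0 -> forall i, m (w i 0)) -> D *m D' = 0 ->
  forall i j, m (D' i j).
Proof.
move=> minD DD i j.
have : D *m col j D' = 0 by rewrite colE mulmxA DD mul0mx.
by move=> /minD/(_ i); rewrite mxE.
Qed.

Lemma cover_ker a b (D : 'M[R]_(a, b)) : exists r (D' : 'M[R]_(b, r)),
  (forall v : 'cV_b, D *m v = 0 <-> exists w, v = D' *m w) /\
    forall w : 'cV_r, D' *m w = 0 -> forall i, m (w i 0).
Proof. exact: (cover (subm_ker (mulmx D : {linear 'cV_b -> 'cV_a}))). Qed.

Lemma minres_exists (M : lmodType R) a0 (f0 : {linear 'cV[R]_a0 -> M}) :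
  (forall w : 'cV_a0, f0 w = 0 -> forall i, m (w i 0)) ->
  exists b (d : forall p, 'M[R]_(b p, b p.+1)) (aug : {linear 'cV[R]_(b 0%N) -> M}),
  [/\ minres m d, forall v, aug v = 0 <-> exists w, v = d 0%N *m w
    & forall y, (exists v, f0 v = y) -> exists v, aug v = y].
Proof.
move=> f0m.
have [a1 [D0 [D0P min0]]] := cover (subm_ker f0).
have m0 i j : m (D0 i j).
  have : ker f0 (col j D0) by apply/D0P; exists (delta_mx j 0); rewrite colE.
  by move=> /f0m/(_ i); rewrite mxE.
have covT a b (D : 'M[R]_(a, b)) : {s : {r & 'M[R]_(b, r)} |
    (forall v : 'cV_b, D *m v = 0 <-> exists w, v = projT2 s *m w) /\
    forall w : 'cV_(projT1 s), projT2 s *m w = 0 -> forall i, m (w i 0)}.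
  by apply: cid; have [r [D' h]] := cover_ker D; exists (existT _ r D').
(* A stage of the recursion is a matrix together with its two sizes, since a size is only known once
   the kernel of the previous matrix has been covered. *)
pose st0 : {ab : nat * nat & 'M[R]_(ab.1, ab.2)} := existT _ (a0, a1) D0.
pose nxt (s : {ab : nat * nat & 'M[R]_(ab.1, ab.2)}) : {ab : nat * nat & 'M[R]_(ab.1, ab.2)} :=
  existT _ ((projT1 s).2, projT1 (sval (covT _ _ (projT2 s)))) (projT2 (sval (covT _ _ (projT2 s)))).
pose st p := iter p nxt st0.
exists (fun p => (projT1 (st p)).1), (fun p => projT2 (st p)), f0.
have exP p := (svalP (covT _ _ (projT2 (st p)))).1.
split=> //; split=> [p|p v]; last exact: exP.
have minP : forall w : 'cV_(projT1 (st p)).2, projT2 (st p) *m w = 0 -> forall i, m (w i 0).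
  by case: p => [|p]; [exact: min0|exact: (svalP (covT _ _ (projT2 (st p)))).2].
case: p minP => [|p] minP; first exact: m0.
have minp : forall w : 'cV_(projT1 (st p)).2, projT2 (st p) *m w = 0 -> forall i, m (w i 0).
  by case: p {minP} => [|p]; [exact: min0|exact: (svalP (covT _ _ (projT2 (st p)))).2].
apply: (entries_min minp); apply/matrixP => i j.
have /(congr1 (fun M : 'cV_ _ => M i 0)) := (exP p (projT2 (sval (covT _ _ (projT2 (st p)))) *m delta_mx j 0)).2
   (ex_intro _ (delta_mx j 0) erefl).
by rewrite mulmxA -colE !mxE.
Qed.

Lemma minres_module (M : lmodType R) : finitely_generated M ->
  exists b (d : forall p, 'M[R]_(b p, b p.+1)) (aug : {linear 'cV[R]_(b 0%N) -> M}),
    [/\ minres m d, forall v, aug v = 0 <-> exists w, v = d 0%N *m w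
      & forall y, exists v, aug v = y].
Proof.
move=> [n [e eP]].
have gE : gen e = [set: M] by apply/seteqP; split=> // y _; apply/eP.
have fM : fl [set: M] by rewrite -gE; apply: (fl_gen mP).
have [g [TE ind]] := mingens mP fM.
pose f0 (v : 'cV[R]_(nu m [set: M])) := \sum_j v j 0 *: g j.
have f0l : linear f0.
  move=> a v w; rewrite /f0 scaler_sumr -big_split /=; apply: eq_bigr => j _.
  by rewrite !mxE scalerDl scalerA.
pose aug : {linear 'cV[R]_(nu m [set: M]) -> M} := HB.pack f0 (GRing.isLinear.Build _ _ _ _ f0 f0l).
have [|b [d [f [dP dE fE]]]] := minres_exists (f0 := aug).
  by move=> w w0; apply: (ind (fun i => w i 0)); rewrite -/(f0 w) [f0 w]w0; apply: sub0; apply: subm_smul.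
exists b, d, f; split=> // y; apply: fE.
have : gen g y by rewrite -TE.
by move=> [c ->]; exists (\col_j c j); apply: eq_bigr => j _; rewrite mxE.
Qed.

Variables (b : nat -> nat) (d : forall p, 'M[R]_(b p, b p.+1)).
Hypothesis dP : minres m d.

Lemma minres_dd p : d p *m d p.+1 = 0.
Proof.
apply/matrixP => i j; have := (mr_ex dP (d p.+1 *m delta_mx j 0)).2 (ex_intro _ _ erefl).
by rewrite mulmxA -colE => /(congr1 (fun M : 'cV_ _ => M i 0)); rewrite !mxE.
Qed.

Lemma minres_exM p c (X : 'M[R]_(b p.+1, c)) : d p *m X = 0 -> exists Y, X = d p.+1 *m Y.
Proof.
move=> dX; have colX j : exists w, col j X = d p.+1 *m w.
  by apply/(mr_ex dP); rewrite colE mulmxA dX mul0mx.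
have [w wP] := choice colX.
exists (\matrix_(i, j) w j i 0); apply/matrixP => i j.
have := congr1 (fun M : 'cV_ _ => M i 0) (wP j); rewrite !mxE => ->.
by apply: eq_bigr => k _; rewrite mxE.
Qed.

(** If [F_i] is zero, a basis vector of [F_(i+1)] is a cycle, hence a boundary, and boundaries have
    entries in [m]. *)
Lemma minres_zero p : b p = 0%N -> forall i, (p <= i)%N -> b i = 0%N.
Proof.
move=> bp; elim=> [|i IH]; first by rewrite leqn0 => /eqP p0; move: bp; rewrite p0.
rewrite leq_eqVlt => /predU1P[<-//|/IH bi].
have [//|lt0] := posnP (b i.+1).
have [|w wE] := (mr_ex dP (delta_mx (Ordinal lt0) 0 : 'cV_(b i.+1))).1.
  by apply/colP => k; have := ltn_ord k; rewrite [X in (_ < X)%N]bi.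
have := al_proper mP; case.
have -> : 1 = (d i.+1 *m w) (Ordinal lt0) 0 by rewrite -wE mxE !eqxx.
rewrite mxE.
apply: (@sub_sum R R^o m) => [|k _]; first exact: al_sub mP.
rewrite mulrC; apply: (subZ (V := R^o) (w k 0) (al_sub mP)); exact: mr_min dP _ _ _.
Qed.

Lemma cV_projective a : projective ('cV[R]_a : lmodType R).
Proof.
move=> A B p f psurj; have [x xP] := choice (fun j : 'I_a => psurj (f (delta_mx j 0))).
pose g0 (v : 'cV[R]_a) := \sum_j v j 0 *: x j.
have gl : linear g0.
  move=> c v w; rewrite /g0 scaler_sumr -big_split /=; apply: eq_bigr => j _.
  by rewrite !mxE scalerDl scalerA.
pose g : {linear 'cV[R]_a -> A} := HB.pack g0 (GRing.isLinear.Build _ _ _ _ g0 gl).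
exists g => v.
rewrite /= /g0 linear_sum [in RHS](matrix_sum_delta v) linear_sum.
by apply: eq_bigr => i _; rewrite linearZ /= xP big_ord1 linearZ.
Qed.

Lemma minres_projdim (M : lmodType R) (aug : {linear 'cV[R]_(b 0%N) -> M}) :
  (forall v, aug v = 0 <-> exists w, v = d 0%N *m w) ->
  (forall y, exists v, aug v = y) -> (exists p, b p = 0%N) -> finite_projdim M.
Proof.
move=> augE augS [p bp].
have ex0 : is_exact (mulmx (d 0%N) : {linear 'cV_(b 1%N) -> 'cV_(b 0%N)}) aug.
  by move=> y; rewrite augE; split=> -[w]; exists w.
have exS i : is_exact (mulmx (d i.+1) : {linear 'cV_(b i.+2) -> 'cV_(b i.+1)})
    (mulmx (d i) : {linear 'cV_(b i.+1) -> 'cV_(b i)}).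
  by move=> y; have := mr_ex dP y => /= ->; split=> -[w]; exists w.
exists (ProjResolution (pr_obj := fun i => 'cV[R]_(b i) : lmodType R)
  (fun i => @cV_projective (b i)) augS ex0 exS), p => i /ltnW lei x /=.
by apply/colP => k; have := ltn_ord k; rewrite [X in (_ < X)%N](minres_zero bp lei).
Qed.

End MinimalResolution.

(** * Comparison with an arbitrary projective resolution *)

Section Compare.
Variables (R : comNzRingType) (m : set R^o).
Variables (b : nat -> nat) (d : forall p, 'M[R]_(b p, b p.+1)).
Hypothesis dP : minres m d.
Variables (M : lmodType R) (aug : {linear 'cV[R]_(b 0%N) -> M}).
Hypotheses (augE : forall v, aug v = 0 <-> exists w, v = d 0%N *m w)
  (augS : forall y, exists v, aug v = y).
Variable (P : proj_resolution M).

Lemma projective_lift (Q A B : lmodType R) (f : {linear Q -> B}) (p : {linear A -> B}) :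
  projective Q -> (forall x, exists a, p a = f x) ->
  exists g : {linear Q -> A}, forall x, p (g x) = f x.
Proof.
move=> pQ fp.
have hl : linear (fun z : A * Q => p z.1 - f z.2).
  by move=> a z w; rewrite /= linearP [f _]linearP scalerBr opprD addrACA.
pose h : {linear (A * Q)%type -> B} := HB.pack (fun z : A * Q => p z.1 - f z.2)
  (GRing.isLinear.Build _ _ _ _ _ hl).
pose v : {linear kernel h -> (A * Q)%type} := \val.
have vP z : p (v z).1 = f (v z).2.
  by case: z => z /= /eqP /= /eqP; rewrite subr_eq0 => /eqP.
have [|g gP] := pQ _ _ (snd \o v : {linear kernel h -> Q}) (idfun : {linear Q -> Q}).
  move=> y; have [a aE] := fp y.
  have K : (a, y) \in ker_pred h by apply/eqP; rewrite /= aE subrr.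
  by exists (Kernel K).
exists (fst \o (v \o g) : {linear Q -> A}) => x /=.
by have := vP (g x); have /= -> := gP x.
Qed.

Lemma compare_to : exists u : forall i, 'I_(b i) -> pr_obj P i,
  (forall k, pr_aug P (u 0%N k) = aug (delta_mx k 0)) /\
  forall i k, pr_diff P i (u i.+1 k) = \sum_j d i j k *: u i j.
Proof.
have [u0 u0P] := choice (fun k => pr_aug_surj P (aug (delta_mx k 0))).
(* The compatibility with the augmentation concerns degree 0 only; the cast along [e : i = 0] lets
   it be part of an invariant indexed by [i]. *)
pose Inv i (u : 'I_(b i) -> pr_obj P i) :=
  (forall k, exists y, pr_diff P i y = \sum_j d i j k *: u j) /\
  forall e : i = 0%N, forall k, pr_aug P (ecast i (pr_obj P i) e (u k)) = aug (delta_mx (ecast i 'I_(b i) e k) 0).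
have [||u [uI uR]] := @dependent_seq (fun i => 'I_(b i) -> pr_obj P i)
  (fun i u u' => forall k, pr_diff P i (u' k) = \sum_j d i j k *: u j) Inv.
- exists u0; split=> [k|e k]; last by rewrite eq_axiomK /= u0P.
  apply/(pr_exact0 (p := P)); rewrite linear_sum.
  under eq_bigr => j _ do rewrite linearZ /= u0P -linearZ /=.
  rewrite -linear_sum /=; apply/augE; exists (delta_mx k 0); rewrite -colE.
  apply/colP => i; rewrite summxE mxE (bigD1 i) //= !mxE !eqxx mulr1 big1 ?addr0 // => j ji.
  by rewrite !mxE eq_sym (negPf ji) mulr0.
- move=> i u [uI _]; have [u' u'P] := choice uI; exists u' => //; split=> // k.
  apply/(pr_exact (p := P)); rewrite linear_sum.
  under eq_bigr => j _ do rewrite linearZ /= u'P scaler_sumr.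
  rewrite exchange_big /= big1 // => l _.
  under eq_bigr => j _ do rewrite scalerA mulrC.
  have := congr1 (fun A : 'M_(_, _) => A l k) (minres_dd dP i); rewrite !mxE => E.
  by rewrite -scaler_suml E scale0r.
- by exists u; split=> // k; have [_ /(_ erefl)] := uI 0%N; apply.
Qed.

Lemma compare_from : exists psi : forall i, {linear pr_obj P i -> 'cV[R]_(b i)},
  (forall x, aug (psi 0%N x) = pr_aug P x) /\
  forall i x, d i *m psi i.+1 x = psi i (pr_diff P i x).
Proof.
have [psi0 psi0P] := projective_lift (f := pr_aug P) (@pr_projective _ _ P 0%N) (fun x => augS _).
pose Inv i (psi : {linear pr_obj P i -> 'cV[R]_(b i)}) :=
  (forall x, exists w, d i *m w = psi (pr_diff P i x)) /\
  forall e : i = 0%N, forall x, aug (ecast i 'cV_(b i) e (psi (ecast i (pr_obj P i) (esym e) x))) = pr_aug P x.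
have [||psi [I1 I2]] := @dependent_seq (fun i => {linear pr_obj P i -> 'cV[R]_(b i)})
  (fun i f g => forall x, d i *m g x = f (pr_diff P i x)) Inv.
- exists psi0; split=> [x|e x]; last by rewrite eq_axiomK /= psi0P.
  have [|w ->] := (augE (psi0 (pr_diff P 0 x))).1; last by exists w.
  by rewrite psi0P; apply/(pr_exact0 (p := P)); exists x.
- move=> i f [fI _].
  have [g gP] := projective_lift (f := f \o pr_diff P i) (p := mulmx (d i))
     (@pr_projective _ _ P i.+1) fI.
  exists g => //; split=> // x.
  have [|w ->] := (mr_ex dP (g (pr_diff P i.+1 x))).1; last by exists w.
  have := gP (pr_diff P i.+1 x) => /= ->.
  by have [_ h] := @pr_exact _ _ P i (pr_diff P i.+1 x); rewrite h ?linear0 //; exists x.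
- by exists psi; split=> // x; have [_ /(_ erefl x)] := I1 0%N.
Qed.

Lemma tensor_ext (A N W : lmodType R) (f g : {linear tensor A N -> W}) :
  (forall a n, f (tens a n) = g (tens a n)) -> f =1 g.
Proof.
move=> fg x; rewrite -[x]quo_reprK.
pose q : {linear free_module R (A * N)%type -> tensor A N} := quo_pi (tensor_ker_closed A N).
have := @free_module_ext R _ W (f \o q) (g \o q); move=> /(_ _ (repr x)) /=; apply.
by move=> [a n]; apply: fg.
Qed.

Variable N : lmodType R.

(** The composite of the comparison maps [u] and [psi] is homotopic to the identity of the minimal
    resolution. A cycle with coefficients in [N] is carried to [P], where it bounds because Tor
    vanishes, and brought back. *)
Theorem Tor_minres i : is_zero_module (Tor_of P N i.+1) ->
  forall v : 'I_(b i.+1) -> N, mact (d i) v = 0 -> exists w, v = mact (d i.+1) w.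
Proof.
move=> Tor0 v dv.
have [u [u0 uS]] := compare_to; have [psi [psi0 psiS]] := compare_from.
pose Q i : 'M[R]_(b i) := \matrix_(k, j) psi i (u i j) k 0.
have colQ j k : col k (Q j) = psi j (u j k) by apply/colP => l; rewrite !mxE.
have dQ j : d j *m Q j.+1 = Q j *m d j.
  apply/matrixP => k l; have := congr1 (fun A : 'cV_ _ => A k 0) (psiS j (u j.+1 l)).
  rewrite uS linear_sum summxE !mxE => E.
  transitivity ((d j *m psi j.+1 (u j.+1 l)) k 0).
    by rewrite mxE; apply: eq_bigr => t _; rewrite mxE.
  rewrite mxE E; apply: eq_bigr => t _; rewrite linearZ !mxE mulrC; by [].
pose Rel i (H : 'M[R]_(b i.+1, b i)) (H' : 'M[R]_(b i.+2, b i.+1)) :=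
  Q i.+1 - 1%:M = d i.+1 *m H' + H *m d i.
have [||H [_ HR]] := @dependent_seq (fun i => 'M[R]_(b i.+1, b i)) Rel
  (fun i H => d i *m (Q i.+1 - 1%:M - H *m d i) = 0).
- have colX k : exists w, col k (Q 0%N - 1%:M) = d 0%N *m w.
    apply/augE; rewrite linearB /= colQ linearB psi0 u0 -linearB /=.
    by rewrite (_ : _ - _ = 0) ?linear0 //; apply/colP => l; rewrite !mxE eqxx andbT subrr.
  have [w wP] := choice colX.
  exists (\matrix_(k, l) w l k 0).
  rewrite mulmxBr mulmxBr mulmx1 dQ mulmxA -{2}[d 0%N]mul1mx -mulmxBl -mulmxBl.
  suff -> : Q 0%N - 1%:M - d 0%N *m \matrix_(k, l) w l k 0 = 0 by rewrite mul0mx.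
  apply/eqP; rewrite subr_eq0; apply/eqP/matrixP => k l.
  have := congr1 (fun A : 'cV_ _ => A k 0) (wP l); rewrite mxE => ->.
  by rewrite !mxE; apply: eq_bigr => t _; rewrite mxE.
- move=> j H /(minres_exM dP)[H' H'E].
  have RE : Rel j H H' by rewrite /Rel -H'E subrK.
  exists H' => //; rewrite mulmxBr mulmxBr mulmx1 dQ mulmxA -{2}[d j.+1]mul1mx -!mulmxBl RE.
  by rewrite addrC addKr -mulmxA (minres_dd dP) mulmx0.
pose z : tensor (pr_obj P i.+1) N := \sum_j tens (u i.+1 j) (v j).
have Dz : tensor_map N (pr_diff P i) z = 0.
  have E j : tensor_map N (pr_diff P i) (tens (u i.+1 j) (v j)) =
      \sum_k tens (u i k) (d i k j *: v j).
    rewrite [LHS]tensor_map_tens uS.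
    have tl : linear (fun x : pr_obj P i => tens x (v j)) by move=> a x y; rewrite tensDl tensZl.
    pose t : {linear pr_obj P i -> tensor (pr_obj P i) N} := HB.pack (fun x : pr_obj P i => tens x (v j)) (GRing.isLinear.Build _ _ _ _ _ tl).
    by rewrite -[LHS]/(t _) linear_sum; apply: eq_bigr => k _; rewrite linearZ /= tensZr.
  rewrite /z linear_sum (eq_bigr _ (fun j _ => E j)).
  rewrite exchange_big /= big1 // => k _.
  have tl : linear (fun x : N => tens (u i k) x) by move=> a x y; rewrite tensDr tensZr.
  pose t : {linear N -> tensor (pr_obj P i) N} := HB.pack (fun x : N => tens (u i k) x) (GRing.isLinear.Build _ _ _ _ _ tl).
  have := linear_sum t; rewrite /= => <-.
  by have := congr1 (fun f => f k) dv; rewrite /mact => ->; rewrite -[LHS]/(t 0) linear0.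
have zK : z \in ker_pred (tensor_map N (pr_diff P i)) by rewrite inE Dz.
have [w wE] : exists w, tensor_map N (pr_diff P i.+1) w = z.
  have := Tor0 (quo_pi (boundary_closed _ _) (Kernel zK)).
  rewrite -[RHS](linear0 (quo_pi _)) => /quo_piE; rewrite subr0 inE => -[w wE].
  by exists w.
have PsiT j : exists Psi : {linear tensor (pr_obj P j) N -> 'I_(b j) -> N},
    forall x n k, Psi (tens x n) k = psi j x k 0 *: n.
  have H1 (x x' : pr_obj P j) (n : N) : (fun k => psi j (x + x') k 0 *: n) =
      (fun k => psi j x k 0 *: n) + (fun k => psi j x' k 0 *: n).
    by apply/funext => k; rewrite linearD mxE scalerDl.
  have H2 (x : pr_obj P j) (n n' : N) : (fun k => psi j x k 0 *: (n + n')) =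
      (fun k => psi j x k 0 *: n) + (fun k => psi j x k 0 *: n').
    by apply/funext => k; rewrite scalerDr.
  have H3 a (x : pr_obj P j) (n : N) : (fun k => psi j (a *: x) k 0 *: n) =
      a *: (fun k => psi j x k 0 *: n).
    by apply/funext => k; rewrite linearZ mxE -scalerA.
  have H4 a (x : pr_obj P j) (n : N) : (fun k => psi j x k 0 *: (a *: n)) =
      a *: (fun k => psi j x k 0 *: n).
    by apply/funext => k; rewrite scalerA mulrC -scalerA.
  by exists (tensor_lift H1 H2 H3 H4) => x n k; rewrite tensor_lift_tens.
have [Psi PsiE] := PsiT i.+1; have [Psi' Psi'E] := PsiT i.+2.
have Psid : Psi (tensor_map N (pr_diff P i.+1) w) = mact (d i.+1) (Psi' w).
  have ml : linear (mact (d i.+1) : ('I_(b i.+2) -> N) -> ('I_(b i.+1) -> N)).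
    move=> a x y; apply/funext => k.
    transitivity (a *: mact (d i.+1) x k + mact (d i.+1) y k) => //.
    rewrite /mact scaler_sumr -big_split /=; apply: eq_bigr => l _.
    by rewrite scalerA mulrC -scalerA -scalerDr.
  pose md : {linear ('I_(b i.+2) -> N) -> ('I_(b i.+1) -> N)} :=
    HB.pack (mact (d i.+1) : ('I_(b i.+2) -> N) -> ('I_(b i.+1) -> N)) (GRing.isLinear.Build _ _ _ _ _ ml).
  apply: (tensor_ext (f := Psi \o tensor_map N (pr_diff P i.+1)) (g := md \o Psi')) => x n.
  have E : tensor_map N (pr_diff P i.+1) (tens x n) = tens (pr_diff P i.+1 x) n by exact: tensor_map_tens.
  transitivity (Psi (tens (pr_diff P i.+1 x) n)); first by rewrite -E.
  apply/funext => k; rewrite PsiE -psiS mxE scaler_suml.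
  by apply: eq_bigr => l _; rewrite Psi'E scalerA.
have Psiz : Psi z = mact (Q i.+1) v.
  apply/funext => k; rewrite linear_sum /mact.
  have -> : (\sum_j Psi (tens (u i.+1 j) (v j))) k = \sum_j Psi (tens (u i.+1 j) (v j)) k.
    by elim/big_rec2: _ => //= j x y _ <-.
  by apply: eq_bigr => j _; rewrite PsiE mxE.
exists (Psi' w - mact (H i.+1) v).
rewrite mactBr -Psid wE Psiz -[LHS]mact1.
have -> : Q i.+1 = d i.+1 *m H i.+1 + H i *m d i + 1%:M by rewrite -HR subrK.
by rewrite !mactDl !mactM dv mactr0 addr0 mact1 addrAC subrr add0r.
Qed.

End Compare.

Section TorIndependence.
Variables (R : comNzRingType) (m : set R^o).
Variables (b : nat -> nat) (d : forall p, 'M[R]_(b p, b p.+1)).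
Variables (c : nat -> nat) (d' : forall p, 'M[R]_(c p, c p.+1)).
Hypotheses (dP : minres m d) (d'P : minres m d').

(** The matrices [Y *m (d' q)^T] form the tensor product of [F_(p+1)] with the image of [d' q], so
    this is Tor_(p+1)(M, im d'_q) = 0. *)
Definition tor_indep p q := forall Y : 'M[R]_(b p.+1, c q.+1),
  d p *m Y *m (d' q)^T = 0 -> exists Y', Y *m (d' q)^T = d p.+1 *m Y' *m (d' q)^T.

Lemma tr_minres_exM q r (X : 'M[R]_(r, c q.+1)) : X *m (d' q)^T = 0 -> exists Y, X = Y *m (d' q.+1)^T.
Proof.
move=> /(congr1 trmx); rewrite trmx_mul trmxK trmx0 => /(minres_exM d'P)[Y XE].
by exists Y^T; rewrite -trmx_mul -XE trmxK.
Qed.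

(** Dimension shifting: the image of [d' q.+1] is the syzygy of the image of [d' q]. *)
Lemma tor_indepS p q : tor_indep p.+1 q -> tor_indep p q.+1.
Proof.
move=> T Y; rewrite -mulmxA => /(minres_exM dP)[Z ZE].
have : d p.+1 *m Z *m (d' q)^T = 0.
  by rewrite -ZE -mulmxA -trmx_mul (minres_dd d'P) trmx0 mulmx0.
move=> /T[Y' Y'E].
have [|Y'' YE] := @tr_minres_exM q _ (Z - d p.+2 *m Y'); first by rewrite mulmxBl Y'E subrr.
exists Y''; rewrite ZE -mulmxA -YE mulmxBr mulmxA (minres_dd dP) mul0mx subr0.
by [].
Qed.

(** For [q = 0] the statement follows from the vanishing of Tor_(p+2)(M, N), since the image of
    [d' 0] is the first syzygy of [N]; larger [q] follow by shifting. *)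
Lemma Tor_tor_indep (M N : lmodType R) (aug : {linear 'cV[R]_(b 0%N) -> M})
    (aug' : {linear 'cV[R]_(c 0%N) -> N}) :
  (forall v, aug v = 0 <-> exists w, v = d 0%N *m w) -> (forall y, exists v, aug v = y) ->
  (forall v, aug' v = 0 <-> exists w, v = d' 0%N *m w) -> (forall y, exists v, aug' v = y) ->
  Tor_eventually_zero M N -> exists n, forall p q, (n <= p)%N -> tor_indep p q.
Proof.
move=> augE augS aug'E aug'S [n Tn]; exists n => p q.
elim: q => [|q IH] in p *; last by move=> lep; apply/tor_indepS/IH/leqW.
move=> lep Y; rewrite -mulmxA => /(minres_exM dP)[Z ZE].
have aE r k (A : 'M[R]_(r, k)) (B : 'M[R]_(k, c 0%N)) :
    mact A (fun j => aug' (row j B)^T) = fun i => aug' (row i (A *m B))^T.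
  apply/funext => i; rewrite /mact row_mul mulmx_sum_row linear_sum linear_sum /=.
  by apply: eq_bigr => j _; rewrite !linearZ /= mxE.
have T0 : is_zero_module (Tor_of (free_resolution M) N p.+2) by apply: (Tn p.+2); rewrite ltnW // ltnW.
have [|w wE] := Tor_minres dP augE augS T0 (v := fun j => aug' (row j Z)^T).
  rewrite aE -ZE; apply/funext => i; apply/aug'E.
  by exists (row i Y)^T; rewrite row_mul trmx_mul trmxK.
have [x xE] := choice (fun k => aug'S (w k)).
pose X := \matrix_(k, j) x k j 0.
have wX : w = fun k => aug' (row k X)^T.
  by apply/funext => k; rewrite -xE; congr (aug' _); apply/colP => j; rewrite !mxE.
have yex i : exists y, (row i (Z - d p.+2 *m X))^T = d' 0%N *m y.
  apply/aug'E; rewrite linearB linearB /=.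
  have := congr1 (fun f => f i) wE; rewrite wX aE => E.
  by rewrite linearB /= E subrr.
have [y yE] := choice yex.
have ZX : Z - d p.+2 *m X = (\matrix_(i, j) y i j 0) *m (d' 0%N)^T.
  apply/row_matrixP => i; rewrite row_mul -[LHS]trmxK yE trmx_mul; congr (_ *m _).
  by apply/rowP => j; rewrite !mxE.
exists (\matrix_(i, j) y i j 0).
by rewrite ZE -mulmxA -ZX mulmxBr mulmxA (minres_dd dP) mul0mx subr0.
Qed.

End TorIndependence.

(** * Large embedding dimension *)

Section ExtGens.
Variables (R : comNzRingType) (m : set R^o) (V : lmodType R).
Hypothesis mP : artin_local m.

Lemma len_ltE (U U' : set V) : fl U -> subm U' -> U' `<=` U -> (exists2 x, U x & ~ U' x) ->
  (len U' < len U)%N.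
Proof.
move=> fU sU' UU ex; apply/lenP => //; apply: (chain_ext (fl_subm fU) UU ex).
by apply/lenP => //; apply: fl_sub UU.
Qed.

Lemma ext_gens (U U' : set V) : fl U -> subm U' -> U' `<=` U -> smul (m : set R) U `<=` U' ->
  exists v : 'I_(len U - len U') -> V, (forall i, U (v i)) /\ U = addm U' (gen v).
Proof.
move=> fU; have sU := fl_subm fU.
move: {-2}(len U - len U')%N (erefl (len U - len U')%N) => k.
elim: k U' => [|k IH] U' lk sU' UU mU.
  exists (fun=> 0); split=> [[]//|]; have E : U' = U by apply: len_eq => //; lia.
  rewrite E; apply/seteqP; split; first exact: addmL (subm_gen _).
  by apply: addm_sub => //; apply: gen_sub => // -[].
have [u Uu nu] : exists2 u, U u & ~ U' u.
  apply: contrapT => nex; have : U = U'.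
    by apply/seteqP; split=> // u Uu; apply: contrapT => nu; apply: nex; exists u.
  by move=> E; rewrite E in lk; lia.
have fU' := fl_sub fU sU' UU.
have [fA lA] := len_addcyc (al_unit mP) fU' (fun x mx => mU _ (smul_incl mx Uu)).
set C := [set y | _] in fA lA; have sC : subm C := subm_cyclic u.
have AU : addm U' C `<=` U by apply: addm_sub => // _ [r ->]; apply: subZ.
have ltA : (len U' < len (addm U' C))%N.
  apply: (len_ltE fA sU' (addmL sC)); exists u => //.
  by apply: (addmR sU'); exists 1; rewrite scale1r.
have leA := len_sub fU (fl_subm fA) AU.
have [||v [Uv UE]] := IH _ _ (fl_subm fA) AU.
- lia.
- by apply: subset_trans mU _; apply: addmL.
exists (fun i => if unlift ord_max i is Some j then v j else u); set w := fun i => _; split.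
  by move=> i; rewrite /w; case: unliftP.
have Uw i : U (w i) by rewrite /w; case: unliftP.
have s1 := subm_add sU' (subm_gen w).
apply/seteqP; split; last by apply: addm_sub => //; apply: gen_sub.
rewrite {1}UE; apply: addm_sub => //.
  apply: addm_sub => //; first exact: addmL (subm_gen w).
  move=> _ [r ->]; apply: subZ => //; apply: addmR => //.
  by have := gen_in w ord_max; rewrite {2}/w unlift_none.
apply: gen_sub => // i; apply: addmR => //.
by have := gen_in w (lift ord_max i); rewrite {2}/w liftK.
Qed.

End ExtGens.

Section Resolution.
Variables (R : comNzRingType) (m : set R^o).
Hypothesis mP : artin_local m.
Variables (b : nat -> nat) (d : forall p, 'M[R]_(b p, b p.+1)).
Hypothesis dP : minres m d.
Local Notation lam := (len [set: R^o]).
Local Notation mulf D := (mulmx D : {linear 'cV__ -> 'cV__}).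

Definition syz p : set 'cV[R]_(b p) := (mulmx (d p) : {linear 'cV_(b p.+1) -> 'cV_(b p)}) @` [set: 'cV_(b p.+1)].
Arguments syz : clear implicits.
Definition msyz p : set 'cV[R]_(b p) := (mulmx (d p) : {linear 'cV_(b p.+1) -> 'cV_(b p)}) @` mxin m.

Arguments msyz : clear implicits.
Lemma fl_cV a : fl [set: 'cV[R]_a] /\ len [set: 'cV[R]_a] = (a * lam)%N.
Proof. by have := len_mx a 1%N (al_fl mP); rewrite muln1. Qed.

Lemma fl_cVs a (U : set 'cV[R]_a) : subm U -> fl U.
Proof. by move=> sU; apply: fl_sub (fl_cV a).1 sU (@subsetT _ _). Qed.

Lemma len_cVin a (I : set R^o) : subm I -> len (mxin I : set 'cV[R]_a) = (a * len I)%N.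
Proof.
move=> sI; have fI := fl_sub (al_fl mP) sI (@subsetT _ _).
by have [_ ->] := len_mxin a 1%N fI; rewrite muln1.
Qed.

Lemma ker_syz p : ker (mulmx (d p) : {linear 'cV_(b p.+1) -> 'cV_(b p)}) = syz p.+1.
Proof.
apply/seteqP; split=> [v /(mr_ex dP)[w ->]|_ [w _ <-]]; first by exists w.
by apply/(mr_ex dP); exists w.
Qed.

Lemma syz_min p : syz p `<=` mxin m.
Proof.
move=> _ [w _ <-]; apply: mxin_mull; first exact: al_sub mP.
by move=> i j; apply: mr_min dP _ _ _.
Qed.

Lemma subm_syz p : subm (syz p). Proof. exact/subm_img/submT. Qed.
Lemma subm_msyz p : subm (msyz p). Proof. exact/subm_img/subm_mxin/(al_sub mP). Qed.

Lemma len_syz p : (len (syz p) + len (syz p.+1))%N = (b p.+1 * lam)%N.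
Proof.
have [f l] := fl_cV (b p.+1).
by rewrite -l (len_exact (mulmx (d p) : {linear 'cV_(b p.+1) -> 'cV_(b p)}) f) setTI ker_syz.
Qed.

Lemma len_msyz p : (len (msyz p) + len (syz p.+1) + b p.+1)%N = (b p.+1 * lam)%N.
Proof.
have sm := subm_mxin (a := b p.+1) (b := 1%N) (al_sub mP).
have := len_exact (mulmx (d p) : {linear 'cV_(b p.+1) -> 'cV_(b p)}) (fl_cVs sm).
rewrite ker_syz (len_cVin _ (al_sub mP)) -/(msyz p).
have -> : mxin m `&` syz p.+1 = syz p.+1.
  by apply/seteqP; split=> [x []//|x sx]; split=> //; apply: syz_min.
have : (len m).+1 = lam.
  have fR := al_fl mP; apply/anti_leq/andP; split.
    apply: (len_ltE fR (al_sub mP) (@subsetT _ _)).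
    by exists 1 => //; apply: al_proper mP.
  have fm := fl_sub fR (al_sub mP) (@subsetT _ _).
  have [|fA] := len_addgens (al_unit mP) (r := 1) (e := fun=> (1 : R^o)) fm.
    by move=> x i mx; rewrite -[x *: _]/(x * 1) mulr1.
  rewrite addn1; set A := addm _ _ => lA.
  suff -> : [set: R^o] = A by [].
  apply/seteqP; split=> // x _; apply: addmR; first exact: al_sub mP.
  by exists (fun=> x); rewrite big_ord1 -[x *: _]/(x * 1) mulr1.
by move=> <- <-; rewrite mulnS; lia.
Qed.

End Resolution.
Arguments syz {R b} d p _.
Arguments msyz {R} m {b} d p _.

Section LargeE.
Variables (R : comNzRingType) (m : set R^o) (s : R).
Hypothesis mP : gor_local m s.
Let al := gl_al mP.
Local Notation lam := (len [set: R^o]).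
Local Notation m2 := (smul (m : set R) m).
Local Notation L := (len m2).
Local Notation e := (nu m m).
Hypotheses (e5 : (5 <= e)%N) (L5 : (L <= 5)%N).
Let sm : subm m := al_sub al.
Let sm2 : subm m2 := subm_smul _ _.

Local Notation J := (ann m2).

Let lamE : lam = (1 + e + L)%N.
Proof.
have [<- _] := len_m mP.
have := len_sub (fl_sub (al_fl al) sm (@subsetT _ _)) sm2 (smul_subr sm).
by rewrite /nu; lia.
Qed.

Let lJ : len J = e.+1.
Proof. by have := len_ann mP sm2; lia. Qed.

Let Jm : J `<=` m.
Proof.
move=> x Jx; apply: contrapT => /(al_unit al)[u ux].
have m20 : m2 `<=` [set 0].
  by move=> y m2y; rewrite /= -(mulr1 y) -ux mulrCA Jx // mulr0.
have : m `<=` ann m by move=> y my z mz; apply: m20; apply: (@smul_incl R R^o).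
have fR := al_fl al.
move=> /(len_sub (fl_sub fR (subm_ann _) (@subsetT _ _)) sm).
have [l1 ->] := len_m mP; lia.
Qed.

Let Jmsoc a x : J a -> m x -> ann m (x * a).
Proof.
move=> Ja mx z mz; rewrite mulrA; apply: Ja; exact: (@smul_incl R R^o).
Qed.

(** The annihilator of [m^2] has length [e + 1], at least 6, and so is too long to lie inside
    [m^2]. *)
Let exy : exists2 y, J y & ~ m2 y.
Proof.
apply: contrapT => nex; have : J `<=` m2.
  by move=> x Jx; apply: contrapT => nx; apply: nex; exists x.
have fR := al_fl al.
by move=> /(len_sub (fl_sub fR sm2 (@subsetT _ _)) (subm_ann _)); lia.
Qed.

Lemma len_socF a : len (mxin (ann m) : set 'cV[R]_a) = a.
Proof. by rewrite (len_cVin al a (subm_ann m)) (len_m mP).2 muln1. Qed.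

(** [y] times [m] lies in the socle, so the map takes values in the socle of the free module, whose
    length is [a]. *)
Lemma soc_map a b (D : 'M[R]_(a, b)) y : J y -> mxin m D ->
  (b * lam <= a + len (ker (mulmx (y *: D) : {linear 'cV_b -> 'cV_a})))%N.
Proof.
move=> Jy mD; have [f l] := fl_cV al b.
have E := len_exact (mulmx (y *: D) : {linear 'cV_b -> 'cV_a}) f.
have {l}E : (b * lam = len (mulmx (y *: D) @` [set: 'cV_b]) + len (ker (mulmx (y *: D) : {linear 'cV_b -> 'cV_a})))%N.
  by rewrite -l; move: E; rewrite setTI.
rewrite E leq_add2r.
apply: leq_trans (_ : len (mxin (ann m) : set 'cV[R]_a) <= a)%N; last by rewrite len_socF.
apply: len_sub; [exact: (fl_cVs al (subm_mxin (subm_ann _)))|exact/subm_img/submT|].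
move=> _ [v _ <-]; apply: mxin_mull; first exact: subm_ann.
by move=> i j; rewrite mxE mulrC; apply: Jmsoc => //; apply: mD.
Qed.

Lemma non_min_vec a (U : set 'cV[R]_a) : subm U -> (a * (len m) < len U)%N ->
  exists2 v, U v & exists i, ~ m (v i 0).
Proof.
move=> sU lt; apply: contrapT => nex.
have : U `<=` mxin m.
  move=> v Uv i j; apply: contrapT => nm; apply: nex; exists v => //; exists i.
  by rewrite -(ord1 j).
move=> /(len_sub (fl_cVs al (subm_mxin sm)) sU).
by rewrite (len_cVin al _ sm) leqNgt lt.
Qed.

Section Growth.
Variables (b : nat -> nat) (d : forall p, 'M[R]_(b p, b p.+1)).
Variables (c : nat -> nat) (d' : forall p, 'M[R]_(c p, c p.+1)).
Hypotheses (dP : minres m d) (d'P : minres m d').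

(** When a Betti number rises, the kernel of [y *: d] is too long to lie in [m] times the free
    module. Let [x] and [f] be kernel vectors with unit entries, one on each side. The vanishing of
    Tor writes [y *: (x *m f^T)] as a product of two minimal matrices with a matrix between them, so
    its entries lie in [m^2]; but one of them is [y] up to a unit. *)
Lemma betti_growth p q : tor_indep d d' p q.+1 -> (c q < c q.+1)%N -> (b p.+1 <= b p)%N.
Proof.
move=> T ltc; have [y Jy nm2y] := exy; have [lm _] := len_m mP.
have [f yf [i0 fi0]] : exists2 f : 'cV_(c q.+1), (y *: d' q) *m f = 0 & exists i, ~ m (f i 0).
  apply: (non_min_vec (subm_ker (mulmx (y *: d' q) : {linear 'cV_(c q.+1) -> 'cV_(c q)}))).
  apply: (@leq_trans (c q.+1 * lam - c q)%N); first by rewrite -lm mulnS; lia.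
  by rewrite leq_subLR; apply: soc_map => // i j; apply: mr_min d'P _ _ _.
have [g gE] : exists g, y *: f = d' q.+1 *m g.
  by apply/(mr_ex d'P); rewrite -scalemxAr scalemxAl.
rewrite leqNgt; apply/negP => ltb.
have [x yx [j0 xj0]] : exists2 x : 'cV_(b p.+1), (y *: d p) *m x = 0 & exists i, ~ m (x i 0).
  apply: (non_min_vec (subm_ker (mulmx (y *: d p) : {linear 'cV_(b p.+1) -> 'cV_(b p)}))).
  apply: (@leq_trans (b p.+1 * lam - b p)%N); first by rewrite -lm mulnS; lia.
  by rewrite leq_subLR; apply: soc_map => // i j; apply: mr_min dP _ _ _.
have YE : x *m g^T *m (d' q.+1)^T = y *: (x *m f^T).
  by rewrite -mulmxA -trmx_mul -gE linearZ /= -scalemxAr.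
have [|Y' Y'E] := T (x *m g^T).
  by rewrite -mulmxA YE -scalemxAr mulmxA scalemxAl scalemxAl yx mul0mx.
have : m2 ((y *: (x *m f^T)) j0 i0).
  rewrite -YE Y'E; apply: mxin_mul.
    by apply: mxin_mull => //; move=> i j; apply: mr_min dP _ _ _.
  by move=> i j; rewrite mxE; apply: mr_min d'P _ _ _.
rewrite !mxE big_ord1 mxE => H; apply: nm2y.
have [u ux] := al_unit al xj0; have [v vf] := al_unit al fi0.
have -> : y = (u * v) * (y * (x j0 0 * f i0 0)).
  by rewrite -[in LHS](mulr1 y) -(mulr1 1) -{1}ux -vf; ring.
exact: (@subZ R R^o m2 (u * v) _ sm2 H).
Qed.

End Growth.

Section Const.
Variables (b : nat -> nat) (d : forall p, 'M[R]_(b p, b p.+1)).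
Hypothesis dP : minres m d.
Variable (n : nat).
Hypothesis bn : forall p, b p = n.

Let F p : {linear 'cV_(b p.+1) -> 'cV_(b p)} := mulmx (d p).

(** Let [t] be the length of [msyz m d p.+1] and [k] the number of generators of [F_(p+2)] modulo
    the vectors sent into [J]. Then [t <= n + k (L - 1)], as [m / J] has length [L - 1], and
    [k + e n <= n + t]; eliminating [k] gives the statement. *)
Let lemA p : (len (msyz m d p.+1) + (L - 1) * (e * n) <= n + (L - 1) * (n + len (msyz m d p.+1)))%N.
Proof.
have [lm lsoc] := len_m mP.
pose S : set 'cV[R]_(b p.+1) := mxin (ann m).
have sS : subm S := subm_mxin (subm_ann _).
pose JF a : set 'cV[R]_a := mxin J.
have sJF a : subm (JF a) := subm_mxin (subm_ann _).
have fV a (U : set 'cV[R]_a) : subm U -> fl U := @fl_cVs _ _ al a U.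
pose W := F p.+1 @^-1` JF _.
have sW : subm W by apply: subm_pre.
have smF a : subm (mxin m : set 'cV[R]_a) := subm_mxin sm.
have JAlen : (e * n <= len (syz d p.+1 `&` JF (b p.+1)))%N.
  have := len_exact (F p) (fV _ _ (sJF (b p.+1))).
  rewrite (ker_syz dP p) (len_cVin al _ (subm_ann _)) lJ setIC.
  have En : (b p.+1 * e.+1 = n * e.+1)%N by rewrite bn.
  have : (len (F p @` JF (b p.+1)) <= n)%N.
    apply: leq_trans (_ : len (mxin (ann m) : set 'cV[R]_(b p)) <= n)%N; last by rewrite len_socF bn.
    apply: len_sub; [exact/fV/subm_mxin/subm_ann|exact/subm_img|].
    move=> _ [v Jv <-] i j; rewrite mxE; apply: (@sub_sum R R^o); first exact: subm_ann.
    by move=> k _; apply: Jmsoc; [exact: Jv|exact: mr_min dP _ _ _].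
  move=> lX E; rewrite -(leq_add2l n); apply: (@leq_trans (n * e.+1)%N).
    by rewrite mulnS (mulnC e).
  by rewrite -En E leq_add2r.
have lW : (len W = len (syz d p.+1 `&` JF (b p.+1)) + len (syz d p.+2))%N.
  rewrite (len_exact (F p.+1) (fV _ _ sW)) (ker_syz dP p.+1); congr (_ + _)%N; congr len.
    by apply/seteqP; split=> [_ [v Wv <-]|v [[w _ <-] Jv]]; [split=> //; exists v|exists w].
  apply/seteqP; split=> [x []//|x Ax]; split=> //.
  by move: Ax; rewrite -(ker_syz dP p.+1) /W /preimage /= => ->; apply: sub0.
have lWm : (len (W `&` mxin m) <= len (msyz m d p.+1) + len (syz d p.+2))%N.
  rewrite (len_exact (F p.+1) (fV _ _ (submI sW (smF _)))) (ker_syz dP p.+1) leq_add //.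
    apply: len_sub; [exact/fV/subm_img|exact/subm_img/submI|].
    by move=> _ [v [_ mv] <-]; exists v.
  apply: len_sub; [exact/fV/subm_syz|apply: submI; [exact: submI|exact: subm_syz]|].
  by move=> x [].
have [fWm lA] := len_add (fV _ _ sW) (fV _ _ (smF (b p.+2))).
set U' := addm W (mxin m) in fWm lA.
have [fT lT] := fl_cV al (b p.+2).
have [v [_ TE]] := @ext_gens _ _ _ al [set: 'cV[R]_(b p.+2)] U' fT (fl_subm fWm) (@subsetT _ _)
  ltac:(by rewrite -(mxin_smul _ _ sm); apply: addmR).
set k := (_ - len U')%N in v TE.
have TW : [set: 'cV[R]_(b p.+2)] = addm W (gen v).
  apply/seteqP; split=> //; apply: (nakayama al); first exact: subm_add sW (subm_gen _).
  rewrite {1}TE -(mxin_smul _ _ sm); have s1 := subm_add sW (subm_gen v).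
  have s2 := subm_add s1 (smF (b p.+2)).
  apply: addm_sub => //; last by apply: subset_trans (addmL (smF _)); apply: addmR.
  apply: addm_sub => //; last exact: addmR.
  by apply: subset_trans (addmL (smF _)); apply: addmL; apply: subm_gen.
pose D : 'M[R]_(b p.+1, k) := d p.+1 *m \matrix_(i, j) v j i 0.
pose DF : {linear 'cV_k -> 'cV_(b p.+1)} := mulmx D.
(* Elements of [W] are sent into [J], so [m] times their images lies in the socle part [S]; only the
   generators [v] contribute further. *)
have mA : msyz m d p.+1 `<=` addm S (DF @` mxin m).
  have sX : subm (addm S (DF @` mxin m)) := subm_add sS (subm_img DF (smF k)).
  move=> _ [x mx <-]; move: x mx; rewrite (mxin_smul _ _ sm).
  apply: (smul_sub (subm_pre (F p.+1) sX)) => a x ma _.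
  have : addm W (gen v) x by rewrite -TW.
  move=> [w Ww [_ [c ->] ->]]; rewrite /preimage /= -[d p.+1 *m _]/(F p.+1 _) scalerDr linearD.
  rewrite [F _ (a *: w)]linearZ_LR [F _ (a *: _)]linearZ_LR.
  exists (a *: F p.+1 w).
    by move=> i j; rewrite mxE; apply: Jmsoc => //; apply: Ww.
  exists (DF (a *: \col_j c j)).
    exists (a *: \col_j c j) => //; move=> i j; rewrite !mxE mulrC.
    exact: (subZ (V := R^o)).
  congr (_ + _); rewrite linearZ_LR; congr (_ *: _); rewrite /= -[in RHS]mulmxA; congr (_ *m _).
  apply/colP => i; rewrite summxE mxE; apply: eq_bigr => j _; rewrite !mxE; exact: mulrC.
pose q := qpi sS.
have lX : (len (addm S (DF @` mxin m)) <= n + k * (L - 1))%N.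
  have sX : subm (addm S (DF @` mxin m)) := subm_add sS (subm_img DF (smF k)).
  rewrite (len_exact q (fV _ _ sX)) ker_qpi addnC leq_add //.
    apply: leq_trans (_ : len (mxin (ann m) : set 'cV[R]_(b p.+1)) <= n)%N; last by rewrite len_socF bn.
    by apply: len_sub; [exact: fV|exact: submI|move=> x []].
  have -> : q @` addm S (DF @` mxin m) = (q \o DF : {linear _ -> _}) @` mxin m.
    apply/seteqP; split=> [_ [_ [u Su [_ [x mx <-] ->]] <-]|_ [x mx <-]].
      exists x => //=; rewrite linearD /=; have : ker q u by rewrite ker_qpi.
      by rewrite /ker /= => ->; rewrite add0r.
    by exists (DF x) => //; apply: addmR => //; exists x.
  have := len_exact (q \o DF : {linear _ -> _}) (fV _ _ (smF k)).
  rewrite (len_cVin al _ sm).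
  have : (k * e.+1 <= len (mxin m `&` ker (q \o DF : {linear 'cV_k -> _})))%N.
    rewrite -lJ -(len_cVin al _ (subm_ann _)); apply: len_sub.
    - exact/fV/submI/subm_ker.
    - exact: sJF.
    - move=> x Jx; split; first by move=> i j; apply/Jm/Jx.
      have : ker q (DF x); last by [].
      rewrite ker_qpi => i j; rewrite mxE; apply: (@sub_sum R R^o); first exact: subm_ann.
      move=> l _; apply: Jmsoc; [exact: Jx|].
      by apply: mxin_mull => // i' j'; apply: mr_min dP _ _ _.
  move=> lK E; rewrite -(leq_add2r (k * e.+1)); apply: (@leq_trans (k * len m)%N).
    by rewrite E leq_add2l.
  by rewrite -mulnDr leq_mul2l; apply/orP; right; move: lm lamE; lia.
have := leq_trans (len_sub (fV _ _ (subm_add sS (subm_img DF (smF k)))) (subm_msyz al d p.+1) mA) lX.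
have kE : k = (b p.+2 * lam - len U')%N by rewrite /k lT.
have lmF := len_cVin al (b p.+2) sm.
have : (len U' <= b p.+2 * lam)%N by rewrite -lT; exact: (len_sub fT (fl_subm fWm) (@subsetT _ _)).
move=> lU' lms.
have key lU lWn lWmn lF JA s2 ms bb : (lU + lWmn = lWn + lF -> k = bb * lam - lU -> lU <= bb * lam ->
    lWn = JA + s2 -> lWmn <= ms + s2 -> e * n <= JA -> lF = bb * len m -> bb = n -> k + e * n <= n + ms)%N.
  by move=> + + + + + + + E; rewrite {bb}E -lm mulnS; lia.
have K : (k + e * n <= n + len (msyz m d p.+1))%N.
  exact: (key _ _ _ _ _ _ _ _ lA kE lU' lW lWm JAlen lmF (bn _)).
move: lms K; move: (len (msyz m d p.+1)) => ms lms K.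
apply: (@leq_trans (n + k * (L - 1) + (L - 1) * (e * n))%N); first by rewrite leq_add2r.
by rewrite -addnA leq_add2l (mulnC k) -mulnDr leq_mul2l K orbT.
Qed.

(** Writing [t_p] for [len (msyz m d p)], exactness gives [t_1 + t_2 = n (e + L - 1)], while
    [t_p <= L n]; hence [e <= L + 1] or [n = 0]. The remaining pairs [(L, e)] are (4, 5), (5, 5) and
    (5, 6), and in each the sum of two instances of [lemA] forces [n = 0]. *)
Lemma const_betti_zero : n = 0%N.
Proof.
have := lemA 0; have := lemA 1.
have := len_msyz al dP 0; have := len_msyz al dP 1; have := len_msyz al dP 2.
have := len_syz al dP 1; have := len_syz al dP 2.
have lt p : (len (msyz m d p) <= L * n)%N.
  have E : (L * n = len (mxin m2 : set 'cV[R]_(b p)))%N by rewrite (len_cVin al _ sm2) bn mulnC.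
  rewrite E; apply: len_sub.
  - exact/(fl_cVs al)/subm_mxin.
  - exact: subm_msyz.
  - move=> _ [w mw <-]; apply: mxin_mul => // i j; exact: mr_min dP _ _ _.
rewrite lamE; move: (lt 1%N) (lt 2%N) (bn 1%N) (bn 2%N) (bn 3%N).
move: (len (syz d 1)) (len (syz d 2)) (len (syz d 3)) (len (msyz m d 1)) (len (msyz m d 2)) (len (msyz m d 0)).
move: (b 1%N) (b 2%N) (b 3%N) => b1 b2 b3 s1 s2 s3 t1 t2 t0 + + b1E b2E b3E; rewrite {b1}b1E {b2}b2E {b3}b3E.
have : (e <= L.+1)%N \/ (L.+1 < e)%N by lia.
case; last by nia.
move=> eL; have [eE|[eE|eE]] : (L = 4 /\ e = 5 \/ L = 5 /\ e = 5 \/ L = 5 /\ e = 6)%N by lia.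
all: case: eE => -> -> *; lia.
Qed.

End Const.

(** Either [c] never increases, or a single increase of [c] prevents every increase of [b] beyond
    [n]; a nonincreasing sequence is eventually constant. *)
Theorem large_embdim_vanishing (b : nat -> nat) (d : forall p, 'M[R]_(b p, b p.+1))
    (c : nat -> nat) (d' : forall p, 'M[R]_(c p, c p.+1)) n :
  minres m d -> minres m d' -> (forall p q, (n <= p)%N -> tor_indep d d' p q) ->
  (exists p, b p = 0%N) \/ (exists q, c q = 0%N).
Proof.
have stab k (f : nat -> nat) : (forall p, (k <= p)%N -> (f p.+1 <= f p)%N) ->
    exists l, forall p, f (p + l)%N = f l.
  move=> fS; have [N] := ubnP (f k); elim: N => // N IH in k fS *; rewrite ltnS => lN.
  case: (pselect (forall p, (k <= p)%N -> f p = f k)) => [H|nH].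
    by exists k => p; apply: H; rewrite leq_addl.
  have {nH}[p [lep ne]] : exists p, (k <= p)%N /\ f p <> f k.
    apply: contrapT => h; apply: nH => p lep; apply: contrapT => ne; apply: h; by exists p.
  have lt : (f p < f k)%N.
    have : (f p <= f k)%N.
      elim: p lep {ne} => [|p IHp]; first by rewrite leqn0 => /eqP->.
      by rewrite leq_eqVlt => /predU1P[->//|]; rewrite ltnS => lep; apply: leq_trans (fS _ lep) (IHp lep).
    by rewrite leq_eqVlt => /predU1P[].
  apply: (IH p); last lia.
  by move=> q leq; apply: fS; lia.
have stab0 (f : nat -> nat) (D : forall p, 'M[R]_(f p, f p.+1)) l :
    minres m D -> (forall p, f (p + l)%N = f l) -> exists p, f p = 0%N.
  move=> [D1 D2] fl; exists l.
  apply: (@const_betti_zero (fun p => f (p + l)%N) (fun p => D (p + l)%N)) => //.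
move=> dP d'P T.
case: (pselect (forall q, (c q.+1 <= c q)%N)) => [cS|nc].
  by right; have [l lP] := stab 0%N c (fun q _ => cS q); exact: (stab0 c d' l d'P lP).
have [q ltq] : exists q, (c q < c q.+1)%N.
  apply: contrapT => h; apply: nc => q; rewrite leqNgt; apply/negP => lt; apply: h; by exists q.
left; have [|l lP] := stab n b; last exact: (stab0 b d l dP lP).
by move=> p lep; apply: (betti_growth dP d'P (T p q.+1 lep) ltq).
Qed.

End LargeE.

(** * Operators over the residue field *)

Section ResidueField.
Local Open Scope quotient_scope.
Variables (R : comNzRingType) (m : set R^o).
Hypothesis mP : artin_local m.

Definition max_pred of artin_local m : R -> bool := fun x => `[<m x>].
Local Notation I := (max_pred mP).

Fact max_pred_closed : idealr_closed (I : {pred R}).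
Proof.
split.
- by apply/asboolP; apply: sub0 (al_sub mP).
- by apply/negP => /asboolP; apply: al_proper mP.
- move=> a u v /asboolP mu /asboolP mv; apply/asboolP.
  by case: (al_sub mP) => _ /(_ a u v); apply.
Qed.
HB.instance Definition _ := isIdealr.Build R I max_pred_closed.

Definition resfield := @Quotient.quot R (I : idealr R).
HB.instance Definition _ := GRing.ComNzRing.on resfield.

Definition res_pi : {rmorphism R -> resfield} := \pi_(resfield).

Lemma res_piE x : res_pi x = 0 <-> m x.
Proof.
split=> [|mx].
  rewrite -(rmorph0 res_pi) => /eqP; rewrite /res_pi /= -Quotient.idealrBE subr0.
  by move/asboolP.
apply/eqP; rewrite -(rmorph0 res_pi) /res_pi /= -Quotient.idealrBE subr0.
exact/asboolP.
Qed.

Lemma res_surj (y : resfield) : exists x, res_pi x = y.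
Proof. by exists (repr y); rewrite /res_pi /= reprK. Qed.

Lemma res_inv_ex (x : resfield) : exists y : resfield, (x != 0 -> y * x = 1) /\ (x = 0 -> y = 0).
Proof.
have [->|nx] := eqVneq x 0; first by exists 0; split=> // /eqP.
have [r rE] := res_surj x.
have [|y yr] := al_unit mP (x := r).
  by move=> /res_piE; rewrite rE => x0; move/eqP: nx.
exists (res_pi y); split=> [_|x0]; last by move/eqP: nx.
by rewrite -rE -rmorphM yr rmorph1.
Qed.
Definition res_inv x := sval (cid (res_inv_ex x)).
Fact res_mulV x : x != 0 -> res_inv x * x = 1.
Proof. by rewrite /res_inv; case: cid => y []. Qed.
Fact res_inv0 : res_inv 0 = 0.
Proof. by rewrite /res_inv; case: cid => y [_ /=]; apply. Qed.
HB.instance Definition _ := GRing.ComNzRing_isField.Build resfield res_mulV res_inv0.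

Lemma residue_field : exists (k : fieldType) (pi : {rmorphism R -> k}),
  (forall x, pi x = 0 <-> m x) /\ forall y, exists x, pi x = y.
Proof. by exists resfield, res_pi; split; [exact: res_piE|exact: res_surj]. Qed.

End ResidueField.

Lemma nonincr_stab n (f : nat -> nat) : (forall p, (n <= p)%N -> (f p.+1 <= f p)%N) ->
  exists2 l, (n <= l)%N & forall p, (l <= p)%N -> f p = f l.
Proof.
move=> fS; have [N] := ubnP (f n); elim: N => // N IH in n fS *; rewrite ltnS => lN.
case: (pselect (forall p, (n <= p)%N -> f p = f n)) => [H|nH]; first by exists n.
have {nH}[p [lep ne]] : exists p, (n <= p)%N /\ f p <> f n.
  apply: contrapT => h; apply: nH => p lep; apply: contrapT => ne; apply: h; by exists p.
have lt : (f p < f n)%N.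
  have : (f p <= f n)%N.
    elim: p lep {ne} => [|p IHp]; first by rewrite leqn0 => /eqP->.
    by rewrite leq_eqVlt => /predU1P[->//|]; rewrite ltnS => lep; apply: leq_trans (fS _ lep) (IHp lep).
  by rewrite leq_eqVlt => /predU1P[].
have [||l lel lP] := IH p; [|lia|exists l => //; lia].
by move=> q leq; apply: fS; lia.
Qed.

Section Omega.
Variable k : fieldType.

Lemma subspace_mx r (C : set 'rV[k]_r) : subm C -> exists T : 'M[k]_r, forall v, C v <-> (v <= T)%MS.
Proof.
move=> sC.
pose P n := `[< exists D : 'M[k]_(n, r), row_free D /\ forall i, C (row i D) >].
have P0 : exists n, P n.
  exists 0%N; apply/asboolP; exists 0; split=> [|[]//].
  by rewrite -row_leq_rank leq0n.
have Pr n : P n -> (n <= r)%N.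
  by move=> /asboolP[D [fD _]]; have := rank_leq_col D; rewrite (eqP fD).
case: (ex_maxnP P0 Pr) => n /asboolP[D [fD CD]] nmax.
have CE v : C v <-> (v <= D)%MS.
  split=> [Cv|/submxP[w ->]]; last first.
    by rewrite mulmx_sum_row; apply: sub_sum => // i _; apply: subZ.
  apply: contrapT => /negP nv; have := nmax n.+1; rewrite ltnn => H.
  suff /H : P (1 + n)%N by [].
  apply/asboolP; exists (col_mx v D); split; last first.
    move=> i; case: (split_ordP i) => j ->; first by rewrite rowKu row_id.
    by rewrite rowKd.
  rewrite -row_leq_rank -addsmxE.
  have lt : (\rank D < \rank (v + D)%MS)%N.
    apply: rank_ltmx; rewrite ltmxE addsmxSr /=; apply: contra nv.
    exact: submx_trans (addsmxSl _ _).
  by move: lt; rewrite (eqP fD).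
exists <<D>>%MS => v; rewrite CE; split; rewrite genmxE; exact.
Qed.

Variables (c r : nat) (Th : 'I_c -> 'M[k]_r).
Hypotheses (ThC : forall l l', Th l *m Th l' = Th l' *m Th l) (r0 : (0 < r)%N)
  (irr : forall T : 'M[k]_r, T != 0 -> (forall l, (T *m Th l <= T)%MS) -> row_full T).

(** By irreducibility the row [phi] is cyclic for the bicommutant [A] of the matrices [Th], which is
    commutative. The form [phi a a' u] on [A] is symmetric and makes every element of [A]
    self-adjoint; the inverse of its Gram matrix is the required [Om]. *)
Lemma symmetrizer : exists2 Om : 'M[k]_r, Om != 0 & forall l, (Th l)^T *m Om = Om *m Th l.
Proof.
pose A : set 'M[k]_r := [set a | forall M, (forall l, M *m Th l = Th l *m M) -> a *m M = M *m a].
have A1 : A 1%:M by move=> M _; rewrite mul1mx mulmx1.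
have ATh l : A (Th l) by move=> M ->.
have AM a a' : A a -> A a' -> A (a *m a').
  by move=> Aa Aa' M cM; rewrite -mulmxA Aa' // !mulmxA Aa.
have Acomm a a' : A a -> A a' -> a *m a' = a' *m a.
  by move=> Aa Aa'; apply: Aa => l; apply: Aa'.
have sA : subm A.
  split=> [M _|x a a' Aa Aa' M cM]; first by rewrite mul0mx mulmx0.
  by rewrite mulmxDl mulmxDr -scalemxAl -scalemxAr Aa // Aa'.
pose phi : 'rV[k]_r := delta_mx 0 (Ordinal r0).
have phi0 : phi != 0.
  apply/eqP => /rowP/(_ (Ordinal r0)); rewrite !mxE !eqxx => /eqP; rewrite oner_eq0 //.
pose C : set 'rV[k]_r := [set v | exists2 a, A a & v = phi *m a].
have sC : subm C.
  split=> [|x _ _ [a Aa ->] [a' Aa' ->]]; first by exists 0; [exact: sub0|rewrite mulmx0].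
  exists (x *: a + a'); first by case: sA => _; apply.
  by rewrite mulmxDr scalemxAr.
have [T CT] := subspace_mx sC.
have full : row_full T.
  apply: irr.
    apply/eqP => T0; have /CT : C phi by exists 1%:M; rewrite ?mulmx1.
    by rewrite T0 submx0 (negPf phi0).
  move=> l; apply/row_subP => i; rewrite row_mul.
  have [a Aa ->] : C (row i T) by apply/CT; apply: row_sub.
  by apply/CT; exists (a *m Th l); rewrite ?mulmxA //; apply: AM.
have aex i : exists a, A a /\ phi *m a = delta_mx 0 i :> 'rV_r.
  by have [a Aa ->] : C (delta_mx 0 i) by [apply/CT; apply: submx_full]; exists a.
have [a aP] := choice aex.
have aA i := (aP i).1; have aE i := (aP i).2.
have a0 : a (Ordinal r0) != 0.
  apply/eqP => a0; have := aE (Ordinal r0); rewrite a0 mulmx0 => /rowP/(_ (Ordinal r0)).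
  by rewrite !mxE !eqxx => /eqP; rewrite eq_sym oner_eq0.
have [u u0] : exists u : 'cV_r, a (Ordinal r0) *m u != 0.
  apply: contrapT => nu; move/eqP: a0; apply; apply/matrixP => i j; rewrite mxE.
  have := contrapT (fun h => nu (ex_intro _ (delta_mx j 0) (introN eqP h))).
  by rewrite -colE => /colP/(_ i); rewrite !mxE.
(* The entries are [phi a_i a_j u], as [phi a_i] is the [i]-th basis vector; [u] is chosen so that
   the matrix is nonzero. *)
pose W : 'M[k]_r := \matrix_(i, j) (a j *m u) i 0.
have aTh l i : \sum_j Th l i j *: a j = a i *m Th l.
  set a' := \sum_j _; have Aa' : A a'.
    exact: (@sub_sum k 'M[k]_r A _ (index_enum _) xpredT (fun j => Th l i j *: a j) sA (fun j _ => subZ _ sA (aA j))).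
  have E : phi *m a' = phi *m (a i *m Th l).
    rewrite mulmxA aE mulmx_sumr.
    under eq_bigr => j _ do rewrite -scalemxAr aE.
    by rewrite -rowE; apply/rowP => j; rewrite summxE mxE (bigD1 j) //= !mxE !eqxx mulr1
       big1 ?addr0 // => t tj; rewrite !mxE eq_sym (negPf tj) mulr0.
  apply/row_matrixP => j; rewrite !rowE -!aE -!mulmxA.
  rewrite (Acomm (a j) a') // (Acomm (a j) (a i *m Th l)) //; last exact: AM.
  by rewrite 2!mulmxA E -mulmxA.
have WTh l : Th l *m W = W *m (Th l)^T.
  apply/matrixP => i j.
  have -> : (W *m (Th l)^T) i j = ((a j *m Th l) *m u) i 0.
    rewrite -aTh mulmx_suml summxE mxE; apply: eq_bigr => t _.
    by rewrite -scalemxAl !mxE mulrC.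
  rewrite (Acomm (a j) (Th l)) // -mulmxA mxE [RHS]mxE.
  by apply: eq_bigr => t _; rewrite !mxE.
have Wu : W \in unitmx.
  rewrite -row_full_unit -[row_full _]/(\rank W == r).
  have kst : forall l, (kermx W *m Th l <= kermx W)%MS.
    by move=> l; apply/sub_kermxP; rewrite -mulmxA WTh mulmxA mulmx_ker mul0mx.
  have [k0|kn0] := eqVneq (kermx W) 0.
    by have := mxrank_ker W; rewrite k0 mxrank0 => /esym/eqP; rewrite subn_eq0 eqn_leq rank_leq_row.
  have kf := irr kn0 kst.
  have : (1%:M : 'M_r) *m W = 0.
    have /submxP[D ->] : (1%:M <= kermx W)%MS by apply: submx_full.
    by rewrite -mulmxA mulmx_ker mulmx0.
  rewrite mul1mx => W0; case/eqP: u0; apply/colP => i.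
  by have /matrixP/(_ i (Ordinal r0)) := W0; rewrite !mxE.
exists (invmx W).
  apply/eqP => i0; have := mulmxV Wu; rewrite i0 mulmx0 => /matrixP/(_ (Ordinal r0) (Ordinal r0)).
  by rewrite !mxE eqxx => /eqP; rewrite eq_sym oner_eq0.
move=> l; have := WTh l => /(congr1 (fun M => invmx W *m M *m invmx W)).
by rewrite !mulmxA mulVmx // mul1mx mulmxK.
Qed.

End Omega.

(** * Commuting operators of degree -2 and the tensor square *)

Section SelfTensor.
Variables (k : fieldType) (b : nat -> nat) (c : nat) (X : 'I_c -> forall n, 'M[k]_(b n.+2, b n)).
Hypotheses (XC : forall l l' n, X l n.+2 *m X l' n = X l' n.+2 *m X l n)
  (fin1 : exists n0, forall n, (n0 <= n)%N -> forall v : 'rV_(b n.+2), (forall l, v *m X l n = 0) -> v = 0)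
  (fin2 : forall N, exists n1, forall n, (n1 <= n)%N ->
     forall Y : (forall p q, 'M[k]_(b (p + N)%N, b (q + N)%N)),
     (forall l p q, (p + q = n)%N ->
        (X l (p + N)%N)^T *m Y p.+2 q + Y p q.+2 *m X l (q + N)%N = 0) ->
     forall p q, (p + q = n.+2)%N -> Y p q = 0).

(** The matrices [(-1)^(p/2) B_p^T Om B_q] form an element of the tensor square annihilated by each
    [X (x) 1 + 1 (x) X]: a matrix [Th] passes through [Om], and the two terms differ by the sign. By
    [fin2] it vanishes in large degrees, although the [B] of even index have independent rows. *)
Lemma no_eigensequence r a (B : forall j, 'M[k]_(r, b (j + a)%N)) (Th : 'I_c -> 'M[k]_r) :
  (0 < r)%N -> (forall j, row_free (B j.*2)) ->
  (forall l j, B j.+2 *m X l (j + a)%N = Th l *m B j) ->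
  (forall l l', Th l *m Th l' = Th l' *m Th l) ->
  (forall T : 'M[k]_r, T != 0 -> (forall l, (T *m Th l <= T)%MS) -> row_full T) -> False.
Proof.
move=> r0 fB BX ThC irr; have [Om Om0 OmTh] := symmetrizer ThC r0 irr.
have [n1 n1P] := fin2 a.
pose Y p q : 'M[k]_(b (p + a)%N, b (q + a)%N) := (-1) ^+ p./2 *: ((B p)^T *m Om *m B q).
have := n1P n1.*2 _ Y; rewrite -addnn leq_addl => /(_ isT) H.
have : Y (n1.*2.+2) 0%N = 0.
  apply: H; last by rewrite addn0 addnn.
  move=> l p q _; rewrite /Y -[p.+2./2]/(p./2).+1 exprS mulN1r scaleNr mulmxN.
  rewrite -!scalemxAr -!scalemxAl -scalerN -scalerDr.
  suff -> : (X l (p + a)%N)^T *m ((B p.+2)^T *m Om *m B q) = (B p)^T *m Om *m B q.+2 *m X l (q + a)%N.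
    by rewrite addNr scaler0.
  rewrite !mulmxA -trmx_mul BX -!mulmxA BX !mulmxA trmx_mul -!mulmxA; congr (_ *m _).
  by rewrite !mulmxA OmTh.
rewrite /Y => /eqP; rewrite scaler_eq0 expf_eq0 oppr_eq0 oner_eq0 andbF /= => /eqP E.
case/eqP: Om0; have /row_freeP[D BD] := fB n1.+1; have /row_freeP[D0 BD0] := fB 0%N.
have : D^T *m ((B n1.*2.+2)^T *m Om *m B 0%N) *m D0 = Om.
  rewrite !mulmxA -trmx_mul -[n1.*2.+2]/(n1.+1.*2) BD trmx1 mul1mx -mulmxA.
  by have -> : B 0%N *m D0 = 1%:M := BD0; rewrite mulmx1.
by rewrite E mulmx0 mul0mx.
Qed.

Lemma irreducible_part r (Th : 'I_c -> 'M[k]_r) : (0 < r)%N ->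
  (forall l l', Th l *m Th l' = Th l' *m Th l) ->
  exists r' (S : 'M[k]_(r', r)) (Th' : 'I_c -> 'M[k]_r'),
  [/\ (0 < r')%N, row_free S, forall l, S *m Th l = Th' l *m S,
    forall l l', Th' l *m Th' l' = Th' l' *m Th' l
    & forall T : 'M[k]_r', T != 0 -> (forall l, (T *m Th' l <= T)%MS) -> row_full T].
Proof.
move=> r0 ThC.
pose P n := `[< exists T : 'M[k]_r, [/\ \rank T = n, T != 0 & forall l, (T *m Th l <= T)%MS] >].
have Pex : exists n, P n.
  exists r; apply/asboolP; exists 1%:M; split=> [||l]; rewrite ?mxrank1 ?submx1 //.
  by rewrite -mxrank_eq0 mxrank1 -lt0n.
case: (ex_minnP Pex) => n /asboolP[T [rT T0 Tst]] nmin.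
have fS := row_base_free T; set S := row_base T in fS.
have SE : (S :=: T)%MS := eq_row_base T.
have [Th' Th'E] : exists Th' : 'I_c -> 'M[k]_(\rank T), forall l, S *m Th l = Th' l *m S.
  have H l : exists M : 'M[k]_(\rank T), S *m Th l = M *m S.
    apply/submxP; rewrite SE; apply: submx_trans (Tst l).
    by rewrite submxMr // SE.
  by have [f fP] := choice H; exists f.
exists (\rank T), S, Th'; split=> //.
- by rewrite lt0n mxrank_eq0.
- move=> l l'; have E i j : Th' i *m Th' j *m S = S *m (Th i *m Th j).
    by rewrite -mulmxA -Th'E mulmxA -Th'E mulmxA.
  by apply: (row_free_inj fS); rewrite !E ThC.
- move=> T' T'0 T'st; rewrite -[row_full _]/(\rank T' == \rank T)%N eqn_leq rank_leq_row /=.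
  have : P (\rank (T' *m S)).
    apply/asboolP; exists <<T' *m S>>%MS; split=> [||l]; first by rewrite mxrank_gen.
      by rewrite -mxrank_eq0 mxrank_gen mxrankMfree // mxrank_eq0.
    rewrite !genmxE; apply: submx_trans (submxMr (Th l) _) _; first by rewrite genmxE.
    by rewrite -mulmxA Th'E mulmxA; apply: submxMr.
  by move=> /nmin; rewrite mxrankMfree // -{1}rT.
Qed.

(** Induction on the number of operators that may be nonzero on [U]. If one of them has a kernel in
    [U] in arbitrarily large degrees, that kernel replaces [U]. Otherwise the operators in [L] are
    injective in large degrees, the ranks stabilize, and inverting one of them turns the others into
    commuting matrices on a single [U a']. *)
Lemma operators_drop (L : {set 'I_c}) (U : forall n, 'M[k]_(b n)) :
  (forall l n, (U n.+2 *m X l n <= U n)%MS) ->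
  (forall l n, l \notin L -> U n.+2 *m X l n = 0) ->
  (forall N, exists2 n, (N <= n)%N & U n != 0) -> False.
Proof.
have [N] := ubnP #|L|; elim: N => // N IH in L U *; rewrite ltnS => lN Ust UL Uinf.
case: (pselect (exists2 l, l \in L & forall N, exists2 n, (N <= n)%N & (U n.+2 :&: kermx (X l n))%MS != 0)).
  case=> l lL linf.
  (* The operators reach no lower than degree 0, so the kernel makes sense from degree 2 on; the two
     lowest terms are kept as they are. *)
  pose U' n : 'M[k]_(b n) := match n with n.+2 => (U n.+2 :&: kermx (X l n))%MS | 0 => U 0 | 1 => U 1 end.
  have U'U n : (U' n <= U n)%MS by case: n => [|[|n]] //=; apply: capmxSl.
  apply: (IH (L :\ l) U').
  - by move: lN; rewrite (cardsD1 l L) lL.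
  - move=> l' [|[|n]] /=; try exact: submx_trans (submxMr _ (capmxSl _ _)) (Ust _ _).
    rewrite sub_capmx (submx_trans (submxMr _ (capmxSl _ _)) (Ust _ _)) /=.
    apply/sub_kermxP; rewrite -mulmxA XC mulmxA.
    suff -> : (U n.+4 :&: kermx (X l n.+2))%MS *m X l n.+2 = 0 by rewrite mul0mx.
    by apply/sub_kermxP; apply: capmxSr.
  - move=> l' n; rewrite in_setD1 negb_and negbK => /orP[/eqP->|nl'].
      by apply/sub_kermxP; apply: capmxSr.
    by have /submxP[D ->] := U'U n.+2; rewrite -mulmxA UL ?mulmx0.
  - move=> N'; have [n len Hn] := linf N'; exists n.+2 => //; lia.
(* From here on every operator in [L] is injective on [U] in large degrees, and [L] is not empty by
   [fin1]. *)
move=> ninj; have [n0 n0P] := fin1.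
have [M [Mn0 MP]] : exists M, (n0 <= M)%N /\ forall l, l \in L -> forall n, (M <= n)%N -> (U n.+2 :&: kermx (X l n))%MS = 0.
  have H (l : 'I_c) : exists M, l \in L -> forall n, (M <= n)%N -> (U n.+2 :&: kermx (X l n))%MS = 0.
    apply: contrapT => h; apply: ninj; exists l.
      by apply: contrapT => nl; apply: h; exists 0%N => lL; case: nl.
    move=> N'; apply: contrapT => h'; apply: h; exists N' => _ n len; apply/eqP/negPn/negP => ne.
    by apply: h'; exists n.
  have [f fP] := choice H; exists (n0 + \max_l f l)%N; split; first exact: leq_addr.
  move=> l lL n len; apply: fP => //; apply: leq_trans len; apply: leq_trans (leq_addl _ _).
  exact: leq_bigmax.
have inj l n c' (V : 'M_(c', _)) : l \in L -> (M <= n)%N -> (V <= U n.+2)%MS -> V *m X l n = 0 -> V = 0.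
  move=> lL len VU VX; apply/eqP; rewrite -submx0 -(MP l lL n len) sub_capmx VU /=.
  exact/sub_kermxP.
have [l0 l0L] : exists l, l \in L.
  apply: contrapT => nL; have [n len Un] := Uinf (n0 + 2)%N.
  case: n len Un => [|[|n]] len Un; try (by move: len; lia).
  case/eqP: Un; apply/row_matrixP => i; rewrite row0; apply: (n0P n); first by lia.
  move=> l; rewrite -row_mul UL ?row0 //; apply/negP => lL; apply: nL; by exists l.
have rkX n : (M <= n)%N -> \rank (U n.+2 *m X l0 n) = \rank (U n.+2).
  by move=> len; rewrite -[RHS](mxrank_mul_ker _ (X l0 n)) MP // mxrank0 addn0.
have rk n : (M <= n)%N -> (\rank (U n.+2) <= \rank (U n))%N.
  by move=> len; rewrite -rkX //; apply: mxrankS.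
have [a aM aP] : exists2 a, (M <= a)%N & forall n, (a <= n)%N -> \rank (U n.+2) = \rank (U n).
  have [|a1 _ a1P] := @nonincr_stab M (fun i => \rank (U (i.*2)%N)).
    by move=> p lep; apply: (rk p.*2); lia.
  have [|a2 _ a2P] := @nonincr_stab M (fun i => \rank (U (i.*2.+1)%N)).
    by move=> p lep; apply: (rk p.*2.+1); lia.
  exists (M + (a1 + a2).*2.+2)%N => [|n len]; first exact: leq_addr.
  have := odd_double_half n; case: (odd n) => nE; rewrite -nE ?add1n ?add0n.
    have := a2P n./2; have := a2P (n./2).+1; rewrite doubleS => -> ; last by lia.
    by move=> ->; lia.
  have := a1P n./2; have := a1P (n./2).+1; rewrite doubleS => -> ; last by lia.
  by move=> ->; lia.
have [a' lea Ua] := Uinf a.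
have {aP} aP n : (a' <= n)%N -> \rank (U n.+2) = \rank (U n) by move=> len; apply: aP; lia.
have {aM lea} aM : (M <= a')%N by lia.
have imU n : (a' <= n)%N -> (U n <= U n.+2 *m X l0 n)%MS.
  move=> len; rewrite -(mxrank_leqif_sup (Ust l0 n)) rkX ?aP //; lia.
pose r := \rank (U a').
(* Operators lower the degree by two, so a stage stores two consecutive terms. The odd terms start
   from zero, the even ones from a basis of [U a']. *)
pose T i := ('M[k]_(r, b (i + a')%N) * 'M[k]_(r, b (i + a').+1))%type.
pose Inv i (t : T i) := [/\ (t.1 <= U (i + a')%N)%MS, (t.2 <= U (i + a').+1)%MS
   & i = 0%N -> \rank t.1 = r /\ t.2 = 0].
pose Rel i (t : T i) (t' : T i.+1) := t'.1 = t.2 /\ t'.2 *m X l0 (i + a')%N = t.1.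
have [||t [tI tR]] := @dependent_seq T Rel Inv.
- exists (row_base (U a'), 0); split; rewrite /= ?sub0mx ?eq_row_base //.
- move=> i [P Q] [/= PU QU _].
  have /submxP[D DE] : (P <= U (i + a').+2 *m X l0 (i + a')%N)%MS.
    by apply: submx_trans PU _; apply: imU; rewrite leq_addl.
  by exists (Q, D *m U (i + a').+2) => //; split=> //=; rewrite ?submxMl // -mulmxA.
pose B j : 'M[k]_(r, b (j + a')%N) := (t j).1.
have BU j : (B j <= U (j + a')%N)%MS by case: (tI j).
have BX0 j : B j.+2 *m X l0 (j + a')%N = B j.
  by rewrite /B (tR j.+1).1 (tR j).2.
have B1 : B 1%N = 0 by rewrite /B (tR 0%N).1; case: (tI 0%N) => _ _ /(_ erefl)[].
have rB0 : \rank (B 0%N) = r by case: (tI 0%N) => _ _ /(_ erefl)[].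
have fB j : row_free (B j.*2).
  rewrite -row_leq_rank; elim: j => [|j IHj]; first by rewrite -[0.*2]/0%N rB0.
  by apply: leq_trans IHj _; rewrite -BX0; apply: mxrankM_maxl.
have [Th ThE] : exists Th : 'I_c -> 'M[k]_r, forall l, B 2%N *m X l a' = Th l *m B 0%N.
  have H l : exists M' : 'M[k]_r, B 2%N *m X l a' = M' *m B 0%N.
    apply/submxP; apply: (@submx_trans _ _ _ _ _ _ (U a')).
      by apply: submx_trans (Ust l a'); exact: (submxMr _ (BU 2%N)).
    by rewrite -(mxrank_leqif_sup (BU 0%N)) rB0.
  by have [f fP] := choice H; exists f.
have BX l j : B j.+2 *m X l (j + a')%N = Th l *m B j.
  have inj0 n (V : 'M_(r, _)) : (a' <= n)%N -> (V <= U n.+2)%MS -> V *m X l0 n = 0 -> V = 0.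
    by move=> len; apply: inj => //; lia.
  have B3 : B 3%N = 0.
    by apply: (inj0 (1 + a')%N) => //; [exact: (BU 3%N)|rewrite (BX0 1%N)].
  elim/ltn_ind: j => -[_|[_|j IHj]]; [exact: ThE|by rewrite B3 B1 mul0mx mulmx0|].
  apply/eqP; rewrite -subr_eq0; apply/eqP/(inj0 (j + a')%N); first by rewrite leq_addl.
    rewrite addmx_sub ?eqmx_opp //; first by apply: submx_trans (Ust l _); exact: (submxMr _ (BU j.+4)).
    exact: submx_trans (submxMl _ _) (BU j.+2).
  by rewrite mulmxBl -mulmxA XC mulmxA BX0 -mulmxA BX0 IHj ?subrr //; lia.
have fB0 : row_free (B 0%N) by have := fB 0%N.
have ThC l l' : Th l *m Th l' = Th l' *m Th l.
  apply: (row_free_inj fB0); rewrite -!mulmxA -!(BX _ 0%N).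
  by rewrite !mulmxA -!(BX _ 2%N) -!mulmxA XC.
have r0 : (0 < r)%N by rewrite lt0n mxrank_eq0.
have [r' [S [Th' [r'0 fS SE Th'C irr]]]] := irreducible_part r0 ThC.
apply: (@no_eigensequence r' a' (fun j => S *m B j) Th') => //.
- by move=> j; rewrite /row_free mxrankMfree.
- by move=> l j; rewrite -mulmxA BX mulmxA SE mulmxA.
Qed.

Theorem zero_betti : exists n, b n = 0%N.
Proof.
apply: contrapT => nb; apply: (@operators_drop [set: 'I_c] (fun n => 1%:M)).
- by move=> l n; rewrite submx1.
- by move=> l n; rewrite inE.
- move=> N; exists N => //; rewrite -mxrank_eq0 mxrank1; apply/eqP => bN; apply: nb; by exists N.
Qed.

End SelfTensor.

(** * Koszul complexes *)

(* The pair [(f, g)] stands for [f + e g], [e] being the first of the [n]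
   exterior generators. *)
Fixpoint ext (R : comNzRingType) (n : nat) (V : lmodType R) : lmodType R :=
  if n is n'.+1 then (ext n' V * ext n' V)%type else V.

Notation tl z := (fun i : nat => z i.+1).

Section Ext.
Variables (R : comNzRingType) (V : lmodType R).
Implicit Types (x z : nat -> R).

(** [iota x] is the Koszul differential (contraction by [x]), [omega z] the exterior multiplication
    by the one-form with coordinates [z], and [prK i] the projection to degree [i]; [uK] and [cK]
    are the inclusion of, and the projection to, the coefficients of degree 0. The minus signs come
    from moving past the first generator. *)
Fixpoint iota n x : ext n V -> ext n V :=
  if n is n'.+1 then fun f => (iota (tl x) f.1 + x 0%N *: f.2, - iota (tl x) f.2) else fun=> 0.
Fixpoint omega n z : ext n V -> ext n V :=
  if n is n'.+1 then fun f => (omega (tl z) f.1, z 0%N *: f.1 - omega (tl z) f.2) else fun=> 0.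
Fixpoint prK n i : ext n V -> ext n V :=
  if n is n'.+1 then fun f => (prK i f.1, if i is j.+1 then prK j f.2 else 0)
  else fun f => if i is 0%N then f else 0.
Fixpoint uK n : V -> ext n V :=
  if n is n'.+1 then fun v => (uK n' v, 0) else fun v => v.
Fixpoint cK n : ext n V -> V :=
  if n is n'.+1 then fun f => cK f.1 else fun v => v.

Lemma pair_eq n (f g : ext n.+1 V) : f.1 = g.1 -> f.2 = g.2 -> f = g.
Proof. by case: f g => [f0 f1] [g0 g1] /= -> ->. Qed.

Lemma iota_linear n x : linear (@iota n x).
Proof.
elim: n x => [|n IH] x a f g; first by rewrite /= scaler0 addr0.
apply: pair_eq; rewrite /=.
  rewrite !IH !scalerDr addrACA; congr (_ + _); congr (_ + _).
  by rewrite !scalerA mulrC.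
by rewrite !IH opprD -scalerN.
Qed.
HB.instance Definition _ n x := GRing.isLinear.Build R (ext n V) (ext n V) _ (@iota n x) (@iota_linear n x).

Lemma omega_linear n z : linear (@omega n z).
Proof.
elim: n z => [|n IH] z a f g; first by rewrite /= scaler0 addr0.
apply: pair_eq; rewrite /=; first exact: IH.
rewrite !IH scalerDr scalerBr opprD !scalerA mulrC -!addrA; congr (_ + _).
by rewrite addrCA.
Qed.
HB.instance Definition _ n z := GRing.isLinear.Build R (ext n V) (ext n V) _ (@omega n z) (@omega_linear n z).

Lemma prK_linear n i : linear (@prK n i).
Proof.
elim: n i => [|n IH] i a f g; first by case: i => //=; rewrite scaler0 addr0.
apply: pair_eq; rewrite /=; first exact: IH.
by case: i => [|i]; [rewrite scaler0 addr0|exact: IH].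
Qed.
HB.instance Definition _ n i := GRing.isLinear.Build R (ext n V) (ext n V) _ (@prK n i) (@prK_linear n i).

Lemma uK_linear n : linear (@uK n).
Proof.
elim: n => [//|n IH] a v w; apply: pair_eq; rewrite /=; first exact: IH.
by rewrite scaler0 addr0.
Qed.
HB.instance Definition _ n := GRing.isLinear.Build R V (ext n V) _ (@uK n) (@uK_linear n).

Lemma cK_linear n : linear (@cK n).
Proof. by elim: n => [//|n IH] a v w; exact: IH. Qed.
HB.instance Definition _ n := GRing.isLinear.Build R (ext n V) V _ (@cK n) (@cK_linear n).

Lemma iotaD n x (f g : ext n V) : iota x (f + g) = iota x f + iota x g. Proof. exact: linearD. Qed.
Lemma iotaB n x (f g : ext n V) : iota x (f - g) = iota x f - iota x g. Proof. exact: linearB. Qed.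
Lemma iotaZ n x a (f : ext n V) : iota x (a *: f) = a *: iota x f. Proof. exact: linearZ_LR. Qed.
Lemma iotaN n x (f : ext n V) : iota x (- f) = - iota x f. Proof. exact: linearN. Qed.
Lemma omegaD n z (f g : ext n V) : omega z (f + g) = omega z f + omega z g. Proof. exact: linearD. Qed.
Lemma omegaB n z (f g : ext n V) : omega z (f - g) = omega z f - omega z g. Proof. exact: linearB. Qed.
Lemma omegaZ n z a (f : ext n V) : omega z (a *: f) = a *: omega z f. Proof. exact: linearZ_LR. Qed.
Lemma omegaN n z (f : ext n V) : omega z (- f) = - omega z f. Proof. exact: linearN. Qed.
Lemma prKD n i (f g : ext n V) : prK i (f + g) = prK i f + prK i g. Proof. exact: linearD. Qed.
Lemma prKB n i (f g : ext n V) : prK i (f - g) = prK i f - prK i g. Proof. exact: linearB. Qed.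
Lemma prKZ n i a (f : ext n V) : prK i (a *: f) = a *: prK i f. Proof. exact: linearZ_LR. Qed.
Lemma prKN n i (f : ext n V) : prK i (- f) = - prK i f. Proof. exact: linearN. Qed.

Lemma iota_iota n x (f : ext n V) : iota x (iota x f) = 0.
Proof.
elim: n x f => [//|n IH] x f; apply: pair_eq; rewrite /=.
  by rewrite linearD /= IH add0r linearZ /= scalerN subrr.
by rewrite linearN /= IH !oppr0.
Qed.

Lemma omegaC n z z' (f : ext n V) : omega z (omega z' f) = - omega z' (omega z f).
Proof.
elim: n z z' f => [|n IH] z z' f; first by rewrite /= oppr0.
apply: pair_eq; rewrite /=; first exact: IH.
rewrite !omegaB !omegaZ.
by rewrite IH opprK opprB opprD addrA addrAC.
Qed.

Lemma omega_omega n z (f : ext n V) : omega z (omega z f) = 0.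
Proof.
elim: n z f => [//|n IH] z f; apply: pair_eq; rewrite /=; first exact: IH.
by rewrite linearB linearZ /= IH subr0 subrr.
Qed.

Definition dot n x z : R := \sum_(i < n) x i * z i.

(** The Leibniz rule for multiplication by a form of degree 1, whose differential is [dot n x z]. *)
Lemma iota_omega n x z (f : ext n V) : iota x (omega z f) = dot n x z *: f - omega z (iota x f).
Proof.
elim: n x z f => [|n IH] x z f; first by rewrite /dot big_ord0 scale0r subr0.
have E : dot n.+1 x z = x 0%N * z 0%N + dot n (tl x) (tl z).
  by rewrite /dot big_ord_recl.
rewrite E; apply: pair_eq; rewrite /=.
  rewrite IH scalerBr omegaD omegaZ addrACA -opprD.
  by rewrite scalerDl scalerA [dot _ _ _ *: _ + _]addrC.
rewrite iotaB iotaZ IH omegaN opprK.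
rewrite scalerDr scalerA (mulrC (z 0%N)) scalerDl; set X := (x 0%N * _) *: _.
set Z := z 0%N *: _; set W := omega _ _; set Dt := dot _ _ _ *: _.
by rewrite [X + Dt]addrC [Z + X]addrC -[X + Z + W]addrA addrKA !opprB opprD addrA addrAC.
Qed.

Lemma iota_prK0 n x (f : ext n V) : iota x (prK 0 f) = 0.
Proof.
elim: n x f => [//|n IH] x f; apply: pair_eq; rewrite /=; first by rewrite IH scaler0 addr0.
by rewrite linear0 oppr0.
Qed.

Lemma prK_iota n i x (f : ext n V) : prK i (iota x f) = iota x (prK i.+1 f).
Proof.
elim: n i x f => [|n IH] i x f; first by case: i.
apply: pair_eq; rewrite /=; first by rewrite prKD prKZ IH.
by case: i => [|i]; rewrite ?iota_prK0 ?oppr0 // prKN IH.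
Qed.

Lemma prK0_omega n z (f : ext n V) : prK 0 (omega z f) = 0.
Proof. by elim: n z f => [//|n IH] z f; apply: pair_eq; rewrite /= ?IH. Qed.

Lemma prK_omega n i z (f : ext n V) : prK i.+1 (omega z f) = omega z (prK i f).
Proof.
elim: n i z f => [|n IH] i z f; first by case: i.
apply: pair_eq; rewrite /=; first exact: IH.
rewrite prKB prKZ; congr (_ - _).
by case: i => [|i]; rewrite ?prK0_omega ?linear0 // IH.
Qed.

Lemma prK_prK n i j (f : ext n V) : prK i (prK j f) = if i == j then prK j f else 0.
Proof.
elim: n i j f => [|n IH] i j f; first by case: i j => [|i] [|j] //=; case: ifP.
apply: pair_eq; rewrite /= ?IH; first by case: ifP.
by case: i j => [|i] [|j] //=; rewrite ?linear0 ?IH ?eqSS //; case: ifP.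
Qed.

Lemma prK_out n i (f : ext n V) : (n < i)%N -> prK i f = 0.
Proof.
by elim: n i f => [|n IH] [|i] f //= lt; apply: pair_eq => /=; apply: IH => //; lia.
Qed.

Lemma sum_prK n N (f : ext n V) : (n < N)%N -> \sum_(i < N) prK i f = f.
Proof.
elim: n N f => [|n IH] N f.
  by case: N => // N _; rewrite big_ord_recl /= big1 ?addr0.
case: N => // N lt.
have fstS k (F : 'I_k -> ext n.+1 V) : (\sum_i F i).1 = \sum_i (F i).1.
  by elim/big_rec2: _ => //= i x y _ <-.
have sndS k (F : 'I_k -> ext n.+1 V) : (\sum_i F i).2 = \sum_i (F i).2.
  by elim/big_rec2: _ => //= i x y _ <-.
apply: pair_eq; first by rewrite fstS /= IH //; lia.
by rewrite sndS big_ord_recl /= add0r IH.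
Qed.

Lemma prK0E n (f : ext n V) : prK 0 f = uK n (cK f).
Proof. by elim: n f => [//|n IH] f; apply: pair_eq; rewrite /= ?IH. Qed.
Lemma cK_uK n v : cK (uK n v) = v. Proof. by elim: n. Qed.
Lemma cK_omega n z (f : ext n V) : cK (omega z f) = 0.
Proof. by elim: n z f => [//|n IH] z f; apply: IH. Qed.
Lemma iota_uK n x v : iota x (uK n v) = 0.
Proof. by rewrite -(cK_uK n v) -prK0E iota_prK0. Qed.
Lemma prK0_uK n v : prK 0 (uK n v) = uK n v.
Proof. by rewrite prK0E cK_uK. Qed.
Lemma cK_iota n x (S : set V) (f : ext n V) : subm S ->
  (forall i v, (i < n)%N -> S (x i *: v)) -> S (cK (iota x f)).
Proof.
move=> sS; elim: n x f => [|n IH] x f Sx /=; first exact: sub0.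
rewrite linearD linearZ /=; apply: subD => //; last exact: Sx.
by apply: IH => i v lt; apply: (Sx i.+1).
Qed.

End Ext.

Section ExtR.
Variable R : comNzRingType.

Lemma deg1_omega n (f : ext n R^o) : prK 1 f = f -> exists z, f = omega z (uK n (1 : R^o)).
Proof.
elim: n f => [|n IH] f; first by move=> /= <-; exists (fun=> 0).
move=> E; have E1 : prK 1 f.1 = f.1 by rewrite -{2}E.
have E2 : f.2 = uK n (cK f.2) by rewrite -prK0E -{1}E.
have [z zE] := IH _ E1.
exists (fun i => if i is j.+1 then z j else cK f.2); apply: pair_eq; rewrite /= ?linear0 ?oppr0 ?addr0 //.
by rewrite {1}E2 -linearZ_LR; congr (uK n _); rewrite -[RHS]/(cK f.2 * 1) mulr1.
Qed.

End ExtR.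

(** * Adjoining divided power variables *)

Section SeqOps.
Variables (R : comNzRingType) (A B : lmodType R).

Definition mapS (f : {linear A -> B}) (a : nat -> A) : nat -> B := fun k => f (a k).
Lemma mapS_linear f : linear (mapS f).
Proof. by move=> c a b; apply/funext => k; rewrite /mapS; exact: linearP. Qed.
HB.instance Definition _ f := GRing.isLinear.Build R (nat -> A) (nat -> B) _ (mapS f) (mapS_linear f).

Definition shS (a : nat -> A) : nat -> A := fun k => a k.+1.
Lemma shS_linear : linear shS. Proof. by []. Qed.
HB.instance Definition _ := GRing.isLinear.Build R (nat -> A) (nat -> A) _ shS shS_linear.

(** A sequence [a] stands for the sum of the [a k] times the divided powers of a variable of degree
    2 with differential [z]. The [k]-th divided power has differential [z] times the previous one,
    so [z (a k.+1)] contributes to the coefficient [k]. In the same notation [shS] is the derivation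
    with respect to the variable. *)
Definition diffS (D z : {linear A -> A}) (a : nat -> A) : nat -> A := fun k => D (a k) + z (a k.+1).
Lemma diffS_linear D z : linear (diffS D z).
Proof.
move=> c a b; apply/funext => k; rewrite /diffS.
transitivity (c *: (D (a k) + z (a k.+1)) + (D (b k) + z (b k.+1))) => //.
by rewrite (linearP D) (linearP z) scalerDr addrACA.
Qed.
HB.instance Definition _ D z := GRing.isLinear.Build R (nat -> A) (nat -> A) _ (diffS D z) (diffS_linear D z).

Definition atS (n : nat) (x : A) : nat -> A := fun k => if k == n then x else 0.
Lemma atS_linear n : linear (atS n).
Proof.
move=> c a b; apply/funext => k; rewrite /atS.
transitivity (c *: (if k == n then a else 0) + (if k == n then b else 0)) => //.
by case: ifP; rewrite ?scaler0 ?addr0.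
Qed.
HB.instance Definition _ n := GRing.isLinear.Build R A (nat -> A) _ (atS n) (atS_linear n).

End SeqOps.

Section ExteriorHomology.
Variables (R : comNzRingType) (S : lmodType R) (mS : set S).

(** The value of an exterior polynomial in the operators [zs], its coefficients in [S] being mapped
    by [u]. *)
Fixpoint evz (A : lmodType R) (u : {linear S -> A}) n (zs : nat -> {linear A -> A}) : ext n S -> A :=
  if n is n'.+1 then fun a => evz u (tl zs) a.1 + zs 0%N (evz u (tl zs) a.2) else fun a => u a.

Fixpoint inm n : ext n S -> Prop :=
  if n is n'.+1 then fun a => inm a.1 /\ inm a.2 else fun a => mS a.

(* The homology of [A] is freely generated by the exterior monomials in [zs],
   with scalars in [S] modulo [mS]; [Fi] stands for finite support. *)
Record ext_homology (A : lmodType R) (D : {linear A -> A}) (u : {linear S -> A})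
    (Fi : set A) n (zs : nat -> {linear A -> A}) : Prop := ExtHomology {
  eh_sub : subm Fi;
  eh_D : forall f, Fi f -> Fi (D f);
  eh_u : forall s, Fi (u s);
  eh_z : forall l f, Fi f -> Fi (zs l f);
  eh_DD : forall f, D (D f) = 0;
  eh_Du : forall s, D (u s) = 0;
  eh_Dz : forall l f, D (zs l f) = - zs l (D f);
  eh_gen : forall f, Fi f -> D f = 0 -> exists a g, Fi g /\ f = evz u zs (a : ext n S) + D g;
  eh_ind : forall a g, Fi g -> evz u zs (a : ext n S) = D g -> inm a;
  eh_bd : forall a, inm (a : ext n S) -> exists2 g, Fi g & evz u zs a = D g
}.

Lemma evz_linear (A : lmodType R) (u : {linear S -> A}) n (zs : nat -> {linear A -> A}) :
  linear (evz u zs : ext n S -> A).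
Proof.
elim: n zs => [|n IH] zs c a b /=; first exact: linearP.
by rewrite !IH linearP scalerDr addrACA.
Qed.

Section Step.
Hypothesis smS : subm mS.
Variables (A : lmodType R) (D : {linear A -> A}) (u : {linear S -> A}) (Fi : set A) (n : nat)
  (zs : nat -> {linear A -> A}).
Hypothesis H : ext_homology D u Fi n.+1 zs.
Hypothesis zz : forall f, zs 0%N (zs 0%N f) = 0.
Hypothesis zC : forall l f, zs 0%N (zs l f) = - zs l (zs 0%N f).

Let D' : {linear (nat -> A) -> (nat -> A)} := diffS D (zs 0%N).
Let u' : {linear S -> (nat -> A)} := atS 0 \o u.
Let zs' l : {linear (nat -> A) -> (nat -> A)} := mapS (zs l.+1).
Definition finS (F : set A) : set (nat -> A) :=
  [set f | (forall k, F (f k)) /\ exists N, forall k, (N <= k)%N -> f k = 0].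
Local Notation e0 := (evz u (tl zs)).

Let e00 k : e0 (0 : ext k S) = 0.
Proof.
by have := evz_linear u (tl zs) (-1) (0 : ext k S) 0; rewrite scaler0 addr0 scaleN1r addNr.
Qed.
Let e0N k (a : ext k S) : e0 (- a) = - e0 a.
Proof.
by have := evz_linear u (tl zs) (-1) a 0; rewrite addr0 e00 addr0 !scaleN1r.
Qed.

Let evz_at k (a : ext k S) l : evz u' (fun i => zs' (i + l)) a = atS 0 (evz u (fun i => zs (i + l).+1) a).
Proof.
elim: k l a => [//|k IH] l a /=.
have E (f : ext k S) : evz u' (tl (fun i => zs' (i + l))) f = atS 0 (evz u (fun i => zs (i + l.+1).+1) f).
  rewrite -IH; congr (evz _ _ _); apply/funext => i; by rewrite addSnnS.
rewrite !E; have E2 (f : ext k S) : evz u (fun i => zs (i + l.+1).+1) f = evz u (tl (fun i => zs (i + l).+1)) f.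
  by congr (evz _ _ _); apply/funext => i; rewrite addSnnS.
rewrite !E2; apply/funext => j; rewrite /zs' /mapS /atS.
by rewrite -[LHS]/(_ + _); case: eqP => _; rewrite ?linear0 ?addr0.
Qed.

Let ev' (a : ext n S) : evz u' zs' a = atS 0 (e0 a).
Proof.
have := evz_at a 0; have -> : (fun i => zs' (i + 0)) = zs' by apply/funext => i; rewrite addn0.
by move=> ->; congr (atS 0 (evz _ _ _)); apply/funext => i; rewrite addn0.
Qed.

Let eFi k l (a : ext k S) : Fi (evz u (fun i => zs (i + l)) a).
Proof.
elim: k l a => [|k IH] l a /=; first exact: eh_u H _.
have E (f : ext k S) : Fi (evz u (tl (fun i => zs (i + l))) f).
  by have := IH l.+1 f; congr Fi; congr (evz _ _ _); apply/funext => i; rewrite addSnnS.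
by apply: subD (eh_sub H) (E _) _; apply: eh_z H _ _ (E _).
Qed.
Let e0Fi (a : ext n S) : Fi (e0 a).
Proof. by have := eFi 1 a; congr Fi; congr (evz _ _ _); apply/funext => i; rewrite addn1. Qed.

Let eD k l (a : ext k S) : D (evz u (fun i => zs (i + l)) a) = 0.
Proof.
elim: k l a => [|k IH] l a /=; first exact: eh_Du H _.
have E (f : ext k S) : D (evz u (tl (fun i => zs (i + l))) f) = 0.
  by rewrite -[RHS](IH l.+1 f); congr (D (evz _ _ _)); apply/funext => i; rewrite addSnnS.
by rewrite linearD (eh_Dz H) !E linear0 subr0.
Qed.
Let e0D (a : ext n S) : D (e0 a) = 0.
Proof. by rewrite -[RHS](eD 1 a); congr (D (evz _ _ _)); apply/funext => i; rewrite addn1. Qed.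

Let gen1 f : Fi f -> D f = 0 -> exists (a b : ext n S) g, Fi g /\ f = e0 a + zs 0%N (e0 b) + D g.
Proof. by move=> Ff /(eh_gen H Ff)[[a b] [g [Fg fE]]]; exists a, b, g. Qed.

Let bd1 (a : ext n S) : inm a -> exists2 g, Fi g & e0 a = D g.
Proof.
move=> ma; have [|g Fg] := eh_bd H (a := (a, 0)).
  split=> //; have inm0 : forall k, inm (0 : ext k S); last exact: inm0.
  by elim=> [|k IH] //; exact: sub0.
by rewrite /= e00 linear0 addr0 => E; exists g.
Qed.

Let D'at k (x : A) : D' (atS k x) = atS k (D x) + (if k is j.+1 then atS j (zs 0%N x) else 0).
Proof.
apply/funext => j; rewrite /D' /= /diffS /atS.
case: k => [|k]; first by rewrite /= linear0 [RHS]addr0 addr0; case: ifP => _; rewrite ?linear0.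
rewrite eqSS -[RHS]/((if j == k.+1 then D x else 0) + (if j == k then zs 0%N x else 0)).
by case: (j == k.+1); case: (j == k); rewrite ?linear0.
Qed.

Let DD' f : D' (D' f) = 0.
Proof.
apply/funext => k; rewrite /D' /= /diffS !linearD /= (eh_DD H) add0r (eh_Dz H) zz addr0.
by rewrite addNr.
Qed.

Let finS_at k x : Fi x -> finS Fi (atS k x).
Proof.
move=> Fx; split=> [j|]; first by rewrite /atS; case: ifP => // _; exact: sub0 (eh_sub H).
by exists k.+1 => j lt; rewrite /atS; case: eqP => // E; rewrite E ltnn in lt.
Qed.

Let s' : subm (finS Fi).
Proof.
split=> [|c f g [Ff [N fN]] [Fg [M gM]]].
  by split; [move=> k; exact: sub0 (eh_sub H)|exists 0%N].
split=> [k|]; first by case: (eh_sub H) => _; apply; [apply: Ff|apply: Fg].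
exists (N + M)%N => k lek.
by rewrite -[LHS]/(c *: f k + g k) fN ?gM ?scaler0 ?addr0 //; lia.
Qed.

(* A cycle with top coefficient [f N] can be modified by a boundary so that its
   top coefficient involves only the remaining monomials. *)
Let reduce N f : finS Fi f -> (forall k, (N < k)%N -> f k = 0) -> D (f N) = 0 ->
  exists (a : ext n S) h, [/\ finS Fi h, finS Fi (f - D' h),
    forall k, (N < k)%N -> (f - D' h) k = 0 & (f - D' h) N = e0 a].
Proof.
move=> Ff fN DfN; have [a [b [g [Fg fE]]]] := gen1 (Ff.1 N) DfN.
exists a, (atS N g + atS N.+1 (e0 b)).
have Fh : finS Fi (atS N g + atS N.+1 (e0 b)).
  by apply: subD => //; apply: finS_at.
have hE k : (N <= k)%N -> (f - D' (atS N g + atS N.+1 (e0 b))) k = f k - (if k == N then D g + zs 0%N (e0 b) else 0).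
  move=> lek; rewrite [D' (_ + _)]linearD !D'at e0D linear0 add0r.
  rewrite -[LHS]/(f k - ((atS N (D g) k + (if N is j.+1 then atS j (zs 0%N g) else 0) k) + atS N (zs 0%N (e0 b)) k)).
  congr (f k - _); have -> : (if N is j.+1 then atS j (zs 0%N g) else 0) k = 0.
    by case: (N) lek => [//|j] lek; rewrite /atS; case: eqP => // E; lia.
  by rewrite addr0 /atS; case: eqP => _; rewrite ?addr0.
have FD : finS Fi (f - D' (atS N g + atS N.+1 (e0 b))).
  split=> [k|]; last first.
    by exists N.+1 => k lt; rewrite hE ?(ltnW lt) // fN // sub0r; case: eqP => [E|_]; [lia|rewrite oppr0].
  apply: (subB (eh_sub H)); first exact: Ff.1.
  by apply: (subD (eh_sub H)); [apply: eh_D H _ _|apply: eh_z H _ _ _]; apply: Fh.1.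
split=> //.
  by move=> k lt; rewrite hE ?(ltnW lt) // fN // sub0r; case: eqP => [E|_]; [lia|rewrite oppr0].
by rewrite hE // eqxx fE -(addrA (e0 a)) [D g + _]addrC addrK.
Qed.

Let drop N f (a : ext n S) : finS Fi f -> (forall k, (N.+1 < k)%N -> f k = 0) -> f N.+1 = e0 a -> inm a ->
  exists h, [/\ finS Fi h, finS Fi (f - D' h) & forall k, (N < k)%N -> (f - D' h) k = 0].
Proof.
move=> Ff fN fE /bd1[g Fg gE]; exists (atS N.+1 g); have Fh := finS_at N.+1 Fg.
have hE k : (N < k)%N -> (f - D' (atS N.+1 g)) k = f k - (if k == N.+1 then D g else 0).
  move=> lt; rewrite D'at -[LHS]/(f k - (atS N.+1 (D g) k + atS N (zs 0%N g) k)) /atS.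
  by congr (_ - _); case: (k =P N) => [E|_]; [lia|rewrite addr0].
have Z k : (N < k)%N -> (f - D' (atS N.+1 g)) k = 0.
  move=> lt; rewrite hE //; case: eqP => [->|ne]; first by rewrite fE gE subrr.
  by rewrite subr0 fN //; lia.
split=> //; split=> [k|]; last by exists N.+1.
apply: (subB (eh_sub H)); first exact: Ff.1.
by apply: (subD (eh_sub H)); [apply: eh_D H _ _|apply: eh_z H _ _ _]; apply: Fh.1.
Qed.

(** Tate's construction: a divided power variable with differential [z_0] removes [z_0] from an
    exterior homology algebra and keeps the other generators. Finite support allows induction on the
    top exponent of a cycle. *)
Lemma ext_homologyS : ext_homology D' u' (finS Fi) n zs'.
Proof.
split=> //.
- move=> f [Ff [N fN]]; split=> [k|].
    by apply: (subD (eh_sub H)); [apply: eh_D H _ _|apply: eh_z H _ _ _].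
  by exists N => k lek; rewrite /D' /= /diffS !fN ?linear0 ?addr0 //; lia.
- by move=> s; apply: finS_at; apply: eh_u H _.
- move=> l f [Ff [N fN]]; split=> [k|]; first by apply: eh_z H _ _ _.
  by exists N => k lek; rewrite /zs' /= /mapS fN // linear0.
- by move=> s; rewrite /u' /= D'at (eh_Du H) linear0 addr0.
- move=> l f; apply/funext => k; rewrite /D' /zs' /= /diffS /mapS (eh_Dz H) zC -opprD.
  by rewrite -linearD.
- move=> f Ff; have [_ [N fN]] := Ff.
  have {fN} fN : forall k, (N < k)%N -> f k = 0 by move=> k lt; apply: fN; lia.
  have top0 K g : D' g = 0 -> (forall k, (K < k)%N -> g k = 0) -> D (g K) = 0.
    by move=> Dg gK; have := congr1 (fun g => g K) Dg; rewrite /D' /= /diffS (gK K.+1) // linear0 addr0.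
  elim: N f Ff fN => [|N IH] f Ff fN Df.
    have [a [h [Fh Ff' f'N f'E]]] := reduce Ff fN (top0 _ _ Df fN).
    exists a, h; split=> //; rewrite ev'; apply/eqP; rewrite -subr_eq; apply/eqP/funext => k.
    by rewrite /atS; case: eqP => [->//|ne]; apply: f'N; lia.
  have [a [h [Fh Ff' f'N f'E]]] := reduce Ff fN (top0 _ _ Df fN).
  set f' := f - D' h in Ff' f'N f'E.
  have Df' : D' f' = 0 by rewrite linearB Df DD' subr0.
  have ma : inm a.
    have := eh_ind H (a := (0, a)) (subN (eh_sub H) (Ff'.1 N)).
    rewrite /= e00 add0r linearN => h'; apply h'; apply/eqP; rewrite -addr_eq0 addrC; apply/eqP.
    by have := congr1 (fun g => g N) Df'; rewrite /D' /= /diffS f'E.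
  have [h2 [Fh2 Ff2 f2N]] := drop Ff' f'N f'E ma.
  have [|a3 [g3 [Fg3 E3]]] := IH _ Ff2 f2N; first by rewrite linearB Df' DD' subr0.
  exists a3, (g3 + h2 + h); split; first by apply: subD => //; apply: subD.
  have DD x y : D' (x + y) = D' x + D' y := linearD D' x y.
  have E4 : f = evz u' zs' a3 + D' g3 + D' h2 + D' h by rewrite -E3 !subrK.
  by rewrite {1}E4 !DD -!addrA.
- move=> a g Fg; have [_ [N gN]] := Fg; rewrite ev' => E.
  have {gN} gN : forall k, (N < k)%N -> g k = 0 by move=> k lt; apply: gN; lia.
  elim: N g Fg gN E => [|N IH] g Fg gN E.
    have := congr1 (fun f => f 0%N) E; rewrite /D' /= /diffS (gN 1%N) // linear0 addr0 /atS /= => E0.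
    have := eh_ind H (a := (a, 0)) (Fg.1 0%N); rewrite /= e00 linear0 addr0.
    by move=> /(_ E0)[].
  have DgN : D (g N.+1) = 0.
    by have := congr1 (fun f => f N.+1) E; rewrite /D' /= /diffS (gN N.+2) // linear0 addr0 /atS => <-.
  have [a' [h [Fh Fg' g'N g'E]]] := reduce Fg gN DgN.
  set g' := g - D' h in Fg' g'N g'E.
  have E' : atS 0 (e0 a) = D' g' by rewrite linearB DD' subr0.
  (* When only exponent 1 is left above 0, its coefficient enters exponent 0 through [z_0], and
     freeness is applied to the pair [(a, - a')]. *)
  case: N IH gN DgN g'N g'E => [|N] IH gN DgN g'N g'E.
    have := congr1 (fun f => f 0%N) E'; rewrite /D' /= /diffS g'E /atS /= => E0.
    have := eh_ind H (a := (a, - a')) (Fg'.1 0%N); rewrite /= e0N linearN => h'.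
    by case: h' => //; rewrite E0 addrK.
  have ma : inm a'.
    have := eh_ind H (a := (0, a')) (subN (eh_sub H) (Fg'.1 N.+1)).
    rewrite /= e00 add0r linearN => h'; apply h'; apply/eqP; rewrite -addr_eq0 addrC; apply/eqP.
    by have := congr1 (fun f => f N.+1) E'; rewrite /D' /= /diffS g'E /atS => <-.
  have [h2 [Fh2 Fg2 g2N]] := drop Fg' g'N g'E ma.
  by apply: IH Fg2 g2N _; rewrite linearB DD' subr0.
- move=> a /bd1[g Fg gE]; exists (atS 0 g); first exact: finS_at.
  by rewrite ev' D'at gE addr0.
Qed.

End Step.

End ExteriorHomology.

Import Order.TTheory Num.Theory.

(** * Artinianness of the homology over the shift operators *)

Section ShiftComplex.
Variable R : comNzRingType.

(* Dual form of Hilbert's basis theorem: for the polynomial ring acting by the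
   [j] degree [-2] operators [sg l], submodules of the homology are determined
   in large degrees by the joint preimages of their lower degree parts. *)
Record shift_complex (Q : lmodType R) (D : {linear Q -> Q}) (pr : int -> {linear Q -> Q})
    (j : nat) (sg : nat -> {linear Q -> Q}) : Prop := ShiftComplex {
  sc_fl : forall n, fl [set f | pr n f = f];
  sc_neg : forall n f, n < 0 -> pr n f = 0;
  sc_D : forall n f, pr n (D f) = D (pr (n + 1) f);
  sc_DD : forall f, D (D f) = 0;
  sc_sg : forall l n f, pr n (sg l f) = sg l (pr (n + 2) f);
  sc_sD : forall l f, sg l (D f) = D (sg l f)
}.

Definition shift_closed (Q : lmodType R) (D : {linear Q -> Q}) (pr : int -> {linear Q -> Q})
    (j : nat) (sg : nat -> {linear Q -> Q}) (U : int -> set Q) : Prop :=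
  [/\ forall n, subm (U n), forall n f, U n f -> pr n f = f /\ D f = 0,
     forall n g, pr (n + 1) g = g -> U n (D g)
   & forall l n f, (l < j)%N -> U (n + 2) f -> U n (sg l f)].

Definition shift_artinian (Q : lmodType R) (D : {linear Q -> Q}) (pr : int -> {linear Q -> Q})
    (j : nat) (sg : nat -> {linear Q -> Q}) : Prop :=
  forall U, shift_closed D pr j sg U -> exists n0 : nat, forall n : int, n0%:Z <= n ->
    forall w, pr (n + 2) w = w -> D w = 0 -> (forall l, (l < j)%N -> U n (sg l w)) -> U (n + 2) w.

(** Without operators the last hypothesis on [w] is empty, so what is asked is that the homology
    vanish in large degrees. *)
Lemma shift_artinian0 (Q : lmodType R) (D : {linear Q -> Q}) (pr : int -> {linear Q -> Q})
    (sg : nat -> {linear Q -> Q}) (n0 : nat) :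
  (forall n : int, n0%:Z <= n -> forall w, pr n w = w -> D w = 0 -> exists2 g, pr (n + 1) g = g & w = D g) ->
  shift_artinian D pr 0 sg.
Proof.
move=> H U [_ _ Ubd _]; exists n0 => n len w pw Dw _.
have [|g pg ->] := H (n + 2) _ w pw Dw; first by lia.
exact: Ubd.
Qed.

Section Step.
Variables (Q : lmodType R) (D : {linear Q -> Q}) (pr : int -> {linear Q -> Q})
  (j : nat) (sg : nat -> {linear Q -> Q}) (z : {linear Q -> Q}).
Hypotheses (scQ : shift_complex D pr j sg) (artQ : shift_artinian D pr j sg).
Hypotheses (prz : forall n f, pr (n + 1) (z f) = z (pr n f)) (Dz : forall f, D (z f) = - z (D f))
  (zz : forall f, z (z f) = 0) (sz : forall l f, sg l (z f) = z (sg l f)).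

(** The variable has degree 2, so the coefficient of its [k]-th power is taken in degree
    [n - 2k]. *)
Definition prS (p : int -> {linear Q -> Q}) (n : int) (f : nat -> Q) : nat -> Q :=
  fun k => p (n - (k.*2)%:Z) (f k).
Lemma prS_linear p n : linear (prS p n).
Proof. by move=> c a b; apply/funext => k; rewrite /prS; exact: linearP. Qed.
HB.instance Definition _ p n := GRing.isLinear.Build R (nat -> Q) (nat -> Q) _ (prS p n) (prS_linear p n).
Definition sgS (s : nat -> {linear Q -> Q}) l : {linear (nat -> Q) -> (nat -> Q)} :=
  if l == j then (@shS R Q : {linear (nat -> Q) -> (nat -> Q)}) else mapS (s l).
Let D' : {linear (nat -> Q) -> (nat -> Q)} := diffS D z.
Let pr' n : {linear (nat -> Q) -> (nat -> Q)} := prS pr n.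
Let sg' := sgS sg.

Let dg'P n f : pr' n f = f <-> forall k, pr (n - (k.*2)%:Z) (f k) = f k.
Proof.
split=> [E k|E]; first by rewrite -{2}E.
by apply/funext => k; exact: E.
Qed.

Let pr'D n f : pr' n (D' f) = D' (pr' (n + 1) f).
Proof.
apply/funext => k; rewrite /pr' /D' /= /prS /diffS linearD (sc_D scQ) /=; congr (D (pr _ _) + _).
  by lia.
by rewrite -prz; congr (pr _ _); lia.
Qed.

Let sg'D l f : sg' l (D' f) = D' (sg' l f).
Proof.
rewrite /sg' /sgS; case: eqP => _ //.
by apply/funext => k; rewrite /D' /= /mapS /diffS linearD (sc_sD scQ) sz.
Qed.

Let pr'neg n f : n < 0 -> pr' n f = 0.
Proof. by move=> n0; apply/funext => k; rewrite /pr' /= /prS (sc_neg scQ) //; lia. Qed.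

Let fl' n : fl [set f | pr' n f = f].
Proof.
have sdg k : subm [set f | pr' k f = f].
  split=> [|c a b /= Ea Eb]; first by rewrite /= linear0.
  by have /= -> := linearP (pr' k) c a b; rewrite Ea Eb.
have neg k : k < 0 -> fl [set f | pr' k f = f].
  move=> k0; have -> : [set f | pr' k f = f] = [set 0]; last exact: fl0.
  by apply/seteqP; split=> [f /= <-|_ -> /=]; rewrite ?linear0 // pr'neg.
case: (ltP n 0) => [/neg//|n0].
have [N] := ubnP `|n|%N; elim: N => // N IH in n n0 *; rewrite ltnS => lN.
pose hd (f : nat -> Q) := f 0%N.
have hdl : linear hd by [].
pose H : {linear (nat -> Q) -> Q} := HB.pack hd (GRing.isLinear.Build _ _ _ _ hd hdl).
pose Sh : {linear (nat -> Q) -> (nat -> Q)} := @shS R Q.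
apply: (@fl_exact _ _ _ H) => //.
  apply: fl_sub (sc_fl scQ n) (subm_img H (sdg n)) _.
  by move=> _ [f /dg'P/(_ 0%N) fE <-]; move: fE; rewrite double0 subr0.
have sK := submI (sdg n) (subm_ker H).
apply: (@fl_exact _ _ _ Sh) => //.
  have fl2 : fl [set f | pr' (n - 2) f = f].
    by case: (ltP (n - 2) 0) => [/neg//|n2]; apply: IH => //; lia.
  apply: fl_sub fl2 (subm_img Sh sK) _ => _ [f [/dg'P fE _] <-]; apply/dg'P => k.
  by rewrite -[RHS]fE; congr (pr _ _); lia.
suff -> : [set f | pr' n f = f] `&` ker H `&` ker Sh = [set 0] by apply: fl0.
apply/seteqP; split=> [f [[_ f0] fS]|_ ->]; last by split=> //; split=> //=; rewrite linear0.
by apply/funext => -[|k]; [exact: f0|exact: (congr1 (fun h => h k) fS)].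
Qed.

Lemma shift_complexS : shift_complex D' pr' j.+1 sg'.
Proof.
split=> //.
- move=> f; apply/funext => k; rewrite /D' /= /diffS !linearD /= (sc_DD scQ) add0r Dz zz addr0.
  by rewrite addNr.
- move=> l n f; apply/funext => k; rewrite /pr' /sg' /sgS; case: eqP => _ /=; rewrite /prS.
    by rewrite /shS; congr (pr _ _); lia.
  by rewrite /mapS (sc_sg scQ); congr (sg _ (pr _ _)); lia.
Qed.

Section Closed.
Variable U : int -> set (nat -> Q).
Hypothesis UP : shift_closed D' pr' j.+1 sg' U.

(** Leading coefficients, as in the proof of Hilbert's basis theorem, of the elements of [U] whose
    top exponent is at most [i]. As the shift lowers the exponent, they decrease with [i]. *)
Let V (i : nat) (n : int) : set Q :=
  [set w | exists f, [/\ U (n + (i.*2)%:Z) f, f i = w & forall k, (i < k)%N -> f k = 0]].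

Let sU n : subm (U n). Proof. by case: UP. Qed.
Let UE n f : U n f -> pr' n f = f /\ D' f = 0. Proof. by case: UP => _ /(_ n f). Qed.
Let Ubd n g : pr' (n + 1) g = g -> U n (D' g). Proof. by case: UP => _ _ /(_ n g). Qed.
Let Usg l n f : (l <= j)%N -> U (n + 2) f -> U n (sg' l f).
Proof. by case: UP => _ _ _ /(_ l n f). Qed.

Let VP i : shift_closed D pr j sg (V i).
Proof.
split.
- move=> n; split=> [|c a b [f [Uf fa f0]] [h [Uh hb h0]]].
    by exists 0; split=> //; exact: sub0 (sU _).
  exists (c *: f + h); split; first by case: (sU (n + (i.*2)%:Z)) => _; apply.
    by rewrite -fa -hb.
  by move=> k lt; rewrite -[LHS]/(c *: f k + h k) f0 // h0 // scaler0 addr0.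
- move=> n w [f [/UE[/dg'P pf Df] fw f0]]; split.
    by rewrite -fw -{2}pf; congr (pr _ _); lia.
  by have := congr1 (fun h => h i) Df; rewrite /D' /= /diffS (f0 i.+1) // linear0 addr0 fw.
- move=> n g pg; exists (D' (atS i g)); split.
  + apply: Ubd; apply/dg'P => k; rewrite /atS; case: eqP => [->|_]; last by rewrite linear0.
    by rewrite -[RHS]pg; congr (pr _ _); lia.
  + rewrite /D' /= /diffS /atS eqxx; case: eqP => [E|_]; first by lia.
    by rewrite linear0 addr0.
  + move=> k lt; rewrite /D' /= /diffS /atS; do 2 (case: eqP => [E|_]; first by lia).
    by rewrite !linear0 addr0.
- move=> l n w ltl [f [Uf fw f0]]; exists (sg' l f).
  have sE : sg' l = mapS (sg l) by rewrite /sg' /sgS; case: eqP => // E; rewrite E ltnn in ltl.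
  split.
  + by apply: Usg; [exact: ltnW|move: Uf; congr U; lia].
  + by rewrite sE /= /mapS fw.
  + by move=> k lt; rewrite sE /= /mapS f0 // linear0.
Qed.

Let Vdec i n : V i.+1 n `<=` V i n.
Proof.
move=> w [f [Uf fw f0]]; exists (shS f); split.
- have -> : shS f = sg' j f by rewrite /sg' /sgS eqxx.
  by apply: Usg => //; move: Uf; congr U; lia.
- by [].
- by move=> k lt; rewrite /shS f0.
Qed.
Let Vle i i' n : (i <= i')%N -> V i' n `<=` V i n.
Proof.
move=> /subnK <-; elim: (i' - i)%N => [//|k IH]; exact: subset_trans (@Vdec _ n) IH.
Qed.

Let Vinf (n : int) : set Q := [set w | forall i, V i n w].
Let VinfP : shift_closed D pr j sg Vinf.
Proof.
split.
- move=> n; split=> [i|c a b Va Vb i]; have [s _ _ _] := VP i; first exact: sub0 (s n).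
  by case: (s n) => _; apply; [exact: Va|exact: Vb].
- by move=> n w /(_ 0%N); have [_ h _ _] := VP 0; apply: h.
- by move=> n g pg i; have [_ _ h _] := VP i; apply: h.
- by move=> l n w lt Vw i; have [_ _ _ h] := VP i; apply: h.
Qed.

Let Vstab n : exists I, forall i, (I <= i)%N -> V i n `<=` Vinf n.
Proof.
have s i : subm (V i n) by have [h _ _ _] := VP i.
have f i : fl (V i n).
  by apply: fl_sub (sc_fl scQ n) (s i) _ => w Vw; have [_ h _ _] := VP i; case: (h n w Vw).
have [|I _ IP] := @nonincr_stab 0 (fun i => len (V i n)).
  by move=> p _; apply: len_sub => //; apply: Vdec.
exists I => i leI w Vw i'; case: (leqP i' i) => [le|lt]; first exact: (Vle le).
have -> : V i' n = V i n; last exact: Vw.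
by apply: len_eq => //; [apply: Vle; apply: ltnW|rewrite (IP i) // (IP i') //; lia].
Qed.

(** In a fixed degree the sets stabilize by finite length. Artinianness, applied to their
    intersection, makes the bound uniform, since degrees from [n0 + 2] on are controlled by lower
    ones. *)
Let Vstab_all : exists I, forall i n, (I <= i)%N -> V i n `<=` Vinf n.
Proof.
have [n0 n0P] := artQ VinfP; have [f fP] := choice Vstab.
pose I := (\max_(n < n0.+2) f (n : nat)%:Z)%N.
exists I => i n leI.
have neg k : k < 0 -> V i k `<=` Vinf k.
  move=> k0 w Vw; have [_ h _ _] := VP i; have [<- _] := h _ _ Vw.
  by rewrite (sc_neg scQ) //; have [s _ _ _] := VinfP; exact: sub0 (s k).
case: (ltP n 0) => [/neg//|n_ge0].
have [N] := ubnP `|n|%N; elim: N => // N IH in n n_ge0 *; rewrite ltnS => lN.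
case: (ltP n (n0%:Z + 2)) => [lt|ge].
  have lt' : (`|n| < n0.+2)%N by lia.
  have nE : n = (Ordinal lt' : nat)%:Z by rewrite /=; lia.
  rewrite nE; apply: fP; apply: leq_trans leI.
  exact: (leq_bigmax (F := fun n : 'I_n0.+2 => f (n : nat)%:Z) (Ordinal lt')).
move=> w Vw; have [_ h _ hs] := VP i; have [pw Dw] := h _ _ Vw.
have nE : n - 2 + 2 = n by lia.
have := n0P (n - 2); rewrite nE => H; apply: H => //; first by lia.
move=> l ltl; have Vs : V i (n - 2) (sg l w) by apply: hs => //; rewrite nE.
by case: (ltP (n - 2) 0) => [/neg|n2]; [apply|apply: (IH (n - 2)) => //; lia].
Qed.

(** The top coefficient of [w], at exponent [K], is removed by an element of [U]. If [K > I] it is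
    already a leading coefficient of the shift of [w], and stability lifts it to exponent [K]; if
    [K <= I], Artinianness is applied to [V K], in a degree smaller by [2 K], whence the summand
    [I.*2] in the bound. *)
Lemma shift_artinian_step : exists n0 : nat, forall n : int, n0%:Z <= n ->
  forall w, pr' (n + 2) w = w -> D' w = 0 -> (forall l, (l < j.+1)%N -> U n (sg' l w)) -> U (n + 2) w.
Proof.
have [I IP] := Vstab_all.
have [f fP] := choice (fun i => artQ (VP i)).
pose M := (\max_(i < I.+1) f i)%N.
have fM i : (i <= I)%N -> (f i <= M)%N.
  by move=> le; exact: (leq_bigmax (F := fun i : 'I_I.+1 => f i) (Ordinal (le : (i < I.+1)%N))).
exists (M + I.*2)%N => n len w pw Dw sw.
have [K wK] : exists K, forall k, (K <= k)%N -> w k = 0.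
  exists (absz (n + 3)) => k lek; rewrite -pw /pr' /= /prS (sc_neg scQ) //; lia.
elim: K w pw Dw sw wK => [|K IH] w pw Dw sw wK.
  by have -> : w = 0; [apply/funext => k; exact: wK|exact: sub0 (sU _)].
have pw' := (dg'P _ _).1 pw.
pose r := n + 2 - (K.*2)%:Z.
have wKr : pr r (w K) = w K by exact: pw'.
suff [h [Uh hK h0]] : V K r (w K).
  have Uh' : U (n + 2) h by move: Uh; congr U; rewrite /r; lia.
  have [ph Dh] := UE Uh'.
  rewrite -(subrK h w); apply: subD => //; apply: IH.
  - by rewrite linearB ph pw.
  - by rewrite linearB Dh Dw subrr.
  - by move=> l ltl; rewrite linearB; apply: subB => //; [exact: sw|apply: Usg].
  - move=> k lek; rewrite -[LHS]/(w k - h k).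
    by have [<-|ne] := eqVneq K k; [rewrite hK subrr|rewrite wK ?h0 ?subrr //; lia].
case: (ltnP I K) => [ltK|leK].
  have K0 : (0 < K)%N by lia.
  have : V K.-1 r (w K).
    exists (sg' j w); split.
    - by have := sw j (ltnSn j); congr U; rewrite /r; lia.
    - by rewrite /sg' /sgS eqxx /= /shS prednK.
    - by move=> k lt; rewrite /sg' /sgS eqxx /= /shS wK //; lia.
  by move=> /IP h; apply: h; lia.
have rE : r - 2 + 2 = r by lia.
have DwK : D (w K) = 0.
  by have := congr1 (fun h => h K) Dw; rewrite /D' /= /diffS (wK K.+1) // linear0 addr0.
have := fP K (r - 2); rewrite rE => H; apply: H => //.
  by have := fM _ leK; rewrite /r; lia.
move=> l ltl; exists (sg' l w).
have sE : sg' l = mapS (sg l) by rewrite /sg' /sgS; case: eqP => // E; rewrite E ltnn in ltl.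
split.
- by have := sw l (ltnW ltl); congr U; rewrite /r; lia.
- by rewrite sE.
- by move=> k lt; rewrite sE /= /mapS wK ?linear0.
Qed.

End Closed.

Lemma shift_artinianS : shift_artinian D' pr' j.+1 sg'.
Proof. by move=> U; apply: shift_artinian_step. Qed.

End Step.
End ShiftComplex.

(** * Iterated adjunction of variables *)

Section Tate.
Variables (R : comNzRingType) (A : lmodType R).

Fixpoint tate (j : nat) : lmodType R :=
  if j is j'.+1 then (nat -> tate j' : lmodType R) else A.

Fixpoint liftT j (h : {linear A -> A}) : {linear tate j -> tate j} :=
  if j is j'.+1 then mapS (liftT j' h) else h.
Fixpoint DT j (D : {linear A -> A}) (zs : nat -> {linear A -> A}) : {linear tate j -> tate j} :=
  if j is j'.+1 then diffS (DT j' D zs) (liftT j' (zs j')) else D.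
Fixpoint prT j (p : int -> {linear A -> A}) (n : int) : {linear tate j -> tate j} :=
  if j is j'.+1 then prS (prT j' p) n else p n.
Fixpoint sgT j (l : nat) : {linear tate j -> tate j} :=
  if j is j'.+1 then sgS j' (sgT j') l else \0.
Fixpoint uT (S : lmodType R) j (u : {linear S -> A}) : {linear S -> tate j} :=
  if j is j'.+1 then atS 0 \o uT j' u else u.
Fixpoint at0 j : tate j -> A := if j is j'.+1 then fun w => at0 (w 0%N) else fun w => w.
Fixpoint FiT j : set (tate j) := if j is j'.+1 then finS (@FiT j') else setT.

Lemma at0_linear j : linear (@at0 j).
Proof. by elim: j => [//|j IH] c a b; exact: IH. Qed.
HB.instance Definition _ j := GRing.isLinear.Build R (tate j) A _ (@at0 j) (@at0_linear j).

Lemma liftT_eq j (h h' : {linear A -> A}) : h =1 h' -> liftT j h =1 liftT j h'.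
Proof. by move=> E; elim: j => [//|j IH] w; apply/funext => k; exact: IH. Qed.

Lemma liftT_comp j (h h' h2 : {linear A -> A}) : (forall f, h (h' f) = h2 f) ->
  forall w, liftT j h (liftT j h' w) = liftT j h2 w.
Proof. by move=> E; elim: j => [//|j IH] w; apply/funext => k; exact: IH. Qed.

Lemma liftTC j (h h' : {linear A -> A}) : (forall f, h (h' f) = h' (h f)) ->
  forall w, liftT j h (liftT j h' w) = liftT j h' (liftT j h w).
Proof. by move=> E; elim: j => [//|j IH] w; apply/funext => k; exact: IH. Qed.

Lemma liftT_anti j (h h' : {linear A -> A}) : (forall f, h (h' f) = - h' (h f)) ->
  forall w, liftT j h (liftT j h' w) = - liftT j h' (liftT j h w).
Proof. by move=> E; elim: j => [//|j IH] w; apply/funext => k; exact: IH. Qed.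

Lemma liftT0 j (h : {linear A -> A}) : (forall f, h f = 0) -> forall w, liftT j h w = 0.
Proof. by move=> E; elim: j => [//|j IH] w; apply/funext => k; exact: IH. Qed.

Lemma DT_liftC j (D h : {linear A -> A}) (zs : nat -> {linear A -> A}) : (forall f, D (h f) = h (D f)) ->
  (forall l f, zs l (h f) = h (zs l f)) -> forall w, DT j D zs (liftT j h w) = liftT j h (DT j D zs w).
Proof.
move=> Dh zh; elim: j => [//|j IH] w; apply/funext => k /=.
by rewrite /diffS /mapS IH liftTC // -linearD.
Qed.

Lemma DT_lift_anti j (D h : {linear A -> A}) (zs : nat -> {linear A -> A}) : (forall f, D (h f) = - h (D f)) ->
  (forall l f, zs l (h f) = - h (zs l f)) -> forall w, DT j D zs (liftT j h w) = - liftT j h (DT j D zs w).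
Proof.
move=> Dh zh; elim: j => [//|j IH] w; apply/funext => k /=.
rewrite -[RHS]/(- (mapS (liftT j h) (diffS (DT j D zs) (liftT j (zs j)) w) k)).
by rewrite /diffS /mapS IH liftT_anti // -opprD -linearD.
Qed.

Lemma DT_add j (D h D2 : {linear A -> A}) zs : (forall f, D2 f = D f + h f) ->
  forall w, DT j D2 zs w = DT j D zs w + liftT j h w.
Proof.
move=> E; elim: j => [//|j IH] w; apply/funext => k /=.
rewrite -[RHS]/(diffS (DT j D zs) (liftT j (zs j)) w k + mapS (liftT j h) w k).
by rewrite /diffS /mapS IH addrAC.
Qed.

Lemma at0_lift j (h : {linear A -> A}) w : at0 (liftT j h w) = h (at0 w).
Proof. by elim: j w => [//|j IH] w; exact: IH. Qed.

(** Besides [D], only the terms linear in one variable reach the part free of variables, through the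
    differential [zs l] of that variable. *)
Lemma at0_DT j (D : {linear A -> A}) zs w :
  at0 (DT j D zs w) = D (at0 w) + \sum_(l < j) zs l (at0 (sgT j l w)).
Proof.
elim: j w => [|j IH] w; first by rewrite big_ord0 addr0.
rewrite big_ord_recr /= /sgS eqxx /= /diffS linearD /= IH at0_lift addrA; congr (_ + _ + _).
by apply: eq_bigr => l _; case: eqP => [E|//]; have := ltn_ord l; rewrite {1}E ltnn.
Qed.

Lemma at0_uT (S : lmodType R) j (u : {linear S -> A}) s : at0 (uT j u s) = u s.
Proof. by elim: j => [//|j IH]; rewrite /= /atS eqxx IH. Qed.

Lemma liftT_uT (S : lmodType R) j (u : {linear S -> A}) (h : {linear A -> A}) s s' :
  h (u s) = u s' -> liftT j h (uT j u s) = uT j u s'.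
Proof.
move=> E; elim: j => [//|j IH]; apply/funext => k /=; rewrite /mapS /atS.
by case: ifP => _; rewrite ?linear0 ?IH.
Qed.

Lemma prT_uT (S : lmodType R) j (u : {linear S -> A}) (p : int -> {linear A -> A}) n s s' :
  p n (u s) = u s' -> prT j p n (uT j u s) = uT j u s'.
Proof.
move=> E; elim: j => [//|j IH]; apply/funext => k /=; rewrite /prS /atS.
by case: eqP => [->|_]; rewrite ?linear0 // double0 subr0 IH.
Qed.

Lemma prT_lift j (p : int -> {linear A -> A}) (h : {linear A -> A}) a :
  (forall n f, p (n + a) (h f) = h (p n f)) -> forall n w, prT j p (n + a) (liftT j h w) = liftT j h (prT j p n w).
Proof.
move=> E; elim: j => [//|j IH] n w; apply/funext => k /=; rewrite /prS /mapS -IH.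
by congr (prT _ _ _ _); lia.
Qed.

Lemma prT_idem j (p : int -> {linear A -> A}) :
  (forall n f, p n (p n f) = p n f) -> forall n w, prT j p n (prT j p n w) = prT j p n w.
Proof. by move=> E; elim: j => [//|j IH] n w; apply/funext => k /=; rewrite /prS IH. Qed.

Lemma at0_prT j (p : int -> {linear A -> A}) n w : at0 (prT j p n w) = p n (at0 w).
Proof. by elim: j n w => [//|j IH] n w; rewrite /= /prS double0 subr0 IH. Qed.

End Tate.

Section PairLength.
Variables (R : comNzRingType) (V W : lmodType R).

Lemma len_prod (U : set V) (X : set W) : fl U -> fl X ->
  fl [set p : V * W | U p.1 /\ X p.2] /\ len [set p : V * W | U p.1 /\ X p.2] = (len U + len X)%N.
Proof.
move=> fU fX; pose S := [set p : V * W | U p.1 /\ X p.2].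
pose f1 (p : V * W) := p.1; have l1 : linear f1 by [].
pose F : {linear (V * W)%type -> V} := HB.pack f1 (GRing.isLinear.Build _ _ _ _ f1 l1).
pose f2 (p : V * W) := p.2; have l2 : linear f2 by [].
pose G : {linear (V * W)%type -> W} := HB.pack f2 (GRing.isLinear.Build _ _ _ _ f2 l2).
have sU : subm U := fU.1; have sX : subm X := fX.1.
have sS : subm S.
  split=> [|a p q [p1 p2] [q1 q2]]; first by split; apply: sub0.
  by split; [case: sU => _; apply|case: sX => _; apply].
have iF : [set F x | x in S] = U.
  apply/seteqP; split=> [_ [p [? _] <-] //|v Uv].
  by exists (v, 0) => //; split=> //; apply: sub0.
have sK := submI sS (subm_ker F).
have iG : [set G x | x in S `&` ker F] = X.
  apply/seteqP; split=> [_ [p [[_ ?] _] <-] //|w Xw].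
  by exists (0, w) => //; split=> //; split=> //; apply: sub0.
have injG p : (S `&` ker F) p -> G p = 0 -> p = 0.
  by case: p => a b [_ a0] b0; rewrite (a0 : a = 0) (b0 : b = 0).
have fK : fl (S `&` ker F).
  apply: (@fl_exact _ _ _ G) => //; first by rewrite iG.
  suff -> : S `&` ker F `&` ker G = [set 0] by exact: fl0.
  apply/seteqP; split=> [p [Sp Gp]|_ ->]; first exact: injG.
  by split=> //; split=> //; apply: sub0.
have fS : fl S by apply: (@fl_exact _ _ _ F) => //; rewrite iF.
split=> //.
by rewrite (len_exact F fS) iF -(len_inj (f := G) fK injG) iG.
Qed.

End PairLength.

Lemma len_inm (R : comNzRingType) (S : lmodType R) (I : set S) n : fl I ->
  fl (@inm R S I n) /\ len (@inm R S I n) = (2 ^ n * len I)%N.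
Proof.
move=> fI; elim: n => [|n [IH1 IH2]]; first by rewrite mul1n.
have [h1 h2] := len_prod IH1 IH1; split=> //.
by rewrite -[LHS]/(len [set p : ext n S * ext n S | inm I p.1 /\ inm I p.2]) h2 IH2 expnS mul2n -addnn mulnDl.
Qed.

Fixpoint prodz (A : Type) (zs : nat -> A -> A) n (f : A) : A :=
  if n is n'.+1 then zs 0%N (prodz (tl zs) n' f) else f.

Section Independence.
Variables (R : comNzRingType) (m : set R^o) (al : artin_local m) (A : lmodType R) (B : set A).
Hypothesis sB : subm B.
Variable u : {linear R^o -> A}.

Lemma evz_inm n (zs : nat -> {linear A -> A}) : (forall a, m a -> B (u a)) ->
  (forall l f, B f -> B (zs l f)) -> forall a : ext n R^o, inm m a -> B (evz u zs a).
Proof.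
move=> uB; elim: n zs => [|n IH] zs zB a; first exact: uB.
by move=> -[a1 a2]; apply: subD => //=; [|apply/zB]; apply: IH => // l f; apply/zB.
Qed.

(** Multiplication by [z_0] kills the monomials containing it, so the coefficients of the others are
    in [m] by induction; these can be subtracted, and what remains is [z_0] times a relation in the
    other operators. [h] stands for the factors already split off and [c] for the sign they
    produce. *)
Lemma evz_ind n (zs : nat -> {linear A -> A}) (h : {linear A -> A}) (c : R) :
  (forall a, m a -> B (u a)) -> (forall l f, B f -> B (zs l f)) ->
  (forall l l' f, zs l (zs l' f) = - zs l' (zs l f)) -> (forall l f, zs l (zs l f) = 0) ->
  (forall f, B f -> B (h f)) -> (forall l f, h (zs l f) = c *: zs l (h f)) ->
  ~ B (h (prodz (fun l => zs l : A -> A) n (u 1))) ->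
  forall a : ext n R^o, B (h (evz u zs a)) -> inm m a.
Proof.
move=> uB; elim: n zs h c => [|n IH] zs h c zB zC zz hB hz top a.
  move=> /= Ba; apply: contrapT => /(al_unit al)[y ya]; apply: top.
  have -> : u 1 = y *: u a by rewrite -linearZ_LR -ya.
  by rewrite /= linearZ /=; apply: subZ.
case: a => a b /=; rewrite linearD /= => Bab.
have IH' h' c' := IH (tl zs) h' c' (fun l f => zB l.+1 f) (fun l l' f => zC l.+1 l'.+1 f) (fun l f => zz l.+1 f).
pose h' : {linear A -> A} := h \o zs 0%N.
have h'z l f : h' (zs l.+1 f) = (- c) *: zs l.+1 (h' f).
  by rewrite /h' /= zC linearN hz scaleNr.
have h'B f : B f -> B (h' f) by move=> Bf; apply: hB; apply: zB.
have ma : inm m a.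
  apply: (IH' h' (- c)) => //.
  rewrite /h' /= hz; apply: subZ => //.
  have E : zs 0%N (h (zs 0%N (evz u (tl zs) b))) = 0 by rewrite hz linearZ /= zz scaler0.
  by have := zB 0%N _ Bab; rewrite linearD /= E addr0.
split=> //=; apply: (IH' h' (- c)) => //.
have := evz_inm uB (fun l f => zB l.+1 f) ma => /hB Ba.
by have := subB sB Bab Ba; rewrite addrAC subrr add0r.
Qed.

End Independence.

Lemma uK_scale (R : comNzRingType) n (a : R^o) : uK n a = (a : R) *: uK n (1 : R^o).
Proof.
elim: n => [|n IH] /=; first by rewrite -[RHS]/(a * 1) mulr1.
by apply: pair_eq; rewrite /= ?IH // scaler0.
Qed.

Section KoszulExterior.
Variables (R : comNzRingType) (m : set R^o) (s : R) (e : nat) (x : nat -> R) (z : nat -> nat -> R).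
Hypothesis gor : gor_local m s.
Hypotheses (xg : forall r, m r -> exists t, r = dot e x t) (zc : forall l, dot e x (z l) = 0).
Local Notation K := (ext e R^o).
Local Notation I := (@iota R R^o e x : {linear K -> K}).
Local Notation zs := (fun l : nat => @omega R R^o e (z l) : {linear K -> K}).
Let al := gl_al gor.

Lemma koszul_kill r (f : K) : m r -> iota x f = 0 -> range I (r *: f).
Proof.
by move=> /xg[t ->] f0; exists (omega t f) => //; rewrite /= iota_omega f0 linear0 subr0.
Qed.

Lemma koszul_cycle l (f : K) : range I f -> range I (omega (z l) f).
Proof.
by move=> [g _ <-]; exists (- omega (z l) g) => //; rewrite linearN /= iota_omega zc scale0r sub0r opprK.
Qed.

Lemma prK_prodz (y : nat -> nat -> R) n (k := e) :
  prK n (prodz (fun l => @omega R R^o k (y l)) n (uK k (1 : R^o))) = prodz (fun l => @omega R R^o k (y l)) n (uK k (1 : R^o)).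
Proof. by elim: n y => [|n IH] y /=; rewrite ?prK0_uK // prK_omega IH. Qed.

Lemma fl_ext n : fl [set: ext n R^o].
Proof.
have [h _] := len_inm n (al_fl al); suff <- : @inm R R^o setT n = setT by [].
by elim: n {h} => [|n IH] //; apply/seteqP; split=> // a _; split; rewrite IH.
Qed.

(** A nonzero element of top degree is not a boundary, so the full product of the [z] stays nonzero
    in homology. Then all [2^e] monomials are independent over the residue field, and they exhaust a
    homology of length at most [2^e]. *)
Lemma koszul_homology :
  prodz (fun l => zs l : K -> K) e (uK e (1 : R^o)) != 0 -> (len (ker I) <= len (range I) + 2 ^ e)%N ->
  ext_homology (S := R^o) m I (uK e : {linear R^o -> K}) setT e zs.
Proof.
move=> top lenZ; pose B := range I; have sB : subm B by apply: subm_img; split.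
have uB (a : R^o) : m a -> B (uK e a).
  move=> ma; have -> : uK e a = a *: uK e (1 : R^o).
    exact: uK_scale.
  by apply: koszul_kill => //; rewrite iota_uK.
have topB : ~ B (prodz (fun l => zs l : K -> K) e (uK e (1 : R^o))).
  move=> [g _ gE]; move/eqP: top; apply.
  by rewrite -(prK_prodz z) -gE /= prK_iota prK_out ?linear0.
have ind a : B (evz (uK e) zs (a : ext e R^o)) -> inm m a.
  move=> Ba; pose h : {linear K -> K} := idfun.
  apply: (@evz_ind _ m al K B sB (uK e) e zs h 1) => //.
  - exact: koszul_cycle.
  - by move=> l l' f; exact: omegaC.
  - by move=> l f; exact: omega_omega.
  - by move=> l f; rewrite scale1r.
have ev a : inm m a -> B (evz (uK e) zs (a : ext e R^o)).
  by apply: evz_inm => // l f; apply: koszul_cycle.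
split=> //.
- by move=> f; exact: iota_iota.
- by move=> f; exact: iota_uK.
- by move=> l f; rewrite /= iota_omega zc scale0r sub0r.
- pose E := evz (uK e) zs : ext e R^o -> K.
  pose E' : {linear ext e R^o -> K} := HB.pack E (GRing.isLinear.Build _ _ _ _ E (evz_linear _ _)).
  have fK := fl_ext e.
  have fm := fl_sub (al_fl al) (al_sub al) (fun _ _ => Logic.I).
  have [fi li] := len_inm e fm; have [fT lT] := len_inm e (al_fl al).
  have iT : @inm R R^o setT e = setT.
    apply/seteqP; split=> // a _; clear; elim: (e) a => [|n IH] a //; split; exact: IH.
  rewrite iT in fT lT.
  have sE : subm (range E') by apply: subm_img; split.
  have fE : fl (range E') by apply: fl_img.
  have fB : fl B by apply: fl_img; exact: fK.
  have [fV lV] := len_add fE fB.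
  have l1 := len_exact E' fT; have l2 := len_exact E' fi.
  have e1 : [set E' a | a in @inm R R^o m e] = range E' `&` B.
    apply/seteqP; split=> [_ [a ma <-]|_ [[a _ <-] Ba]]; last by exists a => //; exact: ind.
    by split; [exists a|exact: ev].
  have e2 : @inm R R^o m e `&` ker E' = setT `&` ker E'.
    apply/seteqP; split=> a [_ a0]; split=> //; apply: ind.
    by rewrite -[evz _ _ _]/(E' a) a0; apply: sub0.
  rewrite e1 e2 in l2.
  have [lm _] := len_m gor.
  have fZ : fl (ker I) by apply: fl_sub fK (subm_ker I) _.
  have EZ : forall a, I (E a) = 0.
    suff H n (a : ext n R^o) l : iota x (evz (uK e) (fun i => zs (i + l)%N) a) = 0.
      by move=> a; rewrite -[RHS](H _ a 0%N) /= /E; congr (iota x (evz _ _ _)); apply/funext => i; rewrite addn0.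
    elim: n a l => [|n IH] a l /=; first exact: iota_uK.
    have IH' b : iota x (evz (uK e) (tl (fun i => zs (i + l)%N)) (b : ext n R^o)) = 0.
      by rewrite -[RHS](IH b l.+1); congr (iota x (evz _ _ _)); apply/funext => i; rewrite addSnnS.
    by rewrite iotaD iota_omega !IH' zc scale0r linear0 subr0 addr0.
  have VZ : addm (range E') B = ker I.
    apply: (len_eq fZ); first exact: subm_add.
      apply: addm_sub; first exact: subm_ker.
        by move=> _ [a _ <-]; exact: EZ.
      by move=> _ [g _ <-]; exact: iota_iota.
    apply: (leq_trans lenZ); move: lV l1 l2; rewrite lT li -lm mulnS.
    set v1 := len _; set v2 := len _; set v3 := len _; set v4 := len _; set v5 := len _.
    have key (p a b c d f g h : nat) : (a + b = c + d -> p + f = c + g -> f = b + g -> d + p <= a)%N by lia.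
    by move=> k1 k2 k3; exact: (key _ _ _ _ _ _ _ 0%N k1 k2 k3).
  move=> f _ f0; have : addm (range E') B f by rewrite VZ.
  by move=> [_ [a _ <-] [_ [g _ <-] ->]]; exists a, g.
- by move=> a g _ aE; apply: ind; exists g.
- by move=> a /ev[g _ gE]; exists g.
Qed.

End KoszulExterior.

Section Pointwise.
Variables (R : comNzRingType) (J : Type).

Definition mapJ (A B : lmodType R) (f : {linear A -> B}) (a : J -> A) : J -> B := fun k => f (a k).
Lemma mapJ_linear A B f : linear (@mapJ A B f).
Proof. by move=> c a b; apply/funext => k; rewrite /mapJ; exact: linearP. Qed.
HB.instance Definition _ (A B : lmodType R) f := GRing.isLinear.Build R (J -> A) (J -> B) _ (@mapJ A B f) (mapJ_linear f).

Variable S : lmodType R.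
Fixpoint exJ n : (J -> ext n S) -> ext n (J -> S) :=
  if n is n'.+1 then fun f => (exJ (fun j => (f j).1), exJ (fun j => (f j).2)) else fun f => f.

Lemma exJ_surj n (a : ext n (J -> S)) : exists f, a = exJ f.
Proof.
elim: n a => [|n IH] a; first by exists a.
case: a => a b; have [f fE] := IH a; have [g gE] := IH b.
by exists (fun j => (f j, g j)); rewrite fE gE.
Qed.

Lemma evz_exJ (A : lmodType R) (u : {linear S -> A}) n (zs : nat -> {linear A -> A}) f j :
  evz (mapJ u) (fun l => mapJ (zs l)) (@exJ n f) j = evz u zs (f j).
Proof. elim: n zs f => [//|n IH] zs f /=.
by rewrite -(IH (tl zs) (fun j => (f j).1)) -(IH (tl zs) (fun j => (f j).2)). Qed.

Lemma inm_exJ (mS : set S) n f : inm [set s | forall j, mS (s j)] (@exJ n f) <-> forall j, inm mS (f j).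
Proof.
elim: n f => [//|n IH] f; split=> [[/IH h1 /IH h2] j|h].
  by split; [exact: h1|exact: h2].
by split; apply/IH => j; case: (h j).
Qed.

Lemma ext_homologyJ (mS : set S) (A : lmodType R) (D : {linear A -> A}) (u : {linear S -> A}) n
    (zs : nat -> {linear A -> A}) : ext_homology mS D u setT n zs ->
  ext_homology [set s | forall j, mS (s j)] (mapJ D) (mapJ u) setT n (fun l => mapJ (zs l)).
Proof.
move=> H; split=> //.
- by move=> f; apply/funext => j; exact: (eh_DD H).
- by move=> f; apply/funext => j; exact: (eh_Du H).
- by move=> l f; apply/funext => j; exact: (eh_Dz H).
- move=> f _ f0.
  have h j : exists p : ext n S * A, f j = evz u zs p.1 + D p.2.
    have [|a [g [_ E]]] := eh_gen H (f := f j) Logic.I; first exact: (congr1 (fun h => h j) f0).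
    by exists (a, g).
  have [p pP] := choice h; exists (exJ (fun j => (p j).1)), (fun j => (p j).2); split=> //.
  by apply/funext => j; rewrite pP -(evz_exJ u zs (fun j => (p j).1)).
- move=> a g _; have [f ->] := exJ_surj a => E; apply/inm_exJ => j.
  by apply: (eh_ind H (g := g j)) => //; rewrite -evz_exJ E.
- move=> a; have [f ->] := exJ_surj a => /inm_exJ h.
  have h' j : exists g, evz u zs (f j) = D g by have [g _ ?] := eh_bd H (h j); exists g.
  have [g gP] := choice h'; exists g => //.
  by apply/funext => j; rewrite evz_exJ gP.
Qed.

End Pointwise.

(** At [j = n] all generators have been killed and the homology is [S] modulo [mS]; for the Koszul
    complex this is Tate's resolution of the residue field. *)
Lemma tate_homology (R : comNzRingType) (S : lmodType R) (mS : set S) (A : lmodType R) (D : {linear A -> A})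
    (u : {linear S -> A}) n (zs : nat -> {linear A -> A}) : subm mS -> ext_homology mS D u setT n zs ->
  (forall l f, zs l (zs l f) = 0) -> (forall l l' f, zs l (zs l' f) = - zs l' (zs l f)) ->
  forall j, (j <= n)%N ->
  ext_homology mS (DT j D zs) (uT j u) (@FiT R A j) (n - j) (fun l => liftT j (zs (l + j)%N)).
Proof.
move=> sm H zz zC; elim=> [|j IH] lt.
  by rewrite subn0; have -> : (fun l => liftT 0 (zs (l + 0)%N)) = zs by apply/funext => l; rewrite addn0.
have {IH} := IH (ltnW lt); rewrite subnS; case E : (n - j)%N => [|k]; first by lia.
move=> IH; have := ext_homologyS sm IH; rewrite [k.+1.-1]/=.
have -> : (fun l => liftT j.+1 (zs (l + j.+1)%N)) = (fun l : nat => mapS (liftT j (zs (l.+1 + j)%N))).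
  by apply/funext => l; rewrite addSnnS.
apply=> [f|l f] /=; first by rewrite (liftT_comp (h2 := \0)) ?liftT0.
by apply: liftT_anti.
Qed.

Section Alpha.
Variables (R : comNzRingType) (V : lmodType R).

Fixpoint alpha n : ext n V -> ext n V :=
  if n is n'.+1 then fun f => (alpha f.1, - alpha f.2) else fun f => f.

Lemma alpha_linear n : linear (@alpha n).
Proof.
elim: n => [//|n IH] a f g; apply: pair_eq; rewrite /= IH //.
by rewrite opprD scalerN.
Qed.
HB.instance Definition _ n := GRing.isLinear.Build R (ext n V) (ext n V) _ (@alpha n) (@alpha_linear n).

Lemma alphaD n (f g : ext n V) : alpha (f + g) = alpha f + alpha g. Proof. exact: linearD. Qed.
Lemma alphaN n (f : ext n V) : alpha (- f) = - alpha f. Proof. exact: linearN. Qed.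
Lemma alphaB n (f g : ext n V) : alpha (f - g) = alpha f - alpha g. Proof. exact: linearB. Qed.
Lemma alphaZ n a (f : ext n V) : alpha (a *: f) = a *: alpha f. Proof. exact: linearZ_LR. Qed.

Lemma alphaK n (f : ext n V) : alpha (alpha f) = f.
Proof. by elim: n f => [//|n IH] f; apply: pair_eq; rewrite /= ?alphaN ?opprK IH. Qed.

Lemma alpha_iota n x (f : ext n V) : alpha (iota x f) = - iota x (alpha f).
Proof.
elim: n x f => [|n IH] x f; first by rewrite /= oppr0.
apply: pair_eq; rewrite /=; last by rewrite alphaN IH iotaN !opprK.
by rewrite alphaD alphaZ IH opprD -scalerN opprK.
Qed.

Lemma alpha_omega n z (f : ext n V) : alpha (omega z f) = - omega z (alpha f).
Proof.
elim: n z f => [|n IH] z f; first by rewrite /= oppr0.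
apply: pair_eq; rewrite /=; first exact: IH.
by rewrite alphaB alphaZ IH omegaN !opprK.
Qed.

Lemma prK_alpha n i (f : ext n V) : prK i (alpha f) = alpha (prK i f).
Proof.
elim: n i f => [|n IH] i f; first by case: i.
apply: pair_eq; rewrite /=; first exact: IH.
by case: i => [|i]; rewrite ?linear0 ?oppr0 // prKN IH.
Qed.

Lemma alpha_uK n v : alpha (uK n v) = uK n v :> ext n V.
Proof. by elim: n => [//|n IH]; apply: pair_eq; rewrite /= ?IH // linear0 oppr0. Qed.

Lemma alpha_prK1 n (f : ext n V) : alpha (prK 1 f) = - prK 1 f.
Proof.
elim: n f => [|n IH] f; first by rewrite /= oppr0.
apply: pair_eq; rewrite /=; first exact: IH.
by rewrite prK0E alpha_uK.
Qed.

Lemma cK_prK n k (f : ext n V) : k != 0%N -> cK (prK k f) = 0.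
Proof.
move=> k0; rewrite -(cK_uK n (cK (prK k f))) -prK0E prK_prK eq_sym (negPf k0).
exact: linear0.
Qed.

Lemma prK_uK n k v : prK k (uK n v : ext n V) = if k == 0%N then uK n v else 0.
Proof. by rewrite -{1}prK0_uK prK_prK; case: eqP => // _; rewrite prK0_uK. Qed.

(** Degrees become integers, with zero in negative degrees, because the degrees of variables and of
    basis elements are subtracted. *)
Definition prKz n (k : int) (f : ext n V) : ext n V := if k is Posz k then prK k f else 0.
Lemma prKz_linear n k : linear (@prKz n k).
Proof. by case: k => k a f g /=; rewrite ?linearP // scaler0 addr0. Qed.
HB.instance Definition _ n k := GRing.isLinear.Build R (ext n V) (ext n V) _ (@prKz n k) (@prKz_linear n k).

Lemma prKz_iota n k x (f : ext n V) : prKz k (iota x f) = iota x (prKz (k + 1) f).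
Proof.
case: k => [k|[|k]].
- by rewrite (_ : Posz k + 1 = Posz k.+1); [exact: prK_iota|lia].
- by rewrite (_ : Negz 0 + 1 = Posz 0); [rewrite /= iota_prK0|lia].
- by rewrite (_ : Negz k.+1 + 1 = Negz k); [rewrite /= linear0|lia].
Qed.

Lemma prKz_omega n k x (f : ext n V) : prKz (k + 1) (omega x f) = omega x (prKz k f).
Proof.
case: k => [k|[|k]].
- by rewrite (_ : Posz k + 1 = Posz k.+1); [exact: prK_omega|lia].
- by rewrite (_ : Negz 0 + 1 = Posz 0); [rewrite /= prK0_omega linear0|lia].
- by rewrite (_ : Negz k.+1 + 1 = Negz k); [rewrite /= linear0|lia].
Qed.

Lemma prKz_alpha n k (f : ext n V) : prKz k (alpha f) = alpha (prKz k f).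
Proof. by case: k => k /=; rewrite ?prK_alpha // linear0. Qed.

Lemma prKz_idem n k (f : ext n V) : prKz k (prKz k f) = prKz k f.
Proof. by case: k => k //=; rewrite prK_prK eqxx. Qed.

Lemma prKz_neg n k (f : ext n V) : k < 0 -> prKz k f = 0.
Proof. by case: k. Qed.

Lemma prKz_uK n k v : prKz k (uK n v : ext n V) = if k == 0 then uK n v else 0.
Proof. by case: k => k //=; rewrite prK_uK. Qed.

Lemma cK_prKz n k (f : ext n V) : k != 0 -> cK (prKz k f) = 0.
Proof. by case: k => k k0 /=; [apply: cK_prK|exact: linear0]. Qed.

End Alpha.

Section TateMore.
Variables (R : comNzRingType) (A : lmodType R).

Lemma liftT_add j (h h' h2 : {linear A -> A}) : (forall f, h2 f = h f + h' f) ->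
  forall w, liftT j h2 w = liftT j h w + liftT j h' w.
Proof. by move=> E; elim: j => [//|j IH] w; apply/funext => k; exact: IH. Qed.

Lemma sgT_lift j l (h : {linear A -> A}) w : sgT A j l (liftT j h w) = liftT j h (sgT A j l w).
Proof.
elim: j l w => [|j IH] l w; first by rewrite /= linear0.
rewrite /= /sgS; case: eqP => _ //.
by apply/funext => k; exact: IH.
Qed.

Lemma sgTC j l l' w : sgT A j l (sgT A j l' w) = sgT A j l' (sgT A j l w).
Proof.
elim: j l l' w => [|j IH] l l' w; first by [].
rewrite /= /sgS; case: eqP => _; case: eqP => _ //.
by apply/funext => k; exact: IH.
Qed.

Lemma prT_DT j (p : int -> {linear A -> A}) (D : {linear A -> A}) (zs : nat -> {linear A -> A}) :
  (forall n f, p n (D f) = D (p (n + 1) f)) -> (forall l n f, p (n + 1) (zs l f) = zs l (p n f)) ->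
  forall n w, prT j p n (DT j D zs w) = DT j D zs (prT j p (n + 1) w).
Proof.
move=> pD pz; elim: j => [//|j IH] n w; apply/funext => k /=.
rewrite /prS /diffS linearD /= IH; congr (DT j D zs (prT _ _ _ _) + _); first by lia.
rewrite -(prT_lift (p := p) (h := zs j) (a := 1)) //; congr (prT _ _ _ _); lia.
Qed.

Lemma prT_neg j (p : int -> {linear A -> A}) : (forall n f, n < 0 -> p n f = 0) ->
  forall n w, n < 0 -> prT j p n w = 0.
Proof.
move=> pn; elim: j => [//|j IH] n w n0.
by apply/funext => k; rewrite /= /prS IH //; lia.
Qed.

Lemma prT_Fi j (p : int -> {linear A -> A}) : (forall n f, n < 0 -> p n f = 0) ->
  forall n w, prT j p n w = w -> FiT w.
Proof.
move=> pn; elim: j => [//|j IH] n w wE.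
have E k : prT j p (n - (k.*2)%:Z) (w k) = w k by rewrite -{2}wE.
split=> [k|]; first exact: IH (E k).
by exists (absz (n + 1)) => k lek; rewrite -E prT_neg //; lia.
Qed.

End TateMore.

Lemma evz_uK (R : comNzRingType) (A : lmodType R) (u : {linear R^o -> A}) n (zs : nat -> {linear A -> A}) a :
  evz u zs (uK n a : ext n R^o) = u a.
Proof.
elim: n zs => [//|n IH] zs /=; rewrite IH.
have -> : evz u (tl zs) (0 : ext n R^o) = 0.
  by have := evz_linear u (tl zs) (-1) (0 : ext n R^o) 0; rewrite scaler0 addr0 scaleN1r addNr.
by rewrite linear0 addr0.
Qed.

Lemma evz_omega (R : comNzRingType) (A : lmodType R) (u : {linear R^o -> A}) n (zs : nat -> {linear A -> A}) c :
  evz u zs (omega c (uK n (1 : R^o)) : ext n R^o) = \sum_(l < n) c l *: zs l (u 1).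
Proof.
elim: n zs c => [|n IH] zs c; first by rewrite big_ord0 /= linear0.
rewrite big_ord_recl /= IH linear0 subr0 addrC; congr (_ + _).
have uE : u (c 0%N) = c 0%N *: u 1.
  by rewrite -linearZ_LR; congr (u _); rewrite -[RHS]/(c 0%N * 1) mulr1.
by rewrite -uK_scale evz_uK uE linearZ_LR.
Qed.

Lemma inm_omega (R : comNzRingType) (m : set R^o) n c : inm m (omega c (uK n (1 : R^o)) : ext n R^o) ->
  forall l, (l < n)%N -> m (c l).
Proof.
elim: n c => [//|n IH] c /= [h1 h2] [|l] lt; last exact: (IH (tl c)).
move: h2; rewrite linear0 subr0 -uK_scale; clear.
by elim: n => [|n IH] //= [h _]; exact: IH.
Qed.

Section Graded.
Variables (R : comNzRingType) (e : nat) (x : nat -> R) (J : eqType) (g : J -> nat)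
  (nb : J -> seq ((nat -> R) * J)).

(* The free complex with basis [J], graded by [g]; the matrix of the
   differential is listed row by row, each entry being given by its coordinates
   on the generators [x] of the maximal ideal. *)
Definition dJ (V : lmodType R) (f : J -> V) : J -> V := fun i => \sum_(p <- nb i) dot e x p.1 *: f p.2.
Lemma dJ_linear V : linear (@dJ V).
Proof.
move=> a f f'; apply/funext => i; rewrite /dJ.
transitivity (a *: (\sum_(p <- nb i) dot e x p.1 *: f p.2) + \sum_(p <- nb i) dot e x p.1 *: f' p.2) => //.
rewrite scaler_sumr -big_split /=; apply: eq_bigr => p _.
by rewrite -[(a *: f + f') _]/(a *: f p.2 + f' p.2) scalerDr !scalerA mulrC.
Qed.
HB.instance Definition _ (V : lmodType R) := GRing.isLinear.Build R (J -> V) (J -> V) _ (@dJ V) (@dJ_linear V).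

Lemma dJ_map (V W : lmodType R) (h : {linear V -> W}) f i : dJ (fun j => h (f j)) i = h (dJ f i).
Proof. by rewrite /dJ linear_sum; apply: eq_bigr => p _; rewrite linearZ. Qed.

(** Exactness is required in positive degrees only. [tc_dd] is stated for all modules because the
    differential will act on families of Koszul chains. *)
Record tcomplex : Prop := TComplex {
  tc_nb : forall i, all (fun p => g p.2 == (g i).+1) (nb i);
  tc_fin : forall n, exists s : seq J, forall i, (g i <= n)%N -> i \in s;
  tc_dd : forall (V : lmodType R) (f : J -> V) i, dJ (dJ f) i = 0;
  tc_ex : forall n (f : J -> R^o), (forall i, g i <> n.+1 -> f i = 0) -> (forall i, dJ f i = 0) ->
    exists h : J -> R^o, (forall i, g i <> n.+2 -> h i = 0) /\ forall i, f i = dJ h i }.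

Hypothesis T : tcomplex.

Lemma dJ_eq (V : lmodType R) (f f' : J -> V) i : (forall j, g j = (g i).+1 -> f j = f' j) -> dJ f i = dJ f' i.
Proof.
move=> E; rewrite /dJ; have /all_filterP <- := tc_nb T i.
by rewrite !big_filter; apply: eq_bigr => p /eqP /E ->.
Qed.

Lemma dJ0 (V : lmodType R) i : dJ (fun _ : J => 0 : V) i = 0.
Proof. by rewrite /dJ big1 // => p _; rewrite scaler0. Qed.

Section Level.
Variable n : nat.
Local Notation K := (ext n R^o).

Definition chi (P : pred nat) (w : J -> K) : J -> K := fun i => if P (g i) then w i else 0.
Lemma chi_linear P : linear (chi P).
Proof.
move=> a f f'; apply/funext => i; rewrite /chi.
transitivity (a *: (if P (g i) then f i else 0) + (if P (g i) then f' i else 0)) => //.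
by case: ifP => _; rewrite ?scaler0 ?addr0.
Qed.
HB.instance Definition _ P := GRing.isLinear.Build R (J -> K) (J -> K) _ (chi P) (chi_linear P).

Definition prA (k : int) (w : J -> K) : J -> K := fun i => prKz (k - (g i)%:Z) (w i).
Lemma prA_linear k : linear (prA k).
Proof. by move=> a f f'; apply/funext => i; rewrite /prA; exact: linearP. Qed.
HB.instance Definition _ k := GRing.isLinear.Build R (J -> K) (J -> K) _ (prA k) (prA_linear k).

(** The sign [alpha] makes this differential anticommute with the Koszul differential. *)
Definition dA (w : J -> K) : J -> K := dJ (fun i => alpha (w i)).
Lemma dA_linear : linear dA.
Proof.
move=> a f f'; rewrite /dA -[RHS]linearP; congr dJ; apply/funext => i /=.
exact: linearP.
Qed.
HB.instance Definition _ := GRing.isLinear.Build R (J -> K) (J -> K) _ dA dA_linear.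

Lemma prA_dA k w : prA k (dA w) = dA (prA (k + 1) w).
Proof.
apply/funext => i; rewrite /prA /dA -(dJ_map (prKz (k - (g i)%:Z) : {linear K -> K})).
apply: dJ_eq => j gj; rewrite /= prKz_alpha gj; congr (alpha (prKz _ _)); lia.
Qed.

Lemma prA_idem k w : prA k (prA k w) = prA k w.
Proof. by apply/funext => i; exact: prKz_idem. Qed.

Lemma prA_neg k w : k < 0 -> prA k w = 0.
Proof. by move=> k0; apply/funext => i; apply: prKz_neg; lia. Qed.

Lemma prA_chi P k w : prA k (chi P w) = chi P (prA k w).
Proof. by apply/funext => i; rewrite /prA /chi; case: ifP => // _; rewrite linear0. Qed.

End Level.

Section Total.
Variable n : nat.
Local Notation K := (ext n R^o).

Definition DA (y : nat -> R) (w : J -> K) : J -> K := fun i => iota y (w i) + dA w i.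
Lemma DA_linear y : linear (DA y).
Proof.
move=> a f f'; apply/funext => i; rewrite /DA.
rewrite (linearP (@dA n)) /= -[(a *: f + f') i]/(a *: f i + f' i) linearP.
rewrite -[(a *: dA f + dA f') i]/(a *: dA f i + dA f' i) addrACA -scalerDr.
by [].
Qed.
HB.instance Definition _ y := GRing.isLinear.Build R (J -> K) (J -> K) _ (DA y) (DA_linear y).

Lemma dA_dA (w : J -> K) : dA (dA w) = 0.
Proof.
apply/funext => i; rewrite /dA -[RHS](tc_dd T w i); apply: dJ_eq => j _.
rewrite -(dJ_map (@alpha R R^o n : {linear K -> K})); apply: dJ_eq => k _ /=.
exact: alphaK.
Qed.

Lemma dA_anti (h : {linear K -> K}) (w : J -> K) i : (forall f, alpha (h f) = - h (alpha f)) ->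
  dA (fun j => h (w j)) i = - h (dA w i).
Proof.
move=> E; have := dJ_map (GRing.opp \o h : {linear K -> K}) (fun j => alpha (w j)) i => /= <-.
by apply: dJ_eq => j _; rewrite E.
Qed.

Lemma DA_DA y (w : J -> K) : DA y (DA y w) = 0.
Proof.
apply/funext => i; rewrite /DA iotaD iota_iota add0r.
have -> : dA (fun j => iota y (w j) + dA w j) = dA (fun j => iota y (w j)) + dA (dA w).
  by rewrite -linearD.
rewrite dA_dA addr0 (dA_anti _ _ (h := iota y : {linear K -> K})) ?subrr //.
exact: alpha_iota.
Qed.

Lemma prA_DA y k (w : J -> K) : prA k (DA y w) = DA y (prA (k + 1) w).
Proof.
apply/funext => i; rewrite /DA /= -prA_dA /prA linearD /= prKz_iota.
by congr (iota y (prKz _ _) + _); lia.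
Qed.

End Total.

(* Filtering by the degree in the Koszul factor, which is at most [n], the
   exactness of the free complex gives that of the total complex. *)
Lemma total_exact n y (k : nat) (w : J -> ext n R^o) : (n < k)%N -> prA k w = w -> DA y w = 0 ->
  exists2 h, prA (k%:Z + 1) h = h & w = DA y h.
Proof.
elim: n y k w => [|n IH] y k w nk pw Dw.
  have wg i : g i <> k -> w i = 0.
    move=> gi; rewrite -pw /prA; case E : (k%:Z - (g i)%:Z) => [[|l]|l] //.
    by exfalso; apply: gi; lia.
  case: k nk pw wg => // k _ pw wg.
  have [|h [hg hE]] := tc_ex T wg; first by move=> i; have := congr1 (fun f => f i) Dw; rewrite /DA /= add0r.
  exists h; last by apply/funext => i; rewrite hE /DA /= add0r.
  apply/funext => i; rewrite /prA; case: (g i =P k.+2) => [->|ne].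
    by have -> : k.+1%:Z + 1 - k.+2%:Z = 0 by lia.
  by rewrite hg // linear0.
pose w1 i := (w i).1; pose w2 i := (w i).2.
have dA1 (v : J -> ext n.+1 R^o) i : (dA v i).1 = dA (fun j => (v j).1) i.
  rewrite /dA /dJ; elim: (nb i) => [|p s IHs]; rewrite ?big_nil ?big_cons //=.
  by rewrite -IHs.
have dA2 (v : J -> ext n.+1 R^o) i : (dA v i).2 = - dA (fun j => (v j).2) i.
  rewrite /dA /dJ; elim: (nb i) => [|p s IHs]; rewrite ?big_nil ?big_cons ?oppr0 //=.
  by rewrite -[LHS]/(_ + _) IHs /= scalerN opprD.
have E1 i : DA (tl y) w1 i + y 0%N *: w2 i = 0.
  have := congr1 (fun f => (f i).1) Dw; rewrite /DA /=.
  by rewrite dA1 addrAC.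
have E2 : DA (tl y) w2 = 0.
  apply/funext => i; have := congr1 (fun f => (f i).2) Dw; rewrite /DA /=.
  by rewrite dA2 -opprD => /eqP; rewrite oppr_eq0 => /eqP.
have p1 : prA k w1 = w1.
  apply/funext => i; rewrite -[RHS]/(w i).1 -[in RHS]pw /prA /w1.
  by case: (k%:Z - _).
have p2 : prA (k.-1) w2 = w2.
  apply/funext => i; rewrite -[RHS]/(w i).2 -[in RHS]pw /prA /w2.
  case E : (k%:Z - _) => [[|l]|l] //=.
  - by have -> : k.-1%:Z - (g i)%:Z = Negz 0 by lia.
  - by have -> : k.-1%:Z - (g i)%:Z = l%:Z by lia.
  - by have -> : k.-1%:Z - (g i)%:Z = Negz l.+1 by lia.
have [|h ph hE] := IH (tl y) k.-1 w2 _ p2 E2; first by lia.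
have {}ph : prA k h = h by rewrite -{2}ph; congr prA; lia.
have [|||h1 ph1 h1E] := IH (tl y) k (w1 + y 0%N *: h) _ _ _; first by lia.
- by rewrite linearD linearZ_LR /= p1 ph.
- rewrite linearD linearZ_LR /= -hE; apply/funext => i; exact: E1.
exists (fun i => (h1 i, - h i)).
  apply/funext => i; rewrite -[RHS]/(h1 i, - h i); rewrite /prA.
  case E : (k%:Z + 1 - _) => [l|l]; apply: pair_eq => /=.
  - by rewrite -{2}ph1 /prA E.
  - have := congr1 (fun f => f i) ph; rewrite /prA; case: l E => [|l] E.
      have -> : k%:Z - (g i)%:Z = Negz 0 by lia.
      by move=> <-; rewrite oppr0.
    have -> : k%:Z - (g i)%:Z = l%:Z by lia.
    by move=> /= E'; rewrite prKN E'.
  - by rewrite -ph1 /prA E.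
  - have := congr1 (fun f => f i) ph; rewrite /prA.
    have -> : k%:Z - (g i)%:Z = Negz l.+1 by lia.
    by move=> <-; rewrite oppr0.
apply/funext => i; apply: pair_eq.
  rewrite /DA -[(_ + _).1]/(_ + _) dA1 /= scalerN addrAC.
  have := congr1 (fun f => f i) h1E; rewrite -[LHS]/(w1 i + y 0%N *: h i) /DA => E.
  by apply/eqP; rewrite eq_sym subr_eq -E.
rewrite /DA -[(_ + _).2]/(_ + _) dA2 /= iotaN opprK.
have -> : dA (fun i => - h i) = - dA h by rewrite -linearN.
by rewrite opprK; exact: (congr1 (fun f => f i) hE).
Qed.

End Graded.

(** * Resolutions over the Koszul complex *)

Section TotalTate.
Variables (R : comNzRingType) (m : set R^o) (s : R) (e : nat) (x : nat -> R) (z : nat -> nat -> R).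
Hypothesis gor : gor_local m s.
Hypotheses (xm : forall t, m (dot e x t)) (xg : forall r, m r -> exists t, r = dot e x t)
  (zc : forall l, dot e x (z l) = 0).
Local Notation K := (ext e R^o).
Hypothesis HK : ext_homology (S := R^o) m (@iota R R^o e x : {linear K -> K}) (@uK R R^o e : {linear R^o -> K})
  setT e (fun l => @omega R R^o e (z l) : {linear K -> K}).
Variables (J : eqType) (g : J -> nat) (nb : J -> seq ((nat -> R) * J)).
Hypothesis T : tcomplex e x g nb.

Let al := gl_al gor.
Let sm : subm m := al_sub al.
Local Notation A := (J -> K).
Local Notation DAx := (@DA R e x J nb e x : {linear A -> A}).
Local Notation dAx := (@dA R e x J nb e : {linear A -> A}).
Local Notation pA := (fun n => @prA R J g e n : {linear A -> A}).
Local Notation DK := (mapJ (J := J) (@iota R R^o e x : {linear K -> K}) : {linear A -> A}).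
Local Notation zA := (fun l => mapJ (J := J) (@omega R R^o e (z l) : {linear K -> K}) : {linear A -> A}).
Local Notation uA := (mapJ (J := J) (@uK R R^o e : {linear R^o -> K}) : {linear (J -> R^o) -> A}).
Local Notation D := (DT e DAx zA).
Local Notation DD := (DT e DK zA).
Local Notation dT := (liftT e dAx).
Local Notation ch P := (liftT e (@chi R J g e P : {linear A -> A})).
Local Notation pr := (prT e pA).
Local Notation uu := (uT e uA).
Local Notation sg := (sgT A e).

Let prA_zA l n w : prA g (n + 1) (zA l w) = zA l (prA g n w).
Proof.
apply/funext => i; rewrite /prA /= /mapJ -prKz_omega; congr (prKz _ _); lia.
Qed.

Let DA_zA l w : DAx (zA l w) = - zA l (DAx w).
Proof.
apply/funext => i; rewrite -[RHS]/(- omega (z l) (DAx w i)) /= /DA /mapJ iota_omega zc scale0r sub0r.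
rewrite (dA_anti T _ _ (h := @omega R R^o e (z l) : {linear K -> K})); last exact: alpha_omega.
by rewrite -opprD -omegaD.
Qed.

Let zA_zA l w : zA l (zA l w) = 0.
Proof. by apply/funext => i; exact: omega_omega. Qed.
Let zA_C l l' w : zA l (zA l' w) = - zA l' (zA l w).
Proof. by apply/funext => i; exact: omegaC. Qed.

Lemma fl_total n : fl [set w : A | pA n w = w].
Proof.
have sP : subm [set w : A | pA n w = w].
  split=> [|c a b]; first by rewrite /= linear0.
  by move=> /= Ea Eb; have /= -> := linearP (pA n) c a b; rewrite Ea Eb.
have fl_supp (q : seq J) (S : set A) : subm S -> (forall w, S w -> forall i, i \notin q -> w i = 0) -> fl S.
  elim: q S => [|j q IH] S sS Sq.
    have -> : S = [set 0]; last exact: fl0.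
    apply/seteqP; split=> [w Sw|_ ->]; last exact: sub0.
    by apply/funext => i; apply: (Sq w).
  pose ev (w : A) : K := w j; have evl : linear ev by [].
  pose ev' : {linear A -> K} := HB.pack ev (GRing.isLinear.Build _ _ _ _ ev evl).
  apply: (@fl_exact _ _ _ ev') => //.
    by apply: fl_sub (fl_ext gor e) (subm_img _ sS) _.
  apply: IH; first by apply: submI => //; exact: subm_ker.
  move=> w [Sw w0] i iq; have [->|ne] := eqVneq i j; first exact: w0.
  by apply: (Sq w Sw); rewrite inE negb_or ne.
case: (ltP n 0) => [n0|]; last case: n sP => // n sP _.
  apply: (fl_supp [::]) => // w /= <- i _.
  by rewrite (prA_neg g w n0).
have [q qP] := tc_fin T n; apply: (fl_supp q) => // w /= <- i /negP iq.
rewrite /prA prKz_neg //; have : ~ (g i <= n)%N by move=> /qP.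
by lia.
Qed.

(** The product of the complex with [K] is exact above degree [e], and each variable adds one shift
    operator; so the homology of the full product is Artinian over the [e] shifts. *)
Lemma total_shift j : (j <= e)%N -> shift_complex (DT j DAx zA) (prT j pA) j (sgT A j) /\
  shift_artinian (DT j DAx zA) (prT j pA) j (sgT A j).
Proof.
elim: j => [|j IH] lt.
  split; last first.
    apply: (@shift_artinian0 _ _ _ _ _ e.+1) => n le w pw Dw.
    case: n le pw => // n le pw.
    by apply: (total_exact T) => //; lia.
  split=> //=.
  - exact: fl_total.
  - by move=> n f; exact: prA_neg.
  - by move=> n f; exact: (prA_DA T).
  - by move=> f; exact: (DA_DA T).
  - by move=> l n f; rewrite /= linear0.
  - by move=> l f; rewrite linear0.
have [c1 c2] := IH (ltnW lt).
have h1 n f : prT j pA (n + 1) (liftT j (zA j) f) = liftT j (zA j) (prT j pA n f).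
  by apply: prT_lift => k w; exact: prA_zA.
have h2 f : DT j DAx zA (liftT j (zA j) f) = - liftT j (zA j) (DT j DAx zA f).
  by apply: DT_lift_anti => *; [exact: DA_zA|exact: zA_C].
have h3 f : liftT j (zA j) (liftT j (zA j) f) = 0.
  by rewrite (liftT_comp (h2 := \0)) ?liftT0.
have h4 l f : sgT A j l (liftT j (zA j) f) = liftT j (zA j) (sgT A j l f) by exact: sgT_lift.
by split; [apply: shift_complexS|apply: shift_artinianS].
Qed.

Let SC := (total_shift (leqnn e)).1.

(** When the differential of the complex is left out, each basis element contributes a copy of
    Tate's resolution, whose homology is the residue field. *)
Lemma total_tate : ext_homology [set a : J -> R^o | forall j, m (a j)] DD uu (@FiT R A e) 0 (fun l => liftT e (zA (l + e)%N)).
Proof.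
have := tate_homology _ (ext_homologyJ J HK) zA_zA zA_C (leqnn e); rewrite subnn; apply.
split=> [j|c a b ma mb j]; first exact: sub0 sm.
by case: sm => _; apply; [exact: ma|exact: mb].
Qed.

Let DE w : D w = DD w + dT w.
Proof. by apply: DT_add => f; apply/funext. Qed.

Let ch_ch P Q w : ch P (ch Q w) = ch (fun q => P q && Q q) w.
Proof. by apply: liftT_comp => f; apply/funext => i /=; rewrite /chi; case: (P _); case: (Q _). Qed.
Let ch_eq P Q w : P =1 Q -> ch P w = ch Q w.
Proof. by move=> E; apply: liftT_eq => f; apply/funext => i /=; rewrite /chi E. Qed.
Let ch_none P w : (forall q, P q = false) -> ch P w = 0.
Proof. by move=> E; apply: liftT0 => f; apply/funext => i /=; rewrite /chi E. Qed.
Let ch_split P Q w : ch P w = ch (fun q => P q && Q q) w + ch (fun q => P q && ~~ Q q) w.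
Proof.
apply: liftT_add => f; apply/funext => i /=.
rewrite -[RHS]/(chi g (fun q => P q && Q q) f i + chi g (fun q => P q && ~~ Q q) f i) /chi.
by case: (P _); case: (Q _); rewrite ?addr0 ?add0r.
Qed.
Let ch_DD P w : DD (ch P w) = ch P (DD w).
Proof.
apply: DT_liftC => [f|l f]; apply/funext => i /=; rewrite /mapJ /chi; case: ifP => _ //; exact: linear0.
Qed.
Let ch_dT P w : ch P (dT w) = dT (ch (fun q => (0 < q)%N && P q.-1) w).
Proof.
rewrite (liftT_comp (h2 := (dAx \o (@chi R J g e (fun q => (0 < q)%N && P q.-1) : {linear A -> A})))); last first.
  move=> f; apply/funext => i /=; rewrite /chi /dA; case Pi : (P (g i)).
    by apply: (dJ_eq T) => j gj; rewrite gj /= Pi.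
  rewrite -[LHS](dJ0 e x nb _ i); apply: (dJ_eq T) => j gj; by rewrite gj /= Pi linear0.
by rewrite -(liftT_comp (h := dAx) (h' := @chi R J g e (fun q => (0 < q)%N && P q.-1) : {linear A -> A})).
Qed.
Let ch_dT_id (P Q : pred nat) w : (forall q, Q q.+1 -> P q) -> ch P (dT (ch Q w)) = dT (ch Q w).
Proof.
move=> QP; have E v : dT (ch Q v) = liftT e (dAx \o (@chi R J g e Q : {linear A -> A})) v.
  by apply: liftT_comp.
rewrite E; apply: liftT_comp => f; apply/funext => i /=; rewrite /chi /dA; case Pi : (P (g i)) => //.
rewrite -[LHS](dJ0 e x nb _ i); apply: (dJ_eq T) => j gj.
by case Qj : (Q (g j)); rewrite ?linear0 //; move: Qj; rewrite gj => /QP; rewrite Pi.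
Qed.
Let ch_pr P n w : pr n (ch P w) = ch P (pr n w).
Proof. by rewrite -{1}[n]addr0; apply: prT_lift => k f; rewrite addr0; exact: prA_chi. Qed.
Let pr_D n w : pr n (D w) = D (pr (n + 1) w). Proof. exact: (sc_D SC). Qed.
Let pr_DD n w : pr n (DD w) = DD (pr (n + 1) w).
Proof.
apply: prT_DT => [k f|l k f]; last exact: prA_zA.
by apply/funext => i; rewrite /= /prA /mapJ prKz_iota; congr (iota x (prKz _ _)); lia.
Qed.
Let pr_idem n w : pr n (pr n w) = pr n w.
Proof. by apply: prT_idem => k f; exact: prA_idem. Qed.
Let D_D w : D (D w) = 0. Proof. exact: (sc_DD SC). Qed.

Let pr_ch0 (P : pred nat) (n : int) w : (forall q, P q -> n < q%:Z) -> pr n (ch P w) = 0.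
Proof.
move=> nP; suff H j k (v : tate A j) : k <= n -> prT j pA k (liftT j (@chi R J g e P : {linear A -> A}) v) = 0.
  exact: H.
elim: j k v => [|j IH] k v kn.
  apply/funext => i; rewrite /= /prA /chi; case: ifP => [/nP h|_]; last exact: linear0.
  by apply: prKz_neg; lia.
by apply/funext => l /=; rewrite /prS /mapS IH //; lia.
Qed.

Let pr_uu n a : pr n (uu a) = uu (fun i => if n == (g i)%:Z then a i else 0).
Proof.
apply: prT_uT; apply/funext => i; rewrite /= /prA /mapJ prKz_uK subr_eq0.
by case: ifP => // _; rewrite linear0.
Qed.

Let ch_uu P a : ch P (uu a) = uu (fun i => if P (g i) then a i else 0).
Proof.
apply: liftT_uT; apply/funext => i; rewrite /= /chi /mapJ.
by case: ifP => // _; rewrite linear0.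
Qed.

Let dT_uu a : dT (uu a) = uu (dJ e x nb a).
Proof.
apply: liftT_uT; apply/funext => i; rewrite /= /dA /mapJ -(dJ_map e x nb (@uK R R^o e : {linear R^o -> K})).
by apply: (dJ_eq T) => j _; exact: alpha_uK.
Qed.

Let top_ch (n : nat) w : pr n w = w -> ch (fun q => q == n) w = uu (fun i => if g i == n then cK (at0 w i) else 0).
Proof.
move=> pw; rewrite -{1}pw -ch_pr.
suff H j (v : tate A j) : prT j pA n (liftT j (@chi R J g e (fun q => q == n) : {linear A -> A}) v) =
    uT j uA (fun i => if g i == n then cK (at0 v i) else 0) by exact: H.
elim: j v => [|j IH] v; apply/funext => i /=.
  rewrite /prA /chi /mapJ; case: eqP => [->|_]; last by rewrite !linear0.
  by rewrite subrr /= prK0E.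
rewrite /prS /mapS /atS; case: eqP => [->|ne]; first by rewrite double0 subr0 IH.
suff H k : k < n%:Z -> prT j pA k (liftT j (@chi R J g e (fun q => q == n) : {linear A -> A}) (v i)) = 0.
  by apply: H; lia.
move=> kn; move: (v i); clear v ne; elim: j k kn {IH} => [|j IH] k kn v.
  apply/funext => l; rewrite /= /prA /chi; case: eqP => [h|_]; last exact: linear0.
  by apply: prKz_neg; lia.
by apply/funext => l /=; rewrite /prS /mapS IH //; lia.
Qed.

Let low n w : pr n w = w -> forall P, (forall q, ~~ P q -> n < q%:Z) -> ch P w = w.
Proof.
move=> pw P nP; have E : w = ch P w + ch (fun q => ~~ P q) w.
  have idT j (v : tate A j) : liftT j idfun v = v.
    by elim: j v => [|j IH] v //; apply/funext => k; exact: IH.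
  rewrite -{1}[w]idT; apply: liftT_add => f; apply/funext => i /=.
  rewrite -[RHS]/(chi g P f i + chi g (fun q => ~~ P q) f i) /chi.
  by case: (P _); rewrite ?addr0 ?add0r.
have := pr_ch0 w nP; rewrite ch_pr pw => E0; by rewrite {2}E E0 addr0.
Qed.

(** One step of the filtration by complex degree: subtracting [D g1] removes the component of degree
    [p] and changes only lower ones, because the differential of the complex lowers that degree. *)
Let peel (n p : nat) w g0 : pr n w = w -> D w = 0 -> ch (fun q => q <= p)%N w = w ->
  ch (fun q => q == p) w = DD g0 ->
  exists g1, [/\ pr (n%:Z + 1) g1 = g1, ch (fun q => q <= p)%N g1 = g1, pr n (w - D g1) = w - D g1,
    D (w - D g1) = 0 & ch (fun q => q < p)%N (w - D g1) = w - D g1].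
Proof.
move=> pw Dw lw tw; pose g1 := ch (fun q => q == p) (pr (n%:Z + 1) g0).
have pg : pr (n%:Z + 1) g1 = g1 by rewrite ch_pr pr_idem.
have tE : DD g1 = ch (fun q => q == p) w.
  rewrite ch_DD -pr_DD -tw ch_pr pw ch_ch; apply: ch_eq => q; exact: andbb.
have wE : w = ch (fun q => q == p) w + ch (fun q => q < p)%N w.
  rewrite -{1}lw (ch_split _ (fun q => q == p)); congr (_ + _); apply: ch_eq => q.
    by case: eqP => [->|]; rewrite ?leqnn ?andbF.
  by rewrite ltn_neqAle andbC.
have E : w - D g1 = ch (fun q => q < p)%N w - dT g1.
  by rewrite {1}wE DE tE opprD addrA [X in X - _]addrAC subrr add0r.
exists g1; split=> //.
- by rewrite ch_ch; apply: ch_eq => q; case: eqP => [->|]; rewrite ?leqnn ?andbF.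
- by rewrite linearB /= pw pr_D pg.
- by rewrite linearB /= Dw D_D subrr.
- rewrite E linearB /= ch_ch ch_dT_id; last by move=> q /eqP <-.
  by congr (_ - _); apply: ch_eq => q; exact: andbb.
Qed.

Let top_cycle (p : nat) w : D w = 0 -> ch (fun q => q <= p)%N w = w -> DD (ch (fun q => q == p) w) = 0.
Proof.
move=> Dw lw; rewrite ch_DD; have : ch (fun q => q == p) (D w) = 0 by rewrite Dw linear0.
rewrite DE linearD /= ch_dT; have -> : ch (fun q => (0 < q)%N && (q.-1 == p)) w = 0.
  by rewrite -lw ch_ch; apply: ch_none => -[|q] //=; case: eqP => // ->; rewrite ltnn.
by rewrite linear0 addr0.
Qed.

(* In total degree [n] a cycle supported in complex degrees less than [n] has
   no component in degree [0] of the Tate factor, which is acyclic there. *)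
Let acyclic (n p : nat) w : (p <= n)%N -> pr n w = w -> D w = 0 -> ch (fun q => q < p)%N w = w ->
  exists h, [/\ pr (n%:Z + 1) h = h, ch (fun q => q < p)%N h = h & w = D h].
Proof.
elim: p w => [|p IH] w pn pw Dw lw.
  exists 0; rewrite !linear0; split=> //; rewrite -lw; exact: ch_none.
pose wp := ch (fun q => q == p) w; have pwp : pr n wp = wp by rewrite ch_pr pw.
have [a [g0 [_ E]]] := eh_gen total_tate (prT_Fi (fun n f => @prA_neg R J g e n f) pwp) (top_cycle Dw lw).
have {}E : wp = DD (ch (fun q => q == p) (pr (n%:Z + 1) g0)).
  have Ew : wp = ch (fun q => q == p) (pr n wp).
    by rewrite pwp ch_ch; apply: ch_eq => q; rewrite andbb.
  have Ea : ch (fun q => q == p) (pr n (uu a)) = 0.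
    rewrite pr_uu ch_uu -[RHS](linear0 uu); congr (uT _ _ _).
    by apply/funext => i; case: eqP => // ->; case: eqP => // -[h]; move: pn; rewrite h ltnn.
  have E' : wp = uu a + DD g0 := E.
  by rewrite ch_DD -pr_DD Ew E' !linearD /= Ea add0r.
have [g1 [pg1 lg1 pw1 Dw1 lw1]] := peel pw Dw lw E.
have [|h [ph lh wh]] := IH _ _ pw1 Dw1 lw1; first exact: ltnW.
exists (h + g1); split.
- by rewrite linearD /= ph pg1.
- rewrite linearD /= lg1 -{1}lh ch_ch; congr (_ + _).
  by rewrite -[RHS]lh; apply: ch_eq => q; case: (ltnP q p) => [/ltnW|] //=; rewrite ltnS ?andbF // => ->.
- by rewrite linearD /= -wh subrK.
Qed.

(** Injectivity of the map from the homology to leading coefficients modulo [m]: the component of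
    complex degree [n] bounds by [total_tate], and [acyclic] handles the rest. *)
Let cycle_bd (n : nat) w : pr n w = w -> D w = 0 -> (forall i, m (cK (at0 w i))) ->
  exists h, [/\ pr (n%:Z + 1) h = h, ch (fun q => q <= n)%N h = h & w = D h].
Proof.
move=> pw Dw mw; have lw : ch (fun q => q <= n)%N w = w by apply: (low pw) => q; lia.
pose a i := if g i == n then cK (at0 w i) else 0 : R^o.
have ma i : m (a i) by rewrite /a; case: ifP => // _; exact: sub0 sm.
have [g0 _ gE] := eh_bd total_tate (a := (a : ext 0 (J -> R^o))) ma.
have [g1 [pg1 lg1 pw1 Dw1 lw1]] := peel pw Dw lw (eq_trans (top_ch pw) gE).
have [h [ph lh wh]] := acyclic (leqnn n) pw1 Dw1 lw1.
exists (h + g1); split.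
- by rewrite linearD /= ph pg1.
- rewrite linearD /= lg1 -{1}lh ch_ch; congr (_ + _).
  by rewrite -[RHS]lh; apply: ch_eq => q; case: (ltnP q n) => [/ltnW ->|]; rewrite ?andbF.
- by rewrite linearD /= -wh subrK.
Qed.

Let bd_lead w i : m (cK (at0 (D w) i)).
Proof.
rewrite at0_DT -[(_ + _) i]/(DA e x nb x (at0 w) i + (\sum_(l < e) zA l (at0 (sg l w))) i) fct_sumE.
rewrite /DA linearD linearD /= -addrA.
have mx i' (v : R^o) : (i' < e)%N -> m (x i' *: v).
  move=> lt; have -> : x i' *: v = v * (dot e x (fun k => (k == i')%:R)).
    rewrite /dot (bigD1 (Ordinal lt)) //= eqxx mulr1 big1 ?addr0 1?mulrC // => k ne.
    by rewrite (_ : (k == i' :> nat) = false) ?mulr0 //; apply/negP => /eqP E; case/eqP: ne; apply: val_inj.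
  by rewrite -[_ * _]/(v *: (_ : R^o)); apply: subZ.
apply: subD => //; first by apply: cK_iota.
apply: subD => //.
  rewrite /dA -(dJ_map e x nb (@cK R R^o e : {linear K -> R^o})) /dJ; apply: sub_sum => // p _.
  by rewrite -[_ *: _]/(dot e x p.1 * _) mulrC; apply: (@subZ R R^o).
by rewrite linear_sum big1 => [|l _]; [exact: sub0|rewrite /= /mapJ cK_omega].
Qed.

(** Surjectivity of the same map. The boundary of the naive lift of [v] has leading coefficients in
    [m], hence bounds a chain of lower complex degree, which is subtracted. *)
Let lift_cycle (n : nat) (v : J -> R^o) : (forall i, g i <> n.+1 -> v i = 0) ->
  exists w, [/\ pr n.+1 w = w, D w = 0 & forall i, cK (at0 w i) = v i].
Proof.
move=> vn; have puv : pr n.+1 (uu v) = uu v.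
  rewrite pr_uu; congr (uT _ _ _); apply/funext => i; case: eqP => // ne.
  by rewrite vn // => E; apply: ne; rewrite E.
have Duv : D (uu v) = uu (dJ e x nb v).
  by rewrite DE dT_uu (eh_Du total_tate) add0r.
have [|||h [ph lh hE]] := @cycle_bd n (D (uu v)).
- by rewrite pr_D (_ : n%:Z + 1 = n.+1) ?puv //; lia.
- exact: D_D.
- exact: bd_lead.
exists (uu v - h); split.
- rewrite linearB /= puv; have -> : n.+1%:Z = n%:Z + 1 by lia.
  by rewrite ph.
- by rewrite linearB /= hE subrr.
move=> i; rewrite linearB -[(_ - _) i]/(at0 (uu v) i - at0 h i) linearB at0_uT /= /mapJ cK_uK.
suff -> : cK (at0 h i) = 0 by rewrite subr0.
have [E|ne] := eqVneq (n%:Z + 1) (g i)%:Z.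
  rewrite -lh at0_lift /= /chi ifF ?linear0 //; lia.
by rewrite -ph at0_prT /= /prA cK_prKz // subr_eq0.
Qed.

Section Lead.
(** [tau] lifts the differential to one-forms. Applying the differential once more gives Koszul
    cycles, as it squares to zero; [chi0 l] is the coordinate of their class along [z l]. *)
Variables (tau : (J -> R^o) -> J -> K) (chi0 : nat -> (J -> R^o) -> J -> R).
Hypotheses (tauE : forall v j, tau v j = \sum_(p <- nb j) (v p.2 : R) *: omega p.1 (uK e (1 : R^o)))
  (chiE : forall v i, exists q, \sum_(p <- nb i) dot e x p.1 *: tau v p.2 =
     \sum_(l < e) chi0 l v i *: omega (z l) (uK e (1 : R^o)) + iota x q).

(** The cycle condition is read in complex degrees [n + 1] and [n]. In the former the one-form part
    of [w] is [- tau v] up to Koszul cycles, which the differential turns into boundaries; in the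
    latter independence of the [z] compares the coefficients. So the shift acts on leading
    coefficients as [- chi0 l] modulo [m]. *)
Let lead_shift (n : nat) w (v : J -> R^o) i : pr n.+2 w = w -> D w = 0 ->
  (forall i, cK (at0 w i) = v i) -> g i = n ->
  forall l, (l < e)%N -> m (cK (at0 (sg l w) i) + chi0 l v i).
Proof.
move=> pw Dw wv gi.
set W := at0 w; pose y l := at0 (sg l w).
have eqn j : iota x (W j) + dA e x nb W j + \sum_(l < e) omega (z l) (y l j) = 0.
  have := congr1 (fun u => at0 u j) Dw; rewrite at0_DT.
  rewrite [at0 0]linear0.
  by rewrite -[(_ + _) j]/(DA e x nb x W j + (\sum_(l < e) zA l (at0 (sg l w))) j) fct_sumE.
have pW : prA g n.+2 W = W by rewrite -[RHS](congr1 (@at0 R A e) pw) at0_prT.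
have py l : prA g n (y l) = y l.
  rewrite /y -at0_prT; congr at0; rewrite (sc_sg SC) -{2}pw; congr (sg l (pr _ _)); lia.
have W2 j : g j = n.+2 -> W j = uK e (v j).
  by move=> gj; rewrite -wv -prK0E -[LHS](congr1 (fun f => f j) pW) /prA gj subrr.
have W1 j : g j = n.+1 -> alpha (W j) = - W j.
  move=> gj; have E : W j = prK 1 (W j).
    by rewrite -{1}pW /prA gj (_ : n.+2%:Z - n.+1%:Z = 1) //; lia.
  by rewrite E alpha_prK1.
have y1 l j : g j = n.+1 -> y l j = 0.
  by move=> gj; rewrite -py /prA gj prKz_neg //; lia.
pose Y j := W j + tau v j.
have Y0 j : g j = n.+1 -> iota x (Y j) = 0.
  move=> gj; have := eqn j; rewrite big1 => [|l _]; last by rewrite y1 // linear0.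
  rewrite addr0 /Y iotaD => E; rewrite -[RHS]E; congr (_ + _).
  rewrite tauE linear_sum /dA /dJ; have /all_filterP <- := tc_nb T j.
  rewrite !big_filter; apply: eq_bigr => p /eqP gp.
  rewrite [LHS]iotaZ iota_omega iota_uK linear0 subr0 W2 ?gp ?gj // alpha_uK (uK_scale e (v p.2)) !scalerA mulrC.
  by [].
have yE l : y l i = uK e (cK (y l i)).
  by rewrite -prK0E -[LHS](congr1 (fun f => f i) (py l)) /prA gi subrr.
have [q qE] := chiE v i.
pose B := range (@iota R R^o e x : {linear K -> K}); have sB : subm B by apply: subm_img; split.
have BY : B (\sum_(p <- nb i) dot e x p.1 *: Y p.2).
  have /all_filterP <- := tc_nb T i; rewrite big_filter; apply: sub_sum => // p /eqP gp.
  by apply: (koszul_kill xg) => //; apply: Y0; rewrite gp gi.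
have dW : dA e x nb W i = - \sum_(p <- nb i) dot e x p.1 *: W p.2.
  rewrite /dA /dJ -sumrN; have /all_filterP <- := tc_nb T i.
  rewrite !big_filter; apply: eq_bigr => p /eqP gp.
  by rewrite W1 ?gp ?gi // scalerN.
have sumY : \sum_(p <- nb i) dot e x p.1 *: Y p.2 = \sum_(p <- nb i) dot e x p.1 *: W p.2 +
    (\sum_(l < e) chi0 l v i *: omega (z l) (uK e (1 : R^o)) + iota x q).
  by rewrite -qE -big_split /=; apply: eq_bigr => p _; rewrite scalerDr.
have tot : B (\sum_(l < e) (cK (y l i) + chi0 l v i) *: omega (z l) (uK e (1 : R^o))).
  have -> : \sum_(l < e) (cK (y l i) + chi0 l v i) *: omega (z l) (uK e (1 : R^o)) =
      \sum_(p <- nb i) dot e x p.1 *: Y p.2 - iota x (W i + q).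
    have E1 : \sum_(l < e) (cK (y l i) + chi0 l v i) *: omega (z l) (uK e (1 : R^o)) =
        \sum_(l < e) omega (z l) (y l i) + \sum_(l < e) chi0 l v i *: omega (z l) (uK e (1 : R^o)).
      rewrite -big_split /=; apply: eq_bigr => l _; rewrite scalerDl; congr (_ + _).
      by rewrite [in RHS]yE [in RHS]uK_scale omegaZ.
    have E2 : \sum_(l < e) omega (z l) (y l i) = \sum_(p <- nb i) dot e x p.1 *: W p.2 - iota x (W i).
      have := eqn i; rewrite dW => /eqP; rewrite addr_eq0 => /eqP E.
      by rewrite -[LHS]opprK -E opprB.
    rewrite E1 E2 sumY iotaD; set P := \sum_(p <- _) _; set Q := \sum_(l < e) _.
    by rewrite [P + (Q + _)]addrA opprD [RHS]addrACA subrr addr0 addrAC.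
  by apply: subB => //; exists (W i + q).
move: tot => [h _ hE] l lt.
pose cc l : R := (cK (y l i) : R) + chi0 l v i.
apply: (inm_omega (c := cc) (n := e) _ lt).
have := @eh_ind _ _ _ _ _ _ _ _ _ HK (omega cc (uK e (1 : R^o))) h Logic.I; apply.
by rewrite evz_omega hE.
Qed.

(** Artinianness applied to the cycles whose leading coefficients lie in [m], which are the
    boundaries. *)
Lemma shift_lead_minimal : exists n1 : nat, forall n, (n1 <= n)%N -> forall v : J -> R^o,
  (forall i, g i <> n.+2 -> v i = 0) -> (forall l i, (l < e)%N -> g i = n -> m (chi0 l v i)) -> forall i, m (v i).
Proof.
pose U (n : int) : set (tate A e) := [set w | [/\ pr n w = w, D w = 0 & forall i, m (cK (at0 w i))]].
have [|n1 n1P] := (total_shift (leqnn e)).2 U.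
  split.
  - move=> n; split; first by rewrite /U /= !linear0; split=> // i; rewrite linear0; exact: sub0 sm.
    move=> c a b [pa Da ma] [pb Db mb]; split.
    + by have /= -> := linearP (pr n) c a b; rewrite pa pb.
    + by have /= -> := linearP D c a b; rewrite Da Db scaler0 addr0.
    + move=> i; have -> : at0 (c *: a + b) = c *: at0 a + at0 b by exact: at0_linear.
      rewrite -[(_ + _) i]/(c *: at0 a i + at0 b i).
      have -> : cK (c *: at0 a i + at0 b i) = c *: cK (at0 a i) + cK (at0 b i) by exact: cK_linear.
      by case: sm => _; apply.
  - by move=> n w [].
  - move=> n h ph; split; [by rewrite pr_D ph|exact: D_D|exact: bd_lead].
  - move=> l n w lt [pw Dw mw]; split.
    + by rewrite (sc_sg SC) pw.
    + by rewrite -(sc_sD SC) Dw linear0.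
    + case E : (n + 2) pw => [k|k] pw.
        have [h [_ _ ->]] := cycle_bd pw Dw mw; move=> i; rewrite (sc_sD SC); exact: bd_lead.
      have -> : w = 0 by rewrite -pw (sc_neg SC).
      by move=> i; rewrite !linear0; exact: sub0 sm.
exists n1 => n len v vn mchi i.
have [w [pw Dw wv]] := lift_cycle vn.
rewrite -wv; suff [_ _] : U (n%:Z + 2) w by exact.
have nE : n%:Z + 2 = n.+2 by lia.
apply: n1P; rewrite ?nE // => l lt; split.
- by rewrite (sc_sg SC) nE pw.
- by rewrite -(sc_sD SC) Dw linear0.
move=> j; have [gj|ne] := eqVneq (g j) n.
  rewrite -[cK _](addrK (chi0 l v j)); apply: (subB sm); first exact: lead_shift pw Dw wv gj l lt.
  exact: mchi.
have -> : cK (at0 (sg l w) j) = 0; last exact: sub0 sm.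
have E : pr n (sg l w) = sg l w by rewrite (sc_sg SC) nE pw.
rewrite -E at0_prT /= /prA cK_prKz //; lia.
Qed.

(** The shifts commute, so the operators they induce on leading coefficients commute modulo [m]. *)
Lemma shift_lead_comm (n : nat) (v : J -> R^o) l l' i :
  (forall l v v' i, chi0 l (fun j => v j + v' j) i = chi0 l v i + chi0 l v' i) ->
  (forall l v i, (forall j, m (v j)) -> m (chi0 l v i)) ->
  (forall j, g j <> n.+4 -> v j = 0) -> (l < e)%N -> (l' < e)%N -> g i = n ->
  let c l v j := if g j == n.+2 then chi0 l v j else 0 in
  m (chi0 l (c l' v) i - chi0 l' (c l v) i).
Proof.
move=> chiD chim vn lt lt' gi c.
have [w [pw Dw wv]] := lift_cycle vn.
have H k k' : (k < e)%N -> (k' < e)%N -> m (cK (at0 (sg k (sg k' w)) i) - chi0 k (c k' v) i).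
  move=> ltk ltk'; pose v' j : R^o := cK (at0 (sg k' w) j).
  have pw' : pr n.+2 (sg k' w) = sg k' w.
    by rewrite (sc_sg SC) -{2}pw; congr (sg k' (pr _ _)); lia.
  have Dw' : D (sg k' w) = 0 by rewrite -(sc_sD SC) Dw linear0.
  have h1 := lead_shift pw' Dw' (fun j => erefl (v' j)) gi ltk.
  have h2 j : m (v' j + c k' v j).
    rewrite /c; case: eqP => gj; first exact: lead_shift pw Dw wv gj k' ltk'.
    rewrite addr0 /v' -pw' at0_prT /= /prA cK_prKz; first exact: sub0 sm.
    by apply/eqP => E; apply: gj; lia.
  have h3 := chim k _ i h2; rewrite chiD in h3.
  have := subB sm h1 h3; congr m.
  by rewrite opprD addrA addrK.
have := subB sm (H l l' lt lt') (H l' l lt' lt); rewrite sgTC opprB addrC addrA subrK => h.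
by have := subN sm h; rewrite opprB.
Qed.

End Lead.

End TotalTate.

Section TensorSquare.
Variables (R : comNzRingType) (e : nat) (x : nat -> R) (J : eqType) (g : J -> nat)
  (nb : J -> seq ((nat -> R) * J)).

Definition g2 (j : J * J) : nat := (g j.1 + g j.2)%N.
Definition nb2 (j : J * J) : seq ((nat -> R) * (J * J)) :=
  [seq (p.1, (p.2, j.2)) | p <- nb j.1] ++ [seq (fun k => (-1) ^+ g j.1 * p.1 k, (j.1, p.2)) | p <- nb j.2].

Lemma dotZ c t : dot e x (fun k => c * t k) = c * dot e x t.
Proof. by rewrite /dot mulr_sumr; apply: eq_bigr => k _; rewrite mulrCA. Qed.

Lemma omegaZl (V : lmodType R) n c t (f : ext n V) : omega (fun k => c * t k) f = c *: omega t f.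
Proof.
elim: n t f => [|n IH] t f; first by rewrite /= scaler0.
by apply: pair_eq; rewrite /= ?(IH (tl t)) // scalerBr scalerA.
Qed.

Lemma scalerCA (V : lmodType R) a b (v : V) : a *: (b *: v) = b *: (a *: v).
Proof. by rewrite !scalerA mulrC. Qed.

Lemma dJ2E (V : lmodType R) (f : J * J -> V) i i' : dJ e x nb2 f (i, i') =
  dJ e x nb (fun j => f (j, i')) i + (-1) ^+ g i *: dJ e x nb (fun j' => f (i, j')) i'.
Proof.
rewrite /dJ big_cat !big_map /= scaler_sumr; congr (_ + _).
by apply: eq_bigr => p _; rewrite dotZ scalerA.
Qed.

Hypothesis T : tcomplex e x g nb.

Lemma sum_nb (V : zmodType) i (F : (nat -> R) * J -> V) :
  \sum_(p <- nb i) F p = \sum_(p <- nb i | g p.2 == (g i).+1) F p.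
Proof. by have /all_filterP {1}<- := tc_nb T i; rewrite big_filter. Qed.

Lemma dJ2_dd (V : lmodType R) (f : J * J -> V) i : dJ e x nb2 (dJ e x nb2 f) i = 0.
Proof.
case: i => i i'; rewrite dJ2E.
have -> : dJ e x nb (fun j => dJ e x nb2 f (j, i')) i =
    - ((-1) ^+ g i *: dJ e x nb (fun j => dJ e x nb (fun j' => f (j, j')) i') i).
  transitivity (dJ e x nb (fun j => dJ e x nb (fun k => f (k, i')) j) i +
     dJ e x nb (fun j => (-1) ^+ g j *: dJ e x nb (fun j' => f (j, j')) i') i).
    rewrite /dJ -big_split /=; apply: eq_bigr => p _; rewrite -scalerDr -[X in _ *: X]/(dJ e x nb2 f (p.2, i')).
    by rewrite dJ2E.
  rewrite (tc_dd T) add0r -scaleNr /dJ scaler_sumr !sum_nb; apply: eq_bigr => p /eqP ->.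
  by rewrite exprS mulN1r !scalerA mulrC.
have -> : dJ e x nb (fun j' => dJ e x nb2 f (i, j')) i' = dJ e x nb (fun j' => dJ e x nb (fun j => f (j, j')) i) i'.
  transitivity (dJ e x nb (fun j' => dJ e x nb (fun j => f (j, j')) i) i' +
     (-1) ^+ g i *: dJ e x nb (fun j' => dJ e x nb (fun k => f (i, k)) j') i').
    rewrite /dJ scaler_sumr -big_split /=; apply: eq_bigr => p _; rewrite [in RHS](scalerCA ((-1) ^+ _)) -scalerDr.
    by rewrite -[X in _ *: X = _]/(dJ e x nb2 f (i, p.2)) dJ2E.
  by rewrite (tc_dd T) scaler0 addr0.
rewrite addrC; apply/eqP; rewrite subr_eq0; apply/eqP; congr (_ *: _).
rewrite /dJ; under eq_bigr => p _ do rewrite scaler_sumr.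
rewrite exchange_big /=; apply: eq_bigr => p _; rewrite scaler_sumr; apply: eq_bigr => q _.
by rewrite !scalerA mulrC.
Qed.

Lemma tensor_nb i : all (fun p => g2 p.2 == (g2 i).+1) (nb2 i).
Proof.
case: i => i i'; rewrite all_cat !all_map; apply/andP; split.
  by apply: sub_all (tc_nb T i) => p /eqP gp; rewrite /g2 /= gp addSn.
by apply: sub_all (tc_nb T i') => p /eqP gp; rewrite /g2 /= gp addnS.
Qed.

Lemma tensor_fin n : exists s : seq (J * J), forall i, (g2 i <= n)%N -> i \in s.
Proof.
have [s sP] := tc_fin T n; exists [seq (i, i') | i <- s, i' <- s] => -[i i']; rewrite /g2 /= => le.
by apply/allpairsP; exists (i, i'); split=> //; apply: sP; apply: leq_trans le; rewrite ?leq_addr ?leq_addl.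
Qed.

Variables (z : nat -> nat -> R) (chi0 : nat -> (J -> R^o) -> J -> R).
Local Notation K := (ext e R^o).
Local Notation om t := (omega t (uK e (1 : R^o))).
Definition tau0 (nb' : J -> seq ((nat -> R) * J)) (v : J -> R^o) (j : J) : K :=
  \sum_(p <- nb' j) (v p.2 : R) *: om p.1.
Hypothesis chiE : forall v i, exists q, \sum_(p <- nb i) dot e x p.1 *: tau0 nb v p.2 =
     \sum_(l < e) chi0 l v i *: om (z l) + iota x q.

(** The operators have even degree, so they extend to the tensor square as derivations without
    signs. *)
Definition chi2 l (v : J * J -> R^o) (i : J * J) : R :=
  chi0 l (fun j => v (j, i.2)) i.1 + chi0 l (fun j' => v (i.1, j')) i.2.
Definition tau2 (v : J * J -> R^o) (j : J * J) : K := \sum_(p <- nb2 j) (v p.2 : R) *: om p.1.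

Lemma tau2E v i i' : tau2 v (i, i') =
  tau0 nb (fun j => v (j, i')) i + (-1) ^+ g i *: tau0 nb (fun j' => v (i, j')) i'.
Proof.
rewrite /tau2 /tau0 big_cat !big_map /= scaler_sumr; congr (_ + _).
by apply: eq_bigr => p _; rewrite omegaZl scalerCA.
Qed.

(* Koszul boundary of the product of two cochains lifting the differentials of
   the two factors: these operators anticommute up to homotopy. *)
Lemma chi2E v i : exists q, \sum_(p <- nb2 i) dot e x p.1 *: tau2 v p.2 =
     \sum_(l < e) chi2 l v i *: om (z l) + iota x q.
Proof.
case: i => i i'; have [q1 E1] := chiE (fun j => v (j, i')) i; have [q2 E2] := chiE (fun j' => v (i, j')) i'.
pose w := \sum_(p <- nb i) \sum_(p' <- nb i') (v (p.2, p'.2) : R) *: omega p.1 (om p'.1).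
exists (q1 + q2 - (-1) ^+ g i *: w).
have -> : \sum_(l < e) chi2 l v (i, i') *: om (z l) =
    \sum_(l < e) chi0 l (fun j => v (j, i')) i *: om (z l) + \sum_(l < e) chi0 l (fun j' => v (i, j')) i' *: om (z l).
  by rewrite -big_split /=; apply: eq_bigr => l _; rewrite scalerDl.
rewrite iotaB iotaD addrA addrACA -E1 -E2 big_cat !big_map /=.
pose S1 := \sum_(p <- nb i) \sum_(p' <- nb i') (dot e x p.1 * (v (p.2, p'.2) : R)) *: om p'.1.
pose S2 := \sum_(p <- nb i) \sum_(p' <- nb i') (dot e x p'.1 * (v (p.2, p'.2) : R)) *: om p.1.
have Ew : iota x w = S1 - S2.
  rewrite /w linear_sum /S1 /S2 -sumrB; apply: eq_bigr => p _; rewrite linear_sum -sumrB; apply: eq_bigr => p' _.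
  rewrite [LHS]iotaZ iota_omega iota_omega iota_uK linear0 subr0 omegaZ scalerBr !scalerA.
  by rewrite [in X in _ - X]mulrC [in X in X - _]mulrC.
have -> : \sum_(p <- nb i) dot e x p.1 *: tau2 v (p.2, i') =
    \sum_(p <- nb i) dot e x p.1 *: tau0 nb (fun j => v (j, i')) p.2 - (-1) ^+ g i *: S1.
  rewrite /S1 scaler_sumr -sumrB !sum_nb; apply: eq_bigr => p /eqP gp.
  rewrite tau2E scalerDr gp; congr (_ + _).
  rewrite /tau0 !scaler_sumr -sumrN; apply: eq_bigr => p' _; rewrite exprS mulN1r !scalerA -scaleNr.
  by congr (_ *: _); ring.
have -> : \sum_(p <- nb i') dot e x (fun k => (-1) ^+ g i * p.1 k) *: tau2 v (i, p.2) =
    \sum_(p <- nb i') dot e x p.1 *: tau0 nb (fun j' => v (i, j')) p.2 + (-1) ^+ g i *: S2.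
  rewrite /S2 exchange_big /= scaler_sumr -big_split /=; apply: eq_bigr => p _.
  rewrite dotZ tau2E scalerDr !scalerA addrC; congr (_ + _).
    by rewrite /tau0 !scaler_sumr; apply: eq_bigr => p' _; rewrite !scalerA mulrA.
  by rewrite mulrAC -expr2 sqrr_sign mul1r.
rewrite (iotaZ x _ w) Ew scalerBr opprB addrACA; congr (_ + _); exact: addrC.
Qed.

End TensorSquare.

Section MinimalComplex.
Variables (R : comNzRingType) (m : set R^o) (e : nat) (x : nat -> R) (b : nat -> nat)
  (d : forall p, 'M[R]_(b p, b p.+1)) (t : forall p, 'I_(b p) -> 'I_(b p.+1) -> nat -> R).
Hypotheses (dP : minres m d) (tE : forall p i j, d p i j = dot e x (t i j)).

Definition basis : eqType := {p : nat & 'I_(b p)}.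
Definition bas p (i : 'I_(b p)) : basis := Tagged (fun p => 'I_(b p)) i.
Definition bdeg (j : basis) : nat := tag j.
Definition bnb (j : basis) : seq ((nat -> R) * basis) := [seq (t (tagged j) k, bas k) | k <- enum 'I_(b (tag j).+1)].

Lemma dJ_bas (V : lmodType R) (f : basis -> V) p (i : 'I_(b p)) :
  dJ e x bnb f (bas i) = \sum_(j < b p.+1) d p i j *: f (bas j).
Proof. by rewrite /dJ big_map big_enum /=; apply: eq_bigr => j _; rewrite tE. Qed.

Lemma bas_dd (V : lmodType R) (f : basis -> V) i : dJ e x bnb (dJ e x bnb f) i = 0.
Proof.
case: i => p i; rewrite -[existT _ p i]/(bas i) dJ_bas.
under eq_bigr => j _ do rewrite dJ_bas scaler_sumr.
rewrite exchange_big big1 //= => k _; under eq_bigr => j _ do rewrite scalerA.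
rewrite -scaler_suml; have := congr1 (fun M : 'M_(_, _) => M i k) (minres_dd dP p).
by rewrite !mxE => ->; rewrite scale0r.
Qed.

Lemma bas_nb i : all (fun p => bdeg p.2 == (bdeg i).+1) (bnb i).
Proof. by rewrite all_map; apply/allP => k _ /=. Qed.

Lemma bas_fin n : exists s : seq basis, forall i, (bdeg i <= n)%N -> i \in s.
Proof.
exists (flatten [seq [seq bas i | i <- enum 'I_(b p)] | p <- seq.iota 0 n.+1]) => -[p i] le.
apply/flattenP; exists [seq bas i | i <- enum 'I_(b p)].
  by apply/mapP; exists p => //; rewrite mem_iota add0n ltnS.
by apply/mapP; exists i => //; rewrite mem_enum.
Qed.

Definition unsig (M : forall p, 'cV[R]_(b p)) (j : basis) : R^o := M (tag j) (tagged j) 0.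
(** [conform_mx] serves as a transport along [p = p0]. *)
Definition single p0 (H : 'cV[R]_(b p0)) p : 'cV[R]_(b p) := if p == p0 then conform_mx 0 H else 0.
Lemma singleE p0 (H : 'cV[R]_(b p0)) : single H p0 = H.
Proof. by rewrite /single eqxx conform_mx_id. Qed.
Lemma single0 p0 (H : 'cV[R]_(b p0)) p : p != p0 -> single H p = 0.
Proof. by rewrite /single => /negPf ->. Qed.

Lemma bas_tcomplex : tcomplex e x bdeg bnb.
Proof.
split; [exact: bas_nb|exact: bas_fin|exact: bas_dd|].
move=> n f fn df; pose v := \col_(j < b n.+1) (f (bas j) : R).
have dv : d n *m v = 0.
  apply/matrixP => i j; rewrite !mxE -[RHS](df (bas i)) dJ_bas.
  by apply: eq_bigr => k _; rewrite !mxE.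
have [w wE] := (mr_ex dP v).1 dv.
exists (unsig (single w)); split=> [[p i] ne|[p i]].
  by rewrite /unsig /= single0 ?mxE //; apply/eqP.
rewrite -[existT _ p i]/(bas i) dJ_bas; have [E|ne] := eqVneq p n.+1.
  move: i; rewrite E => i; have := congr1 (fun M : 'cV_ _ => M i 0) wE; rewrite !mxE => ->.
  by apply: eq_bigr => j _; rewrite /unsig /= singleE.
rewrite fn; last by apply/eqP.
rewrite big1 // => j _; rewrite /unsig /= single0 ?mxE ?scaler0 //.
Qed.

(* The tensor square of the complex, in terms of the matrices of coefficients
   of its elements. *)
Definition dM (M : forall p q, 'M[R]_(b p, b q)) p q : 'M[R]_(b p, b q) :=
  d p *m M p.+1 q + (-1) ^+ p *: (M p q.+1 *m (d q)^T).
Definition single2 p0 q0 (H : 'M[R]_(b p0, b q0)) p q : 'M[R]_(b p, b q) :=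
  if (p == p0) && (q == q0) then conform_mx 0 H else 0.
Lemma single2E p0 q0 (H : 'M[R]_(b p0, b q0)) : single2 H p0 q0 = H.
Proof. by rewrite /single2 !eqxx conform_mx_id. Qed.
Lemma single20 p0 q0 (H : 'M[R]_(b p0, b q0)) p q : (p != p0) || (q != q0) -> single2 H p q = 0.
Proof. by rewrite /single2 -negb_and => /negPf ->. Qed.

(** Exactness at the edge [p = 0], the only place where the exactness of the complex itself does not
    suffice. *)
Hypothesis TI : forall q (Y : 'M[R]_(b 0, b q.+1)), (exists Z : 'M[R]_(b 1, b q), Y *m (d q)^T = d 0%N *m Z) ->
  exists Y' : 'M[R]_(b 1, b q.+1), Y *m (d q)^T = d 0%N *m Y' *m (d q)^T.

Lemma dM_B M M' p q : dM (fun p q => M p q - M' p q) p q = dM M p q - dM M' p q.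
Proof. by rewrite /dM mulmxBr mulmxBl scalerBr opprD addrACA. Qed.
Lemma dM_D M M' p q : dM (fun p q => M p q + M' p q) p q = dM M p q + dM M' p q.
Proof. by rewrite /dM mulmxDr mulmxDl scalerDr addrACA. Qed.

Lemma dM_dM M p q : dM (dM M) p q = 0.
Proof.
rewrite /dM !mulmxDr mulmxDl mulmxA (minres_dd dP) mul0mx add0r -!scalemxAr -!scalemxAl scalerDr scalerA.
have -> : M p q.+2 *m (d q.+1)^T *m (d q)^T = 0 by rewrite -mulmxA -trmx_mul (minres_dd dP) trmx0 mulmx0.
rewrite scaler0 addr0 exprS mulN1r mulmxA scaleNr; exact: addNr.
Qed.

(** The entry at [p = 0] is corrected by [TI]; the others are then cleared in order of decreasing
    [q], using the exactness of the columns. *)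
Lemma dM_exact n M : (forall p q, (p + q)%N <> n.+1 -> M p q = 0) -> (forall p q, (p + q)%N = n -> dM M p q = 0) ->
  exists H, (forall p q, (p + q)%N <> n.+2 -> H p q = 0) /\ forall p q, M p q = dM H p q.
Proof.
have main Q M' : (Q <= n.+1)%N -> (forall p q, (p + q)%N <> n.+1 -> M' p q = 0) ->
    (forall p q, (Q <= q)%N -> M' p q = 0) -> (forall p q, (p + q)%N = n -> dM M' p q = 0) ->
  exists H, (forall p q, (p + q)%N <> n.+2 -> H p q = 0) /\ forall p q, M' p q = dM H p q.
  elim: Q M' => [|Q IH] M' le sM sQ cM.
    exists (fun _ _ => 0); split=> // p q; rewrite sQ // /dM mulmx0 mul0mx scaler0 addr0 //.
  pose p1 := (n - Q)%N; have p1E : (p1 + Q = n)%N by rewrite /p1; lia.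
  have := cM p1 Q p1E; rewrite /dM (sQ p1 Q.+1) // mul0mx scaler0 addr0 => /(minres_exM dP)[H HE].
  pose h := single2 H.
  have hE p q : dM h p q = if (p == p1.+1) && (q == Q) then M' p q else
      if (p == p1.+2) && (q.+1 == Q) then dM h p q else 0.
    case: ifP => [/andP[/eqP -> /eqP ->]|ne1].
      have z1 : h p1.+1 Q.+1 = 0 by apply: single20; lia.
      have z2 : h p1.+2 Q = H := single2E H.
      by rewrite /dM z1 z2 mul0mx scaler0 addr0 HE.
    case: ifP => // ne2; rewrite /dM /h single20 ?mulmx0 ?add0r; last by move: ne1; lia.
    by rewrite single20 ?mul0mx ?scaler0 //; move: ne2; lia.
  have [||||H' [sH' H'E]] := IH (fun p q => M' p q - dM h p q).
  - by lia.
  - move=> p q ne; rewrite sM // hE; case: ifP => [/andP[/eqP E1 /eqP E2]|_]; first by lia.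
    by case: ifP => [/andP[/eqP E1 /eqP E2]|_]; [lia|rewrite subrr].
  - move=> p q le'; rewrite hE; case: ifP => [/andP[/eqP E1 /eqP E2]|ne1]; first by rewrite subrr.
    case: ifP => [/andP[/eqP E1 /eqP E2]|_]; first by lia.
    rewrite subr0; have [E|ne] := eqVneq q Q; last by apply: sQ; lia.
    by apply: sM; move: ne1; rewrite E eqxx andbT => /eqP; lia.
  - by move=> p q E; rewrite dM_B cM // dM_dM subrr.
  exists (fun p q => H' p q + h p q); split=> [p q ne|p q].
    by rewrite sH' // /h single20 ?addr0 //; lia.
  by rewrite -[RHS]/(dM (fun p q => H' p q + h p q) p q) dM_D -H'E subrK.
move=> sM cM; have := cM 0%N n (add0n n); rewrite /dM expr0 scale1r => c0.
have [|Y' Y'E] := @TI n (M 0%N n.+1).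
  by exists (- M 1%N n); rewrite mulmxN; apply/eqP; rewrite -addr_eq0 addrC c0.
have : (M 0%N n.+1 - d 0%N *m Y') *m (d n)^T = 0 by rewrite mulmxBl Y'E subrr.
move=> /(congr1 trmx); rewrite trmx_mul trmxK trmx0 => /(minres_exM dP)[H HE].
have {}HE : M 0%N n.+1 - d 0%N *m Y' = H^T *m (d n.+1)^T by rewrite -trmx_mul -HE trmxK.
pose h p q := single2 Y' p q + single2 H^T p q.
have h0 : dM h 0 n.+1 = M 0%N n.+1.
  have z1 : h 1%N n.+1 = Y' by rewrite /h single2E single20 ?addr0.
  have z2 : h 0%N n.+2 = H^T by rewrite /h single2E single20 ?add0r.
  by rewrite /dM z1 z2 expr0 scale1r -HE addrC subrK.
have hn p q : (p + q)%N <> n.+1 -> dM h p q = 0.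
  move=> ne; rewrite /h dM_D /dM !single20 ?mulmx0 ?mul0mx ?scaler0 ?addr0 //; lia.
have [||||H' [sH' H'E]] := main n.+1 (fun p q => M p q - dM h p q).
- by [].
- by move=> p q ne; rewrite sM // hn // subrr.
- move=> p q le; have [E|ne] := eqVneq (p + q)%N n.+1; last by rewrite sM ?hn ?subrr //; apply/eqP.
  have p0 : p = 0%N by lia.
  have qn : q = n.+1 by lia.
  by rewrite p0 qn h0 subrr.
- by move=> p q E; rewrite dM_B cM // dM_dM subrr.
exists (fun p q => H' p q + h p q); split=> [p q ne|p q].
  by rewrite sH' // /h !single20 ?addr0 //; lia.
by rewrite -[RHS]/(dM (fun p q => H' p q + h p q) p q) dM_D -H'E subrK.
Qed.

Definition unsig2 (M : forall p q, 'M[R]_(b p, b q)) (j : basis * basis) : R^o :=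
  M (tag j.1) (tag j.2) (tagged j.1) (tagged j.2).

Lemma dJ_unsig2 M p q (i : 'I_(b p)) (j : 'I_(b q)) :
  dJ e x (nb2 bdeg bnb) (unsig2 M) (bas i, bas j) = dM M p q i j.
Proof.
rewrite dJ2E !dJ_bas !mxE; congr (_ + _ * _); apply: eq_bigr => k _; rewrite /unsig2 ?mxE //=.
by rewrite -[LHS]/(_ * _) mulrC.
Qed.

Lemma tensor_tcomplex : tcomplex e x (g2 bdeg) (nb2 bdeg bnb).
Proof.
split; [exact: tensor_nb bas_tcomplex|exact: tensor_fin bas_tcomplex|exact: (dJ2_dd bas_tcomplex)|].
move=> n f fn df; pose M p q : 'M[R]_(b p, b q) := \matrix_(i, j) (f (bas i, bas j) : R).
have fE : f = unsig2 M by apply/funext => -[[p i] [q j]]; rewrite /unsig2 /= mxE.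
have [||H [sH HE]] := @dM_exact n M.
- by move=> p q ne; apply/matrixP => i j; rewrite !mxE fn.
- by move=> p q E; apply/matrixP => i j; rewrite -dJ_unsig2 -fE df mxE.
exists (unsig2 H); split=> [[[p i] [q j]] ne|[[p i] [q j]]].
  by rewrite /unsig2 /= sH ?mxE.
by rewrite -[(existT _ p i, existT _ q j)]/(bas i, bas j) dJ_unsig2 -HE fE.
Qed.

End MinimalComplex.

Section ExteriorKoszulHomology.
Variables (R : comNzRingType) (m : set R^o) (s : R) (e : nat) (x : nat -> R) (z : nat -> nat -> R).
Hypothesis gor : gor_local m s.
Hypotheses (xm : forall t, m (dot e x t)) (xg : forall r, m r -> exists t, r = dot e x t)
  (zc : forall l, dot e x (z l) = 0).
Local Notation K := (ext e R^o).
Local Notation om t := (omega t (uK e (1 : R^o))).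
Hypothesis HK : ext_homology (S := R^o) m (@iota R R^o e x : {linear K -> K}) (@uK R R^o e : {linear R^o -> K})
  setT e (fun l => @omega R R^o e (z l) : {linear K -> K}).
Let al := gl_al gor.
Let sm : subm m := al_sub al.

Lemma prK_evz n k (y : nat -> nat -> R) (a : ext n R^o) :
  prK k (evz (@uK R R^o e) (fun l => @omega R R^o e (y l) : {linear K -> K}) a) =
  evz (@uK R R^o e) (fun l => @omega R R^o e (y l) : {linear K -> K}) (prK k a).
Proof.
elim: n k y a => [|n IH] k y a; first by rewrite /= prK_uK; case: k => //=; rewrite linear0.
rewrite /= prKD (IH k (tl y)); congr (_ + _); case: k => [|k].
  rewrite prK0_omega; have -> : evz (@uK R R^o e) (tl (fun l => @omega R R^o e (y l) : {linear K -> K})) (0 : ext n R^o) = 0.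
    have := evz_linear (@uK R R^o e) (tl (fun l => @omega R R^o e (y l) : {linear K -> K})) (-1) (0 : ext n R^o) 0.
    by rewrite scaler0 addr0 scaleN1r addNr.
  by rewrite linear0.
by rewrite prK_omega (IH k (tl y)).
Qed.

Lemma koszul_cycle1 (c : K) : prK 1 c = c -> iota x c = 0 ->
  exists (a : nat -> R) q, c = \sum_(l < e) a l *: om (z l) + iota x q.
Proof.
move=> c1 c0; have [a [q [_ E]]] := eh_gen HK Logic.I c0.
have [t tE] : exists t, prK 1 (a : ext e R^o) = om t by apply: deg1_omega; rewrite prK_prK.
exists t, (prK 2 q); rewrite -{1}c1 E prKD prK_iota; congr (_ + _).
by rewrite (prK_evz 1 z a) tE evz_omega.
Qed.

Section Complex.
Variables (b : nat -> nat) (d : forall p, 'M[R]_(b p, b p.+1)) (t : forall p, 'I_(b p) -> 'I_(b p.+1) -> nat -> R).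
Arguments t {p} _ _ _.
Hypotheses (dP : minres m d) (tE : forall p i j, d p i j = dot e x (t i j)).
Variable Xc : forall p, 'I_(b p) -> 'I_(b p.+2) -> nat -> R.
Arguments Xc {p} _ _ _.
Hypothesis XcE : forall p (i : 'I_(b p)) k, exists q,
  \sum_j d p i j *: om (t j k) = \sum_(l < e) Xc i k l *: om (z l) + iota x q.

Let chi0 l (v : basis b -> R^o) (j : basis b) : R := \sum_k Xc (tagged j) k l * (v (bas k) : R).
Let T := bas_tcomplex dP tE.

Let chiE v i : exists q, \sum_(p <- bnb (@t) i) dot e x p.1 *: tau0 e (bnb (@t)) v p.2 =
     \sum_(l < e) chi0 l v i *: om (z l) + iota x q.
Proof.
case: i => p i; have [q qE] := choice (fun k => XcE i k).
exists (\sum_k (v (bas k) : R) *: q k).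
rewrite -[LHS]/(dJ e x (bnb (@t)) (tau0 e (bnb (@t)) v) (bas i)) (dJ_bas tE).
transitivity (\sum_j \sum_k (v (bas k) : R) *: (d p i j *: om (t j k))).
  apply: eq_bigr => j _; rewrite /tau0 big_map big_enum /= scaler_sumr; apply: eq_bigr => k _.
  by rewrite !scalerA mulrC.
rewrite exchange_big /=.
transitivity (\sum_k (v (bas k) : R) *: (\sum_(l < e) Xc i k l *: om (z l) + iota x (q k))).
  by apply: eq_bigr => k _; rewrite -qE scaler_sumr.
rewrite linear_sum /=; transitivity (\sum_k ((v (bas k) : R) *: (\sum_(l < e) Xc i k l *: om (z l)) + iota x ((v (bas k) : R) *: q k))).
  by apply: eq_bigr => k _; rewrite scalerDr iotaZ.
rewrite big_split /=; congr (_ + _).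
transitivity (\sum_k \sum_(l < e) ((v (bas k) : R) * Xc i k l) *: om (z l)).
  by apply: eq_bigr => k _; rewrite scaler_sumr; apply: eq_bigr => l _; rewrite scalerA.
rewrite exchange_big /=; apply: eq_bigr => l _; rewrite scaler_suml; apply: eq_bigr => k _.
by rewrite mulrC.
Qed.

Let chi0D l v v' i : chi0 l (fun j => v j + v' j) i = chi0 l v i + chi0 l v' i.
Proof. by rewrite /chi0 -big_split /=; apply: eq_bigr => k _; rewrite mulrDr. Qed.

Let chi0m l v i : (forall j, m (v j)) -> m (chi0 l v i).
Proof. by move=> mv; apply: (@sub_sum R R^o) => // k _; apply: (@subZ R R^o). Qed.

Lemma chi_minimal : exists n1 : nat, forall n, (n1 <= n)%N -> forall v : 'cV[R]_(b n.+2),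
  (forall l (i : 'I_(b n)), (l < e)%N -> m (\sum_k Xc i k l * v k 0)) -> forall k, m (v k 0).
Proof.
have [n1 n1P] := shift_lead_minimal gor xm xg zc HK T (fun v j => erefl (tau0 e (bnb (@t)) v j)) chiE.
exists n1 => n len v mv k.
have := n1P n len (unsig (single v)); rewrite /unsig => H.
have {H} := H _ _ (bas k); rewrite /= singleE; apply.
  by move=> [p i] ne; rewrite /= single0 ?mxE //; apply/eqP.
move=> l [p i] lt /= E; move: i; rewrite (E : p = n) => i; rewrite /chi0 /=.
under eq_bigr => k' _ do rewrite singleE.
exact: mv.
Qed.

Lemma chi_comm n (i : 'I_(b n)) (r : 'I_(b n.+4)) l l' : (l < e)%N -> (l' < e)%N ->
  m (\sum_k Xc i k l * Xc k r l' - \sum_k Xc i k l' * Xc k r l).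
Proof.
move=> lt lt'; pose v := unsig (single (delta_mx r 0 : 'cV[R]_(b n.+4))).
have := shift_lead_comm gor xm xg zc HK T (fun v j => erefl (tau0 e (bnb (@t)) v j)) chiE
  (v := v) (i := bas i) (n := n) chi0D chi0m _ lt lt' erefl.
have E l0 (k : 'I_(b n.+2)) : chi0 l0 v (bas k) = Xc k r l0.
  rewrite /chi0 /= /v /unsig /= (bigD1 r) //= singleE mxE !eqxx mulr1 big1 ?addr0 // => r' ne.
  by rewrite mxE (negPf ne) mulr0.
have F l1 l2 : chi0 l1 (fun j => if bdeg j == n.+2 then chi0 l2 v j else 0) (bas i) = \sum_k Xc i k l1 * Xc k r l2.
  by rewrite {1}/chi0 /=; apply: eq_bigr => k _; rewrite eqxx E.
move=> H; have {H} := H _; cbv zeta; rewrite !F; apply=> -[p j] ne.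
by rewrite /v /unsig /= single0 ?mxE //; exact/eqP.
Qed.

Hypothesis TI : forall q (Y : 'M[R]_(b 0, b q.+1)), (exists Z : 'M[R]_(b 1, b q), Y *m (d q)^T = d 0%N *m Z) ->
  exists Y' : 'M[R]_(b 1, b q.+1), Y *m (d q)^T = d 0%N *m Y' *m (d q)^T.

Lemma chi2_minimal : exists n1 : nat, forall n, (n1 <= n)%N -> forall V : forall p q, 'M[R]_(b p, b q),
  (forall l p q, (l < e)%N -> (p + q)%N = n -> forall i j,
     m (\sum_k Xc i k l * V p.+2 q k j + \sum_k Xc j k l * V p q.+2 i k)) ->
  forall p q, (p + q)%N = n.+2 -> forall i j, m (V p q i j).
Proof.
have [n1 n1P] := shift_lead_minimal gor xm xg zc HK (tensor_tcomplex dP tE TI)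
  (fun v j => erefl (tau2 e (@bdeg b) (bnb (@t)) v j)) (chi2E T chiE).
exists n1 => n len V mV p q pq i j.
pose V' p q : 'M[R]_(b p, b q) := if (p + q == n.+2)%N then V p q else 0.
have VE p' q' : (p' + q')%N = n.+2 -> V' p' q' = V p' q' by move=> E; rewrite /V' E eqxx.
have := n1P n len (unsig2 V'); rewrite /unsig2 => H.
have {H} := H _ _ (bas i, bas j); rewrite /= VE //; apply.
  by move=> [[p' i'] [q' j']] ne; rewrite /= /V'; case: eqP => // _; rewrite mxE.
move=> l [[p' i'] [q' j']] lt /= E; rewrite /chi2 /chi0 /=.
have E' : (p' + q')%N = n := E.
have := mV l p' q' lt E' i' j'; congr (m (_ + _)); apply: eq_bigr => k _; rewrite VE //.
  by rewrite !addSn E'.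
by rewrite !addnS E'.
Qed.

End Complex.

(* The operators of degree [-2] on [F] induced by the relations [z] of the
   Koszul complex generate finite modules over both [F] and [F (x) F] when
   [Tor(M, M)] eventually vanishes, which forces [F] to be finite. *)
Theorem exterior_zero_betti (b : nat -> nat) (d : forall p, 'M[R]_(b p, b p.+1)) n0 : minres m d ->
  (forall p q, (n0 <= p)%N -> tor_indep d d p q) -> exists p, b p = 0%N.
Proof.
move=> dP TI.
have Ht p i j : exists t, d p i j = dot e x t by apply: xg; apply: mr_min dP _ _ _.
pose t p i j := projT1 (cid (Ht p i j)).
have tE p i j : d p i j = dot e x (t p i j) by exact: projT2 (cid (Ht p i j)).
have Hx p (i : 'I_(b p)) (k : 'I_(b p.+2)) : exists (a : nat -> R) q,
    \sum_j d p i j *: om (t p.+1 j k) = \sum_(l < e) a l *: om (z l) + iota x q.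
  apply: koszul_cycle1.
    rewrite linear_sum; apply: eq_bigr => j _ /=.
    by rewrite prKZ prK_omega prK0_uK.
  rewrite linear_sum /=; transitivity (\sum_j (d p i j * d p.+1 j k) *: uK e (1 : R^o)).
    apply: eq_bigr => j _; rewrite iotaZ iota_omega iota_uK linear0 subr0 scalerA.
    by rewrite (tE p.+1).
  have := congr1 (fun M : 'M_(_, _) => M i k) (minres_dd dP p).
  by rewrite -scaler_suml !mxE => ->; rewrite scale0r.
pose Xc p i k := projT1 (cid (Hx p i k)).
have XcE p i k : exists q, \sum_j d p i j *: om (t p.+1 j k) = \sum_(l < e) Xc p i k l *: om (z l) + iota x q.
  exact: projT2 (cid (Hx p i k)).
have [k [pi [piE pis]]] := residue_field al.
(* Truncation beyond [n0] makes the tensor square exact in positive degrees, and so does any further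
   truncation by [N], as [zero_betti] requires. The operators act on row vectors, hence the exchange
   of indices in [X]. *)
pose b1 p := b (p + n0).+1.
pose X (l : 'I_e) n : 'M[k]_(b1 n.+2, b1 n) := \matrix_(r, i) pi (Xc (n + n0).+1 i r l).
suff [n bn] : exists n, b1 n = 0%N by exists (n + n0).+1.
pose d1 p : 'M[R]_(b (p + n0).+1, b (p + n0).+2) := d (p + n0).+1.
have dP1 : minres m (b := fun p => b (p + n0).+1) d1.
  by split=> [p i j|p v]; [exact: mr_min dP _ _ _|exact: (mr_ex dP)].
pose t1 p (i : 'I_(b (p + n0).+1)) (j : 'I_(b (p.+1 + n0).+1)) := t (p + n0).+1 i j.
have tE1 p i j : d1 p i j = dot e x (t1 p i j) by exact: tE.
pose X1 p (i : 'I_(b (p + n0).+1)) (j : 'I_(b (p.+2 + n0).+1)) := Xc (p + n0).+1 i j.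
have XE1 p i j : exists q, \sum_k d1 p i k *: om (t1 p.+1 k j) = \sum_(l < e) X1 p i j l *: om (z l) + iota x q.
  exact: XcE.
pose dN N p : 'M[R]_(b (p + N + n0).+1, b (p + N + n0).+2) := d (p + N + n0).+1.
have dPN N : minres m (b := fun p => b (p + N + n0).+1) (dN N).
  by split=> [p i j|p v]; [exact: mr_min dP _ _ _|exact: (mr_ex dP)].
pose tN N p (i : 'I_(b (p + N + n0).+1)) (j : 'I_(b (p.+1 + N + n0).+1)) := t (p + N + n0).+1 i j.
have tEN N p i j : dN N p i j = dot e x (tN N p i j) by exact: tE.
pose XN N p (i : 'I_(b (p + N + n0).+1)) (j : 'I_(b (p.+2 + N + n0).+1)) := Xc (p + N + n0).+1 i j.
have XEN N p i j : exists q, \sum_k dN N p i k *: om (tN N p.+1 k j) = \sum_(l < e) XN N p i j l *: om (z l) + iota x q.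
  exact: XcE.
have pi_sum a (f g' : 'I_a -> R) : pi (\sum_i f i * g' i) = \sum_i pi (f i) * pi (g' i).
  by rewrite rmorph_sum; apply: eq_bigr => i _; rewrite rmorphM.
apply: (zero_betti (X := X)).
- move=> l l' n; apply/matrixP => r i; rewrite !mxE.
  have E l1 l2 : \sum_j X l1 n.+2 r j * X l2 n j i =
      pi (\sum_k Xc (n + n0).+1 i k l2 * Xc (n + n0).+3 k r l1).
    by rewrite pi_sum; apply: eq_bigr => j _; rewrite !mxE mulrC.
  rewrite !E; apply/eqP; rewrite -subr_eq0 -rmorphB; apply/eqP/piE.
  exact: (chi_comm dP1 tE1 XE1 (n := n) i r (ltn_ord l') (ltn_ord l)).
- have [n1 n1P] := chi_minimal dP1 tE1 XE1.
  exists n1 => n len v vX.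
  have [w wE] := choice (fun j => pis (v 0 j)).
  apply/matrixP => i0 j; rewrite ord1 mxE -wE; apply/piE.
  have H := n1P n len (\col_j w j) _ j; move: H; rewrite mxE; apply=> l i lt; apply/piE.
  rewrite pi_sum; have := congr1 (fun M : 'rV_(_) => M 0 i) (vX (Ordinal lt)); rewrite !mxE => E.
  by rewrite -[RHS]E; apply: eq_bigr => r _; rewrite !mxE wE mulrC.
- move=> N.
  have TN q (Y : 'M[R]_(b (0 + N + n0).+1, b (q.+1 + N + n0).+1)) :
      (exists Z : 'M[R]_(b (1 + N + n0).+1, b (q + N + n0).+1), Y *m (dN N q)^T = dN N 0%N *m Z) ->
      exists Y' : 'M[R]_(b (1 + N + n0).+1, b (q.+1 + N + n0).+1),
      Y *m (dN N q)^T = dN N 0%N *m Y' *m (dN N q)^T.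
    move=> [Z ZE]; apply: (TI (N + n0)%N (q + N + n0).+1); first exact: leq_addl.
    by rewrite -mulmxA ZE mulmxA (minres_dd dP) mul0mx.
  have [n1 n1P] := chi2_minimal (dPN N) (tEN N) (XEN N) TN.
  have [w wE] := choice pis.
  exists n1 => n len Y YX p q pq.
  pose W p q : 'M[R]_(b (p + N + n0).+1, b (q + N + n0).+1) := \matrix_(i, j) w (Y p q i j).
  apply/matrixP => i j; rewrite [RHS]mxE -(wE (Y p q i j)); apply/piE.
  have H := n1P n len W _ p q pq i j; move: H; rewrite mxE; apply=> l p' q' lt pq' i' j'; apply/piE.
  rewrite rmorphD !pi_sum; have := congr1 (fun M : 'M_(_, _) => M i' j') (YX (Ordinal lt) p' q' pq').
  rewrite !mxE => E; rewrite -[RHS]E; congr (_ + _); apply: eq_bigr => r _; rewrite !mxE wE // mulrC //.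
Qed.

End ExteriorKoszulHomology.

(** * Lengths of images in the tensor square *)

Section TensorLengths.
Variables (R : comNzRingType) (m : set R^o) (s : R) (gor : gor_local m s).
Variables (b : nat -> nat) (d : forall p, 'M[R]_(b p, b p.+1)) (n0 : nat).
Hypotheses (dP : minres m d) (TI : forall p q, (n0 <= p)%N -> tor_indep d d p q).
Let al := gl_al gor.
Local Notation lam := (len [set: R^o]).
Local Notation m2 := (smul (m : set R) m).

(** [Gt k q] is the tensor product of a free module of rank [k] with the image of [d q], and
    [Xt p q] is the image of the tensor product of [d p] and [d q]. *)
Local Notation Mr k q := (mulmxr (d q)^T : {linear 'M[R]_(k, b q.+1) -> 'M[R]_(k, b q)}).
Local Notation Ml p k := (mulmx (d p) : {linear 'M[R]_(b p.+1, k) -> 'M[R]_(b p, k)}).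
Local Notation Gt k q := (range (Mr k q)).
Local Notation Xt p q := (range (Ml p (b q) \o Mr (b p.+1) q)).

Let exMr k q (Y : 'M[R]_(k, b q.+1)) : Y *m (d q)^T = 0 -> exists Y', Y = Y' *m (d q.+1)^T.
Proof.
move=> /(congr1 trmx); rewrite trmx_mul trmxK trmx0 => /(minres_exM dP)[W WE].
by exists W^T; rewrite -trmx_mul -WE trmxK.
Qed.

Let flM k l : fl [set: 'M[R]_(k, l)]. Proof. by case: (@len_mx R k l (al_fl al)). Qed.

Let len_G k q : (len (Gt k q) + len (Gt k q.+1) = k * b q.+1 * lam)%N.
Proof.
have [_ <-] := @len_mx R k (b q.+1) (al_fl al).
rewrite (len_exact (Mr k q) (flM _ _)); congr (_ + len _)%N.
apply/seteqP; split=> [_ [Y _ <-]|Y [_ /exMr[Y' ->]]]; last by exists Y'.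
split=> //; rewrite /ker /mkset /= -mulmxA -trmx_mul (minres_dd dP) trmx0 mulmx0 //.
Qed.

(** The vanishing of Tor enters here: the resolution stays exact after tensoring with the image of
    [d q]. *)
Let len_X p q : (n0 <= p)%N -> (len (Xt p q) + len (Xt p.+1 q) = len (Gt (b p.+1) q))%N.
Proof.
move=> le; have fG : fl (Gt (b p.+1) q) by apply: fl_img; exact: flM.
rewrite (len_exact (Ml p (b q)) fG); congr (_ + _)%N; congr len.
  by apply/seteqP; split=> [_ [Y _ <-]|_ [_ [Y _ <-] <-]]; [exists (Mr _ q Y) => //; exists Y|exists Y].
apply/seteqP; split=> [_ [Y _ <-]|_ [[Y _ <-] /= Y0]].
  split; first by exists (d p.+1 *m Y) => //=; rewrite mulmxA.
  by rewrite /ker /mkset /= mulmxA (minres_dd dP) mul0mx.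
have [Y' E] := TI le (etrans (esym (mulmxA _ _ _)) Y0).
by exists Y' => //=; rewrite E mulmxA.
Qed.

Let kerX p q : (n0 <= p)%N -> forall Y, d p *m Y *m (d q)^T = 0 ->
  exists Y1 Y2, Y = d p.+1 *m Y1 + Y2 *m (d q.+1)^T.
Proof.
move=> le Y /(TI le)[Y1 E]; have : (Y - d p.+1 *m Y1) *m (d q)^T = 0 by rewrite mulmxBl E subrr.
by move=> /exMr[Y2 E2]; exists Y1, Y2; rewrite -E2 addrC subrK.
Qed.

Let len_Xker p q : (len (Xt p q) + len (ker (Ml p (b q) \o Mr (b p.+1) q)) = b p.+1 * b q.+1 * lam)%N.
Proof.
have [_ <-] := @len_mx R (b p.+1) (b q.+1) (al_fl al).
by rewrite (len_exact (Ml p (b q) \o Mr (b p.+1) q) (flM _ _)) setTI.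
Qed.

Let ker_in p q (I : set R^o) : subm I -> (forall i j k, I (d p i j * k)) ->
  (forall i j k, I (k * d q i j)) ->
  forall Y1 Y2, mxin I (d p *m Y1 + Y2 *m (d q)^T).
Proof.
move=> sI h1 h2 Y1 Y2 i j; rewrite !mxE; apply: (subD sI); apply: (@sub_sum R R^o) => // k _.
by rewrite mxE; exact: h2.
Qed.

(** The kernel of the tensor product of the two maps has entries in [m], by the vanishing of Tor and
    minimality. *)
Lemma len_X_ge p q : (n0 <= p)%N -> (b p.+1 * b q.+1 <= len (Xt p q))%N.
Proof.
move=> le; have h := len_Xker p q; have [lm _] := len_m gor.
have [fm lmx] := @len_mxin R (b p.+1) (b q.+1) m (fl_sub (al_fl al) (al_sub al) (fun _ _ => Logic.I)).
have := len_sub fm (subm_ker (Ml p (b q) \o Mr (b p.+1) q)) _.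
have sub : ker (Ml p (b q) \o Mr (b p.+1) q) `<=` mxin m.
  move=> Y; rewrite /ker /mkset /= mulmxA => /(kerX le)[Y1 [Y2 ->]].
  apply: ker_in (al_sub al) _ _ _ _ => i j k; last by apply: (@subZ R R^o _ _ _ (al_sub al)); exact: (mr_min dP).
  by rewrite mulrC; apply: (@subZ R R^o _ _ _ (al_sub al)); exact: (mr_min dP).
move=> /(_ sub); rewrite lmx => h2; move: h; rewrite -lm.
by move: h2; set B := (b _ * _)%N; set y := len (ker _); set u := len (Xt _ _); set v := len m; nia.
Qed.

(** Modulo [m^2] the same kernel is generated by the images of the basis matrices of the two
    adjacent terms. *)
Lemma len_X_ge2 p q : (n0 <= p)%N ->
  (b p.+1 * b q.+1 * lam <= len (Xt p q) + b p.+1 * b q.+1 * len m2 + b p.+2 * b q.+1 + b p.+1 * b q.+2)%N.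
Proof.
move=> le; have h := len_Xker p q.
have sm2 : subm m2 by exact: subm_smul.
have [fm lmx] := @len_mxin R (b p.+1) (b q.+1) m2 (fl_sub (al_fl al) sm2 (fun _ _ => Logic.I)).
have mm2 (x y : R) : m x -> m y -> m2 (x * y) by move=> mx my; exact: (@smul_incl R R^o _ _ x y).
pose e1 (k : 'I_(b p.+2 * b q.+1)) : 'M[R]_(b p.+1, b q.+1) := d p.+1 *m vec_mx (delta_mx 0 k).
pose e2 (k : 'I_(b p.+1 * b q.+2)) : 'M[R]_(b p.+1, b q.+1) := vec_mx (delta_mx 0 k) *m (d q.+1)^T.
have me1 (x : R) k : m x -> mxin m2 (x *: e1 k).
  move=> mx i j; rewrite !mxE mulr_sumr; apply: (@sub_sum R R^o) => // l _; rewrite mulrA mulrC.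
  by apply: (@subZ R R^o _ _ _ sm2); apply: (mm2 x _ mx); exact: (mr_min dP).
have me2 (x : R) k : m x -> mxin m2 (x *: e2 k).
  move=> mx i j; rewrite !mxE mulr_sumr; apply: (@sub_sum R R^o) => // l _; rewrite mulrCA.
  by apply: (@subZ R R^o _ _ _ sm2); rewrite mxE; apply: (mm2 x _ mx); exact: (mr_min dP).
have [f1 l1] := len_addgens (al_unit al) (e := e1) fm me1.
have sm1 := subm_mxin (a := b p.+1) (b := b q.+1) sm2.
have sg1 : subm (gen e1) by exact: subm_gen.
have [f2 l2] := len_addgens (al_unit al) (e := e2) f1 (fun x i mx => addmL sg1 (me2 x i mx)).
have sub : ker (Ml p (b q) \o Mr (b p.+1) q) `<=` addm (addm (mxin m2) (gen e1)) (gen e2).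
  move=> Y; rewrite /ker /mkset /= mulmxA => /(kerX le)[Y1 [Y2 ->]].
  exists (d p.+1 *m Y1).
    apply: (addmR sm1); exists (fun k => mxvec Y1 0 k); rewrite -{1}[Y1]mxvecK {1}[mxvec Y1]row_sum_delta.
    rewrite linear_sum mulmx_sumr; apply: eq_bigr => k _.
    by rewrite linearZ /= -scalemxAr.
  exists (Y2 *m (d q.+1)^T) => //.
  exists (fun k => mxvec Y2 0 k); rewrite -{1}[Y2]mxvecK {1}[mxvec Y2]row_sum_delta.
  rewrite linear_sum mulmx_suml; apply: eq_bigr => k _.
  by rewrite linearZ /= -scalemxAl.
have := len_sub f2 (subm_ker _) sub; move: h l1 l2; rewrite lmx.
set y := len (ker _); set u := len (Xt _ _); set w1 := len (addm _ _); set w2 := len (addm _ _).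
by move=> h l1 l2 l3; rewrite -h -!addnA leq_add2l; lia.
Qed.

Lemma len_X4 p q : (n0 <= p)%N ->
  (len (Xt p q) + len (Xt p.+1 q) + len (Xt p q.+1) + len (Xt p.+1 q.+1) = b p.+1 * b q.+1 * lam)%N.
Proof. by move=> le; rewrite len_X // -addnA len_X // len_G. Qed.

(** The four images of [len_X4] with [p = q] are each bounded below by [len_X_ge]; the lower bounds
    add up to the square. *)
Lemma betti_square p : (n0 <= p)%N -> ((b p.+1 + b p.+2) ^ 2 <= lam * b p.+1 ^ 2)%N.
Proof.
move=> le; have := len_X4 p le; have le' := leqW le.
have := len_X_ge p le; have := len_X_ge p le'; have := len_X_ge p.+1 le; have := len_X_ge p.+1 le'.
set u1 := len _; set u2 := len _; set u3 := len _; set u4 := len _.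
by move: (b p.+1) (b p.+2) (lam) => x y l; nia.
Qed.

Lemma betti_square2 (e : nat) p : (n0 <= p)%N -> lam = (len m2 + 1 + e)%N ->
  ((e + 1) * (b p.+1 + b p.+2) ^ 2 <= lam * b p.+1 ^ 2 + 2 * (b p.+1 + b p.+2) * (b p.+2 + b p.+3))%N.
Proof.
move=> le lE; have := len_X4 p le; have le' := leqW le.
have := len_X_ge2 p le; have := len_X_ge2 p le'; have := len_X_ge2 p.+1 le; have := len_X_ge2 p.+1 le'.
rewrite lE; set u1 := len (Xt _ _); set u2 := len (Xt _ _); set u3 := len (Xt _ _); set u4 := len (Xt _ _).
move: (b p.+1) (b p.+2) (b p.+3) (len m2) => x y w l; nia.
Qed.

(** By [betti_square] the ratio of consecutive Betti numbers is at most [sqrt 11 - 1], which is less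
    than 7/3. *)
Lemma betti_ratio p : (n0 <= p)%N -> (lam <= 11)%N -> (3 * b p.+2 <= 7 * b p.+1)%N.
Proof. by move=> /betti_square; move: (b p.+1) (b p.+2) (lam) => x y l h le; nia. Qed.

End TensorLengths.

(** * Growth of Betti numbers *)

Section FunctionLengths.
Variable R : comNzRingType.

Lemma len_fpair (J : Type) (V W : lmodType R) (U : set (J -> V)) (X : set (J -> W)) : fl U -> fl X ->
  let S := [set w : J -> V * W | U (fun j => (w j).1) /\ X (fun j => (w j).2)] in
  fl S /\ len S = (len U + len X)%N.
Proof.
move=> fU fX S.
pose f1 (w : J -> V * W) : J -> V := fun j => (w j).1; have l1 : linear f1 by [].
pose F : {linear (J -> V * W : lmodType R) -> (J -> V)} := HB.pack f1 (GRing.isLinear.Build _ _ _ _ f1 l1).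
pose f2 (w : J -> V * W) : J -> W := fun j => (w j).2; have l2 : linear f2 by [].
pose G : {linear (J -> V * W : lmodType R) -> (J -> W)} := HB.pack f2 (GRing.isLinear.Build _ _ _ _ f2 l2).
have sU : subm U := fU.1; have sX : subm X := fX.1.
have sS : subm S.
  split=> [|a p q [p1 p2] [q1 q2]]; first by split; [exact: (sub0 sU)|exact: (sub0 sX)].
  by split; [exact: (sU.2 a _ _ p1 q1)|exact: (sX.2 a _ _ p2 q2)].
have iF : [set F x | x in S] = U.
  apply/seteqP; split=> [_ [p [? _] <-] //|v Uv].
  by exists (fun j => (v j, 0)) => //; split=> //=; exact: (sub0 sX).
have sK := submI sS (subm_ker F).
have iG : [set G x | x in S `&` ker F] = X.
  apply/seteqP; split=> [_ [p [[_ ?] _] <-] //|w Xw].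
  by exists (fun j => (0, w j)) => //; split=> //; split=> //; exact: (sub0 sU).
have injG p : (S `&` ker F) p -> G p = 0 -> p = 0.
  move=> [_ a0] b0; apply/funext => j; have := congr1 (fun h => h j) a0; have := congr1 (fun h => h j) b0.
  by rewrite /= /f1 /f2; case: (p j) => a b /= -> ->.
have fK : fl (S `&` ker F).
  apply: (@fl_exact _ _ _ G) => //; first by rewrite iG.
  suff -> : S `&` ker F `&` ker G = [set 0] by exact: fl0.
  apply/seteqP; split=> [p [Sp Gp]|_ ->]; first exact: injG.
  by split=> //; split=> //; apply: sub0.
have fS : fl S by apply: (@fl_exact _ _ _ F) => //; rewrite iF.
split=> //.
by rewrite (len_exact F fS) iF -(len_inj (f := G) fK injG) iG.
Qed.

Lemma len_pow (V : lmodType R) (U : set V) a : fl U ->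
  fl [set w : 'I_a -> V | forall k, U (w k)] /\ len [set w : 'I_a -> V | forall k, U (w k)] = (a * len U)%N.
Proof.
move=> fU; have sU : subm U := fU.1; elim: a => [|a [f0 l0]].
  have -> : [set w : 'I_0 -> V | forall k, U (w k)] = [set 0].
    by apply/seteqP; split=> [w _|_ -> []] //; apply/funext => -[].
  by split; [exact: fl0|rewrite len0].
set S := [set w | _].
have sS : subm S.
  by split=> [k|c w w' Sw Sw' k]; [exact: sub0|case: sU => _ h; exact: h (Sw k) (Sw' k)].
pose f1 (w : 'I_a.+1 -> V) : V := w ord0; have l1 : linear f1 by [].
pose F : {linear ('I_a.+1 -> V) -> V} := HB.pack f1 (GRing.isLinear.Build _ _ _ _ f1 l1).
pose f2 (w : 'I_a.+1 -> V) : 'I_a -> V := fun k => w (lift ord0 k); have l2 : linear f2 by [].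
pose G : {linear ('I_a.+1 -> V) -> ('I_a -> V)} := HB.pack f2 (GRing.isLinear.Build _ _ _ _ f2 l2).
have iF : [set F x | x in S] = U.
  apply/seteqP; split=> [_ [w Sw <-]|v Uv]; first exact: Sw.
  by exists (fun=> v).
have sK := submI sS (subm_ker F).
have iG : [set G x | x in S `&` ker F] = [set w : 'I_a -> V | forall k, U (w k)].
  apply/seteqP; split=> [_ [w [Sw _] <-] k|w Uw]; first exact: Sw.
  exists (fun k => if unlift ord0 k is Some j then w j else 0).
    split=> [k|]; first by case: (unlift ord0 k) => [j|]; [exact: Uw|exact: sub0].
    by rewrite /ker /mkset /= /f1 unlift_none.
  by apply/funext => k; rewrite /= /f2 liftK.
have injG w : (S `&` ker F) w -> G w = 0 -> w = 0.
  move=> [_ w0] wG; apply/funext => k; case: (unliftP ord0 k) => [j|] ->; last exact: w0.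
  exact: (congr1 (fun h => h j) wG).
have fK : fl (S `&` ker F).
  apply: (@fl_exact _ _ _ G) => //; first by rewrite iG.
  suff -> : S `&` ker F `&` ker G = [set 0] by exact: fl0.
  apply/seteqP; split=> [p [Sp Gp]|_ ->]; first exact: injG.
  by split=> //; split=> //; apply: sub0.
have fS : fl S by apply: (@fl_exact _ _ _ F) => //; rewrite iF.
by split=> //; rewrite (len_exact F fS) iF -(len_inj (f := G) fK injG) iG l0 mulSn.
Qed.

Lemma mact_linear (V : lmodType R) a c (M : 'M[R]_(a, c)) : linear (@mact R V a c M).
Proof.
move=> r v w; apply/funext => i; rewrite /mact.
transitivity (r *: (\sum_j M i j *: v j) + \sum_j M i j *: w j) => //.
rewrite scaler_sumr -big_split /=; apply: eq_bigr => j _.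
by rewrite -[(r *: v + w) j]/(r *: v j + w j) scalerDr !scalerA mulrC.
Qed.
HB.instance Definition _ (V : lmodType R) a c M := GRing.isLinear.Build R ('I_c -> V) ('I_a -> V) _
  (@mact R V a c M) (@mact_linear V a c M).

Lemma mact_map (V W : lmodType R) (h : {linear V -> W}) a c (M : 'M[R]_(a, c)) w k :
  h (mact M w k) = mact M (fun j => h (w j)) k.
Proof. by rewrite /mact linear_sum; apply: eq_bigr => j _; rewrite linearZ. Qed.

(* Families of elements of degree [i] of [ext n R^o] whose coefficients on each
   exterior monomial form a vector of [A]. *)
Fixpoint inK a (A : set ('I_a -> R^o)) n i : set ('I_a -> ext n R^o) :=
  if n is n'.+1 then
    [set w | @inK a A n' i (fun k => (w k).1) /\ (if i is j.+1 then @inK a A n' j else [set 0]) (fun k => (w k).2)]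
  else if i is 0%N then A else [set 0].

Arguments inK {a} A n i _.

Lemma len_inK a (A : set ('I_a -> R^o)) n i : fl A -> fl (inK A n i) /\ len (inK A n i) = ('C(n, i) * len A)%N.
Proof.
move=> fA; elim: n i => [|n IH] [|i] /=.
- by rewrite bin0 mul1n.
- by rewrite bin0n mul0n len0; split=> //; exact: fl0.
- have [h1 h2] := IH 0%N; have [h3 h4] := len_fpair h1 (@fl0 R ('I_a -> ext n R^o)).
  by split=> //; rewrite h4 h2 len0 addn0 !bin0.
- have [h1 h2] := IH i.+1; have [h3 h4] := IH i; have [h5 h6] := len_fpair h1 h3.
  by split=> //; rewrite h6 h2 h4 binS mulnDl.
Qed.

Lemma inKT a n i (w : 'I_a -> ext n R^o) : inK (a := a) setT n i w <-> forall k, prK i (w k) = w k.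
Proof.
elim: n i w => [|n IH] [|i] w /=.
- by [].
- split=> [-> k //|h]; apply/funext => k; by rewrite -h.
- split=> [[/IH h1 h2] k|h].
    apply: pair_eq; rewrite /= ?h1 //.
    by rewrite -[LHS](congr1 (fun f => f k) h2).
  split; first by apply/IH => k; rewrite -{2}h.
  by apply/funext => k; rewrite -h.
- split=> [[/IH h1 /IH h2] k|h]; first by apply: pair_eq; rewrite /= ?h1 ?h2.
  by split; apply/IH => k; rewrite -{2}h.
Qed.

Lemma mact_fst n a c (M : 'M[R]_(a, c)) (w : 'I_c -> ext n.+1 R^o) k :
  (mact M w k).1 = mact M (fun j => (w j).1) k.
Proof. by rewrite /mact; elim/big_rec2: _ => //= j x y _ <-. Qed.
Lemma mact_snd n a c (M : 'M[R]_(a, c)) (w : 'I_c -> ext n.+1 R^o) k :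
  (mact M w k).2 = mact M (fun j => (w j).2) k.
Proof. by rewrite /mact; elim/big_rec2: _ => //= j x y _ <-. Qed.

Lemma inK_img n i a c (M : 'M[R]_(a, c)) :
  [set mact M w | w in inK (a := c) setT n i] = inK (range (@mact R R^o a c M)) n i.
Proof.
have m0 n' : mact M (fun=> 0 : ext n' R^o) = 0 by exact: (linear0 (@mact R (ext n' R^o) a c M)).
elim: n i => [|n IH] i.
  case: i => [|i] /=; first by [].
  by apply/seteqP; split=> [_ [w -> <-]|_ ->]; [rewrite linear0|exists 0; rewrite ?linear0].
apply/seteqP; split=> [_ [w [w1 w2] <-]|w [w1 w2]].
  split; first by rewrite -IH; exists (fun j => (w j).1) => //; apply/funext => k; rewrite mact_fst.
  have -> : (fun k => (mact M w k).2) = mact M (fun j => (w j).2) by apply/funext => k; rewrite mact_snd.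
  case: i w2 {w1} => [|i] w2; last by rewrite -IH; exists (fun j => (w j).2).
  by rewrite (w2 : _ = 0); exact: m0.
have {w1} : inK (range (@mact R R^o a c M)) n i (fun k => (w k).1) := w1.
rewrite -IH => -[v1 v1i v1E].
have [v2 v2i v2E] : exists2 v2, (if i is j.+1 then inK (a := c) setT n j else [set 0]) v2 & mact M v2 = (fun k => (w k).2).
  case: i w2 {v1i} => [|i] w2; first by exists 0 => //; rewrite (w2 : _ = 0); exact: m0.
  have {w2} : inK (range (@mact R R^o a c M)) n i (fun k => (w k).2) := w2.
  by rewrite -IH => -[v2 h E]; exists v2.
exists (fun j => (v1 j, v2 j)); first by split.
apply/funext => k; apply: pair_eq; rewrite ?mact_fst ?mact_snd.
  exact: (congr1 (fun f => f k) v1E).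
exact: (congr1 (fun f => f k) v2E).
Qed.

Lemma inK_ker n i a c (M : 'M[R]_(a, c)) (A : set ('I_c -> R^o)) :
  (forall v, mact M v = 0 -> A v) -> forall w, inK (a := c) setT n i w -> mact M w = 0 -> inK A n i w.
Proof.
move=> kA; elim: n i => [|n IH] i w.
  by case: i => [|i] //= _; exact: kA.
move=> [w1 w2] w0; split.
  by apply: IH => //; apply/funext => k; rewrite -[mact _ _ _]mact_fst w0.
have w20 : mact M (fun j => (w j).2) = 0 by apply/funext => k; rewrite -[mact _ _ _]mact_snd w0.
by case: i w2 {w1} => [|i] // w2; apply: IH.
Qed.

Lemma omega_sum (V : lmodType R) n (I : Type) (r : seq I) (c : I -> R) (t : I -> nat -> R) (f : ext n V) :
  omega (fun l => \sum_(j <- r) c j * t j l) f = \sum_(j <- r) c j *: omega (t j) f.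
Proof.
elim: n t f => [|n IH] t f; first by rewrite /= big1 // => j _; rewrite scaler0.
have E1 (F : I -> ext n.+1 V) : (\sum_(j <- r) F j).1 = \sum_(j <- r) (F j).1.
  by elim/big_rec2: _ => //= j x y _ <-.
have E2 (F : I -> ext n.+1 V) : (\sum_(j <- r) F j).2 = \sum_(j <- r) (F j).2.
  by elim/big_rec2: _ => //= j x y _ <-.
apply: pair_eq; rewrite ?E1 ?E2 /=; first exact: (IH (fun j => tl (t j))).
rewrite (IH (fun j => tl (t j))) scaler_suml -sumrB; apply: eq_bigr => j _.
by rewrite scalerBr scalerA.
Qed.

End FunctionLengths.

Arguments inK {R a} A n i _.

Section Growth.
Variables (R : comNzRingType) (m : set R^o) (s : R) (gor : gor_local m s) (e : nat) (x : nat -> R).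
Hypotheses (xm : forall t, m (dot e x t)) (xg : forall r, m r -> exists t, r = dot e x t).
Let al := gl_al gor.
Local Notation lam := (len [set: R^o]).
Local Notation K := (ext e R^o).
Local Notation om t := (omega t (uK e (1 : R^o))).

Definition Zk i : set K := [set f | prK i f = f /\ iota x f = 0].
Definition Bk i : set K := [set (iota x : K -> K) f | f in [set f | prK i.+1 f = f]].
Definition zeta i := len (Zk i).

Lemma Gk_subm i : subm [set f : K | prK i f = f].
Proof.
split=> [|a f g /= Ef Eg]; first by rewrite /= linear0.
by rewrite prKD prKZ Ef Eg.
Qed.
Lemma Zk_subm i : subm (Zk i).
Proof.
split=> [|a f g [Ef f0] [Eg g0]]; first by split; rewrite linear0.
by split; [rewrite prKD prKZ Ef Eg|rewrite iotaD iotaZ f0 g0 scaler0 addr0].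
Qed.
Lemma Bk_subm i : subm (Bk i).
Proof. exact: (subm_img (iota x : {linear K -> K}) (Gk_subm i.+1)). Qed.
Lemma fl_K (U : set K) : subm U -> fl U.
Proof. by move=> sU; apply: fl_sub (fl_ext gor e) sU _. Qed.

Lemma kill_Zk i r f : m r -> Zk i f -> Bk i (r *: f).
Proof.
move=> /xg[t ->] [fi f0]; exists (omega t f); first by rewrite /= prK_omega fi.
by rewrite iota_omega f0 linear0 subr0.
Qed.

Lemma len_Gk i : len [set f : K | prK i f = f] = ('C(e, i) * lam)%N.
Proof.
have [_] := len_inK e i (proj1 (len_pow 1 (al_fl al))); rewrite (len_pow 1 (al_fl al)).2 mul1n.
have -> : [set w : 'I_1 -> R^o | forall k, [set: R^o] (w k)] = setT by apply/seteqP.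
have -> : inK (a := 1) setT e i = [set w : 'I_1 -> K | forall k, [set f : K | prK i f = f] (w k)].
  by apply/seteqP; split=> w /inKT.
by rewrite (len_pow 1 (fl_K (Gk_subm i))).2 mul1n.
Qed.

Lemma zeta_exact i : (zeta i.+1 + len (Bk i) = 'C(e, i.+1) * lam)%N.
Proof.
rewrite -len_Gk (len_exact (iota x : {linear K -> K}) (fl_K (Gk_subm i.+1))) addnC; congr (_ + _)%N.
Qed.

Variables (b : nat -> nat) (d : forall p, 'M[R]_(b p, b p.+1)).
Hypothesis dP : minres m d.
Definition Aim p : set ('I_(b p) -> R^o) := range (@mact R R^o _ _ (d p)).
Arguments Aim p _ : clear implicits.
Local Notation alpha p := (len (Aim p)).
Local Notation V p := ('I_(b p) -> K).
Local Notation dd p := (@mact R K _ _ (d p) : {linear V p.+1 -> V p}).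
Local Notation D p := (mapJ (J := 'I_(b p)) (@iota R R^o e x : {linear K -> K}) : {linear V p -> V p}).
Local Notation G p i := (inK (setT : set ('I_(b p) -> R^o)) e i).
Local Notation N p i := (inK (Aim p) e i).
Local Notation Zf p i := [set w : V p | forall k, Zk i (w k)].

Let dR p := (@mact R R^o _ _ (d p) : {linear ('I_(b p.+1) -> R^o) -> ('I_(b p) -> R^o)}).

Let ddd (W : lmodType R) p (w : 'I_(b p.+2) -> W) : mact (d p) (mact (d p.+1) w) = 0.
Proof. by rewrite -mactM (minres_dd dP); apply/funext => i; rewrite /mact big1 // => j _; rewrite mxE scale0r. Qed.

Let exR p (v : 'I_(b p.+1) -> R^o) : mact (d p) v = 0 -> Aim p.+1 v.
Proof.
move=> v0; have [|w wE] := (mr_ex dP (\col_j (v j : R))).1.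
  apply/matrixP => i j; rewrite !mxE -[RHS](congr1 (fun f => f i) v0).
  by apply: eq_bigr => k _; rewrite mxE.
exists (fun k => w k 0) => //; apply/funext => i.
have := congr1 (fun M : 'cV_ _ => M i 0) wE; rewrite !mxE => ->.
by apply: eq_bigr.
Qed.

Let flT p : fl [set: 'I_(b p) -> R^o].
Proof.
have [h _] := len_pow (b p) (al_fl al); suff <- : [set w : 'I_(b p) -> R^o | forall k, [set: R^o] (w k)] = setT by [].
by apply/seteqP.
Qed.
Let lenT p : len [set: 'I_(b p) -> R^o] = (b p * lam)%N.
Proof.
have [_ <-] := len_pow (b p) (al_fl al); congr len.
by apply/seteqP.
Qed.
Let flA p : fl (Aim p). Proof. by apply: (@fl_img _ _ _ (dR p)); exact: flT. Qed.

Lemma len_Aim p : (alpha p + alpha p.+1 = b p.+1 * lam)%N.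
Proof.
rewrite -lenT (len_exact (dR p) (flT p.+1)); congr (_ + len _)%N.
apply/seteqP; split=> [_ [w _ <-]|v [_ /exR]//]; split=> //; exact: ddd.
Qed.

Let flG p i : fl (G p i). Proof. by have [h _] := len_inK e i (flT p). Qed.
Let flN p i : fl (N p i). Proof. by have [h _] := len_inK e i (flA p). Qed.
Let lenN p i : len (N p i) = ('C(e, i) * alpha p)%N.
Proof. by have [_ h] := len_inK e i (flA p); rewrite h. Qed.
Let lenZ p i : len (Zf p i) = (b p * zeta i)%N.
Proof. by have [_ h] := len_pow (b p) (fl_K (Zk_subm i)); rewrite h. Qed.
Let flZ p i : fl (Zf p i).
Proof. by have [h _] := len_pow (b p) (fl_K (Zk_subm i)). Qed.
Let Nimg p i : [set dd p w | w in G p.+1 i] = N p i. Proof. exact: inK_img. Qed.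
Let Nker p i w : G p.+1 i w -> dd p w = 0 -> N p.+1 i w. Proof. by apply: inK_ker; exact: exR. Qed.
Let NG p i : N p i `<=` G p i.
Proof.
move=> w; rewrite -Nimg => -[v /inKT vi <-]; apply/inKT => k.
by rewrite (mact_map (prK i : {linear K -> K})); congr (mact _ _ _); apply/funext.
Qed.
Let Ndd p i w : N p.+1 i w -> dd p w = 0.
Proof. by rewrite -Nimg => -[v _ <-]; exact: ddd. Qed.
Let Ddd p w : D p (dd p w) = dd p (D p.+1 w).
Proof. by apply/funext => k; exact: (mact_map (iota x : {linear K -> K})). Qed.

Local Notation mA p := [set dR p v | v in [set v | forall k, m (v k)]].

Let len_mA p : (len (mA p) + b p.+1 = alpha p)%N.
Proof.
have [fm lm] := len_pow (b p.+1) (fl_sub (al_fl al) (al_sub al) (fun _ _ => Logic.I)).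
have := len_exact (dR p) fm; have -> : [set v : 'I_(b p.+1) -> R^o | forall k, m (v k)] `&` ker (dR p) = Aim p.+1.
  apply/seteqP; split=> [v [_ /exR]//|_ [w _ <-]]; split; last exact: ddd.
  move=> k; apply: sub_sum (al_sub al) _ => j _; rewrite -[_ *: _]/(d p.+1 k j * w j) mulrC.
  by apply: (@subZ R R^o _ _ _ (al_sub al)); exact: (mr_min dP).
rewrite lm; have := len_Aim p; have [<- _] := len_m gor.
have key (a0 b0 c0 d0 f0 : nat) : (c0 + d0 = b0 + f0 -> f0 = a0 + d0 -> a0 + b0 = c0)%N by lia.
by rewrite mulnS => h1 h2; exact: key h1 h2.
Qed.

(** The Koszul differential maps the 1-chains with values in the image of [d p] onto [m] times that
    image, whose length is [alpha p - b p.+1]. *)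
Let len_z1 p : (len (N p 1 `&` ker (D p)) + alpha p = e * alpha p + b p.+1)%N.
Proof.
have := len_exact (D p) (flN p 1); rewrite lenN bin1.
have -> : [set D p w | w in N p 1] = [set mapJ (@uK R R^o e : {linear R^o -> K}) v | v in mA p].
  apply/seteqP; split=> [_ [w wN <-]|_ [u [v mv <-] <-]].
    move: wN; rewrite -Nimg => -[v /inKT vi <-]; exists (dR p (fun k => cK (iota x (v k)))).
      exists (fun k => cK (iota x (v k))) => // k.
      have [t tE] := deg1_omega (vi k); rewrite tE iota_omega iota_uK linear0 subr0 linearZ /= cK_uK.
      by rewrite -[_ *: _]/(dot e x t * 1) mulr1.
    rewrite Ddd; apply/funext => k; rewrite /mapJ /= (mact_map (@uK R R^o e : {linear R^o -> K})).
    congr (mact _ _ k); apply/funext => j /=; rewrite -prK0E prK_iota vi //.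
  have [t tE] : exists t : 'I_(b p.+1) -> nat -> R, forall k, v k = dot e x (t k).
    by have [t tE] := choice (fun k => xg (mv k)); exists t.
  exists (dd p (fun k => om (t k))).
    by rewrite -Nimg; exists (fun k => om (t k)) => //; apply/inKT => k; rewrite prK_omega prK0_uK.
  rewrite Ddd; apply/funext => k; rewrite /mapJ /= (mact_map (@uK R R^o e : {linear R^o -> K})).
  congr (mact _ _ k); apply/funext => j /=.
  by rewrite iota_omega iota_uK linear0 subr0 [RHS]uK_scale -tE.
have fm : fl (mA p) by apply: fl_img; case: (len_pow (b p.+1) (fl_sub (al_fl al) (al_sub al) (fun _ _ => Logic.I))).
rewrite (len_inj fm); last first.
  by move=> v _ v0; apply/funext => k; have := congr1 (fun f => cK (f k)) v0; rewrite /= /mapJ cK_uK linear0.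
have key (ea a0 z0 a b0 : nat) : (a0 + b0 = a -> ea = a0 + z0 -> z0 + a = ea + b0)%N by lia.
exact: key (len_mA p).
Qed.

Variables (Q : set K) (t0 : nat).
Hypotheses (sQ : subm Q) (BQ : Bk 2 `<=` Q)
  (ZQ : forall t t', dot e x t = 0 -> dot e x t' = 0 -> Q (omega t (om t')))
  (lenQ : (len Q <= len (Bk 2) + t0)%N).

(* Rank-nullity for the Koszul complexes of consecutive syzygies: [zeta i] is the
   length of the [i]-cycles over [R], and [t0] bounds the length of the products
   of 1-cycles modulo boundaries. *)
Theorem koszul_growth q :
  (zeta 1 * b (q + 4) + zeta 2 * b (q + 3) + zeta 3 * b (q + 2) + 'C(e, 4) * alpha q + alpha (q + 4) <=
   e * alpha (q + 4) + b (q + 5) + 'C(e, 2) * alpha (q + 3) + 'C(e, 3) * alpha (q + 2) + t0 * b (q + 2)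
   + zeta 3 * b (q + 1) + zeta 4 * b q)%N.
Proof.
rewrite !addnS !addn0.
set p := q.+3; pose F1 := [set dd p w | w in Zf p.+1 1].
have fF1 : fl F1 by exact: fl_img (flZ _ _).
have lF1 : (len F1 + e * alpha p.+1 + b p.+2 = zeta 1 * b p.+1 + alpha p.+1)%N.
  have := len_exact (dd p) (flZ p.+1 1); rewrite lenZ.
  have -> : Zf p.+1 1 `&` ker (dd p) = N p.+1 1 `&` ker (D p.+1).
    apply/seteqP; split=> w [w1 w2]; split.
    - by apply: Nker => //; apply/inKT => k; case: (w1 k).
    - by apply/funext => k; case: (w1 k).
    - by move=> k; split; [exact: (inKT _ _).1 (NG w1) k|exact: (congr1 (fun f => f k) w2)].
    - exact: Ndd w1.
  by have := len_z1 p.+1; rewrite -/F1; lia.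
have [t tE] : exists t : 'I_(b p) -> 'I_(b p.+1) -> nat -> R, forall j k, d p j k = dot e x (t j k).
  have h j : exists f : 'I_(b p.+1) -> nat -> R, forall k, d p j k = dot e x (f k).
    by have [f fP] := choice (fun k => xg (mr_min dP j k)); exists f.
  by have [t tE] := choice h; exists t.
(* The entries of [d] lie in [m], so [d] times a 1-cycle is the Koszul boundary of its product with
   the one-forms [t]. *)
pose xi0 (w : V p.+1) : V p := fun j => \sum_k omega (t j k) (w k).
have xi0P w : Zf p.+1 1 w -> G p 2 (xi0 w) /\ D p (xi0 w) = dd p w.
  move=> Zw; split.
    apply/inKT => j; rewrite /xi0 linear_sum; apply: eq_bigr => k _ /=.
    by rewrite prK_omega (Zw k).1.
  apply/funext => j; rewrite /= /mapJ /xi0 linear_sum /mact; apply: eq_bigr => k _ /=.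
  by rewrite iota_omega (Zw k).2 linear0 subr0 tE.
have sD : subm (D p @^-1` F1) by apply: subm_pre; case: fF1.
pose Xi := G p 2 `&` (D p @^-1` F1).
have fXi : fl Xi by apply: fl_sub (flG p 2) (submI (flG p 2).1 sD) _ => w [].
have lXi : (len F1 + zeta 2 * b p <= len Xi)%N.
  rewrite (len_exact (D p) fXi); apply: leq_add.
    apply: len_sub; [exact: fl_img|exact: fF1.1|].
    by move=> _ [w Zw <-]; have [h1 h2] := xi0P w Zw; exists (xi0 w) => //; split=> //; rewrite /preimage /mkset h2; exists w.
  rewrite mulnC -lenZ; apply: len_sub; [|exact: (flZ p 2).1|].
    by apply: fl_sub fXi (submI fXi.1 (subm_ker _)) _ => w [].
  move=> w Zw; have w0 : D p w = 0 by apply/funext => k; case: (Zw k).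
  split=> //; split; first by apply/inKT => k; case: (Zw k).
  by rewrite /preimage /mkset w0; apply: sub0 fF1.1.
pose U := [set dd q.+2 w | w in Xi].
have fU : fl U by exact: fl_img.
have lU : (len Xi <= len U + 'C(e, 2) * alpha p)%N.
  rewrite (len_exact (dd q.+2) fXi) leq_add2l -lenN; apply: len_sub; [exact: flN|exact: submI fXi.1 (subm_ker _)|].
  by move=> w [[w1 _] w2]; apply: Nker.
(* Up to boundaries such an element is a sum of products of the 1-cycles [z k] with one-forms of
   coordinates [d t], which are cycles since [d] squares to zero. *)
have UQ w : U w -> forall i, Q (w i).
  move=> [xi [/inKT xi2 [z Zz zE]] <-] i.
  have [/inKT h1 h2] := xi0P z Zz.
  have -> : dd q.+2 xi i = dd q.+2 (xi0 z) i + dd q.+2 (fun j => xi j - xi0 z j) i.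
    rewrite -[RHS]/((dd q.+2 (xi0 z) + dd q.+2 (xi - xi0 z)) i) -linearD.
    by rewrite addrC subrK.
  apply: subD => //; last first.
    apply: sub_sum => // j _; apply: BQ; apply: kill_Zk; first exact: (mr_min dP).
    split; first by rewrite prKB xi2 h1.
    rewrite iotaB -[iota x (xi j)]/(D p xi j) -[iota x (xi0 z j)]/(D p (xi0 z) j) h2 -zE subrr //.
  have -> : dd q.+2 (xi0 z) i = \sum_k omega (fun l => \sum_j d q.+2 i j * t j k l) (z k).
    transitivity (\sum_j \sum_k d q.+2 i j *: omega (t j k) (z k)).
      by apply: eq_bigr => j _; rewrite /xi0 scaler_sumr.
    by rewrite exchange_big; apply: eq_bigr => k _; rewrite omega_sum.
  apply: sub_sum => // k _; have [t' zE'] := deg1_omega (Zz k).1.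
  have t'0 : dot e x t' = 0.
    have := (Zz k).2; rewrite zE' iota_omega iota_uK linear0 subr0 => /(congr1 (@cK R R^o e)).
    by rewrite linearZ /= cK_uK linear0 -[_ *: _]/(dot e x t' * 1) mulr1.
  rewrite zE'; apply: ZQ => //; rewrite /dot.
  transitivity (\sum_j d q.+2 i j * d q.+3 j k).
    transitivity (\sum_(l < e) \sum_j d q.+2 i j * (x l * t j k l)).
      by apply: eq_bigr => l _; rewrite mulr_sumr; apply: eq_bigr => j _; rewrite mulrCA.
    by rewrite exchange_big; apply: eq_bigr => j _; rewrite tE /dot mulr_sumr.
  have := congr1 (fun M : 'M_(_, _) => M i k) (minres_dd dP q.+2).
  by rewrite !mxE.
pose Bd := [set w : V q.+2 | forall k, Bk 2 (w k)].
have [fBd lBd] := len_pow (b q.+2) (fl_K (Bk_subm 2)).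
have [fQd lQd] := len_pow (b q.+2) (fl_K sQ).
have lUB : (len U <= len (U `&` Bd) + t0 * b q.+2)%N.
  have [fa la] := len_add fU fBd.
  have := len_sub fQd (fa.1) _ => h.
  have {}h : (len (addm U Bd) <= b q.+2 * len Q)%N.
    rewrite -lQd; apply: h; apply: addm_sub; [exact: fQd.1|exact: UQ|].
    by move=> w Bw k; apply: BQ; exact: Bw.
  move: la h lenQ; rewrite lBd; set u := len (addm _ _); set v := len (_ `&` _); set w := len U.
  set l2 := len (Bk 2); set l3 := len Q; move: (b q.+2) => B; nia.
have sZ' : subm ((D q.+1 \o dd q.+1) @^-1` [set 0]).
  by apply: subm_pre; case: (@fl0 R (V q.+1)).
(* Chains of degree 3 whose image under [d] is a Koszul cycle; their Koszul boundaries include the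
   boundaries found in [U]. *)
pose Z' := G q.+2 3 `&` ((D q.+1 \o dd q.+1) @^-1` [set 0]).
have fZ' : fl Z' by apply: fl_sub (flG q.+2 3) (submI (flG q.+2 3).1 sZ') _ => w [].
have lUB2 : (len (U `&` Bd) + zeta 3 * b q.+2 <= len Z')%N.
  rewrite (len_exact (D q.+2) fZ'); apply: leq_add.
    apply: len_sub; [exact: fl_img|exact: submI fU.1 fBd.1|].
    move=> _ [[xi _ <-] Bxi].
    have [f fP] : exists f : V q.+2, forall k, prK 3 (f k) = f k /\ iota x (f k) = dd q.+2 xi k.
      have h k : exists g : K, prK 3 g = g /\ iota x g = dd q.+2 xi k.
        by have [g g3 gE] := Bxi k; exists g.
      by have [f fP] := choice h; exists f.
    have fE : D q.+2 f = dd q.+2 xi by apply/funext => k; case: (fP k).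
    exists f => //; split; first by apply/inKT => k; case: (fP k).
    have E : D q.+1 (dd q.+1 f) = 0 by rewrite Ddd fE; exact: ddd.
    exact: E.
  rewrite mulnC -lenZ; apply: len_sub; [|exact: (flZ q.+2 3).1|].
    by apply: fl_sub fZ' (submI fZ'.1 (subm_ker _)) _ => w [].
  move=> w Zw; have w0 : D q.+2 w = 0 by apply/funext => k; case: (Zw k).
  split=> //; split; first by apply/inKT => k; case: (Zw k).
  by rewrite /preimage /mkset /= Ddd w0 linear0.
have lZ' : (len Z' <= len (Zf q.+1 3 `&` ker (dd q)) + 'C(e, 3) * alpha q.+2)%N.
  rewrite (len_exact (dd q.+1) fZ'); apply: leq_add.
    apply: len_sub; [|exact: subm_img fZ'.1|].
      by apply: fl_sub (flZ q.+1 3) (submI (flZ q.+1 3).1 (subm_ker _)) _ => w [].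
    move=> _ [w [w3 w0] <-]; split; last exact: ddd.
    move=> k; split; last exact: (congr1 (fun f => f k) w0).
    by have /inKT h : G q.+1 3 (dd q.+1 w) by [apply: NG; rewrite -Nimg; exists w]; exact: h.
  rewrite -lenN; apply: len_sub; [exact: flN|exact: submI fZ'.1 (subm_ker _)|].
  by move=> w [[w1 _] w2]; apply: Nker.
have l3 : (len (Zf q.+1 3 `&` ker (dd q)) + 'C(e, 4) * alpha q <= zeta 3 * b q.+1 + zeta 4 * b q)%N.
  have := len_exact (dd q) (flZ q.+1 3); rewrite lenZ.
  have h1 := len_exact (D q) (flN q 4); rewrite lenN in h1.
  have h2 : (len (N q 4 `&` ker (D q)) <= b q * zeta 4)%N.
    rewrite -lenZ; apply: len_sub; [exact: flZ|exact: submI (flN q 4).1 (subm_ker _)|].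
    by move=> w [/NG/inKT w4 w0] k; split=> //; exact: (congr1 (fun f => f k) w0).
  have h3 : (len [set D q w | w in N q 4] <= len [set dd q w | w in Zf q.+1 3])%N.
    apply: len_sub; [exact: fl_img (flZ _ _)|exact: subm_img (flN q 4).1|].
    move=> _ [w wN <-]; move: wN; rewrite -Nimg => -[v /inKT v4 <-]; exists (D q.+1 v); last by rewrite Ddd.
    by move=> k; split; rewrite /= /mapJ ?iota_iota // prK_iota v4.
  rewrite (mulnC (zeta 3)) (mulnC (zeta 4)) => h4.
  have key (c u2 u3 u4 bz b1 X0 : nat) : (c = u2 + u3 -> u3 <= bz -> u2 <= u4 -> b1 = u4 + X0 -> X0 + c <= b1 + bz)%N by lia.
  exact: key h1 h2 h3 h4.
by move: lF1 lXi lU lUB lUB2 lZ' l3; rewrite /p; lia.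
Qed.

End Growth.

(** * Duality of the Koszul complex *)

Section Pairing.
Variable R : comNzRingType.

(* The coefficient of the top exterior monomial in the product. *)
Fixpoint bil n : ext n R^o -> ext n R^o -> R^o :=
  if n is n'.+1 then fun u v => bil (alpha u.1) v.2 + bil u.2 v.1 else fun u v => (u : R) * (v : R).

Lemma bil_linear n u : linear (@bil n u).
Proof.
elim: n u => [|n IH] u a v w /=; first by rewrite mulrDr mulrCA.
by rewrite !IH scalerDr addrACA.
Qed.
HB.instance Definition _ n u := GRing.isLinear.Build R (ext n R^o) R^o _ (@bil n u) (@bil_linear n u).

Lemma bil_linear_l n v : linear (fun u => @bil n u v).
Proof.
elim: n v => [|n IH] v a u w /=; first by rewrite mulrDl -mulrA.
by rewrite alphaD alphaZ !IH scalerDr addrACA.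
Qed.
Lemma bilNl n u v : @bil n (- u) v = - bil u v.
Proof.
have := @bil_linear_l n v (-1) u 0; have -> : bil (0 : ext n R^o) v = 0.
  by have := @bil_linear_l n v (-1) 0 0; rewrite scaler0 addr0 scaleN1r addNr.
by rewrite !addr0 !scaleN1r.
Qed.
Lemma bilDl n u u' v : @bil n (u + u') v = bil u v + bil u' v.
Proof. by have := @bil_linear_l n v 1 u u'; rewrite !scale1r. Qed.
Lemma bilZl n a u v : @bil n (a *: u) v = a *: bil u v.
Proof.
have := @bil_linear_l n v a u 0; have -> : bil (0 : ext n R^o) v = 0.
  by have := @bil_linear_l n v (-1) 0 0; rewrite scaler0 addr0 scaleN1r addNr.
by rewrite !addr0.
Qed.
Lemma bilDr n u v w : @bil n u (v + w) = bil u v + bil u w. Proof. exact: linearD. Qed.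
Lemma bilNr n u v : @bil n u (- v) = - bil u v. Proof. exact: linearN. Qed.
Lemma bilZr n a u v : @bil n u (a *: v) = a *: bil u v. Proof. exact: linearZ_LR. Qed.
Lemma bil0r n u : @bil n u 0 = 0. Proof. exact: linear0. Qed.
Lemma bil0l n u : @bil n 0 u = 0.
Proof. by rewrite -(scale0r (0 : ext n R^o)) bilZl scale0r. Qed.

Lemma bil_nondeg n v : (forall u, @bil n u v = 0) -> v = 0.
Proof.
elim: n v => [|n IH] v h; first by rewrite -[LHS]mul1r; exact: (h 1).
apply: pair_eq; apply: IH => u.
  by have := h (0, u); rewrite /= linear0 bil0l add0r.
by have := h (alpha u, 0); rewrite /= alphaK bil0l addr0.
Qed.

(** Adjointness up to sign: the Koszul complex is its own dual. *)
Lemma bil_iota n x u v : @bil n (iota x u) v = - bil (alpha u) (iota x v).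
Proof.
elim: n x u v => [|n IH] x u v; first by rewrite /= mul0r mulr0 oppr0.
rewrite /= alphaD alphaZ alpha_iota alphaK bilDl !bilNl bilZl !IH bilDr bilNr bilZr alphaK opprK.
by rewrite !opprD !opprK -!addrA; congr (_ + _); rewrite addrC.
Qed.

Lemma bil_omega n z u v : @bil n (omega z u) v = bil (alpha u) (omega z v).
Proof.
elim: n z u v => [|n IH] z u v; first by rewrite /= mul0r mulr0.
rewrite /= alpha_omega bilNl IH !alphaK bilDl bilNl bilZl IH bilNl bilDr bilNr bilZr.
by rewrite addrA [- _ + _]addrC.
Qed.

Lemma bil_prK n i u v : (i <= n)%N -> @bil n (prK i u) v = bil u (prK (n - i) v).
Proof.
elim: n i u v => [|n IH] i u v le; first by case: i le.
rewrite /=; case: i le => [|i] le.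
  rewrite subn0 /= bil0l addr0 -prK_alpha IH // subn0.
  by rewrite (prK_out v.1) // bil0r addr0.
rewrite subSS; have [E|lt] := eqVneq i n.
  rewrite E subnn (prK_out u.1) // linear0 bil0l bil0r !add0r.
  by rewrite IH // subnn.
have lt' : (i < n)%N by lia.
rewrite -prK_alpha (IH i.+1) // (IH i) //.
have -> : (n - i)%N = (n - i.+1).+1 by lia.
by [].
Qed.

End Pairing.

Lemma sum_prK_sub (R : comNzRingType) n (S : set (ext n R^o)) : (forall U : set (ext n R^o), subm U -> fl U) ->
  subm S -> (forall i f, S f -> S (prK i f)) -> len S = (\sum_(i < n.+1) len (S `&` [set f | prK i f = f]))%N.
Proof.
move=> flS sS prS.
pose T k : set (ext n R^o) := [set f | S f /\ forall i, (i < k)%N -> prK i f = 0].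
have sT k : subm (T k).
  split=> [|a f g [Sf f0] [Sg g0]]; first by split; [exact: sub0 sS|move=> i _; rewrite linear0].
  by split; [case: sS => _; apply|move=> i lt; rewrite prKD prKZ f0 // g0 // scaler0 addr0].
have step k : len (T k) = (len (S `&` [set f | prK k f = f]) + len (T k.+1))%N.
  rewrite (len_exact (@prK R R^o n k : {linear _ -> _}) (flS _ (sT k))); congr (_ + _)%N; congr len.
    apply/seteqP; split=> [_ [f [Sf _] <-]|f [Sf fE]].
      by split; [exact: prS|rewrite /mkset /= prK_prK eqxx].
    exists f => //; split=> // i lt; rewrite -fE prK_prK; case: eqP => // E; lia.
  apply/seteqP; split=> [f [[Sf f0] fk]|f [Sf f0]].
    by split=> // i; rewrite ltnS leq_eqVlt => /predU1P[->|/f0].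
  by split; [split=> // i lt; apply: f0; lia|exact: f0].
have -> : len S = len (T 0%N).
  by congr len; apply/seteqP; split=> [f Sf|f []].
have Tn : len (T n.+1) = 0%N.
  have -> : T n.+1 = [set 0]; last exact: len0.
  apply/seteqP; split=> [f [_ f0]|_ ->]; last exact: sub0 (sT _).
  by rewrite /mkset -(sum_prK f (ltnSn n)) big1 // => i _; exact: f0.
suff H k : len (T 0%N) = (\sum_(i < k) len (S `&` [set f | prK i f = f]) + len (T k))%N.
  by rewrite (H n.+1) Tn addn0.
elim: k => [|k IH]; first by rewrite big_ord0.
by rewrite IH big_ord_recr /= step addnA.
Qed.

Section KoszulDuality.
Variables (R : comNzRingType) (m : set R^o) (s : R) (gor : gor_local m s) (e : nat) (x : nat -> R).
Let al := gl_al gor.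
Local Notation lam := (len [set: R^o]).
Local Notation K := (ext e R^o).
Local Notation om t := (omega t (uK e (1 : R^o))).
Local Notation I := (@iota R R^o e x : {linear K -> K}).
Local Notation Z := (@zeta R e x).

Let flK (U : set K) : subm U -> fl U. Proof. by move=> sU; apply: (fl_K gor). Qed.
Let fT : fl [set: K] := fl_ext gor e.

Let perpP (U : set K) : subm U -> (len U + len (perp (@bil R e : K -> {linear K -> R^o}) U) = len [set: K])%N.
Proof.
move=> sU; apply: (len_perp gor) => //; [exact: bil_linear_l|exact: bil_nondeg].
Qed.

Lemma lenK : (len (ker I) + len (range I) = len [set: K])%N.
Proof. by rewrite (len_exact I fT) setTI addnC. Qed.

Lemma lenKT : len [set: K] = (2 ^ e * lam)%N.
Proof.
have [_ <-] := len_inm e (al_fl al); congr len; apply/seteqP; split=> // f _.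
by elim: (e) f => [|n IH] f //; split; exact: IH.
Qed.

(** Boundaries are orthogonal to cycles, and the orthogonal of the cycles is no longer than the
    module of boundaries. *)
Lemma koszul_perp v : (forall w : K, iota x w = 0 -> bil w v = 0) -> exists g, v = iota x g.
Proof.
move=> h; have sB : subm (range I) by apply: subm_img; split.
have E : range I = perp (@bil R e : K -> {linear K -> R^o}) (ker I).
  have h1 := perpP (subm_ker I); have h2 := lenK.
  have sP : subm (perp (@bil R e : K -> {linear K -> R^o}) (ker I)).
    split=> [u _|a u w pu pw z kz]; first exact: linear0.
    by rewrite /= bilDr bilZr (pu z kz) (pw z kz) scaler0 addr0.
  apply: (len_eq (flK sP)) => //; last by lia.
  move=> _ [g _ <-] w w0; have := bil_iota x (alpha w) g; rewrite alphaK.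
  have -> : iota x (alpha w) = 0 by rewrite -[LHS]opprK -alpha_iota (w0 : iota x w = 0) linear0 oppr0.
  rewrite bil0l.
  by move/esym/eqP; rewrite oppr_eq0 => /eqP.
have : perp (@bil R e : K -> {linear K -> R^o}) (ker I) v by move=> w; exact: h.
by rewrite -E => -[g _ <-]; exists g.
Qed.

(** In degree [e - 1] the test elements are the 1-cycles, and pairing with one amounts to the top
    coefficient of a product. *)
Lemma koszul_perp1 i f : prK i f = f -> (i.+1 = e)%N ->
  (forall w, dot e x w = 0 -> bil (uK e (1 : R^o)) (omega w f) = 0) -> exists2 g, prK i.+1 g = g & f = iota x g.
Proof.
move=> fi ie h; have [|g gE] := koszul_perp (v := f); last first.
  by exists (prK i.+1 g); [rewrite prK_prK eqxx|rewrite -prK_iota -gE fi].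
move=> w w0; rewrite -fi; have -> : i = (e - 1)%N by lia.
rewrite -bil_prK; last by lia.
have w1 : prK 1 (prK 1 w) = prK 1 w by rewrite prK_prK eqxx.
have [c cE] := deg1_omega w1; rewrite cE bil_omega alpha_uK; apply: h.
have := congr1 (@cK R R^o e) (prK_iota 0 x w); rewrite w0 !linear0 cE iota_omega iota_uK linear0 subr0.
by rewrite linearZ /= cK_uK [RHS]mulr1 => /esym.
Qed.

(** The cycles of degree [i] are the orthogonal of the boundaries of degree [e - i]. The pairing
    lives on the whole exterior algebra, so the boundaries are first pulled back along the
    projection to their degree. *)
Lemma perp_Bk i : (i <= e)%N -> (Z i + len (@Bk R e x (e - i)) = 'C(e, i) * lam)%N.
Proof.
move=> ie; set j := (e - i)%N; set B := @Bk R e x j.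
have sB : subm B := Bk_subm e x j.
pose P : {linear K -> K} := @prK R R^o e j.
pose U : set K := [set f | B (P f)].
have sU : subm U by exact: subm_pre.
have PB f : B f -> P f = f by move=> [g g1 <-]; rewrite /P /= prK_iota g1.
have lU : (len U = len B + len (ker P))%N.
  rewrite (len_exact P (flK sU)); congr (_ + _)%N; congr len.
    by apply/seteqP; split=> [_ [f Uf <-] //|f Bf]; exists f; [rewrite /U /mkset /= PB|exact: PB].
  by apply/seteqP; split=> [f []|f f0] //; split=> //; rewrite /U /mkset /= (f0 : P f = 0); exact: sub0.
have lP : ('C(e, i) * lam + len (ker P) = len [set: K])%N.
  rewrite (len_exact P fT) setTI -(bin_sub ie) -(len_Gk gor e j); congr (_ + _)%N; congr len.
  by apply/seteqP; split=> [f fE|_ [f _ <-]]; [exists f|rewrite /mkset /= prK_prK eqxx].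
have bE u v : bil (P u) v = bil u (prK i v).
  by rewrite bil_prK ?leq_subr // subKn.
have perpU : perp (@bil R e : K -> {linear K -> R^o}) U = @Zk R e x i.
  apply/seteqP; split=> [v pv|v [vi v0] u [g gj gE]]; last first.
    rewrite /= -vi -bE -gE bil_iota v0 bil0r oppr0 //.
  have pv' u : U u -> bil u v = 0 by exact: pv.
  split; apply/eqP.
    rewrite eq_sym -subr_eq0; apply/eqP; apply: bil_nondeg => u.
    rewrite bilDr bilNr -bE -bilNl -bilDl; apply: pv'.
    rewrite /U /mkset /= linearB /= /P /= prK_prK eqxx subrr; exact: sub0.
  apply/eqP; apply: bil_nondeg => u; have := bil_iota x (alpha u) v; rewrite alphaK => /(congr1 -%R).
  rewrite opprK => <-; rewrite pv' ?oppr0 //; exists (prK j.+1 (alpha u)); first by rewrite /mkset prK_prK eqxx.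
  by rewrite /P /= prK_iota.
have := perpP sU; rewrite perpU lU /zeta; move: lP.
have key (a c k t z : nat) : (c + k = t -> a + k + z = t -> z + a = c)%N by lia.
exact: key.
Qed.

Lemma Bk_top : @Bk R e x e = [set 0].
Proof.
apply/seteqP; split=> [_ [g gE <-]|_ ->]; last exact: sub0 (Bk_subm e x e).
by rewrite -gE prK_out ?linear0.
Qed.

Lemma zeta0 : Z 0%N = lam.
Proof.
by have := perp_Bk (leq0n e); rewrite subn0 Bk_top len0 addn0 bin0 mul1n.
Qed.

Lemma zeta_out i : (e < i)%N -> Z i = 0%N.
Proof.
move=> lt; rewrite /zeta; have -> : @Zk R e x i = [set 0]; last exact: len0.
apply/seteqP; split=> [f [<- _]|_ ->]; first by rewrite prK_out.
by exact: sub0 (Zk_subm e x i).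
Qed.

Lemma len_ker_sum : len (ker I) = (\sum_(i < e.+1) Z i)%N.
Proof.
rewrite (sum_prK_sub flK (subm_ker I)) => [|i f f0]; last first.
  by case: i => [|i]; rewrite /ker /mkset /= ?iota_prK0 // -prK_iota (f0 : iota x f = 0) linear0.
apply: eq_bigr => i _; congr len; apply/seteqP; split=> f []; by split.
Qed.

Local Notation D := [set a : R^o | exists t, a = dot e x t].

Lemma Bk0E : @Bk R e x 0 = [set uK e a | a in D].
Proof.
apply/seteqP; split=> [_ [g gE <-]|_ [a [t ->] <-]].
  have [c cE] := deg1_omega gE; exists (dot e x c); first by exists c.
  by rewrite cE iota_omega iota_uK linear0 subr0 uK_scale.
exists (om t); first by rewrite /mkset prK_omega prK0_uK.
by rewrite iota_omega iota_uK linear0 subr0 -uK_scale.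
Qed.

Lemma subm_dot : subm D.
Proof.
split=> [|a _ _ [t ->] [u ->]].
  by exists (fun=> 0); rewrite /dot big1 // => i _; rewrite mulr0.
exists (fun i => a * t i + u i); rewrite /dot /= -[_ *: _]/(a * _) mulr_sumr -big_split /=.
by apply: eq_bigr => i _; ring.
Qed.

Lemma len_Bk0E : len (@Bk R e x 0) = len D.
Proof.
rewrite Bk0E; apply: (@len_inj _ _ _ (@uK R R^o e : {linear R^o -> K})).
  exact: fl_sub (al_fl al) subm_dot _.
by move=> a _ /(congr1 (@cK R R^o e)); rewrite /= cK_uK linear0.
Qed.

Hypotheses (xm : forall t, m (dot e x t)) (xg : forall r, m r -> exists t, r = dot e x t).

Lemma len_Bk0 : (len (@Bk R e x 0)).+1 = lam.
Proof.
have [<- _] := len_m gor; rewrite len_Bk0E; congr (len _).+1.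
by apply/seteqP; split=> [_ [t ->] //|a /xg[t ->]]; exists t.
Qed.

Lemma zeta1 : (0 < e)%N -> (Z 1 = (e - 1) * lam + 1)%N.
Proof.
move=> e0; have := zeta_exact gor e x 0; have := len_Bk0; rewrite bin1 mulnBl.
have : (lam <= e * lam)%N by rewrite leq_pmull.
by lia.
Qed.

Lemma zeta_top : Z e = 1%N.
Proof.
have := perp_Bk (leqnn e); have := len_Bk0; rewrite subnn binn; lia.
Qed.

End KoszulDuality.

Lemma dotS (R : comNzRingType) n (x t : nat -> R) : dot n.+1 x t = x 0%N * t 0%N + dot n (tl x) (tl t).
Proof. by rewrite /dot big_ord_recl. Qed.

Lemma omega_iotaE (R : comNzRingType) e (x z : nat -> R) (f : ext e R^o) : dot e x z = 0 ->
  iota x f = 0 -> iota x (omega z f) = 0.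
Proof. by move=> z0 f0; rewrite iota_omega z0 f0 linear0 scale0r subr0. Qed.

Lemma iota_evz (R : comNzRingType) e k (x : nat -> R) (y : nat -> nat -> R) (a : ext k R^o) :
  (forall l, dot e x (y l) = 0) ->
  iota x (evz (@uK R R^o e : {linear R^o -> _}) (fun l => @omega R R^o e (y l) : {linear _ -> _}) a) = 0.
Proof.
elim: k y a => [|k IH] y a y0 /=; first exact: iota_uK.
rewrite linearD /= (IH (tl y)) ?add0r => [|l]; last exact: y0.
by apply: omega_iotaE => //; exact: IH.
Qed.

Lemma cycle1_omega (R : comNzRingType) e (x : nat -> R) (f : ext e R^o) : Zk x 1 f ->
  exists2 z, dot e x z = 0 & f = omega z (uK e (1 : R^o)).
Proof.
move=> [/deg1_omega[z ->] z0]; exists z => //.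
have := congr1 (@cK R R^o e) z0; rewrite iota_omega iota_uK linear0 subr0 linear0.
by rewrite linearZ /= cK_uK [_ *: _]mulr1.
Qed.

Lemma omega_comb (R : comNzRingType) (V : lmodType R) n (z w : nat -> R) a (f : ext n V) :
  omega (fun i => z i + a * w i) f = omega z f + a *: omega w f.
Proof.
elim: n z w f => [|n IH] z w f; first by rewrite /= scaler0 addr0.
apply: pair_eq; rewrite /=; first exact: IH.
by rewrite (IH (tl z) (tl w)) scalerDl scalerBr scalerA opprD addrACA.
Qed.

(* Subtracting the boundary of [t' /\ e_0] changes the leading entry of a cycle. *)
Lemma cycle_modify (R : comNzRingType) k (x w t' : nat -> R) r : dot k.+1 x w = 0 ->
  w 0%N = r + dot k (tl x) t' -> exists w', [/\ dot k.+1 x w' = 0, w' 0%N = r &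
    forall f : ext k.+1 R^o, prK k f = f -> iota x f = 0 -> omega w f = omega w' f].
Proof.
move=> w0 wE; pose a i : R := if i is j.+1 then t' j else 0; pose c i : R := if i is j.+1 then 0 else 1.
have da : dot k.+1 x a = dot k (tl x) t' by rewrite dotS /= mulr0 add0r.
have dc : dot k.+1 x c = x 0%N.
  by rewrite dotS /= mulr1 [dot _ _ _]big1 ?addr0 // => i _; rewrite mulr0.
exists (fun i => (w i + (- dot k (tl x) t') * c i) + x 0%N * a i); split=> [||f fk f0].
- have dD (y z : nat -> R) q : dot k.+1 x (fun i => y i + q * z i) = dot k.+1 x y + q * dot k.+1 x z.
    by rewrite /dot mulr_sumr -big_split; apply: eq_bigr => i _ /=; ring.
  by rewrite (dD (fun i => w i + _ * c i)) dD da dc w0; ring.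
- by rewrite /= wE; ring.
rewrite (omega_comb (fun i => w i + _ * c i)) omega_comb.
have g0 : omega a (omega c f) = 0.
  by rewrite -fk -!prK_omega prK_out.
have := iota_omega x a (omega c f); rewrite g0 linear0 da iota_omega dc f0 linear0 subr0 linearZ /=.
by move/esym/subr0_eq; rewrite scaleNr -addrA => ->; rewrite addNr addr0.
Qed.

(** The [2^n] monomials with coefficients modulo [m] embed into [W] modulo [B]. *)
Lemma len_evz (R : comNzRingType) (m : set R^o) (s : R) (gor : gor_local m s) (A : lmodType R) (W B : set A)
    (u : {linear R^o -> A}) n (zs : nat -> {linear A -> A}) : fl W -> subm B ->
  (forall a : ext n R^o, W (evz u zs a)) -> (forall a : ext n R^o, B (evz u zs a) <-> inm m a) ->
  (len (W `&` B) + 2 ^ n <= len W)%N.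
Proof.
move=> fW sB WE BE; have al := gl_al gor.
pose ev : {linear ext n R^o -> A} := HB.pack (evz u zs : ext n R^o -> A)
  (GRing.isLinear.Build _ _ _ _ (evz u zs : ext n R^o -> A) (@evz_linear _ _ _ u n zs)).
pose q := qpi sB; have := len_exact q fW; rewrite ker_qpi => ->.
have fE := fl_ext gor n; have := len_exact (q \o ev) fE; rewrite setTI.
have -> : ker (q \o ev) = @inm R R^o m n.
  apply/seteqP; split=> a; first by move=> qa; apply/BE; rewrite -(ker_qpi sB).
  by move=> /BE; rewrite -[in X in X -> _](ker_qpi sB).
have [_ ->] := len_inm n (fl_sub (al_fl al) (al_sub al) (fun _ _ => Logic.I)).
rewrite (lenKT gor n); have [<- _] := len_m gor; rewrite mulnS => /eqP; rewrite eqn_add2r => /eqP E.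
rewrite addnC E leq_add2r; apply: len_sub; first exact: fl_img.
  by apply: subm_img; exact: submT.
by move=> _ [a _ <-]; exists (ev a); first exact: WE.
Qed.

(** * Embedding dimension at most four *)

Section Criterion.
Variables (R : comNzRingType) (m : set R^o) (s : R) (gor : gor_local m s).
Variables (b : nat -> nat) (d : forall p, 'M[R]_(b p, b p.+1)) (n0 : nat).
Hypotheses (dP : minres m d) (TI : forall p q, (n0 <= p)%N -> tor_indep d d p q).
Let al := gl_al gor.
Local Notation lam := (len [set: R^o]).
Local Notation om e t := (omega t (uK e (1 : R^o))).

(** As the lengths of cycles and boundaries add up to [2^e lam], the inequality bounds the length of
    the Koszul homology by [2^e]. *)
Lemma cycles_zero_betti e (x : nat -> R) (z : nat -> nat -> R) :
  (forall t, m (dot e x t)) -> (forall r, m r -> exists t, r = dot e x t) ->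
  (forall l, dot e x (z l) = 0) -> prodz (fun l => @omega R R^o e (z l)) e (uK e (1 : R^o)) != 0 ->
  (2 * len (ker (@iota R R^o e x : {linear ext e R^o -> ext e R^o})) <= 2 ^ e * (lam + 1))%N -> exists p, b p = 0%N.
Proof.
move=> xm xg zc top le; apply: (exterior_zero_betti gor xm xg zc _ dP TI); apply: (koszul_homology gor) => //.
have := lenK gor e x; rewrite (lenKT gor e); move: le; rewrite mulnDr muln1.
by set k := len _; set r := len _; set a := (_ * _)%N; set c := (2 ^ _)%N; lia.
Qed.

(** For [e = 2], if all products of two 1-cycles vanished, duality would make every 1-cycle a
    boundary, contrary to the lengths [lam + 1] of cycles and [lam - 1] of boundaries. *)
Lemma zero_betti_le2 e (x : nat -> R) : (e <= 2)%N -> (forall t, m (dot e x t)) ->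
  (forall r, m r -> exists t, r = dot e x t) -> exists p, b p = 0%N.
Proof.
move=> e2 xm xg; have l0 := len_Bk0 gor xm xg; have Z0 := zeta0 gor e x; have Ze := zeta_top gor xm xg.
have Z1 := zeta1 gor xm xg.
have lk := len_ker_sum gor e x; case: e e2 x xm xg l0 Z0 Ze Z1 lk => [|[|[|//]]] _ x xm xg l0 Z0 Ze Z1 lk.
- apply: (cycles_zero_betti (z := fun=> fun=> 0) xm xg) => [l||]; first by rewrite /dot big_ord0.
    exact: oner_neq0.
  by rewrite lk big_ord_recl big_ord0 /= Z0 -Ze Z0; lia.
- have [z z0 zn] : exists2 z, dot 1 x z = 0 & om 1 z != 0.
    apply: contrapT => h; have : Zk (e := 1) x 1 = [set 0].
      apply/seteqP; split=> [f /cycle1_omega[z z0 ->]|_ ->]; last exact: sub0 (Zk_subm 1 x 1).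
      by apply/eqP/negPn/negP => fz; apply: h; exists z.
    by move=> E; move: Ze; rewrite /zeta E len0.
  apply: (cycles_zero_betti (z := fun=> z) xm xg) => //.
  by rewrite lk big_ord_recl big_ord1 /= Z0 Ze; lia.
- have {}Z1 := Z1 isT; rewrite mul1n in Z1.
  have [z [w [z0 w0 zn]]] : exists z w, [/\ dot 2 x z = 0, dot 2 x w = 0 & omega z (om 2 w) != 0].
    apply: contrapT => h; have : (zeta 2 x 1 <= len (@Bk R 2 x 1))%N.
      apply: len_sub; [exact/(fl_K gor)/Bk_subm|exact: Zk_subm|] => f [f1 f0].
      have [z z0 zE] := cycle1_omega (conj f1 f0).
      have [w w0|g gE ->] := koszul_perp1 gor f1 (erefl : 2 = 2) _ (x := x); last by exists g.
      rewrite (_ : omega w f = 0) ?bil0r // zE; apply/eqP/negPn/negP => n; apply: h.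
      by exists w, z.
    have := zeta_exact gor 2 x 1; rewrite Ze binn mul1n Z1; lia.
  apply: (cycles_zero_betti (z := nth (fun=> 0) [:: z; w]) xm xg) => [l|//|].
    by case: l => [|[|l]] //; rewrite /dot big1 // => i _; rewrite nth_default ?mulr0.
  rewrite lk !big_ord_recl big_ord0 /= /bump /= Z0 Z1 Ze; lia.
Qed.

End Criterion.

(** * Embedding dimension three *)

Section Three.
Variables (R : comNzRingType) (m : set R^o) (s : R) (gor : gor_local m s).
Variables (b : nat -> nat) (d : forall p, 'M[R]_(b p, b p.+1)) (n0 : nat).
Hypotheses (dP : minres m d) (TI : forall p q, (n0 <= p)%N -> tor_indep d d p q).
Let al := gl_al gor.
Local Notation lam := (len [set: R^o]).
Local Notation om e t := (omega t (uK e (1 : R^o))).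
Variables (x c : nat -> R).
Hypotheses (xm : forall t, m (dot 3 x t)) (xg : forall r, m r -> exists t, r = dot 3 x t)
  (xc : x 0%N * x 0%N = dot 2 (tl x) c) (xI : forall t, x 0%N <> dot 2 (tl x) t)
  (lam11 : (lam <= 11)%N).
Local Notation x' := (tl x).
Local Notation I2 := (@iota R R^o 2 x' : {linear ext 2 R^o -> ext 2 R^o}).
Local Notation I3 := (@iota R R^o 3 x : {linear ext 3 R^o -> ext 3 R^o}).
Let D : set R^o := [set a : R^o | exists t, a = dot 2 x' t].
Let sD : subm D := subm_dot 2 x'.

Let mD a : m a -> exists t, D (a - x 0%N * t).
Proof. by move=> /xg[t ->]; exists (t 0%N), (tl t); rewrite dotS addrAC subrr add0r. Qed.

Let Dx a : m a -> D (x 0%N * a).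
Proof.
move=> /mD[t /(subZ (x 0%N) sD)]; rewrite -[_ *: _]/(_ * _) mulrBr mulrA xc => h.
have : D (t *: (dot 2 x' c : R^o)) by apply: subZ => //; exists c.
by move/(subD sD h); rewrite -[_ *: _]/(_ * _) [t * _]mulrC subrK.
Qed.

Let Dm : D `<=` m.
Proof.
move=> _ [t ->]; have := xm (fun i => if i is j.+1 then t j else 0).
by rewrite dotS /= mulr0 add0r.
Qed.

Let m0 : m (x 0%N).
Proof.
have := xm (fun i => if i is 0%N then 1 else 0).
by rewrite dotS /= mulr1 [dot _ _ _]big1 ?addr0 // => i _; rewrite mulr0.
Qed.

(** The relation puts [x_0 m] inside [D], and [m = D + R x_0] with [x_0] outside [D]; so [m / D] is
    simple. *)
Let lenD : (len D + 2 = lam)%N.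
Proof.
have fm := fl_sub (al_fl al) (al_sub al) (fun _ _ => Logic.I); have fD := fl_sub fm sD Dm.
have lt : (len D < len m)%N.
  by apply: len_ltE => //; exists (x 0%N : R^o) => // -[t] /xI.
have [fa le] := len_addcyc (al_unit al) (a := x 0%N : R^o) fD (fun a ma => eq_ind _ D (Dx ma) _ (mulrC _ _)).
have : (len m <= len (addm D [set y : R^o | exists r : R, y = r *: (x 0%N : R^o)]))%N.
  apply: len_sub => //; first exact: al_sub.
  move=> a /mD[t h]; exists (a - x 0%N * t) => //; exists (x 0%N * t); last by rewrite subrK.
  by exists t; rewrite mulrC.
have [<- _] := len_m gor; move: lt le.
have key (a u v : nat) : (a < u -> v <= a.+1 -> u <= v -> a + 2 = u.+1)%N by lia.
exact: key.
Qed.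

Let beta : (len (@Bk R 2 x' 0) + 2 = lam)%N. Proof. by rewrite (len_Bk0E gor 2 x'). Qed.
Let zeta'1 : (zeta 2 x' 1 = lam + 2)%N.
Proof. have := zeta_exact gor 2 x' 0; rewrite bin1; lia. Qed.
Let zeta'2 : zeta 2 x' 2 = 2.
Proof. have := perp_Bk gor x' (leqnn 2); rewrite subnn binn; lia. Qed.
Let lenZ' : (len (ker I2) = 2 * lam + 4)%N.
Proof. by rewrite (len_ker_sum gor 2 x') !big_ord_recl big_ord0 /= /bump /= (zeta0 gor) zeta'1 zeta'2; lia. Qed.

Let F2f (f : ext 3 R^o) : ext 2 R^o := f.2.
Let F2l : linear F2f. Proof. by []. Qed.
Let F2 : {linear ext 3 R^o -> ext 2 R^o} := HB.pack F2f (GRing.isLinear.Build _ _ _ _ F2f F2l).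
Let G1f (f : ext 2 R^o) : ext 3 R^o := (f, 0).
Let G1l : linear G1f. Proof. by move=> a f g; apply: pair_eq; rewrite //= scaler0 addr0. Qed.
Let G1 : {linear ext 2 R^o -> ext 3 R^o} := HB.pack G1f (GRing.isLinear.Build _ _ _ _ G1f G1l).
Let lenG1 (U : set (ext 2 R^o)) : subm U -> len (G1 @` U) = len U.
Proof. by move=> sU; apply: len_inj => [|f _ []] //; apply: (fl_K gor). Qed.

Let iG1 f : iota x' f = 0 -> iota x (G1 f) = 0.
Proof.
move=> f0; apply: pair_eq; [transitivity (iota x' f + x 0%N *: (0 : ext 2 R^o))|transitivity (- iota x' (0 : ext 2 R^o))] => //.
  by rewrite f0 scaler0 addr0.
by rewrite linear0 oppr0.
Qed.

(** The 1-cycle given by the relation [xc]. *)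
Let square_cycle i : R := if i is j.+1 then - c j else x 0%N.
Let square0 : dot 3 x square_cycle = 0.
Proof.
rewrite dotS /= xc; apply/eqP; rewrite addr_eq0; apply/eqP.
by rewrite /dot -sumrN; apply: eq_bigr => i _; rewrite mulrN opprK.
Qed.

Let omega_pure k (y1 y2 y3 : nat -> R) : y2 0%N = 0 -> y3 0%N = 0 ->
  omega y1 (omega y2 (om k.+1 y3)) = (omega (tl y1) (omega (tl y2) (om k (tl y3))), y1 0%N *: omega (tl y2) (om k (tl y3))).
Proof. by move=> h2 h3; rewrite /= h2 h3 !(scale0r, linear0, subr0). Qed.

(** The product of [square_cycle], [y1] and [y2] has top coefficient given by [x_0 y1 y2], which is
    nonzero. The complex on [x] is the mapping cone of [x_0] on the complex on [x'], so the length
    of its cycles is [len (ker I2)] plus that of the cycles in [B]; the monomials in [y1] and [y2]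
    are independent modulo [B], which makes the total at most [4 lam + 4]. *)
Let regular_case y1 y2 : dot 2 x' y1 = 0 -> dot 2 x' y2 = 0 -> x 0%N *: omega y1 (om 2 y2) <> 0 ->
  exists p, b p = 0%N.
Proof.
move=> h1 h2 ne; pose B' := range I2; have sB' : subm B' by apply: subm_img.
pose B := [set f : ext 2 R^o | B' (x 0%N *: f)].
have sB : subm B.
  split=> [|a f g Bf Bg]; first by rewrite /B /mkset scaler0; exact: sub0.
  rewrite /B /mkset scalerDr scalerA mulrC -scalerA; apply: subD => //; exact: subZ.
pose y := nth (fun=> 0) [:: y1; y2].
have y0 l : dot 2 x' (y l) = 0.
  by case: l => [|[|l]] //; rewrite /dot big1 //= => i _; rewrite /y nth_default ?mulr0.
pose zs l : {linear ext 2 R^o -> ext 2 R^o} := @omega R R^o 2 (y l).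
have uB (a : R^o) : m a -> B (uK 2 a).
  move=> /Dx[t tE]; exists (om 2 t) => //; rewrite -[LHS]/(iota x' _).
  by rewrite iota_omega iota_uK linear0 subr0 -tE [in RHS]uK_scale scalerA.
have zB l f : B f -> B (zs l f).
  move=> [g _ gE]; exists (- omega (y l) g) => //; rewrite -[LHS]/(iota x' _) -[iota x' g]/(iota x' g) in gE *.
  transitivity (- iota x' (omega (y l) g)); first exact: iotaN.
  by rewrite iota_omega y0 scale0r sub0r opprK gE omegaZ.
have W := @len_evz R m s gor (ext 2 R^o) (ker I2) B (@uK R R^o 2 : {linear R^o -> ext 2 R^o}) 2 zs.
have {}W : (len (ker I2 `&` B) + 2 ^ 2 <= len (ker I2))%N.
  apply: W => //; [exact/(fl_K gor)/subm_ker|move=> a|move=> a; split].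
  - exact: (iota_evz a y0).
  - apply: (evz_ind al sB (h := idfun) (c := 1) uB zB) => // [l l' f|l f|l f|].
    + exact: omegaC.
    + exact: omega_omega.
    + by rewrite scale1r.
    move=> [g _ gE]; apply: ne; have {}gE : iota x' g = x 0%N *: omega y1 (om 2 y2) by exact: gE.
    have := prK_iota 2 x' g; rewrite (prK_out g) // linear0 gE prKZ !prK_omega prK0_uK.
    by [].
  exact: evz_inm.
pose z := nth (fun=> 0) [:: square_cycle; (fun i => if i is j.+1 then y1 j else 0); (fun i => if i is j.+1 then y2 j else 0)].
apply: (cycles_zero_betti gor dP TI (x := x) (z := z)) => // [l||].
- case: l => [|[|[|l]]]; [exact: square0|by rewrite dotS /= mulr0 add0r|by rewrite dotS /= mulr0 add0r|].
  by rewrite /dot big1 //= => i _; rewrite /z nth_default ?mulr0.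
- apply/eqP => E0; have : omega (z 0%N) (omega (z 1%N) (om 3 (z 2%N))) = 0 by exact: E0.
  by rewrite omega_pure // => /(congr1 snd).
have fk : fl (ker I3) by exact/(fl_K gor)/subm_ker.
have := len_exact F2 fk; have -> : F2 @` ker I3 = ker I2 `&` B.
  apply/seteqP; split=> [_ [f f0 <-]|f [f0 [g _ gE]]].
    have E1 : iota x' (f.1 : ext 2 R^o) + x 0%N *: (f.2 : ext 2 R^o) = 0 := congr1 fst f0.
    have E2 : - iota x' (f.2 : ext 2 R^o) = 0 := congr1 snd f0.
    split; first by have := congr1 -%R E2; rewrite opprK oppr0.
    exists (- f.1) => //; rewrite -[LHS]/(iota x' (- (f.1 : ext 2 R^o))) iotaN.
    by apply/eqP; rewrite eq_sym -addr_eq0 addrC; apply/eqP.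
  have {}f0 : iota x' f = 0 := f0; have {}gE : iota x' g = x 0%N *: f := gE.
  exists (- g, f) => //; apply: pair_eq; rewrite -?[LHS]/(iota x' (- g) + x 0%N *: f) -?[LHS]/(- iota x' f).
    by rewrite iotaN gE addNr.
  by rewrite f0 oppr0.
have -> : ker I3 `&` ker F2 = G1 @` ker I2.
  apply/seteqP; split=> [f [f0 f2]|_ [f f0 <-]].
    exists f.1; last by apply: pair_eq.
    by have := congr1 fst f0; rewrite /= (f2 : f.2 = 0) scaler0 addr0.
  by split=> //; exact: iG1.
rewrite (lenG1 (subm_ker I2)); lia.
Qed.

Let T u v w : ext 3 R^o := omega u (omega v (om 3 w)).
Let Trot u v w : T u v w = T v w u.
Proof. by rewrite /T omegaC (omegaC u w) linearN opprK. Qed.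
Let Tsw u v w : T u v w = - T v u w. Proof. exact: omegaC. Qed.

Let top0 k (y1 y2 y3 : nat -> R) : (k < 3)%N -> omega y1 (omega y2 (om k y3)) = 0.
Proof. by move=> k3; have := prK_out (i := 3) (omega y1 (omega y2 (om k y3))) k3; rewrite !prK_omega prK0_uK. Qed.

Section Singular.
Hypothesis V : forall y1 y2, dot 2 x' y1 = 0 -> dot 2 x' y2 = 0 -> x 0%N *: omega y1 (om 2 y2) = 0.

Let pure y := y 0%N = 0 /\ dot 2 x' (tl y) = 0.
Let purec y : pure y -> dot 3 x y = 0. Proof. by case=> y0 yc; rewrite dotS y0 mulr0 add0r. Qed.

Let T_pure y1 y2 y3 : pure y1 -> pure y2 -> pure y3 -> T y1 y2 y3 = 0.
Proof. by move=> [h1 _] [h2 _] [h3 _]; rewrite /T omega_pure // top0 // h1 scale0r. Qed.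

Let T_square y1 y2 : pure y1 -> pure y2 -> T square_cycle y1 y2 = 0.
Proof. by move=> [h1 c1] [h2 c2]; rewrite /T omega_pure // top0 // V. Qed.

(** As [x_0] is not in [D], the coefficient [w_0] lies in [m]; it equals [x_0 t] modulo [D], and
    [cycle_modify] absorbs the difference, leaving a pure cycle after [t] times [square_cycle] is
    subtracted. *)
Let dec w : dot 3 x w = 0 -> exists t y, pure y /\ forall u v, dot 3 x u = 0 -> dot 3 x v = 0 ->
  T w u v = T y u v + t *: T square_cycle u v.
Proof.
move=> w0; have mw : m (w 0%N).
  apply: contrapT => /(al_unit al)[r rw].
  have Dw : D (dot 2 x' (tl w)) by exists (tl w).
  have := subZ r sD (subN sD Dw).
  have -> : r *: (- dot 2 x' (tl w) : R^o) = x 0%N; last by case=> t /xI.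
  have E := w0; rewrite dotS in E; move/eqP: E; rewrite addrC addr_eq0 => /eqP ->.
  by rewrite opprK -[_ *: _]/(_ * _) mulrCA rw mulr1.
have [t [t' tE]] := mD mw.
have [w' [w'0 w'1 w'E]] := cycle_modify (k := 2) (r := x 0%N * t) (t' := t') w0 (esym (etrans (congr1 _ (esym tE)) (subrKC _ _))).
exists t, (fun i => w' i - t * square_cycle i); split.
  split; first by rewrite w'1 /= mulrC subrr.
  have dD (y z : nat -> R) q : dot 3 x (fun i => y i - q * z i) = dot 3 x y - q * dot 3 x z.
    by rewrite /dot mulr_sumr -sumrB; apply: eq_bigr => i _ /=; ring.
  have E : x 0%N * (x 0%N * t - t * x 0%N) + dot 2 x' (fun i => w' i.+1 - t * square_cycle i.+1) = 0.
    by rewrite -w'1; have := dD w' square_cycle t; rewrite w'0 square0 mulr0 subr0 dotS.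
  by rewrite -[LHS]add0r -[RHS]E; congr (_ + _); ring.
move=> u v u0 v0; rewrite /T -omega_comb w'E.
- by congr omega; apply/funext => i; rewrite subrK.
- by rewrite !prK_omega prK0_uK.
- by apply: omega_iotaE => //; apply: omega_iotaE => //; exact: iota_uK.
Qed.

Let T_cycles u v w : dot 3 x u = 0 -> dot 3 x v = 0 -> dot 3 x w = 0 -> T u v w = 0.
Proof.
have sq1 v0 : T square_cycle square_cycle v0 = 0 by exact: omega_omega.
have sq2 v0 : T square_cycle v0 square_cycle = 0 by rewrite /T (omegaC v0) omegaN omega_omega oppr0.
have c3 y v0 : pure y -> dot 3 x v0 = 0 -> T square_cycle y v0 = 0.
  move=> py h; have [t [y' [py' E]]] := dec h; have yc := purec py.
  by rewrite -Trot (E _ _ square0 yc) sq1 scaler0 addr0 Trot T_square.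
have c4 y y' v0 : pure y -> pure y' -> dot 3 x v0 = 0 -> T y y' v0 = 0.
  move=> py py' h; have [t [y2 [py2 E]]] := dec h.
  by rewrite -Trot (E _ _ (purec py) (purec py')) T_square // scaler0 addr0 T_pure.
have c5 u0 v0 : dot 3 x u0 = 0 -> dot 3 x v0 = 0 -> T square_cycle u0 v0 = 0.
  move=> h k; have [t [y [py E]]] := dec h.
  by rewrite Trot (E _ _ k square0) sq2 scaler0 addr0 -Trot c3.
have c6 y u0 v0 : pure y -> dot 3 x u0 = 0 -> dot 3 x v0 = 0 -> T y u0 v0 = 0.
  move=> py h k; have [t [y' [py' E]]] := dec h; have yc := purec py.
  by rewrite Trot (E _ _ k yc) (c5 _ _ k yc) scaler0 addr0 -Trot c4.
by move=> hu hv hw; have [t [y [py ->]]] := dec hu; rewrite // c6 // c5 // scaler0 addr0.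
Qed.

Let prod_bound t t' : dot 3 x t = 0 -> dot 3 x t' = 0 -> Bk (e := 3) x 2 (omega t (om 3 t')).
Proof.
move=> h h'; have f2 : prK 2 (omega t (om 3 t')) = omega t (om 3 t') by rewrite !prK_omega prK0_uK.
have [w hw|g gE ->] := koszul_perp1 gor f2 (erefl : 3 = 3) _ (x := x); last by exists g.
by rewrite -[omega w _]/(T w t t') T_cycles // bil0r.
Qed.

(** In the mapping cone every 1-cycle [f] of the smaller complex extends to a 2-cycle, because
    [x_0 f] is a boundary by [V] and duality. *)
Let zeta2 : (lam + 4 <= zeta 3 x 2)%N.
Proof.
have fZ : fl (Zk (e := 3) x 2) by exact/(fl_K gor)/Zk_subm.
rewrite /zeta (len_exact F2 fZ) (_ : lam + 4 = zeta 2 x' 1 + zeta 2 x' 2)%N; last by rewrite zeta'1 zeta'2 -addnA.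
apply: leq_add.
  apply: len_sub; [exact: fl_img|exact: Zk_subm|] => f fZ1; have [f1 f0] := fZ1.
  have [y yc yE] := cycle1_omega fZ1.
  have xf1 : prK 1 (x 0%N *: f) = x 0%N *: f by rewrite prKZ f1.
  have [w hw|g gE xg'] := koszul_perp1 gor xf1 (erefl : 2 = 2) _ (x := x').
    by rewrite omegaZ yE V // bil0r.
  exists (- g, f) => //; split; first by apply: pair_eq; [transitivity (- prK 2 g); [exact: (@prKN R R^o 2 2 g)|by rewrite gE]|exact: f1].
  apply: pair_eq; rewrite -?[LHS]/(iota x' (- g) + x 0%N *: f) -?[LHS]/(- iota x' f).
    by rewrite iotaN xg' addNr.
  by rewrite f0 oppr0.
have -> : zeta 2 x' 2 = len (G1 @` @Zk R 2 x' 2) by rewrite lenG1 //; exact: Zk_subm.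
apply: len_sub.
- exact/(fl_K gor)/submI/subm_ker/Zk_subm.
- exact/subm_img/Zk_subm.
move=> _ [f [f2 f0] <-]; split=> //; split; first by apply: pair_eq; [exact: f2|exact: (linear0 (@prK R R^o 2 1 : {linear _ -> _}))].
exact: iG1.
Qed.

Let growth q : (b (q + 4) + 4 * b (q + 3) + b (q + 2) <= b (q + 5) + b (q + 1))%N.
Proof.
have := koszul_growth gor xm xg dP (t0 := 0) (Bk_subm 3 x 2) (fun f h => h) prod_bound _ q.
rewrite addn0 leqnn => /(_ isT).
rewrite (bin_small (n := 3) (m := 4)) // (_ : 'C(3, 2) = 3) // binn (zeta1 gor xm xg isT) (zeta_top gor xm xg).
rewrite (zeta_out x (ltnSn 3)); have := zeta2.
have := len_Aim gor dP (q + 3); have := len_Aim gor dP (q + 2); rewrite -!addnS.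
have key (l b0 b1 b2 b3 b4 b5 a0 a2 a3 a4 z : nat) : (a2 + a3 = b3 * l -> a3 + a4 = b4 * l -> l + 4 <= z ->
   ((3 - 1) * l + 1) * b4 + z * b3 + 1 * b2 + 0 * a0 + a4 <=
   3 * a4 + b5 + 3 * a3 + 1 * a2 + 0 * b2 + 1 * b1 + 0 * b0 -> b4 + 4 * b3 + b2 <= b5 + b1)%N.
  by move=> h1 h2 h3; have := leq_mul h3 (leqnn b3); nia.
exact: key.
Qed.

(** The ratio 7/3, used twice, gives [b_(q+5) - b_(q+4) <= 28/9 b_(q+3) < 4 b_(q+3)], and [growth]
    then makes the Betti numbers decrease strictly forever. *)
Lemma singular_case : exists p, b p = 0%N.
Proof.
apply: contrapT => h; have bp p : (0 < b p)%N.
  by rewrite lt0n; apply/eqP => E; apply: h; exists p.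
have step q : (n0 <= q)%N -> (b (q + 2) < b (q + 1))%N.
  move=> nq; have := growth q; have := bp (q + 3)%N.
  have := betti_ratio gor dP TI (p := q + 3) (leq_trans nq (leq_addr _ _)) lam11.
  have := betti_ratio gor dP TI (p := q + 2) (leq_trans nq (leq_addr _ _)) lam11.
  rewrite -!addnS; lia.
have desc k : (b (n0 + k + 1) + k <= b (n0 + 1))%N.
  elim: k => [|k IH]; first by rewrite !addn0.
  have := step (n0 + k)%N (leq_addr _ _); rewrite !addnS !addn0 in IH *.
  lia.
by have := desc (b (n0 + 1)); have := bp (n0 + b (n0 + 1) + 1)%N; lia.
Qed.

End Singular.

Theorem zero_betti3 : exists p, b p = 0%N.
Proof.
have [[y1 [y2 [h1 h2 ne]]]|V] := pselect (exists y1 y2, [/\ dot 2 x' y1 = 0, dot 2 x' y2 = 0 & x 0%N *: omega y1 (om 2 y2) <> 0]).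
  exact: regular_case ne.
apply: singular_case => y1 y2 h1 h2; apply: contrapT => ne; apply: V.
by exists y1, y2.
Qed.

End Three.

(** * Numerical contradiction in embedding dimension four *)

Section NumericFour.
Variables (b : nat -> nat) (n0 c : nat).
Hypotheses (bp : forall p, (0 < b p)%N) (c5 : (5 <= c)%N)
  (R1 : forall p, (n0 <= p)%N -> (3 * b p.+2 <= 7 * b p.+1)%N)
  (R2 : forall p, (n0 <= p)%N ->
    (5 * (b p.+1 + b p.+2) ^ 2 <= 11 * b p.+1 ^ 2 + 2 * (b p.+1 + b p.+2) * (b p.+2 + b p.+3))%N)
  (G : forall q, (b (q + 4) + c * b (q + 3) <= b (q + 5) + c * b (q + 1) + b q)%N).

(* The square inequality bounds the next ratio of Betti numbers from below by a
   function that is increasing on the relevant range. *)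
Lemma ratio_step (u v N D : nat) :
  (forall x y : nat, (0 < x)%N -> (u * x <= v * y)%N -> (3 * y <= 7 * x)%N ->
     (2 * N * (x * y + y ^ 2) + 11 * D * x ^ 2 + 2 * D * (x * y + y ^ 2) <= 5 * D * (x + y) ^ 2)%N) ->
  forall p, (n0 <= p)%N -> (u * b p.+1 <= v * b p.+2)%N -> (N * b p.+2 <= D * b p.+3)%N.
Proof.
move=> h p np r; have := h _ _ (bp p.+1) r (R1 np); have := R2 np; have := bp p.+2; have := bp p.+1.
move: (b p.+1) (b p.+2) (b p.+3) => x y z x0 y0 h2 h1; rewrite leqNgt; apply/negP => lt.
have : (D * (5 * (x + y) ^ 2) <= D * (11 * x ^ 2 + 2 * (x + y) * (y + z)))%N by rewrite leq_mul2l h2 orbT.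
have : (2 * (x + y) * (D * z) < 2 * (x + y) * (N * y))%N by rewrite ltn_pmul2l //; lia.
by nia.
Qed.

(** Successive lower bounds for the ratio are 1, 5/4, 3/2, 17/10 and 7/4, each giving the next
    through [ratio_step]; the last one is preserved, being larger than 17/10. *)
Lemma ratio_from p : (n0 <= p)%N -> (b p.+1 <= b p.+2)%N -> forall k, (7 * b (p + k).+4.+1 <= 4 * b (p + k).+4.+2)%N.
Proof.
move=> np r1.
have s1 q : (n0 <= q)%N -> (b q.+1 <= b q.+2)%N -> (5 * b q.+2 <= 4 * b q.+3)%N.
  by move=> nq h; apply: (@ratio_step 1 1) => //; rewrite ?mul1n // => x y x0; nia.
have s2 q : (n0 <= q)%N -> (5 * b q.+1 <= 4 * b q.+2)%N -> (3 * b q.+2 <= 2 * b q.+3)%N.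
  by move=> nq h; apply: (@ratio_step 5 4) => // x y x0; nia.
have s3 q : (n0 <= q)%N -> (3 * b q.+1 <= 2 * b q.+2)%N -> (17 * b q.+2 <= 10 * b q.+3)%N.
  by move=> nq h; apply: (@ratio_step 3 2) => // x y x0; nia.
have s4 q : (n0 <= q)%N -> (17 * b q.+1 <= 10 * b q.+2)%N -> (7 * b q.+2 <= 4 * b q.+3)%N.
  by move=> nq h; apply: (@ratio_step 17 10) => // x y x0; nia.
elim=> [|k IH].
  rewrite addn0; apply: s4; first by lia.
  apply: s3; first by lia.
  apply: s2; first by lia.
  by apply: s1.
rewrite addnS; apply: (s4 (p + k).+4); first by lia.
by lia.
Qed.

(** From some point on the ratios lie between 7/4 and 7/3. Divided by [b_(q+3)], the inequality [G]
    with [c = 5] would give [5 <= 28/9 + 80/49 + 64/343], which is false; a larger [c] makes it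
    worse, as [b_(q+1) <= b_(q+3)]. *)
Lemma no_growth : False.
Proof.
have [p np r1] : exists2 p, (n0 <= p)%N & (b p.+1 <= b p.+2)%N.
  apply: contrapT => h; have dec p : (n0.+1 <= p)%N -> (b p.+1 <= b p)%N.
    case: p => [//|p] np; rewrite leqNgt; apply/negP => lt; apply: h; exists p => //; exact: ltnW.
  have [l ln lE] := nonincr_stab dec; apply: h; exists l; first exact: ltnW.
  by rewrite !lE //; lia.
have rt := ratio_from np r1; set q := (p + 5)%N.
have := G q; have := rt 0%N; have := rt 1%N; have := rt 2%N.
have := R1 (p := q + 2); have := R1 (p := q + 3); have := bp q.
rewrite /q !addn0 !addnS !addn0 => b0 h5 h4 h2 h1 h0 g.
have {}h5 := h5 (ltac:(lia)); have {}h4 := h4 (ltac:(lia)).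
move: (b _) (b _) (b _) (b _) (b _) (b _) b0 h5 h4 h2 h1 h0 g => a0 a1 a2 a3 a4 a5.
nia.
Qed.

End NumericFour.

Section Inm.
Variables (R : comNzRingType) (m : set R^o).
Local Notation "'m*' U" := (smul (m : set R) U) (at level 35).

Lemma subm_inm (U : set R^o) n : subm U -> subm (@inm R R^o U n).
Proof.
move=> sU; elim: n => [|n IH] //; split; first by split; exact: sub0 IH.
by move=> a f g [f1 f2] [g1 g2]; split; case: IH => _; apply.
Qed.

Lemma inm_mono (U U' : set R^o) n (f : ext n R^o) : U `<=` U' -> inm U f -> inm U' f.
Proof. by move=> UU; elim: n f => [|n IH] f; [exact: UU|case=> h1 h2; split; exact: IH]. Qed.

Lemma inm_scale (U : set R^o) n (f : ext n R^o) a : m a -> inm U f -> inm (m* U) (a *: f).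
Proof.
move=> ma; elim: n f => [|n IH] f; first by move=> h; exact: smul_incl.
by move=> [h1 h2]; split; exact: IH.
Qed.

Lemma inm_smul_omega (U : set R^o) n (z : nat -> R) (f : ext n R^o) : (forall i, (i < n)%N -> m (z i)) ->
  inm U f -> inm (m* U) (omega z f).
Proof.
elim: n z f => [|n IH] z f zm; first by move=> _; exact: sub0 (subm_smul _ _).
have zm' i : (i < n)%N -> m (z i.+1) by move=> lt; apply: zm.
move=> [h1 h2]; split=> /=; first exact: IH.
by apply: (subB (subm_inm n (subm_smul _ _))); [apply: inm_scale => //; exact: zm|exact: IH].
Qed.

Lemma inm_smul_iota (U : set R^o) n (z : nat -> R) (f : ext n R^o) : (forall i, (i < n)%N -> m (z i)) ->
  inm U f -> inm (m* U) (iota z f).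
Proof.
elim: n z f => [|n IH] z f zm; first by move=> _; exact: sub0 (subm_smul _ _).
have zm' i : (i < n)%N -> m (z i.+1) by move=> lt; apply: zm.
have s := subm_inm n (subm_smul (m : set R) U).
move=> [h1 h2]; split=> /=; last by apply: (subN s); exact: IH.
by apply: (subD s); [exact: IH|apply: inm_scale => //; exact: zm].
Qed.

Lemma inm_kill (U : set R^o) n (f : ext n R^o) y : (forall u : R, U u -> y * u = 0) -> inm U f -> y *: f = 0.
Proof.
move=> yU; elim: n f => [|n IH] f; first exact: yU.
by move=> [h1 h2]; apply: pair_eq; exact: IH.
Qed.

Lemma len_graded_inm (U : set R^o) n i : fl U ->
  fl [set f : ext n R^o | prK i f = f /\ inm U f] /\
  len [set f : ext n R^o | prK i f = f /\ inm U f] = ('C(n, i) * len U)%N.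
Proof.
move=> fU; elim: n i => [|n IH] i.
  case: i => [|i]; rewrite ?bin0 ?bin0n ?mul1n ?mul0n.
    have -> : [set f : ext 0 R^o | prK 0 f = f /\ inm U f] = U by apply/seteqP; split=> f // [].
    by [].
  have -> : [set f : ext 0 R^o | prK i.+1 f = f /\ inm U f] = [set 0]; last by split; [exact: fl0|exact: len0].
  by apply/seteqP; split=> [f [<-] //|_ ->]; split=> //; exact: sub0 fU.1.
have h0 : fl [set 0 : ext n R^o] /\ len [set 0 : ext n R^o] = 0%N by split; [exact: fl0|exact: len0].
have [f1 l1] := IH i; case: i f1 l1 => [|i] f1 l1.
  have := len_prod f1 h0.1; rewrite l1 h0.2 !bin0 addn0.
  suff -> : [set p : ext n R^o * ext n R^o | [set f | prK 0 f = f /\ inm U f] p.1 /\ [set 0] p.2] =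
    [set f : ext n.+1 R^o | prK 0 f = f /\ inm U f] by [].
  apply/seteqP; split=> [[f g] /= [[h1 h2] ->]|[f g] [h1 [h2 h3]]] /=.
    by split; [rewrite h1|split=> //; exact: sub0 (subm_inm n fU.1)].
  by case: h1 => h1 <-.
have [f2 l2] := IH i; have := len_prod f1 f2; rewrite l1 l2 binS mulnDl.
suff -> : [set p : ext n R^o * ext n R^o | [set f | prK i.+1 f = f /\ inm U f] p.1 /\ [set f | prK i f = f /\ inm U f] p.2] =
    [set f : ext n.+1 R^o | prK i.+1 f = f /\ inm U f] by [].
apply/seteqP; split=> [[f g] /= [[h1 h2] [h3 h4]]|[f g] [h1 [h2 h3]]] /=.
  by split=> //; rewrite h1 h3.
by case: h1 => h1 h4.
Qed.

End Inm.

(** * Embedding dimension four *)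

Section Four.
Variables (R : comNzRingType) (m : set R^o) (s : R) (gor : gor_local m s).
Variables (b : nat -> nat) (d : forall p, 'M[R]_(b p, b p.+1)) (n0 : nat).
Hypotheses (dP : minres m d) (TI : forall p q, (n0 <= p)%N -> tor_indep d d p q).
Let al := gl_al gor.
Local Notation lam := (len [set: R^o]).
Local Notation m2 := (smul (m : set R) m).
Local Notation m3 := (smul (m : set R) m2).
Local Notation om t := (omega t (uK 4 (1 : R^o))).
Variables (x : nat -> R).
Hypotheses (xm : forall t, m (dot 4 x t)) (xg : forall r, m r -> exists t, r = dot 4 x t)
  (xmin : forall t, m2 (dot 4 x t) -> forall i, (i < 4)%N -> m (t i))
  (x3 : forall u : R, m3 u -> x 0%N * u = 0)
  (lam11 : (lam <= 11)%N) (lamE : (lam = len m2 + 5)%N) (h4 : (len m2 <= len m3 + 4)%N).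
Local Notation I := (@iota R R^o 4 x : {linear ext 4 R^o -> ext 4 R^o}).
Local Notation J := (fun k => iter k (smul (m : set R)) [set: R^o]).

Let xi i : (i < 4)%N -> m (x i).
Proof.
move=> i4; have := xm (fun j => if j == i then 1 else 0); rewrite /dot (bigD1 (Ordinal i4)) //= eqxx mulr1.
by rewrite big1 ?addr0 // => j; rewrite -val_eqE /= => /negPf ->; rewrite mulr0.
Qed.

Let cycle_m t : dot 4 x t = 0 -> forall i, (i < 4)%N -> m (t i).
Proof. by move=> t0; apply: xmin; rewrite t0; exact: sub0 (subm_smul _ _). Qed.

Let J3 : J 3 `<=` m3.
Proof.
do 2!(apply: smul_mono => //); apply: smul_sub; first exact: al_sub.
by move=> a u ma _; rewrite -[_ *: _]/(a * u) mulrC; exact: subZ (al_sub al) ma.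
Qed.

(** For a product of [k] special cycles, the coefficients free of the first generator are in [m^k],
    the others in [x_0 m^(k-1)]. For [k = 4] the former vanish by degree and the latter because
    [x_0] annihilates [m^3]. *)
Let P k (f : ext 4 R^o) : Prop := @inm R R^o (J k) 3 f.1 /\
  exists2 g : ext 3 R^o, inm (J k.-1) g & (f.2 : ext 3 R^o) = x 0%N *: g.

Let P_step k (z : nat -> R) (t : R) (f : ext 4 R^o) : (forall i, (i < 4)%N -> m (z i)) -> z 0%N = x 0%N * t -> P k f -> P k.+1 (omega z f).
Proof.
move=> zm z0 [h1 [g gJ gE]]; have zm' i : (i < 3)%N -> m (z i.+1) by move=> lt; apply: zm.
have sJ : subm (@inm R R^o (J k) 3) by apply: subm_inm; case: (k) => [|k']; [exact: submT|exact: subm_smul].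
split; first exact: (@inm_smul_omega R m (J k) 3 (tl z) f.1).
exists (t *: f.1 - omega (tl z) g).
  apply: (subB sJ); first exact: (subZ _ sJ).
  have h : inm (J k.-1.+1) (omega (tl z) g : ext 3 R^o) by exact: inm_smul_omega.
  by apply: inm_mono h; case: {+}k => [|k'] u.
have E : z 0%N *: f.1 - omega (tl z) (f.2 : ext 3 R^o) = x 0%N *: (t *: f.1 - omega (tl z) (g : ext 3 R^o)) :> ext 3 R^o.
  by rewrite gE z0 omegaZ scalerBr scalerA.
exact: E.
Qed.

Let T z1 z2 z3 z4 : ext 4 R^o := omega z1 (omega z2 (omega z3 (om z4))).

Let T_rot z1 z2 z3 z4 : T z1 z2 z3 z4 = - T z2 z3 z4 z1.
Proof. by rewrite /T (omegaC z1 z2) (omegaC z1 z3) (omegaC z1 z4) !(omegaN, opprK). Qed.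

Let special z := dot 4 x z = 0 /\ exists t, z 0%N = x 0%N * t.

Let T_special z1 z2 z3 z4 : special z1 -> special z2 -> special z3 -> special z4 -> T z1 z2 z3 z4 = 0.
Proof.
move=> [c1 [t1 e1]] [c2 [t2 e2]] [c3 [t3 e3]] [c4 [t4 e4]].
have : P 4 (T z1 z2 z3 z4).
  apply: (P_step (cycle_m c1) e1); apply: (P_step (cycle_m c2) e2); apply: (P_step (cycle_m c3) e3).
  apply: (P_step (cycle_m c4) e4); split; first by rewrite /= .
  by exists 0; [|rewrite scaler0].
move=> [_ [g gJ gE]]; apply: pair_eq.
  have : prK 4 (T z1 z2 z3 z4) = T z1 z2 z3 z4 by rewrite /T !prK_omega prK0_uK.
  move/(congr1 fst) => <-; exact: (@prK_out R R^o 3 4).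
rewrite gE; apply: inm_kill gJ => u /J3; exact: x3.
Qed.

Let dec w : dot 4 x w = 0 -> exists2 w', special w' & forall f : ext 4 R^o, prK 3 f = f -> iota x f = 0 ->
  omega w f = omega w' f.
Proof.
move=> w0; have [t tE] := xg (cycle_m w0 (ltn0Sn 3)); rewrite dotS in tE.
have [w' [w'0 w'1 w'E]] := cycle_modify w0 tE.
by exists w' => //; split=> //; exists (t 0%N).
Qed.

Let T_cycles z1 z2 z3 z4 : dot 4 x z1 = 0 -> dot 4 x z2 = 0 -> dot 4 x z3 = 0 -> dot 4 x z4 = 0 -> T z1 z2 z3 z4 = 0.
Proof.
move=> c1 c2 c3 c4; have [w1 s1 E1] := dec c1; have [w2 s2 E2] := dec c2.
have [w3 s3 E3] := dec c3; have [w4 s4 E4] := dec c4.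
have k (u v w : nat -> R) : dot 4 x u = 0 -> dot 4 x v = 0 -> dot 4 x w = 0 ->
    prK 3 (omega u (omega v (om w))) = omega u (omega v (om w)) /\ iota x (omega u (omega v (om w))) = 0.
  move=> h1 h2 h3; split; first by rewrite !prK_omega prK0_uK.
  by do 3!(apply: omega_iotaE => //); exact: iota_uK.
have [d1 _] := s1; have [d2 _] := s2; have [d3 _] := s3.
have F1 : T z1 z2 z3 z4 = T w1 z2 z3 z4 by apply: E1; case: (k z2 z3 z4).
have F2 : T z2 z3 z4 w1 = T w2 z3 z4 w1 by apply: E2; case: (k z3 z4 w1).
have F3 : T z3 z4 w1 w2 = T w3 z4 w1 w2 by apply: E3; case: (k z4 w1 w2).
have F4 : T z4 w1 w2 w3 = T w4 w1 w2 w3 by apply: E4; case: (k w1 w2 w3).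
by rewrite F1 T_rot F2 T_rot F3 T_rot F4 T_special ?oppr0.
Qed.

Let A : set (ext 4 R^o) := [set f | @Bk R 4 x 2 f \/ exists t t', [/\ dot 4 x t = 0, dot 4 x t' = 0 & f = omega t (om t')]].
Let Q := span A.
Let sQ : subm Q := subm_span A.

Let AZ f : A f -> Zk x 2 f.
Proof.
case=> [[g gE <-]|[t [t' [h h' ->]]]]; split.
- by rewrite prK_iota gE.
- exact: iota_iota.
- by rewrite !prK_omega prK0_uK.
- by do 2!(apply: omega_iotaE => //); exact: iota_uK.
Qed.

Let QZ f : Q f -> Zk x 2 f. Proof. by apply; [exact: Zk_subm|exact: AZ]. Qed.

(** Boundaries are orthogonal to cycles, and two products of 1-cycles pair to the top coefficient of
    a product of four, which is zero. *)
Let Q_isotropic u v : Q u -> Q v -> bil u v = 0.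
Proof.
move=> Qu Qv; suff H u' v' : A u' -> A v' -> bil u' v' = 0.
  apply: (Qu [set u' | bil u' v = 0]) => [|u' Au].
    split=> [|a u1 u2 h1 h2]; first exact: bil0l.
    by rewrite /mkset bilDl bilZl h1 h2 scaler0 addr0.
  apply: (Qv [set v' | bil u' v' = 0]) => [|v' Av]; last exact: H.
  split=> [|a u1 u2 h1 h2]; first exact: bil0r.
  by rewrite /mkset bilDr bilZr h1 h2 scaler0 addr0.
move=> Au Av; have [_ v0] := AZ Av; have [_ u0] := AZ Au; rewrite /mkset.
case: Au u0 => [[g gE <-] _|[t [t' [h h' ->]]] u0]; first by rewrite bil_iota v0 bil0r oppr0.
case: Av v0 => [[g gE <-] _|[z [z' [k k' ->]]] v0].
  have := bil_iota x (alpha (omega t (om t'))) g; rewrite alphaK => E; apply/eqP; rewrite -oppr_eq0 -E.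
  by rewrite -[iota x _]opprK -alpha_iota u0 linear0 oppr0 bil0l.
rewrite bil_omega alpha_omega alpha_uK bilNl bil_omega alpha_uK -[omega t' _]/(T t' t z z') T_cycles //.
by rewrite bil0r oppr0.
Qed.

(** The degree 2 part has length [6 lam], and an isotropic submodule takes up at most half of it. *)
Let lenQ : (2 * len Q <= 6 * lam)%N.
Proof.
pose Pr : {linear ext 4 R^o -> ext 4 R^o} := @prK R R^o 4 2; pose U := [set f | Q (Pr f)].
have sU : subm U by exact: subm_pre.
have flK (W : set (ext 4 R^o)) : subm W -> fl W by exact: (fl_K gor).
have PQ f : Q f -> Pr f = f by move=> /QZ[].
have lU : (len U = len Q + len (ker Pr))%N.
  rewrite (len_exact Pr (flK _ sU)); congr (_ + _)%N; congr len.
    by apply/seteqP; split=> [_ [f Uf <-] //|f Qf]; exists f; [rewrite /U /mkset PQ|exact: PQ].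
  by apply/seteqP; split=> [f []|f f0] //; split=> //; rewrite /U /mkset (f0 : Pr f = 0); exact: sub0.
have lP : (6 * lam + len (ker Pr) = len [set: ext 4 R^o])%N.
  rewrite (len_exact Pr (fl_ext gor 4)) setTI -[6%N]/('C(4, 2)) -(len_Gk gor 4 2); congr (_ + _)%N; congr len.
  by apply/seteqP; split=> [f fE|_ [f _ <-]]; [exists f|rewrite /mkset prK_prK eqxx].
have := len_perp gor (@bil_linear_l R 4) (fl_ext gor 4) (fl_ext gor 4) erefl (@bil_nondeg R 4) sQ.
have : (len U <= len (perp (@bil R 4 : ext 4 R^o -> {linear ext 4 R^o -> R^o}) Q))%N.
  apply: len_sub => //; first exact/flK/subm_perp.
  move=> f Uf u Qu; have := bil_prK u f (isT : 2 <= 4)%N; have -> : prK 2 u = u := PQ _ Qu.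
  by move=> E; transitivity (bil u (prK (4 - 2) f)) => //; exact: Q_isotropic.
have key (u q k l t p : nat) : (6 * l + k = t -> u = q + k -> u <= p -> q + p = t -> 2 * q <= 6 * l)%N by lia.
exact: (key _ _ _ _ _ _ lP lU).
Qed.

Let m3_dot u : m3 u -> exists2 t : nat -> R, forall i, m2 (t i : R^o) & u = dot 4 x t.
Proof.
have s2 : subm m2 by exact: subm_smul.
move=> h; have := h [set u | exists2 t : nat -> R, forall i, m2 (t i : R^o) & u = dot 4 x t]; apply.
  split; first by exists (fun=> 0) => [i|]; [exact: (sub0 s2)|rewrite /dot big1 // => i _; rewrite mulr0].
  move=> a _ _ [t tm ->] [t' tm' ->]; exists (fun i => a * t i + t' i).
    by move=> i; case: s2 => _; apply.
  by rewrite /dot -[_ *: _]/(a * _) mulr_sumr -big_split; apply: eq_bigr => i _ /=; ring.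
move=> _ [a /xg[t ->] [w w2 ->]]; exists (fun i => t i * w); first by move=> i; exact: (subZ (t i) s2 w2).
by rewrite -[_ *: _]/(_ * w) /dot mulr_suml; apply: eq_bigr => i _; rewrite mulrA.
Qed.

(** The differential sends chains of degree 2 with coefficients in [m] to cycles of degree 1 with
    coefficients in [m^2]; the chains of degree 1 with coefficients in [m^2] have an image
    containing [m^3]. Allowing all coefficients in degree 2 instead of those in [m] adds at most
    6. *)
Let len_B1 : (len (@Bk R 4 x 1) + len m3 <= 4 * len m2 + 6)%N.
Proof.
have flR (U : set R^o) : subm U -> fl U by move=> sU; apply: fl_sub (al_fl al) sU _.
have f2 : fl m2 by exact/flR/subm_smul.
have fm : fl m by exact/flR/al_sub.
have flK (W : set (ext 4 R^o)) : subm W -> fl W by exact: (fl_K gor).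
pose N := [set f : ext 4 R^o | prK 2 f = f /\ inm m f].
pose W := [set f : ext 4 R^o | prK 1 f = f /\ inm m2 f].
have [fN lN] : fl N /\ len N = (6 * len m)%N by exact: (len_graded_inm 4 2 fm).
have [fW lW] : fl W /\ len W = (4 * len m2)%N by exact: (len_graded_inm 4 1 f2).
pose G := [set f : ext 4 R^o | prK 2 f = f].
have lG : len G = (6 * lam)%N by exact: (len_Gk gor 4 2).
have fG : fl G by exact/flK/Gk_subm.
have e1 := len_exact I fG; have e2 := len_exact I fN; have e3 := len_exact I fW.
have k1 : (len (N `&` ker I) <= len (G `&` ker I))%N.
  apply: len_sub; [exact/flK/submI/subm_ker/(fG.1)|exact: submI fN.1 (subm_ker I)|].
  by move=> f [[h _] k]; split.
have k2 : (len (I @` N) <= len (W `&` ker I))%N.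
  apply: len_sub; [exact/flK/submI/subm_ker/(fW.1)|exact: subm_img fN.1|].
  move=> _ [f [h k] <-]; split; last exact: iota_iota.
  by split; [have := prK_iota 1 x f; rewrite h|exact: inm_smul_iota].
have k3 : (len m3 <= len (I @` W))%N.
  have f3 : fl m3 by exact/flR/subm_smul.
  have <- := len_inj (f := @uK R R^o 4 : {linear R^o -> ext 4 R^o}) f3; last first.
    by move=> a _ /(congr1 (@cK R R^o 4)); rewrite cK_uK linear0.
  apply: len_sub; [exact: fl_img|exact: subm_img f3.1|].
  move=> _ [u /m3_dot[t tm ->] <-]; exists (om t).
    split; first by rewrite prK_omega prK0_uK.
    have : forall n (t' : nat -> R), (forall i, m2 (t' i : R^o)) -> inm m2 (omega t' (uK n (1 : R^o)) : ext n R^o).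
      elim=> [|n IH] t' h; first exact: sub0 f2.1.
      split=> /=; first exact: IH.
      rewrite linear0 subr0 -uK_scale.
      have : forall k (a : R^o), m2 a -> inm m2 (uK k a : ext k R^o).
        by elim=> [//|k IHk] a ha; split; [exact: IHk|exact: sub0 (subm_inm k f2.1)].
      by apply.
    by apply.
  rewrite -[LHS]/(iota x (om t)) iota_omega iota_uK linear0 subr0; exact: esym (uK_scale 4 (dot 4 x t)).
have [lm _] := len_m gor.
move: e1 e2 e3; rewrite lN lW lG.
have -> : I @` G = @Bk R 4 x 1 by [].
have key (l lm3 lm2 lm1 gi gk ni nk wi wk : nat) : (lm1.+1 = l -> 6 * l = gi + gk -> 6 * lm1 = ni + nk -> 4 * lm2 = wi + wk ->
  nk <= gk -> ni <= wk -> lm3 <= wi -> gi + lm3 <= 4 * lm2 + 6)%N by lia.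
move=> e1 e2 e3; exact: key lm e1 e2 e3 k1 k2 k3.
Qed.

Let zeta3 : (lam + 5 <= zeta 4 x 3)%N.
Proof. by have := perp_Bk gor x (leqnSn 3); rewrite (_ : 'C(4, 3) = 4) // (_ : 4 - 3 = 1)%N //; have := len_B1; lia. Qed.

(** Half of [6 lam] exceeds the length [4 lam - zeta_3] of the 2-boundaries by [zeta_3 - lam], which
    is the value of [t0]; the sums of consecutive [alpha] then eliminate the [alpha] terms. *)
Let growth q : (b (q + 4) + (zeta 4 x 3 - lam) * b (q + 3) <= b (q + 5) + (zeta 4 x 3 - lam) * b (q + 1) + b q)%N.
Proof.
have B2 := zeta_exact gor 4 x 2; rewrite (_ : 'C(4, 3) = 4) // in B2.
have B1 := zeta_exact gor 4 x 1; rewrite (_ : 'C(4, 2) = 6) // in B1.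
have B3 := perp_Bk gor x (leqnSn 3); rewrite (_ : 'C(4, 3) = 4) // (_ : 4 - 3 = 1)%N // in B3.
have lQ : (len Q <= len (@Bk R 4 x 2) + (zeta 4 x 3 - lam))%N by have := lenQ; have := zeta3; lia.
have BQ : @Bk R 4 x 2 `<=` Q by move=> f h; apply: span_incl; left.
have ZQ t t' : dot 4 x t = 0 -> dot 4 x t' = 0 -> Q (omega t (om t')).
  by move=> h h'; apply: span_incl; right; exists t, t'.
have := koszul_growth gor xm xg dP sQ BQ ZQ lQ q.
rewrite (_ : 'C(4, 3) = 4) // (_ : 'C(4, 2) = 6) // binn (zeta1 gor xm xg isT) (zeta_top gor xm xg).
have Z2 : (zeta 4 x 2 = 2 * lam + zeta 4 x 3)%N by lia.
rewrite Z2; have := zeta3; set c := (zeta 4 x 3 - lam)%N => z3.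
have -> : zeta 4 x 3 = (lam + c)%N by rewrite /c subnKC //; lia.
have := len_Aim gor dP (q + 3); have := len_Aim gor dP (q + 2); have := len_Aim gor dP (q + 1); have := len_Aim gor dP q.
rewrite -!addnS addn1.
have key (l c' b0 b1 b2 b3 b4 b5 a0 a1 a2 a3 a4 : nat) : (a0 + a1 = b1 * l -> a1 + a2 = b2 * l -> a2 + a3 = b3 * l -> a3 + a4 = b4 * l ->
   ((4 - 1) * l + 1) * b4 + (2 * l + (l + c')) * b3 + (l + c') * b2 + 1 * a0 + a4 <=
   4 * a4 + b5 + 6 * a3 + 4 * a2 + c' * b2 + (l + c') * b1 + 1 * b0 -> b4 + c' * b3 <= b5 + c' * b1 + b0)%N.
  by nia.
exact: key.
Qed.

Theorem zero_betti4 : exists p, b p = 0%N.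
Proof.
apply: contrapT => h; have bp p : (0 < b p)%N.
  by rewrite lt0n; apply/eqP => E; apply: h; exists p.
apply: (no_growth (n0 := n0) bp _ _ _ growth).
- by have := zeta3; lia.
- by move=> p np; exact: (betti_ratio gor dP TI).
- move=> p np; apply: leq_trans (betti_square2 gor dP TI (e := 4) np _) _; first by rewrite lamE -addnA.
  by rewrite leq_add2r leq_mul2r lam11 orbT.
Qed.

End Four.

(** * Choice of generators *)

Section MaximalIdealPowers.
Variables (R : comNzRingType) (m : set R^o) (s : R) (gor : gor_local m s).
Let al := gl_al gor.
Let sm : subm m := al_sub al.
Local Notation lam := (len [set: R^o]).
Local Notation m2 := (smul (m : set R) m).
Local Notation m3 := (smul (m : set R) m2).

Let flR (U : set R^o) : subm U -> fl U.
Proof. by move=> sU; apply: fl_sub (al_fl al) sU _. Qed.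
Let s2 : subm m2. Proof. exact: subm_smul. Qed.
Let s3 : subm m3. Proof. exact: subm_smul. Qed.

Section Relations.
Variables (r : nat) (v : 'I_r -> R^o).
Let Ff (c : 'I_r -> R^o) : R^o := \sum_i c i *: v i.
Let Fl : linear Ff.
Proof.
move=> a c c'; rewrite /Ff scaler_sumr -big_split; apply: eq_bigr => i _ /=.
by rewrite scalerA -scalerDl.
Qed.
Let F : {linear ('I_r -> R^o) -> R^o} := HB.pack Ff (GRing.isLinear.Build _ _ _ _ Ff Fl).

Let rangeF : range F = gen v.
Proof. by apply/seteqP; split=> [_ [c _ <-]|_ [c ->]]; exists c. Qed.

Let fT : fl [set: 'I_r -> R^o].
Proof. by have [h _] := len_pow r (al_fl al); apply: fl_sub h _ _. Qed.
Let lenT : len [set: 'I_r -> R^o] = (r * lam)%N.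
Proof. by have [_ <-] := len_pow r (al_fl al); congr len; apply/seteqP; split. Qed.
Let lenM : fl [set c : 'I_r -> R^o | forall i, m (c i)] /\ (len [set c : 'I_r -> R^o | forall i, m (c i)] + r = r * lam)%N.
Proof. by have [h ->] := len_pow r (flR sm); split=> //; have [<- _] := len_m gor; rewrite mulnS addnC. Qed.

Let pre (U : set R^o) : subm U -> fl (F @^-1` U) /\ (len (F @^-1` U) + len (gen v) = r * lam + len (gen v `&` U))%N.
Proof.
move=> sU; have fP : fl (F @^-1` U) by apply: fl_sub fT (subm_pre F sU) _.
split=> //; have := len_exact F fT; rewrite setTI rangeF lenT => ->; rewrite (len_exact F fP).
have -> : F @` (F @^-1` U) = gen v `&` U.
  apply/seteqP; split=> [_ [c Uc <-]|_ [[c ->] Uc]]; last by exists c.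
  by split=> //; exists c.
have -> : F @^-1` U `&` ker F = ker F.
  apply/seteqP; split=> [c []|c c0] //; split=> //; rewrite /mkset /preimage /= (c0 : Ff c = 0); exact: sub0.
have key (i k g : nat) : (i + k + g = g + k + i)%N by lia.
exact: key.
Qed.

(** Otherwise all relations modulo [U'] have coefficients in [m], and adding the elements [v i] to
    [U'] would raise the length by at least [r] inside [U]. *)
Lemma relation_exists (U U' : set R^o) : subm U -> subm U' -> U' `<=` U -> (forall i, U (v i)) ->
  (len U < len U' + r)%N -> exists c : 'I_r -> R, U' (\sum_i c i *: v i) /\ exists i, ~ m (c i).
Proof.
move=> sU sU' UU Uv lt; apply: contrapT => h; have [fP lP] := pre sU'; have [fM lM] := lenM.
have l1 : (len (F @^-1` U') <= len [set c : 'I_r -> R^o | forall i, m (c i)])%N.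
  apply: len_sub => //; first exact: fP.1.
  by move=> c Uc i; apply: contrapT => ci; apply: h; exists c; split=> //; exists i.
have sg := subm_gen v; have [_ la] := len_add (flR sg) (flR sU').
have l2 : (len (addm (gen v) U') <= len U)%N.
  apply: len_sub; [exact: flR|exact: subm_add|]; apply: addm_sub => //; exact: gen_sub.
move: lP lM l1 la l2 lt; set a := len _; set g := len _; set i := len _; set k := len _; set t := len _; set w := (_ * _)%N.
by set aa := len (addm _ _); lia.
Qed.

Lemma minimal_relations (U : set R^o) : gen v = U -> (len U = len (smul (m : set R) U) + r)%N ->
  forall c : 'I_r -> R, smul (m : set R) U (\sum_i c i *: v i) -> forall i, m (c i).
Proof.
move=> vU lU c Uc; have sU0 : subm U by rewrite -vU; exact: subm_gen.
have sU : subm (smul (m : set R) U) by exact: subm_smul.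
have [fP lP] := pre sU; have [fM lM] := lenM.
suff E : [set c : 'I_r -> R^o | forall i, m (c i)] = F @^-1` smul (m : set R) U.
  have : (F @^-1` smul (m : set R) U) c by exact: Uc.
  by rewrite -E.
apply: len_eq => //; first exact: fM.1.
  move=> c' c'm; apply: sub_sum => // i _; apply: smul_incl; first exact: c'm.
  rewrite -vU; exact: gen_in.
move: lP; rewrite vU; have -> : U `&` smul (m : set R) U = smul (m : set R) U.
  by apply/seteqP; split=> [z []|z h] //; split=> //; exact: (smul_subr sU0 h).
have key (a u w u' k : nat) : (k + r = w -> u = u' + r -> a + u = w + u' -> a <= k)%N by lia.
exact: key lM lU.
Qed.

End Relations.

Lemma m2_sub : m2 `<=` m. Proof. exact: smul_subr. Qed.
Lemma m3_sub : m3 `<=` m2. Proof. exact: smul_subr. Qed.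

Lemma len_maxideal : (lam = (len m2 + nu m m).+1)%N.
Proof.
have [<- _] := len_m gor; rewrite /nu subnKC //.
by apply: len_sub => //; [exact: flR|exact: m2_sub].
Qed.

(** The hypothesis makes [m^2] annihilate itself, and the lengths of an ideal and of its annihilator
    add up to [lam]. *)
Lemma m2_half : (forall a u : R, m a -> m3 u -> a * u = 0) -> (len m2 <= (nu m m).+1)%N.
Proof.
move=> h; have : (len m2 <= len (ann m2))%N.
  apply: len_sub; [exact/flR/subm_ann|exact: s2|] => u hu w hw.
  have := hw [set w : R^o | (w : R) * u = 0]; apply.
    split=> [|a x y h1 h2]; first by rewrite /mkset mul0r.
    by rewrite /mkset mulrDl -[a *: x]/(a * x) -mulrA h1 h2 mulr0 addr0.
  move=> _ [a ma [c mc ->]]; rewrite /mkset -[_ *: _]/(a * c) -mulrA; apply: h => //.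
  by have := smul_incl mc hu.
have := len_ann gor s2; have := len_maxideal; lia.
Qed.

(** By Nakayama's lemma [m] times a nonzero [m^3] is strictly shorter than [m^3]. *)
Lemma len_m3_le1 : (len m3 <= 1)%N -> forall a u : R, m a -> m3 u -> a * u = 0.
Proof.
move=> l1 a u ma hu; apply: contrapT => n0.
have lt : (len (smul (m : set R) m3) < len m3)%N.
  rewrite ltnNge; apply/negP => le.
  have E := len_eq (flR s3) (subm_smul _ _) (smul_subr (I := m) s3) le.
  have Z : m3 `<=` [set 0].
    by apply: (nakayama al (subm0 _)); rewrite E => y y3; exists 0 => //; exists y; rewrite ?add0r.
  by apply: n0; rewrite (Z u hu : u = 0) mulr0.
have E : smul (m : set R) m3 = [set 0] by apply: len_eq0; [exact/flR/subm_smul|lia].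
by have : [set 0 : R^o] (a *: (u : R^o)) by rewrite -E; exact: smul_incl.
Qed.

Lemma generators n : nu m m = n -> exists x : nat -> R, [/\ forall t, m (dot n x t),
  forall r, m r -> exists t, r = dot n x t & forall t, m2 (dot n x t) -> forall i, (i < n)%N -> m (t i)].
Proof.
move=> <-; have [v [vE vmin]] := mingens al (flR sm).
pose x i : R := if insub i is Some j then v j else 0.
have dE t : dot (nu m m) x t = \sum_i t (nat_of_ord i) *: v i.
  by apply: eq_bigr => i _; rewrite /x valK mulrC.
exists x; split=> [t|r|t].
- have h : gen v (dot (nu m m) x t) by rewrite dE; exists (fun i => t (nat_of_ord i)).
  by rewrite -vE in h.
- move=> mr; have [c ->] : gen v r by rewrite -vE.
  exists (fun i => if insub i is Some j then c j else 0).
  by rewrite dE; apply: eq_bigr => i _; rewrite valK.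
- rewrite dE => /vmin h i lt; exact: (h (Ordinal lt)).
Qed.

Section Exchange.
Hypothesis e4 : nu m m = 4.
Variable y : R.
Hypotheses (ym : m y) (y2 : ~ m2 y).

Lemma generators_exchange : exists x : nat -> R, [/\ x 0%N = y, forall t, m (dot 4 x t),
  forall r, m r -> exists t, r = dot 4 x t & forall t, m2 (dot 4 x t) -> forall i, (i < 4)%N -> m (t i)].
Proof.
pose Y : set R^o := [set z : R^o | exists r : R, z = r *: (y : R^o)]; pose U' := addm m2 Y.
have sY : subm Y := subm_cyclic (y : R^o); have sU' : subm U' by exact: subm_add.
have yY : Y y by exists 1; rewrite scale1r.
have lU : len U' = (len m2).+1.
  apply/eqP; rewrite eqn_leq; apply/andP; split.
    by case: (len_addcyc (al_unit al) (a := y : R^o) (flR s2) (fun a ma => smul_incl ma ym)).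
  apply: len_ltE; [exact: flR|exact: s2|exact: addmL|].
  by exists (y : R^o) => //; exact: (addmR s2).
have Um : U' `<=` m.
  by apply: addm_sub => //; [exact: m2_sub|move=> _ [r ->]; exact: subZ].
have [v [_ vE]] := ext_gens al (flR sm) sU' Um (addmL sY).
have n3 : (len m - len U' = 3)%N by have := len_maxideal; have [<- _] := len_m gor; rewrite lU; lia.
rewrite n3 in v vE.
pose x i : R := if i is j.+1 then v (inord j) else y.
have dE t : dot 4 x t = t 0%N *: (y : R^o) + \sum_(i < 3) t i.+1 *: v i.
  rewrite dotS /dot mulrC; congr (_ + _); apply: eq_bigr => i _.
  by rewrite /x inord_val mulrC.
have vm i : m (v i) by rewrite vE; apply: (addmR sU'); exact: gen_in.
have xm t : m (dot 4 x t).
  by rewrite dE; apply: subD => //; [exact: subZ|apply: sub_sum => // i _; exact: subZ].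
have xg r : m r -> exists t, r = dot 4 x t.
  have := nakayama al (subm_dot 4 x) (U := m); apply=> {}r; rewrite [in X in X -> _]vE.
  move=> [_ [u hu [_ [a ->] ->]] [_ [c ->] ->]]; exists (a *: (y : R^o) + \sum_i c i *: v i).
    exists (fun i => if i is j.+1 then c (inord j) else a); rewrite dE; congr (_ + _).
    by apply: eq_bigr => i _; rewrite inord_val.
  by exists u => //; rewrite -addrA addrC.
exists x; split=> // t t2 i i4; pose w (i : 'I_4) : R^o := x i.
have wE : gen w = m.
  apply/seteqP; split=> [_ [c ->]|r /xg[t' ->]].
    apply: sub_sum => // j _; apply: subZ => //; rewrite /w.
    have := xm (fun k => if k == j :> nat then 1 else 0); rewrite /dot (bigD1 j) //= eqxx mulr1.
    by rewrite big1 ?addr0 // => k; rewrite -val_eqE /= => /negPf ->; rewrite mulr0.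
  by exists (fun i => t' i); apply: eq_bigr => j _; rewrite mulrC.
have lE : (len m = len m2 + 4)%N by have := len_maxideal; have [<- _] := len_m gor; rewrite e4; lia.
have := minimal_relations wE lE (c := fun i => t i); move=> h; apply: (h _ (Ordinal i4)).
by have -> : \sum_i t (nat_of_ord i) *: w i = dot 4 x t by apply: eq_bigr => j _; rewrite mulrC.
Qed.

End Exchange.

(** If there is none, then [ann m3] lies in [m^2], and duality leaves only the lengths 6 and 5 for
    [m^2] and [m^3], with [ann m3] equal to [m^2]. Then [m^2] is generated by one product [p q], and
    [p m^2] contains [m^3], so multiplication by [p] has a kernel of length at most 1 on [m^2]. But
    [p^2] annihilates [m^3], so [p m^3], of length at least 4, is in that kernel. *)
Lemma annihilator_m3 : nu m m = 4 -> (lam <= 11)%N -> exists y : R, [/\ m y, ~ m2 y & forall u : R, m3 u -> y * u = 0].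
Proof.
move=> e4 lam11; have lE := len_maxideal; have [lm _] := len_m gor; apply: contrapT => h.
have A2 : ann m3 `<=` m2.
  move=> y hy; apply: contrapT => ny; have [my|/(al_unit al)[w wy]] := pselect (m y).
    by apply: h; exists y; split=> // u /hy; rewrite mulrC.
  have [z mz nz] : exists2 z, m z & ~ m2 z.
    apply: contrapT => k; have : (len m <= len m2)%N.
      by apply: len_sub => //; [exact: flR|move=> z mz; apply: contrapT => nz; apply: k; exists z].
    by move: lm lE; rewrite e4; lia.
  apply: h; exists z; split=> // u /hy uy.
  have -> : u = 0 by rewrite -[u]mulr1 -wy mulrCA uy mulr0.
  by rewrite mulr0.
have l1 : (len (ann m3) <= len m2)%N by apply: len_sub => //; [exact: flR|exact: subm_ann].
have l2 := len_ann gor s3.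
have m30 : (0 < len m3)%N by lia.
have lt : (len m3 < len m2)%N.
  rewrite ltnNge; apply/negP => le; have E := len_eq (flR s2) s3 m3_sub le.
  have E0 : m2 = [set 0].
    apply/seteqP; split=> [|_ ->]; last exact: sub0.
    apply: (nakayama al (subm0 _)) => y y2; exists 0 => //; exists y; last by rewrite add0r.
    by rewrite E.
  by move: m30; rewrite E E0 len0.
have [L6 l35] : len m2 = 6 /\ len m3 = 5%N by lia.
have AE : ann m3 = m2 by apply: len_eq => //; [exact: flR|exact: subm_ann|lia].
have [p [q [mp mq npq]]] : exists p q, [/\ m p, m q & ~ m3 (p * q)].
  apply: contrapT => k; have : (len m2 <= len m3)%N; last by lia.
  apply: len_sub; [exact: flR|exact: s2|]; apply: smul_sub => // a u ma mu.
  by apply: contrapT => n; apply: k; exists a, u.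
have pq2 : m2 (p * q) by exact: smul_incl.
pose Y : set R^o := [set z : R^o | exists r : R, z = r *: (p * q : R^o)].
have sY : subm Y := subm_cyclic (p * q : R^o).
have YE : m2 `<=` Y.
  apply: (nakayama al sY); have E : addm Y m3 = m2; last by rewrite E.
  have sA : subm (addm Y m3) by exact: subm_add.
  have Am : addm Y m3 `<=` m2.
    by apply: addm_sub => //; [move=> _ [r ->]; exact: (subZ r s2 pq2)|exact: m3_sub].
  apply: len_eq => //; first exact: flR.
  have : (len m3 < len (addm Y m3))%N; last by lia.
  apply: len_ltE; [exact: flR|exact: s3|exact: addmR|].
  by exists (p * q : R^o) => //; apply: addmL => //; exists 1; rewrite scale1r.
pose gf (u : R^o) : R^o := p * u.
have gl : linear gf by move=> a u w; rewrite /gf mulrDr -[a *: u]/(a * u) mulrCA.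
pose G : {linear R^o -> R^o} := HB.pack gf (GRing.isLinear.Build _ _ _ _ gf gl).
have e2 := len_exact G (flR s2); have e3 := len_exact G (flR s3).
have k3 : (len m3 <= len (G @` m2))%N.
  apply: len_sub => //; [exact: fl_img (flR s2)|].
  apply: smul_sub; first exact: subm_img.
  move=> a u ma /YE[r ->]; exists (r *: (a * q : R^o)); first exact: (subZ r s2 (smul_incl ma mq)).
  by rewrite /= /gf -!/(_ * _) -[_ *: (a * q : R^o)]/(r * (a * q)) -[a *: _]/(a * (r * (p * q))); ring.
have k4 : (len (m3 `&` ker G) <= len (m2 `&` ker G))%N.
  apply: len_sub; [exact/flR/submI/subm_ker|exact: submI s3 (subm_ker G)|].
  by move=> u [/m3_sub h1 h2]; split.
have k5 : (len (G @` m3) <= len (m2 `&` ker G))%N.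
  apply: len_sub; [exact/flR/submI/subm_ker|exact: subm_img|].
  move=> _ [u hu <-]; split; first exact: (m3_sub (subZ p s3 hu)).
  rewrite /ker /mkset /= /gf mulrA; have : ann m3 (p * p) by rewrite AE; exact: smul_incl.
  by move=> /(_ u hu); rewrite mulrC.
have key (l l' g k g' k' : nat) : (l = 6 -> l' = 5 -> l = g + k -> l' = g' + k' -> l' <= g -> k' <= k -> ~ g' <= k)%N by lia.
exact: key L6 l35 e2 e3 k3 k4 k5.
Qed.

Section Triples.
Hypothesis m35 : (len m2 < len m3 + 6)%N.

(** A minimal system of generators of [m]: minimality is expressed by the coefficients of the
    relations. *)
Let good (a b c : R) := [/\ m a, m b & m c] /\ [/\ forall r : R, m r -> exists p q t : R, r = a * p + b * q + c * t
  & forall p q t : R, a * p + b * q + c * t = 0 -> [/\ m p, m q & m t]].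

Let good_swap a b c : good a b c -> good b a c.
Proof.
move=> [[ma mb mc] [g h]]; split=> //; split=> [r /g[p [q [t ->]]]|p q t].
  by exists q, p, t; rewrite [b * q + _]addrC.
by rewrite [b * p + _]addrC => /h[].
Qed.

Let good_rot a b c : good a b c -> good b c a.
Proof.
move=> [[ma mb mc] [g h]]; split=> //; split=> [r /g[p [q [t ->]]]|p q t E].
  by exists q, t, p; ring.
have /h[] // : a * t + b * p + c * q = 0.
by rewrite -E; ring.
Qed.

Let good_shear a b c : good a b c -> good b (a - b) c.
Proof.
move=> [[ma mb mc] [g h]]; split; first by split=> //; exact: (subB sm ma mb).
split=> [r /g[p [q [t ->]]]|p q t E].
  by exists (p + q), p, t; ring.
have /h[mq mpq mt] : a * q + b * (p - q) + c * t = 0 by rewrite -E; ring.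
by split=> //; rewrite -[p](subrK q); exact: (subD sm mpq mq).
Qed.

(** Modulo [(b, c)] the ideal [m^2] is generated by [a^2] and [m^3] by [m a^2], so the unit [k0]
    minus an element of [m] multiplies [a^2] into [(b, c)]. *)
Let good_quad (a b c k0 k1 k2 k3 k4 k5 : R) : good a b c -> ~ m k0 ->
  m3 (k0 * (a * a) + k1 * (b * b) + k2 * (c * c) + k3 * (a * b) + k4 * (a * c) + k5 * (b * c)) ->
  exists p q : R, a * a = b * p + c * q.
Proof.
move=> [_ [g _]] /(al_unit al)[u uk] h.
pose D : set R^o := [set z : R^o | exists p q, z = b * p + c * q].
have sD : subm D.
  split=> [|r _ _ [p [q ->]] [p' [q' ->]]]; first by exists 0, 0; rewrite !mulr0 addr0.
  by exists (r * p + p'), (r * q + q'); rewrite -[_ *: _]/(r * _); ring.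
have D2 : m2 `<=` [set z : R^o | exists w, D (z - a * a * w)].
  apply: smul_sub.
    split=> [|r z z' [w h1] [w' h2]]; first by exists 0; rewrite mulr0 subr0; exact: sub0.
    exists (r * w + w'); have := subD sD (subZ r sD h1) h2.
    by congr (D _); rewrite -[_ *: z]/(r * z) -[_ *: (_ - _)]/(r * _); ring.
  move=> z z' /g[p [q [t ->]]] /g[p' [q' [t' ->]]]; exists (p * p').
  exists (a * p * q' + a * p' * q + b * q * q' + c * t * q'), (a * p * t' + a * p' * t + b * q * t' + c * t * t').
  by rewrite -[_ *: _]/(_ * _); ring.
have D3 : m3 `<=` [set z : R^o | exists2 w, m w & D (z - a * a * w)].
  apply: smul_sub.
    split=> [|r z z' [w mw h1] [w' mw' h2]]; first by exists 0; [exact: sub0|rewrite mulr0 subr0; exact: sub0].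
    exists (r * w + w'); first by case: sm => _; apply.
    have := subD sD (subZ r sD h1) h2.
    by congr (D _); rewrite -[_ *: z]/(r * z) -[_ *: (_ - _)]/(r * _); ring.
  move=> z z' mz /D2[w Dw]; exists (z * w); first by rewrite mulrC; exact: subZ.
  by have := subZ z sD Dw; congr (D _); rewrite -[_ *: z']/(z * z') -[_ *: (_ - _)]/(z * _); ring.
have [w mw [p [q E]]] := D3 _ h.
have : ~ m (1 - u * w).
  move=> n; apply: (al_proper al); have := subD sm n (subZ u sm mw).
  by rewrite -[u *: _]/(u * w) subrK.
move=> /(al_unit al)[v vE].
exists (v * u * (p - k1 * b - k3 * a - k5 * c)), (v * u * (q - k2 * c - k4 * a)).
have E2 : k0 * (a * a) - a * a * w = b * (p - k1 * b - k3 * a - k5 * c) + c * (q - k2 * c - k4 * a).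
  have -> : b * (p - k1 * b - k3 * a - k5 * c) + c * (q - k2 * c - k4 * a) =
    (b * p + c * q) - (k1 * (b * b) + k2 * (c * c) + k3 * (a * b) + k4 * (a * c) + k5 * (b * c)) by ring.
  by rewrite -E; ring.
have -> : a * a = v * u * (k0 * (a * a) - a * a * w).
  transitivity (v * ((u * k0) * (a * a) - u * w * (a * a))); last by ring.
  by rewrite uk mul1r -[X in X - _]mul1r -mulrBl mulrA vE mul1r.
by rewrite E2; ring.
Qed.

(** The six quadratic monomials satisfy a relation modulo [m^3] with a unit coefficient. If it
    belongs to a square, [good_quad] applies. If it belongs to [a b] and the coefficients of the
    squares are in [m], substituting [a = b + (a - b)] gives [b^2] a unit coefficient, in every
    characteristic. *)
Lemma three_generators : nu m m = 3 -> exists x c : nat -> R, [/\ forall t, m (dot 3 x t),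
  forall r, m r -> exists t, r = dot 3 x t, x 0%N * x 0%N = dot 2 (tl x) c
  & forall t, x 0%N <> dot 2 (tl x) t].
Proof.
move=> e3; have [x [xm xg xmin]] := generators e3.
have d3 (t : nat -> R) : dot 3 x t = x 0%N * t 0%N + x 1%N * t 1%N + x 2%N * t 2%N.
  by rewrite /dot !big_ord_recl big_ord0 /= addr0 addrA.
have gx : good (x 0%N) (x 1%N) (x 2%N).
  split; first split.
  - by have := xm (nth 0 [:: 1; 0; 0]); rewrite d3 /= !mulr0 !addr0 mulr1.
  - by have := xm (nth 0 [:: 0; 1; 0]); rewrite d3 /= !mulr0 addr0 add0r mulr1.
  - by have := xm (nth 0 [:: 0; 0; 1]); rewrite d3 /= !mulr0 !add0r mulr1.
  split=> [r /xg[t ->]|p q t E]; first by exists (t 0%N), (t 1%N), (t 2%N).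
  have := xmin (nth 0 [:: p; q; t]); rewrite d3 /= E => /(_ (sub0 s2)) h.
  by split; [exact: (h 0%N)|exact: (h 1%N)|exact: (h 2%N)].
suff [a [b [c [[[ma mb mc] [g h]] [p [q E]]]]]] : exists a b c : R, good a b c /\ exists p q : R, a * a = b * p + c * q.
  exists (nth 0 [:: a; b; c]), (nth 0 [:: p; q]).
  have d3' (t : nat -> R) : dot 3 (nth 0 [:: a; b; c]) t = a * t 0%N + b * t 1%N + c * t 2%N.
    by rewrite /dot !big_ord_recl big_ord0 /= addr0 addrA.
  have d2' (t : nat -> R) : dot 2 (tl (nth 0 [:: a; b; c])) t = b * t 0%N + c * t 1%N.
    by rewrite /dot !big_ord_recl big_ord0 /= addr0.
  split=> [t|r /g[p' [q' [t' ->]]]||t].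
  - have mM (z w : R) : m z -> m (z * w) by move=> mz; rewrite mulrC; exact: (subZ w sm mz).
    by rewrite d3'; exact: (subD sm (subD sm (mM _ _ ma) (mM _ _ mb)) (mM _ _ mc)).
  - by exists (nth 0 [:: p'; q'; t']); rewrite d3'.
  - by rewrite d2'.
  rewrite d2' /= => E1; have [] := h 1 (- t 0%N) (- t 1%N); last by move=> m1; case: (al_proper al).
  by rewrite E1; ring.
pose v : 'I_6 -> R^o := fun i => nth 0 [:: x 0%N * x 0%N; x 1%N * x 1%N; x 2%N * x 2%N; x 0%N * x 1%N; x 0%N * x 2%N; x 1%N * x 2%N] i.
have [[m0 m1 m2'] _] := gx.
have vm i : m2 (v i) by case: i => -[|[|[|[|[|[|//]]]]]] i6; exact: smul_incl.
have [k [hk [i ki]]] := relation_exists s2 s3 m3_sub vm m35.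
pose K j : R := k (inord j).
have {}hk : m3 (K 0%N * (x 0%N * x 0%N) + K 1%N * (x 1%N * x 1%N) + K 2%N * (x 2%N * x 2%N) + K 3%N * (x 0%N * x 1%N) +
   K 4%N * (x 0%N * x 2%N) + K 5%N * (x 1%N * x 2%N)).
  move: hk; congr (m3 _); transitivity (\sum_(j < 6) K j * v j).
    by apply: eq_bigr => j _; rewrite /K inord_val.
  by rewrite !big_ord_recl big_ord0 /= addr0 !addrA.
have {}ki : ~ m (K i) by rewrite /K inord_val.
move: (x 0%N) (x 1%N) (x 2%N) gx hk => y0 y1 y2 gy hk.
have quad (a b c k0 k1 k2 k3 k4 k5 : R) : good a b c -> ~ m k0 ->
    K 0%N * (y0 * y0) + K 1%N * (y1 * y1) + K 2%N * (y2 * y2) + K 3%N * (y0 * y1) + K 4%N * (y0 * y2) + K 5%N * (y1 * y2) =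
    k0 * (a * a) + k1 * (b * b) + k2 * (c * c) + k3 * (a * b) + k4 * (a * c) + k5 * (b * c) ->
    exists a b c : R, good a b c /\ exists p q : R, a * a = b * p + c * q.
  move=> gabc nk E; have h := hk; rewrite E in h.
  by exists a, b, c; split=> //; exact: (good_quad gabc nk h).
have [k0|/(quad y0 y1 y2) q0] := pselect (m (K 0%N)); last by apply: q0 => //; ring.
have [k1|/(quad y1 y0 y2) q1] := pselect (m (K 1%N)); last first.
  by apply: (q1 (K 0%N) (K 2%N) (K 3%N) (K 5%N) (K 4%N)); [exact: good_swap|ring].
have [k2|/(quad y2 y0 y1) q2] := pselect (m (K 2%N)); last first.
  by apply: (q2 (K 0%N) (K 1%N) (K 4%N) (K 5%N) (K 3%N)); [exact/good_rot/good_rot|ring].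
have nD a b c : m a -> m b -> ~ m c -> ~ m (a + b + c) by move=> ma mb nc; move=> /(subDl sm (subD sm ma mb)).
have [k3|nk3] := pselect (m (K 3%N)); last first.
  apply: (quad y1 (y0 - y1) y2 _ (K 0%N) (K 2%N) (2%:R * K 0%N + K 3%N) (K 4%N + K 5%N) (K 4%N) _ (nD _ _ _ k0 k1 nk3)).
    exact: good_shear.
  by ring.
have [k4|nk4] := pselect (m (K 4%N)); last first.
  apply: (quad y2 (y0 - y2) y1 _ (K 0%N) (K 1%N) (2%:R * K 0%N + K 4%N) (K 3%N + K 5%N) (K 3%N) _ (nD _ _ _ k0 k2 nk4)).
    by apply: good_shear; exact/good_swap/good_rot/good_rot.
  by ring.
have [k5|nk5] := pselect (m (K 5%N)); last first.
  apply: (quad y2 (y1 - y2) y0 _ (K 1%N) (K 0%N) (2%:R * K 1%N + K 5%N) (K 3%N + K 4%N) (K 3%N) _ (nD _ _ _ k1 k2 nk5)).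
    by apply: good_shear; exact: good_rot.
  by ring.
by case: i ki => -[|[|[|[|[|[|//]]]]]] i6 ki; case: ki.
Qed.

End Triples.

End MaximalIdealPowers.

(** The length of [m^2] is at most [10 - e], which is enough for the bounds required in embedding
    dimensions 3 and 4 when [m^3] has length at least 2. If that length is at most 1, then [m^2] has
    length at most [e + 1] by [m2_half], and if [m^3] is zero, [m^2] lies in the socle. *)
Lemma small_embdim_betti (R : comNzRingType) (m : set R^o) (s : R) (gor : gor_local m s) (b : nat -> nat)
    (d : forall p, 'M[R]_(b p, b p.+1)) (n0 : nat) : minres m d ->
  (forall p q, (n0 <= p)%N -> tor_indep d d p q) -> (nu m m <= 4)%N -> (len [set: R^o] <= 11)%N ->
  exists p, b p = 0%N.
Proof.
move=> dP TI e4 lam11; have lE := len_maxideal gor; have half := m2_half gor.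
set m2 := smul (m : set R) m in lE half; set m3 := smul (m : set R) m2 in half.
have [e2|e3] := leqP (nu m m) 2.
  have [x [xm xg _]] := generators gor (erefl (nu m m)).
  exact: (zero_betti_le2 gor dP TI e2 xm xg).
have L1 : (len m3 <= 1)%N -> (len m2 <= (nu m m).+1)%N by move=> /(len_m3_le1 gor); exact: half.
have [E3|n3] := eqVneq (nu m m) 3.
  have [|x [c [xm xg xc xI]]] := three_generators gor _ E3; first by move: lE L1; rewrite E3 -/m2 -/m3; lia.
  exact: (zero_betti3 gor dP TI xm xg xc xI lam11).
have E4 : nu m m = 4%N by lia.
have [y [ym y2 y3]] := annihilator_m3 gor E4 lam11.
have [x [xy xm xg xmin]] := generators_exchange gor E4 ym y2.
have L0 : len m3 = 0%N -> (len m2 <= 1)%N.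
  move=> l3; have sl : subm m2 by exact: subm_smul.
  apply: (len_soc_le1 gor sl) => a u ma hu.
  have : m3 (a *: (u : R^o)) by exact: smul_incl.
  by rewrite (len_eq0 _ l3) //; apply: (fl_sub (al_fl (gl_al gor)) (subm_smul _ _)).
apply: (zero_betti4 gor dP TI xm xg xmin _ lam11).
- by rewrite xy.
- by rewrite lE E4 -/m2 [RHS]addnS.
- by rewrite -/m2 -/m3; move: lE L1 L0; rewrite E4; lia.
Qed.

(** * Translation to the notions of the statement *)

Section Setting.
Variables (R : comNzRingType) (m : {pred R}).
Hypotheses (R_noetherian : noetherian R) (R_local : local_ring m) (R_artinian : artinian R).
Let al := artin_localP R_noetherian R_local R_artinian.
Local Notation M := (mset m).
Local Notation lam := (len [set: R^o]).
Local Notation m2 := (smul (M : set R) M).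
Local Notation m3 := (smul (M : set R) m2).
Let sm : subm M := al_sub al.

Lemma muP (I : {pred R}) : is_ideal I -> generated_in (I : {pred R^o}) (mu I) /\
  forall k, generated_in (I : {pred R^o}) k -> (mu I <= k)%N.
Proof.
move=> iI; pose P := [set n | generated_in (I : {pred R^o}) n /\ forall k, generated_in (I : {pred R^o}) k -> (n <= k)%N].
suff : P (xget 0%N P) by [].
apply: xgetPex; have [n gn] := R_noetherian iI.
have ex : exists n, `[< generated_in (I : {pred R^o}) n >] by exists n; exact/asboolP.
exists (ex_minn ex); case: ex_minnP => k /asboolP gk min; split=> // l gl.
by apply: min; exact/asboolP.
Qed.

Lemma ideal_mulP (I J : {pred R}) x : x \in ideal_mul I J <-> exists n (a b : 'I_n -> R),
  [/\ forall i, a i \in I, forall i, b i \in J & x = \sum_(i < n) a i * b i].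
Proof. by split=> [/asboolP|h] //; apply/asboolP. Qed.

Lemma ideal_mul_ideal (I J : {pred R}) : is_ideal I -> is_ideal (ideal_mul I J).
Proof.
move=> /subm_pred sI; split.
  by apply/ideal_mulP; exists 0%N, (fun=> 0), (fun=> 0); split=> [[]|[]|] //; rewrite big_ord0.
move=> r u v /ideal_mulP[n [a [b [ha hb ->]]]] /ideal_mulP[n' [a' [b' [ha' hb' ->]]]].
apply/ideal_mulP; exists (n + n')%N.
exists (fun i => match fintype.split i with inl j => r * a j | inr j => a' j end).
exists (fun i => match fintype.split i with inl j => b j | inr j => b' j end); split.
- by move=> i; case: (fintype.split i) => j //; exact: (subZ r sI (ha j)).
- by move=> i; case: (fintype.split i) => j.
rewrite big_split_ord /=; congr (_ + _); last first.
  by apply: eq_bigr => j _; rewrite -[rshift _ _]/(unsplit (inr j)) unsplitK.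
rewrite -[_ *: _]/(r * _) mulr_sumr; apply: eq_bigr => j _.
by rewrite -[lshift _ _]/(unsplit (inl j)) unsplitK mulrA.
Qed.

Lemma ideal_mul_incl (I J : {pred R}) a b : a \in I -> b \in J -> a * b \in ideal_mul I J.
Proof.
move=> aI bJ; apply/ideal_mulP; exists 1%N, (fun=> a), (fun=> b); split=> //.
by rewrite big_ord1.
Qed.

Let m_ideal : is_ideal m. Proof. by case: R_local => -[]. Qed.

Lemma ideal_exp2 x : x \in ideal_exp m 2 <-> m2 x.
Proof.
split=> [|h].
  move=> /ideal_mulP[n [a [b [ha hb ->]]]].
  apply: (@sub_sum R R^o m2 _ _ predT (fun i => a i * b i)) => [|i _]; first exact: subm_smul.
  apply: (smul_incl (ha i : M (a i))); have /ideal_mulP[k [a' [b' [ha' _ ->]]]] := hb i.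
  apply: (@sub_sum R R^o M _ _ predT (fun j => a' j * b' j)) => // j _.
  by rewrite mulrC; exact: (subZ _ sm (ha' j)).
have := h [set x | x \in ideal_exp m 2]; apply; first exact/subm_pred/ideal_mul_ideal.
move=> _ [a ma [u mu ->]]; apply: ideal_mul_incl => //.
by rewrite -[u]mulr1; exact: (@ideal_mul_incl m predT).
Qed.

Lemma m4_zero : ideal_exp m 4 =i pred1 0 -> forall a u : R, M a -> m3 u -> a * u = 0.
Proof.
move=> m40 a u ma hu; have Z (b c d : R) : M b -> M c -> M d -> a * (b * (c * d)) = 0.
  move=> mb mc md; apply/eqP; rewrite -[_ == _]/(_ \in pred1 0) -m40.
  do 3!(apply: ideal_mul_incl => //); rewrite -[d]mulr1; exact: (@ideal_mul_incl m predT).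
have sub (V : set R^o) : subm [set w : R^o | forall b : R, V b -> a * (b * w) = 0].
  split=> [b _|r w w' h h' b Vb]; first by rewrite !mulr0.
  have -> : a * (b * (r *: w + w')) = r * (a * (b * w)) + a * (b * w') by rewrite -[r *: w]/(r * w); ring.
  by rewrite h // h' // mulr0 addr0.
have Y (b w : R) : M b -> m2 w -> a * (b * w) = 0.
  move=> mb hw; have := hw _ (sub M); apply=> // _ [c mc [d md ->]] b' mb'; exact: Z.
have := hu [set w : R^o | a * (w : R) = 0]; apply.
  by split=> [|r w w' h h']; [exact: mulr0|rewrite /mkset mulrDr -[r *: w]/(r * w) mulrCA h h' mulr0 addr0].
by move=> _ [b mb [w hw ->]]; exact: Y.
Qed.

Lemma nu_m2 : (nu M m2 <= mu (ideal_exp m 2))%N.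
Proof.
have [[v vE] _] := muP (@ideal_mul_ideal m (ideal_exp m 1) m_ideal).
have E : m2 = gen v.
  apply/seteqP; split=> x; first by move/ideal_exp2/vE.
  by move=> h; apply/ideal_exp2/vE.
by rewrite {1}E; apply: (nu_le al); apply: (fl_sub (al_fl al)); [exact: subm_gen|].
Qed.

(** Transfers a lower bound on the embedding dimension from [mu] to [nu]. *)
Lemma mu_maxideal : (mu m <= nu M M)%N.
Proof.
have [_ min] := muP m_ideal; apply: min.
have [v [vE _]] := mingens al (fl_sub (al_fl al) sm (fun _ _ => Logic.I)).
exists v => x; have : M x <-> gen v x by rewrite {1}vE.
by [].
Qed.

Variables (s : R) (gor : gor_local M s).
Hypothesis H : (ideal_exp m 4 =i pred1 0 /\ (mu (ideal_exp m 2) <= 4)%N) \/ (multiplicity R <= 11)%N.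

(** Under the first condition [m^3] lies in the socle, so it has length at most 1, and four
    generators of [m^2] bound its length by 5; for [e <= 4] this gives [lam <= 10]. Under the second
    condition both bounds come from [lam = len m2 + e + 1]. *)
Lemma length_bounds : ((nu M M <= 4)%N -> (lam <= 11)%N) /\ ((5 <= nu M M)%N -> (len m2 <= 5)%N).
Proof.
have lE := len_maxideal gor; case: H => [[m40 mu4]|mult]; last first.
  by have h : (lam <= 11)%N := leq_trans (module_lengthE (al_fl al)) mult; split; lia.
have z := m4_zero m40; have := m2_half gor z.
have l1 : (len m3 <= 1)%N by apply: (len_soc_le1 gor) => //; exact: subm_smul.
have h4 : (len m2 - len m3 <= 4)%N := leq_trans nu_m2 mu4.
have key (l a c e : nat) : (l = (a + e).+1 -> c <= 1 -> a - c <= 4 -> a <= e.+1 -> (e <= 4 -> l <= 11) /\ (5 <= e -> a <= 5))%N by lia.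
exact: key lE l1 h4.
Qed.

Lemma Tor_persistence_holds : Tor_persistence R.
Proof.
move=> N fgN T0; have [b [d [aug [dP augE augS]]]] := minres_module al fgN.
have [n TI] := Tor_tor_indep dP dP augE augS augE augS T0.
apply: (minres_projdim al dP augE augS); have [le4 ge5] := length_bounds.
have [e5|e4] := leqP 5 (nu M M).
  by case: (large_embdim_vanishing gor e5 (ge5 e5) dP dP TI).
exact: (small_embdim_betti gor dP TI e4 (le4 e4)).
Qed.

Lemma Tor_vanishing_holds : (5 <= embdim m)%N -> Tor_vanishing R.
Proof.
move=> e5' N N' fgN fgN' T0; have e5 : (5 <= nu M M)%N := leq_trans e5' mu_maxideal.
have [b [d [aug [dP augE augS]]]] := minres_module al fgN.
have [c [d' [aug' [d'P aug'E aug'S]]]] := minres_module al fgN'.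
have [n TI] := Tor_tor_indep dP d'P augE augS aug'E aug'S T0.
have [_ /(_ e5) L5] := length_bounds.
have [h|h] := large_embdim_vanishing gor e5 L5 dP d'P TI.
  by left; exact: (minres_projdim al dP augE augS).
by right; exact: (minres_projdim al d'P aug'E aug'S).
Qed.

End Setting.

Theorem theorem4p7 (R : comNzRingType) (m : {pred R})
    (R_noetherian : noetherian R) (R_local : local_ring m)
    (R_artinian : artinian R) (R_gorenstein : gorenstein R)
    (H : (ideal_exp m 4 =i pred1 0 /\ (mu (ideal_exp m 2) <= 4)%N) \/
         (multiplicity R <= 11)%N) :
  Tor_persistence R /\ ((5 <= embdim m)%N -> Tor_vanishing R).
Proof.
have al := artin_localP R_noetherian R_local R_artinian.
have [s [s0 ms soc]] := gorenstein_socle al R_gorenstein.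
have gor := GorLocal al s0 ms soc.
split; [exact: (Tor_persistence_holds R_noetherian R_local R_artinian gor H)|].
exact: (Tor_vanishing_holds R_noetherian R_local R_artinian gor H).
Qed.
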